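(* Let $L$ be an element of the Selberg class $\mathcal{S}$, and let $(\nu+\eta,a)$ be the FS-pair attached to $L$ by its explicit formula, i.e. for $n\ge2$ $$a\left(\tfrac{\log n}{2\pi}\right)=\frac{\Lambda_L(n)}{2\pi\sqrt n},\qquad a\left(-\tfrac{\log n}{2\pi}\right)=\frac{\overline{\Lambda_L(n)}}{2\pi\sqrt n},\qquad a(x)=0\text{ otherwise},$$ $$d\nu(t)=\frac{W_L(t)}{2\pi}\,dt-\sum_{\rho:\,\operatorname{Re}\rho=1/2}\boldsymbol{\delta}_{\gamma_\rho},\qquad \eta=m_L\left(\boldsymbol{\delta}_{i/2}+\boldsymbol{\delta}_{-i/2}\right)-\sum_{\rho:\,\operatorname{Re}\rho\ne1/2}\boldsymbol{\delta}_{\gamma_\rho}.$$ Then the generating function $F_L(z):=\frac12a(0)+\sum_{\lambda>0}a(\lambda)e^{2\pi i\lambda z}$ of this FS-pair is $$F_L(z)=\frac1{2\pi}\sum_{n\ge2}\frac{\Lambda_L(n)}{n^{1/2-iz}}=-\frac1{2\pi}\frac{L'}{L}\left(\frac12-iz\right),\qquad \operatorname{Im} z>\frac12,$$ which extends to $\mathbb{C}^+$ as a meromorphic function through the expression $$F_L(z)=\frac1{4\pi^2i}\int_{\mathbb{R}}\frac{1+tz}{t-z}W_L(t)\frac{dt}{1+t^2}-\frac{4m_Lz}{i\pi(1+4z^2)}-\frac1{2\pi}\sum_{\rho}\frac{1+i(\rho-1/2)z}{\bigl((\rho-1/2)^2-1\bigr)\bigl((\rho-1/2)+iz\bigr)}+iC_L,$$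 where $C_L=-\frac1{2\pi}\operatorname{Im}\frac{L'}{L}\left(\frac32\right)\in\mathbb{R}$.
   Context: $\mathbb{C}^+=\{z\in\mathbb{C}:\operatorname{Im} z>0\}$, and $\boldsymbol{\delta}_\gamma$ is the unit point mass at $\gamma$. Selberg class $\mathcal{S}$: every $L\in\mathcal{S}$ satisfies the following. $L(s)=\sum_{n\ge1}a_L(n)n^{-s}$ is a Dirichlet series converging absolutely for $\operatorname{Re} s>1$, with $a_L(n)\ll n^{\varepsilon}$ for every $\varepsilon>0$. There is an integer $m_L\ge0$ such that $(s-1)^{m_L}L(s)$ is entire of finite order; $m_L$ is taken to be the order of the possible pole of $L$ at $s=1$. $L$ satisfies a functional equation $\Phi_L(s)=\omega_L\overline{\Phi_L(1-\overline s)}$, where $\Phi_L(s):=Q_L^s\prod_{j=1}^r\Gamma(\lambda_js+\mu_j)L(s)$ with $Q_L>0$, $\lambda_j>0$, $\operatorname{Re}\mu_j\ge0$, $\omega_L\in\mathbb{C}$, $|\omega_L|=1$. Finally $\log L(s)=\sum_{n\ge2}b_L(n)n^{-s}$, where $b_L(n)=0$ unless $n=p^m$ for a prime $p$ and $m\ge1$, and $b_L(n)\ll n^\theta$ for some $\theta<1/2$. $\Lambda_L(n):=b_L(n)\log n$, so $-\frac{L'}{L}(s)=\sum_{n\ge2}\Lambda_L(n)n^{-s}$ absolutely for $\operatorname{Re} s>1$. The non-trivial zeros $\rho$ of $L$ are the zeros of the entire function $\xi_L(s):=s^{m_L}(1-s)^{m_L}\Phi_L(s)$ (of order 1); they lie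 in $0\le\operatorname{Re} s\le1$. All sums over $\rho$ run over the non-trivial zeros counted with multiplicity, and $\gamma_\rho:=\frac{1/2-\rho}{i}$. $$W_L(t):=2\log Q_L+2\operatorname{Re}\sum_{j=1}^r\lambda_j\frac{\Gamma'}{\Gamma}\left(\lambda_j\left(\tfrac12-it\right)+\mu_j\right).$$ With $\widehat\varphi(\xi)=\int_{\mathbb{R}}\varphi(t)e^{-2\pi it\xi}\,dt$ (extended to an entire function), the Guinand–Weil explicit formula (known) says that for every $\varphi\in C_c^\infty(\mathbb{R})$ $$\frac1{2\pi}\sum_{n\ge2}\frac1{\sqrt n}\left\{\Lambda_L(n)\varphi\left(\tfrac{\log n}{2\pi}\right)+\overline{\Lambda_L(n)}\varphi\left(-\tfrac{\log n}{2\pi}\right)\right\}=\frac1{2\pi}\int_{\mathbb{R}}\widehat\varphi(t)W_L(t)\,dt+m_L\left\{\widehat\varphi\left(\tfrac i2\right)+\widehat\varphi\left(-\tfrac i2\right)\right\}-\sum_\rho\widehat\varphi(\gamma_\rho).$$ That is, $\sum_{\lambda}a(\lambda)\varphi(\lambda)=\int\widehat\varphi\,d\nu+\int\widehat\varphi\,d\eta$, so $(\nu+\eta,a)$ is a Fourier summation pair (FS-pair) on the strip $|\operatorname{Im} z|\le1/2$; here FS-pair means that this identity holds for all test functions, $a$ is summable over bounded intervals, and $\nu$ (on $\mathbb{R}$) and $\eta$ (discrete, off $\mathbb{R}$) are measures integrating some power $(1+|z|^2)^{-k/2}$ absolutely. *)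

(* Defs.v *)
(* Stdlib reals with Coquelicot's complex numbers. *)
From Stdlib Require Import Reals List ZArith Znumtheory.
From Coquelicot Require Import Coquelicot.

Set Implicit Arguments.
Unset Strict Implicit.
Unset Printing Implicit Defensive.

Open Scope R_scope.
Open Scope C_scope.

Definition Cexp (z : C) : C :=
  (exp (Re z) * cos (Im z), exp (Re z) * sin (Im z))%R.

(* [x ^ s] for real [x > 0]. *)
Definition rpow (x : R) (s : C) : C := Cexp (s * RtoC (ln x)).

Definition holomorphic_at (f : C -> C) (z : C) : Prop :=
  locally z (fun w : C => ex_derive (K := C_AbsRing) (V := C_NormedModule) f w).

Definition entire (f : C -> C) : Prop := forall z : C, holomorphic_at f z.

(* Natural exponents suffice: the order need only be finite. *)
Definition finite_order (f : C -> C) : Prop :=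
  exists (k : nat) (M : R), forall s : C, (Cmod (f s) <= M * exp (Cmod s ^ k))%R.

Definition zero_of_multiplicity (f : C -> C) (z0 : C) (m : nat) : Prop :=
  (1 <= m)%nat /\
  exists g : C -> C, holomorphic_at g z0 /\ g z0 <> 0 /\
    locally z0 (fun z : C => f z = (z - z0) ^ m * g z).

(* The value of [f] at a pole is irrelevant, since only a punctured
   neighbourhood of the pole is considered. *)
Definition pole_of_order (f : C -> C) (z0 : C) (m : nat) : Prop :=
  (1 <= m)%nat /\
  exists g : C -> C, holomorphic_at g z0 /\ g z0 <> 0 /\
    locally' z0 (fun z : C => f z = g z / (z - z0) ^ m).

Definition meromorphic_on (U : C -> Prop) (f : C -> C) : Prop :=
  forall z : C, U z -> holomorphic_at f z \/ exists m : nat, pole_of_order f z m.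

Definition Csum (T : Type) (f : T -> C) (l : list T) : C :=
  fold_right (fun x acc => f x + acc) (RtoC 0) l.

Definition Cprod (T : Type) (f : T -> C) (l : list T) : C :=
  fold_right (fun x acc => f x * acc) (RtoC 1) l.

(* Unordered sum of [f] over the set [P]: the limit of the sums over the finite
   subsets of [P], ordered by inclusion.  In [C] this is absolute summability. *)
Definition is_usum (T : Type) (P : T -> Prop) (f : T -> C) (s : C) : Prop :=
  forall eps : posreal, exists l0 : list T, NoDup l0 /\ List.Forall P l0 /\
    forall l : list T, NoDup l -> List.Forall P l -> incl l0 l ->
      (Cmod (Csum f l - s) < eps)%R.

Definition summable (T : Type) (P : T -> Prop) (f : T -> C) : Prop :=
  exists s : C, is_usum P f s.

Definition usum (T : Type) (P : T -> Prop) (f : T -> C) : C :=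
  iota (T := C_R_CompleteNormedModule) (is_usum P f).

Definition ex_RInt_line (f : R -> C) : Prop :=
  ex_RInt_gen (V := C_R_NormedModule) f (Rbar_locally m_infty) (Rbar_locally p_infty) /\
  ex_RInt_gen (V := R_NormedModule) (fun t => Cmod (f t))
    (Rbar_locally m_infty) (Rbar_locally p_infty).

Definition RInt_line (f : R -> C) : C :=
  RInt_gen (V := C_R_CompleteNormedModule) f
    (Rbar_locally m_infty) (Rbar_locally p_infty).

(* Gauss's formula: Gamma z = lim_n n! n^z / (z (z+1) ... (z+n)). *)
Definition gauss_seq (z : C) (n : nat) : C :=
  RtoC (INR (fact n)) * rpow (INR n) z
    / Cprod (fun k : nat => z + RtoC (INR k)) (seq 0 (S n)).

Definition CGamma (z : C) : C :=
  (real (Lim_seq (fun n => Re (gauss_seq z n))),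
   real (Lim_seq (fun n => Im (gauss_seq z n)))).

Definition log_derive (f : C -> C) (z : C) : C := C_derive f z / f z.

(* The gamma factors [Gamma (lam * s + mu)] are listed as pairs [(lam, mu)]. *)
Definition completed (L : C -> C) (Q : R) (gam : list (R * C)) (s : C) : C :=
  rpow Q s * Cprod (fun p : R * C => CGamma (RtoC (fst p) * s + snd p)) gam * L s.

(* Points at which [completed] is given by the values of its factors. *)
Definition regular_point (gam : list (R * C)) (s : C) : Prop :=
  s <> 1 /\
  forall (p : R * C) (k : nat), In p gam ->
    RtoC (fst p) * s + snd p <> - RtoC (INR k).

(* An element of the Selberg class, together with the data occurring in its
   axioms.  The value [L 1] is meaningful only if [m = 0]. *)
Record selberg_class : Type := {
  L :> C -> C;
  a_coef : nat -> C;
  b_coef : nat -> C;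
  m_pole : nat;
  Qcond : R;
  gammas : list (R * C);
  omega : C;

  L_abs_convergent : forall s : C, (1 < Re s)%R ->
    ex_series (fun k => Cmod (a_coef (S k) * rpow (INR (S k)) (- s)));
  L_dirichlet : forall s : C, (1 < Re s)%R ->
    is_series (K := C_AbsRing) (V := C_NormedModule)
      (fun k => a_coef (S k) * rpow (INR (S k)) (- s)) (L s);
  a_bound : forall eps : R, (0 < eps)%R -> exists M : R, forall n : nat,
    (1 <= n)%nat -> (Cmod (a_coef n) <= M * Rpower (INR n) eps)%R;

  L_continuation : exists E : C -> C,
    entire E /\ finite_order E /\
    (forall s : C, s <> 1 \/ m_pole = 0%nat -> E s = (s - 1) ^ m_pole * L s) /\
    ((0 < m_pole)%nat -> E 1 <> 0);

  Q_pos : (0 < Qcond)%R;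
  gammas_pos : forall p : R * C, In p gammas -> (0 < fst p)%R /\ (0 <= Re (snd p))%R;
  omega_unit : Cmod omega = 1%R;
  (* An identity of meromorphic functions, stated off a discrete set. *)
  functional_equation : forall s : C,
    regular_point gammas s -> regular_point gammas (1 - Cconj s) ->
    completed L Qcond gammas s
      = omega * Cconj (completed L Qcond gammas (1 - Cconj s));

  b_support : forall n : nat,
    (forall p k : nat, prime (Z.of_nat p) -> (1 <= k)%nat -> n <> (p ^ k)%nat) ->
    b_coef n = 0;
  b_bound : exists theta M : R, (theta < 1 / 2)%R /\ forall n : nat,
    (2 <= n)%nat -> (Cmod (b_coef n) <= M * Rpower (INR n) theta)%R;
  logL_abs_convergent : forall s : C, (1 < Re s)%R ->
    ex_series (fun k => Cmod (b_coef (S (S k)) * rpow (INR (S (S k))) (- s)));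
  logL_dirichlet : forall s : C, (1 < Re s)%R -> exists l : C,
    is_series (K := C_AbsRing) (V := C_NormedModule)
      (fun k => b_coef (S (S k)) * rpow (INR (S (S k))) (- s)) l /\
    Cexp l = L s
}.

Definition Lambda (L : selberg_class) (n : nat) : C :=
  b_coef L n * RtoC (ln (INR n)).

(* The limit over punctured neighbourhoods fills in the removable singularities
   of the product. *)
Definition xi (L : selberg_class) : C -> C :=
  C_lim (fun s => s ^ m_pole L * (1 - s) ^ m_pole L
                  * completed L (Qcond L) (gammas L) s).

(* The set of pairs [(rho, k)] with [k] less than the multiplicity of the
   non-trivial zero [rho], so that sums over it count multiplicities. *)
Definition nontrivial_zeros (L : selberg_class) (p : C * nat) : Prop :=
  exists m : nat, zero_of_multiplicity (xi L) (fst p) m /\ (snd p < m)%nat.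

Definition gamma_of (rho : C) : C := (1 / 2 - rho) / Ci.

Definition W (L : selberg_class) (t : R) : R :=
  (2 * ln (Qcond L) +
   2 * Re (Csum (fun p : R * C => RtoC (fst p) *
             log_derive CGamma (RtoC (fst p) * (1 / 2 - Ci * RtoC t) + snd p))%C
           (gammas L)))%R.

(* The function [a] of the Fourier summation pair attached to [L]. *)
Definition explicit_formula_coef (L : selberg_class) (a : R -> C) : Prop :=
  (forall n : nat, (2 <= n)%nat ->
     a (ln (INR n) / (2 * PI))%R = Lambda L n / RtoC (2 * PI * sqrt (INR n)) /\
     a (- (ln (INR n) / (2 * PI)))%R
       = Cconj (Lambda L n) / RtoC (2 * PI * sqrt (INR n))) /\
  (forall x : R,
     (forall n : nat, (2 <= n)%nat ->
        x <> (ln (INR n) / (2 * PI))%R /\ x <> (- (ln (INR n) / (2 * PI)))%R) ->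
     a x = 0).

Definition generating_term (a : R -> C) (z : C) (lam : R) : C :=
  a lam * Cexp (2 * RtoC PI * Ci * RtoC lam * z).

Definition generating_function (a : R -> C) (z : C) : C :=
  1 / 2 * a 0%R + usum (fun lam : R => (0 < lam)%R) (generating_term a z).

Definition integrand (L : selberg_class) (z : C) (t : R) : C :=
  (1 + RtoC t * z) / (RtoC t - z) * RtoC (W L t) / RtoC (1 + t ^ 2).

Definition zero_term (z : C) (p : C * nat) : C :=
  let rho := fst p in
  (1 + Ci * (rho - 1 / 2) * z)
    / (((rho - 1 / 2) ^ 2 - 1) * ((rho - 1 / 2) + Ci * z)).

Definition C_L (L : selberg_class) : R :=
  (- (1 / (2 * PI)) * Im (log_derive L (RtoC (3 / 2))))%R.

Definition F_extension (L : selberg_class) (z : C) : C :=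
  1 / (4 * RtoC PI ^ 2 * Ci) * RInt_line (integrand L z)
  - 4 * RtoC (INR (m_pole L)) * z / (Ci * RtoC PI * (1 + 4 * z ^ 2))
  - 1 / (2 * RtoC PI) * usum (nontrivial_zeros L) (zero_term z)
  + Ci * RtoC (C_L L).

Definition upper_half_plane (z : C) : Prop := (0 < Im z)%R.

Definition singular_point (L : selberg_class) (z : C) : Prop :=
  (exists rho : C * nat, nontrivial_zeros L rho /\ z = gamma_of (fst rho)) \/
  ((0 < m_pole L)%nat /\ z = Ci / 2).

(* Main.v *)
(* Put s = 1/2 - iz. The completed function X (equal to xi_L) is entire, and on Re s > 0
     X'/X(s) = m/s + m/(s-1) + G(s) + L'/L(s),
   where G collects log Q and the digamma terms, so that W_L = 2 Re G on the critical line.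
   Both X'/X and G are recovered from data on the critical strip, up to an imaginary constant.
   - Phragmen-Lindelof turns finite order into |X(s)| <= K_eps exp(eps |s|^2) for every eps > 0.
     Jensen and Borel-Caratheodory then give the partial fraction expansion of
     X'/X(s) - X'/X(c) as a sum of 1/(s-rho) - 1/(c-rho). For s = -1/2 and c = 3/2
     the terms lie in a sector around the negative axis, hence the absolute convergence.
     Averaging over c = 3/2 and c = -1/2, with X'/X(-1/2) = - conj (X'/X(3/2)) from the
     functional equation, gives exactly the terms of the theorem.
   - G is holomorphic on Im z >= 0 and O(|z|^(1/2)), so contour integration yields its
     Herglotz representation by its real part on the line.
   Solving for L'/L gives F_L, and its poles are those of X'/X and m/(s-1). *)

Require Import Defs.
From Stdlib Require Import Reals Lra Lia List ZArith ClassicalEpsilon FunctionalExtensionality.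
From Coquelicot Require Import Coquelicot.

Open Scope R_scope.
Open Scope C_scope.

(** Partial fractions with one subtraction call for log |X(s)| = o(|s|^2), while the axioms give
    only some finite order. Off the strip -1 < Re s < 2 this growth comes from the Gamma factors,
    the Dirichlet series and the functional equation; finite order serves to make the maximum
    principle applicable inside the strip. Counting zeros with such a bound gives o(r^2) of them in
    a disc, too many for absolute convergence of the expansion. The sums over large discs converge
    all the same, and a common sign of the real parts at one pair of points turns this into a bound
    for all finite subsums. The growth |z|^(1/2) of G comes from interpolating two elementary bounds
    for the terms of the digamma series; against a Cauchy kernel decaying like t^(-2) it makes the
    contours close. The base point 3/2 is the image of z = i under s = 1/2 - iz, and i is the point
    at which the Herglotz kernel is normalised. Hence both imaginary constants are taken at the same
    point and cancel, except for the part from L'/L(3/2). *)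

Ltac cfield := cbv beta; match goal with |- @eq _ ?a ?b => change (@eq C a b) end; field.
Ltac cring := cbv beta; match goal with |- @eq _ ?a ?b => change (@eq C a b) end; ring.

(** * Limits, continuity and complex derivatives measured by the modulus *)

Lemma Cmult_reg_r (a b c : C) : c <> 0 -> a * c = b * c -> a = b.
Proof.
  intros Hc E. replace a with (a * c / c) by (field; exact Hc). rewrite E. field. exact Hc.
Qed.

(** Measured with [Cmod] rather than with the balls of the uniform structure, so that all estimates
    use a single norm; [lim_filterlim] translates to Coquelicot's convergence where the statement
    requires it. *)
Definition lim {T : Type} (F : (T -> Prop) -> Prop) (f : T -> C) (l : C) : Prop :=
  forall eps : R, 0 < eps -> F (fun x => Cmod (f x - l) < eps).

Definition cts {T : UniformSpace} (f : T -> C) (x : T) : Prop :=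
  lim (locally x) f (f x).

(** The little-o form of the derivative; [Cd_is_derive] identifies it with [is_derive] over
    [C_AbsRing]. *)
Definition Cd (f : C -> C) (z l : C) : Prop :=
  forall eps : R, 0 < eps ->
    locally z (fun w => Cmod (f w - f z - l * (w - z)) <= eps * Cmod (w - z)).

(** The uniform balls of [C] are squares, since [C] carries the product structure of two copies of
    [R]; passing to discs costs a factor [sqrt 2]. *)
Lemma locallyC (z : C) (P : C -> Prop) :
  locally z P <-> exists d : R, 0 < d /\ forall w, Cmod (w - z) < d -> P w.
Proof.
  split.
  - intros [d H]. exists d. split; [apply cond_pos|].
    intros w Hw. apply H. apply C_NormedModule_mixin_compat1. exact Hw.
  - intros [d [Hd H]].
    assert (Hd2 : 0 < d / sqrt 2).
    { apply Rdiv_lt_0_compat; [exact Hd|apply sqrt_lt_R0; lra]. }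
    exists (mkposreal _ Hd2). intros w Hw. apply H.
    eapply Rlt_le_trans; [apply (C_NormedModule_mixin_compat2 z w _ Hw)|].
    simpl. right. field. apply Rgt_not_eq, sqrt_lt_R0; lra.
Qed.

Lemma locallyC' (z : C) (P : C -> Prop) :
  locally' z P <-> exists d : R, 0 < d /\ forall w, Cmod (w - z) < d -> w <> z -> P w.
Proof. unfold locally', within. rewrite locallyC. reflexivity. Qed.

Lemma locallyR (x : R) (P : R -> Prop) :
  locally x P <-> exists d : R, 0 < d /\ forall y, Rabs (y - x) < d -> P y.
Proof.
  split.
  - intros [d H]. exists d. split; [apply cond_pos|]. exact H.
  - intros [d [Hd H]]. exists (mkposreal d Hd). exact H.
Qed.

Section Limits.
Context {T : Type} (F : (T -> Prop) -> Prop) {FF : Filter F}.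

Lemma lim_const (c : C) : lim F (fun _ => c) c.
Proof.
  intros eps He. apply filter_forall. intros x.
  replace (c - c) with (RtoC 0) by ring. rewrite Cmod_0. exact He.
Qed.

Lemma lim_ext_loc (f g : T -> C) (l : C) :
  F (fun x => f x = g x) -> lim F f l -> lim F g l.
Proof.
  intros H Hf eps He. generalize (filter_and _ _ H (Hf eps He)).
  apply filter_imp. intros x [E Hx]. rewrite <- E. exact Hx.
Qed.

Lemma lim_plus (f g : T -> C) (a b : C) :
  lim F f a -> lim F g b -> lim F (fun x => f x + g x) (a + b).
Proof.
  intros Hf Hg eps He. assert (He2 : 0 < eps / 2) by lra.
  generalize (filter_and _ _ (Hf _ He2) (Hg _ He2)). apply filter_imp.
  intros x [H1 H2]. replace (f x + g x - (a + b)) with ((f x - a) + (g x - b)) by ring.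
  eapply Rle_lt_trans; [apply Cmod_triangle|lra].
Qed.

Lemma lim_opp (f : T -> C) (a : C) : lim F f a -> lim F (fun x => - f x) (- a).
Proof.
  intros Hf eps He. generalize (Hf _ He). apply filter_imp. intros x H.
  replace (- f x - - a) with (- (f x - a)) by ring. rewrite Cmod_opp. exact H.
Qed.

Lemma lim_minus (f g : T -> C) (a b : C) :
  lim F f a -> lim F g b -> lim F (fun x => f x - g x) (a - b).
Proof. intros Hf Hg. apply lim_plus; [exact Hf|apply lim_opp, Hg]. Qed.

Lemma lim_bounded (f : T -> C) (a : C) :
  lim F f a -> F (fun x => Cmod (f x) < Cmod a + 1).
Proof.
  intros Hf. generalize (Hf 1 Rlt_0_1). apply filter_imp. intros x H.
  replace (f x) with ((f x - a) + a) by ring.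
  eapply Rle_lt_trans; [apply Cmod_triangle|lra].
Qed.

Lemma lim_mult_0 (f g : T -> C) (a : C) :
  lim F f a -> lim F g 0 -> lim F (fun x => f x * g x) 0.
Proof.
  intros Hf Hg eps He. pose proof (Cmod_ge_0 a) as Ha.
  assert (He2 : 0 < eps / (Cmod a + 1)) by (apply Rdiv_lt_0_compat; lra).
  generalize (filter_and _ _ (lim_bounded f a Hf) (Hg _ He2)). apply filter_imp.
  intros x [H1 H2]. replace (f x * g x - 0) with (f x * (g x - 0)) by ring.
  rewrite Cmod_mult. apply Rle_lt_trans with ((Cmod a + 1) * Cmod (g x - 0))%R.
  - apply Rmult_le_compat_r; [apply Cmod_ge_0|lra].
  - apply Rlt_le_trans with ((Cmod a + 1) * (eps / (Cmod a + 1)))%R.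
    + apply Rmult_lt_compat_l; lra.
    + right. field. lra.
Qed.

Lemma lim_mult (f g : T -> C) (a b : C) :
  lim F f a -> lim F g b -> lim F (fun x => f x * g x) (a * b).
Proof.
  intros Hf Hg.
  assert (H1 : lim F (fun x => f x * (g x - b)) 0).
  { apply lim_mult_0 with a; [exact Hf|].
    replace (RtoC 0) with (b - b) by ring. apply lim_minus; [exact Hg|apply lim_const]. }
  assert (H2 : lim F (fun x => b * (f x - a)) 0).
  { apply lim_mult_0 with b; [apply lim_const|].
    replace (RtoC 0) with (a - a) by ring. apply lim_minus; [exact Hf|apply lim_const]. }
  apply lim_ext_loc with (fun x => (f x * (g x - b) + b * (f x - a)) + a * b).
  - apply filter_forall. intros x. ring.
  - replace (a * b) with ((0 + 0) + a * b) at 1 by ring.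
    apply lim_plus; [apply lim_plus; assumption|apply lim_const].
Qed.

Lemma lim_neq_0 (f : T -> C) (a : C) :
  lim F f a -> a <> 0 -> F (fun x => Cmod a / 2 < Cmod (f x)).
Proof.
  intros Hf Ha. apply Cmod_gt_0 in Ha.
  assert (He : 0 < Cmod a / 2) by lra.
  generalize (Hf _ He). apply filter_imp. intros x H.
  pose proof (Cmod_triangle (f x) (- (f x - a))) as Ht.
  replace (f x + - (f x - a)) with a in Ht by ring. rewrite Cmod_opp in Ht. lra.
Qed.

Lemma lim_inv (f : T -> C) (a : C) :
  lim F f a -> a <> 0 -> lim F (fun x => / f x) (/ a).
Proof.
  intros Hf Ha eps He. pose proof Ha as Ha0. apply Cmod_gt_0 in Ha0.
  assert (He2 : 0 < eps * (Cmod a * (Cmod a / 2))).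
  { apply Rmult_lt_0_compat; [exact He|]. apply Rmult_lt_0_compat; lra. }
  generalize (filter_and _ _ (lim_neq_0 f a Hf Ha) (Hf _ He2)). apply filter_imp.
  intros x [H1 H2].
  assert (Hx : f x <> 0) by (apply Cmod_gt_0; lra).
  replace (/ f x - / a) with (- (f x - a) / (a * f x)) by (field; tauto).
  rewrite Cmod_div by (apply Cmult_neq_0; assumption).
  rewrite Cmod_opp, Cmod_mult.
  apply Rmult_lt_reg_r with (Cmod a * Cmod (f x))%R.
  { apply Rmult_lt_0_compat; lra. }
  unfold Rdiv. rewrite Rmult_assoc, Rinv_l, Rmult_1_r.
  2:{ apply Rgt_not_eq, Rmult_lt_0_compat; lra. }
  eapply Rlt_le_trans; [exact H2|].
  apply Rmult_le_compat_l; [lra|]. apply Rmult_le_compat_l; lra.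
Qed.

Lemma lim_conj (f : T -> C) (a : C) : lim F f a -> lim F (fun x => Cconj (f x)) (Cconj a).
Proof.
  intros Hf eps He. generalize (Hf _ He). apply filter_imp. intros x H.
  rewrite <- Cminus_conj, Cmod_conj. exact H.
Qed.

Lemma lim_re (f : T -> C) (a : C) : lim F f a -> lim F (fun x => RtoC (Re (f x))) (RtoC (Re a)).
Proof.
  intros Hf eps He. generalize (Hf _ He). apply filter_imp. intros x H.
  rewrite <- RtoC_minus, Cmod_R. eapply Rle_lt_trans; [|exact H].
  exact (re_le_Cmod (f x - a)).
Qed.

Lemma lim_im (f : T -> C) (a : C) : lim F f a -> lim F (fun x => RtoC (Im (f x))) (RtoC (Im a)).
Proof.
  intros Hf eps He. generalize (Hf _ He). apply filter_imp. intros x H.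
  rewrite <- RtoC_minus, Cmod_R. eapply Rle_lt_trans; [|exact H].
  eapply Rle_trans; [|apply (Rmax_Cmod (f x - a))]. apply Rmax_r.
Qed.

End Limits.

Lemma lim_unique {T : Type} (F : (T -> Prop) -> Prop) {FF : ProperFilter F}
  (f : T -> C) (a b : C) : lim F f a -> lim F f b -> a = b.
Proof.
  intros Ha Hb. destruct (Req_dec (Cmod (a - b)) 0) as [E|E].
  - apply Cmod_eq_0 in E. replace a with ((a - b) + b) by ring. rewrite E. ring.
  - exfalso. assert (Hp : 0 < Cmod (a - b) / 2) by (pose proof (Cmod_ge_0 (a - b)); lra).
    destruct (filter_ex _ (filter_and _ _ (Ha _ Hp) (Hb _ Hp))) as [x [H1 H2]].
    pose proof (Cmod_triangle (f x - b) (- (f x - a))) as Ht.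
    replace (f x - b + - (f x - a)) with (a - b) in Ht by ring.
    rewrite Cmod_opp in Ht. lra.
Qed.

Lemma cts_const {T : UniformSpace} (c : C) (x : T) : cts (fun _ => c) x.
Proof. apply lim_const. typeclasses eauto. Qed.

Lemma cts_id (z : C) : cts (fun w : C => w) z.
Proof. intros eps He. apply locallyC. exists eps. split; [exact He|auto]. Qed.

Lemma cts_RtoC (f : R -> R) (x : R) : continuous f x -> cts (fun t => RtoC (f t)) x.
Proof.
  intros H eps He. pose proof (proj1 (filterlim_locally f (f x)) H (mkposreal eps He)) as H'.
  revert H'. apply filter_imp. intros y Hy. rewrite <- RtoC_minus, Cmod_R. exact Hy.
Qed.

Lemma cts_fst (f : R -> C) (x : R) : cts f x -> continuous (fun t => fst (f t)) x.
Proof.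
  intros H. apply filterlim_locally. intros eps.
  generalize (H eps (cond_pos eps)). apply filter_imp. intros y Hy.
  eapply Rle_lt_trans; [|exact Hy]. exact (re_le_Cmod (f y - f x)).
Qed.

Lemma cts_snd (f : R -> C) (x : R) : cts f x -> continuous (fun t => snd (f t)) x.
Proof.
  intros H. apply filterlim_locally. intros eps.
  generalize (H eps (cond_pos eps)). apply filter_imp. intros y Hy.
  eapply Rle_lt_trans; [|exact Hy].
  eapply Rle_trans; [|apply (Rmax_Cmod (f y - f x))]. apply Rmax_r.
Qed.

Section Cts.
Context {T : UniformSpace}.
Implicit Types (f g : T -> C) (x : T).

Lemma cts_plus f g x : cts f x -> cts g x -> cts (fun t => f t + g t) x.
Proof. apply lim_plus. typeclasses eauto. Qed.
Lemma cts_minus f g x : cts f x -> cts g x -> cts (fun t => f t - g t) x.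
Proof. apply lim_minus. typeclasses eauto. Qed.
Lemma cts_mult f g x : cts f x -> cts g x -> cts (fun t => f t * g t) x.
Proof. apply lim_mult. typeclasses eauto. Qed.
Lemma cts_inv f x : cts f x -> f x <> 0 -> cts (fun t => / f t) x.
Proof. apply lim_inv. typeclasses eauto. Qed.
Lemma cts_div f g x : cts f x -> cts g x -> g x <> 0 -> cts (fun t => f t / g t) x.
Proof. intros. apply cts_mult; [assumption|apply cts_inv; assumption]. Qed.
Lemma cts_conj f x : cts f x -> cts (fun t => Cconj (f t)) x.
Proof. apply lim_conj. typeclasses eauto. Qed.
Lemma cts_re f x : cts f x -> cts (fun t => RtoC (Re (f t))) x.
Proof. apply lim_re. typeclasses eauto. Qed.
Lemma cts_im f x : cts f x -> cts (fun t => RtoC (Im (f t))) x.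
Proof. apply lim_im. typeclasses eauto. Qed.
Lemma cts_pow f n x : cts f x -> cts (fun t => f t ^ n) x.
Proof.
  intros H. induction n as [|n IH]; [exact (cts_const 1 x)|]. exact (cts_mult _ _ _ H IH).
Qed.
Lemma cts_ext_loc f g x : locally x (fun t => f t = g t) -> cts f x -> cts g x.
Proof.
  intros H Hf. unfold cts. rewrite <- (locally_singleton _ _ H).
  eapply lim_ext_loc; [typeclasses eauto|exact H|exact Hf].
Qed.

Lemma lim_comp {S : Type} (F : (S -> Prop) -> Prop) {FF : Filter F} (f : C -> C) (g : S -> C) (l : C) :
  lim F g l -> cts f l -> lim F (fun s => f (g s)) (f l).
Proof.
  intros Hg Hf eps He. specialize (Hf eps He). apply locallyC in Hf.
  destruct Hf as [d [Hd H]]. generalize (Hg d Hd). apply filter_imp.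
  intros y Hy. apply H, Hy.
Qed.

Lemma cts_comp (f : C -> C) g x : cts g x -> cts f (g x) -> cts (fun t => f (g t)) x.
Proof. intros Hg Hf. apply (lim_comp _ f g (g x)); assumption. Qed.

Lemma lim_locally {S : Type} (F : (S -> Prop) -> Prop) {FF : Filter F} (g : S -> C) (l : C) (P : C -> Prop) :
  lim F g l -> locally l P -> F (fun s => P (g s)).
Proof.
  intros Hg HP. apply locallyC in HP. destruct HP as [d [Hd H]].
  generalize (Hg d Hd). apply filter_imp. intros y Hy. apply H, Hy.
Qed.
End Cts.

(** Carathéodory's form of the derivative. With the difference quotient as a factor having a limit
    at [z], the product, quotient and chain rules become limit algebra, and in the chain rule the
    points with [g w = g z] are covered automatically. *)
Lemma Cd_cara (f : C -> C) (z l : C) :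
  Cd f z l <-> exists phi : C -> C,
    locally z (fun w => f w = f z + (w - z) * phi w) /\ lim (locally z) phi l.
Proof.
  split.
  - intros H.
    exists (fun w => if excluded_middle_informative (w = z) then l else (f w - f z) / (w - z)).
    split.
    + apply filter_forall. intros w. destruct (excluded_middle_informative (@eq C w z)) as [->|E].
      * ring.
      * field. intros E2. apply E. replace w with ((w - z) + z) by ring. rewrite E2. ring.
    + intros eps He. assert (He2 : 0 < eps / 2) by lra.
      generalize (H _ He2). apply filter_imp. intros w Hw.
      destruct (excluded_middle_informative (@eq C w z)) as [->|E].
      * replace (l - l) with (RtoC 0) by ring. rewrite Cmod_0. exact He.
      * assert (E2 : w - z <> 0).
        { intros E2. apply E. replace w with ((w - z) + z) by ring. rewrite E2. ring. }
        replace ((f w - f z) / (w - z) - l) with ((f w - f z - l * (w - z)) / (w - z))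
          by (field; exact E2).
        rewrite Cmod_div by exact E2. apply Cmod_gt_0 in E2.
        apply Rle_lt_trans with (eps / 2)%R; [|lra].
        apply Rmult_le_reg_r with (Cmod (w - z)); [exact E2|].
        unfold Rdiv at 1. rewrite Rmult_assoc, Rinv_l by lra. lra.
  - intros [phi [H1 H2]] eps He.
    generalize (filter_and _ _ H1 (H2 _ He)). apply filter_imp. intros w [E Hw].
    rewrite E. replace (f z + (w - z) * phi w - f z - l * (w - z)) with ((phi w - l) * (w - z)) by ring.
    rewrite Cmod_mult. apply Rmult_le_compat_r; [apply Cmod_ge_0|lra].
Qed.

Lemma Cd_cts (f : C -> C) (z l : C) : Cd f z l -> cts f z.
Proof.
  intros H. apply Cd_cara in H. destruct H as [phi [H1 H2]].
  unfold cts. apply (lim_ext_loc _ (fun w => f z + (w - z) * phi w)).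
  - revert H1. apply filter_imp. intros w E. symmetry. exact E.
  - replace (f z) with (f z + (z - z) * l) at 1 by ring.
    apply lim_plus; [typeclasses eauto|apply lim_const; typeclasses eauto|].
    apply lim_mult; [typeclasses eauto| |exact H2].
    apply (cts_minus (fun w => w) (fun _ => z)); [apply cts_id|apply cts_const].
Qed.

Lemma Cd_ext_loc (f g : C -> C) (z l : C) :
  locally z (fun w => f w = g w) -> Cd f z l -> Cd g z l.
Proof.
  intros H Hf eps He. pose proof (locally_singleton _ _ H) as E0.
  generalize (filter_and _ _ H (Hf _ He)). apply filter_imp.
  intros w [E Hw]. rewrite <- E, <- E0. exact Hw.
Qed.

Lemma Cd_ext (f g : C -> C) (z l : C) : (forall w, f w = g w) -> Cd f z l -> Cd g z l.
Proof. intros H. apply Cd_ext_loc. apply filter_forall. exact H. Qed.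

Lemma Cd_eq (f : C -> C) (z l l' : C) : Cd f z l -> l = l' -> Cd f z l'.
Proof. intros H <-. exact H. Qed.

Lemma Cd_const (c z : C) : Cd (fun _ => c) z 0.
Proof.
  intros eps He. apply filter_forall. intros w.
  replace (c - c - 0 * (w - z)) with (RtoC 0) by ring. rewrite Cmod_0.
  apply Rmult_le_pos; [lra|apply Cmod_ge_0].
Qed.

Lemma Cd_id (z : C) : Cd (fun w => w) z 1.
Proof.
  intros eps He. apply filter_forall. intros w.
  replace (w - z - 1 * (w - z)) with (RtoC 0) by ring. rewrite Cmod_0.
  apply Rmult_le_pos; [lra|apply Cmod_ge_0].
Qed.

Lemma Cd_plus (f g : C -> C) (z a b : C) :
  Cd f z a -> Cd g z b -> Cd (fun w => f w + g w) z (a + b).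
Proof.
  rewrite !Cd_cara. intros [p [Hp1 Hp2]] [q [Hq1 Hq2]].
  exists (fun w => p w + q w). split.
  - generalize (filter_and _ _ Hp1 Hq1). apply filter_imp. intros w [-> ->]. ring.
  - apply lim_plus; [typeclasses eauto|assumption|assumption].
Qed.

Lemma Cd_mult (f g : C -> C) (z a b : C) :
  Cd f z a -> Cd g z b -> Cd (fun w => f w * g w) z (a * g z + f z * b).
Proof.
  intros Hf Hg. pose proof (Cd_cts _ _ _ Hg) as Hc. revert Hf Hg.
  rewrite !Cd_cara. intros [p [Hp1 Hp2]] [q [Hq1 Hq2]].
  exists (fun w => p w * g w + f z * q w). split.
  - generalize (filter_and _ _ Hp1 Hq1). apply filter_imp. intros w [-> ->]. ring.
  - apply lim_plus; [typeclasses eauto| |].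
    + apply lim_mult; [typeclasses eauto|assumption|exact Hc].
    + apply lim_mult; [typeclasses eauto|apply lim_const; typeclasses eauto|assumption].
Qed.

Lemma Cd_scal (c : C) (f : C -> C) (z a : C) : Cd f z a -> Cd (fun w => c * f w) z (c * a).
Proof.
  intros H. eapply Cd_eq; [apply (Cd_mult (fun _ => c) f); [apply Cd_const|exact H]|ring].
Qed.

Lemma Cd_opp (f : C -> C) (z a : C) : Cd f z a -> Cd (fun w => - f w) z (- a).
Proof.
  intros H. eapply Cd_eq; [eapply Cd_ext; [|apply (Cd_scal (- (1)) _ _ _ H)]|ring].
  intros w. simpl. ring.
Qed.

Lemma Cd_minus (f g : C -> C) (z a b : C) :
  Cd f z a -> Cd g z b -> Cd (fun w => f w - g w) z (a - b).
Proof. intros Hf Hg. apply Cd_plus; [exact Hf|apply Cd_opp, Hg]. Qed.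

Lemma Cd_inv (f : C -> C) (z a : C) :
  Cd f z a -> f z <> 0 -> Cd (fun w => / f w) z (- a / (f z * f z)).
Proof.
  intros Hf Hz. pose proof (Cd_cts _ _ _ Hf) as Hc. revert Hf.
  rewrite !Cd_cara. intros [p [Hp1 Hp2]].
  pose proof (lim_neq_0 (locally z) f (f z) Hc Hz) as Hn.
  exists (fun w => - p w / (f z * f w)). split.
  - generalize (filter_and _ _ Hp1 Hn). apply filter_imp. intros w [E Hw].
    assert (Hw0 : f w <> 0).
    { apply Cmod_gt_0. pose proof (Cmod_ge_0 (f z)). lra. }
    replace (- p w) with ((- p w)) by ring.
    apply (Cmult_reg_r _ _ (f z * f w)); [apply Cmult_neq_0; assumption|].
    replace (/ f w * (f z * f w)) with (f z) by (field; assumption).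
    replace ((/ f z + (w - z) * (- p w / (f z * f w))) * (f z * f w))
      with (f w - (w - z) * p w) by (field; split; assumption).
    rewrite E. ring.
  - apply lim_mult; [typeclasses eauto|apply lim_opp; [typeclasses eauto|assumption]|].
    apply lim_inv; [typeclasses eauto| |apply Cmult_neq_0; assumption].
    apply lim_mult; [typeclasses eauto|apply lim_const; typeclasses eauto|exact Hc].
Qed.

Lemma Cd_div (f g : C -> C) (z a b : C) :
  Cd f z a -> Cd g z b -> g z <> 0 ->
  Cd (fun w => f w / g w) z ((a * g z - f z * b) / (g z * g z)).
Proof.
  intros Hf Hg Hz. eapply Cd_eq; [apply Cd_mult; [exact Hf|apply Cd_inv; eassumption]|].
  cfield. exact Hz.
Qed.

Lemma Cd_comp (f g : C -> C) (z a b : C) :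
  Cd g z b -> Cd f (g z) a -> Cd (fun w => f (g w)) z (a * b).
Proof.
  intros Hg. pose proof (Cd_cts _ _ _ Hg) as Hc. revert Hg.
  rewrite !Cd_cara. intros [p [Hp1 Hp2]] [q [Hq1 Hq2]].
  exists (fun w => q (g w) * p w). split.
  - pose proof (lim_locally _ _ _ _ Hc Hq1) as H. simpl in H.
    generalize (filter_and _ _ Hp1 H). apply filter_imp. intros w [E1 E2].
    rewrite E2. rewrite E1 at 1. ring.
  - apply lim_mult; [typeclasses eauto| |assumption].
    intros eps He. apply (lim_locally _ _ _ _ Hc (Hq2 _ He)).
Qed.

Lemma Cd_pow (f : C -> C) (z a : C) (n : nat) :
  Cd f z a -> Cd (fun w => f w ^ n) z (RtoC (INR n) * f z ^ (pred n) * a).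
Proof.
  intros H. induction n as [|n IH].
  - eapply Cd_eq; [exact (Cd_const 1 z)|]. simpl. ring.
  - eapply Cd_eq; [exact (Cd_mult _ _ _ _ _ H IH)|].
    rewrite S_INR, RtoC_plus. destruct n; simpl; ring.
Qed.

Lemma Cd_is_derive (f : C -> C) (z l : C) :
  Cd f z l <-> is_derive (K := C_AbsRing) (V := C_NormedModule) f z l.
Proof.
  split.
  - intros H. split; [apply is_linear_scal_l|].
    intros x Hx.
    pose proof (is_filter_lim_locally_unique (V := AbsRing_NormedModule C_AbsRing) z x Hx) as E.
    subst x.
    intros eps. assert (He : 0 < eps) by apply cond_pos. specialize (H eps He).
    apply locally_C. revert H. apply filter_imp. intros w Hw.
    change (Cmod (f w + - f z + - ((w + - z) * l)) <= eps * Cmod (w - z)).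
    replace (f w + - f z + - ((w + - z) * l)) with (f w - f z - l * (w - z)) by ring.
    exact Hw.
  - intros [_ H] eps He. specialize (H z (fun P HP => HP) (mkposreal eps He)).
    apply locally_C in H. revert H. apply filter_imp. intros w Hw.
    change (Cmod (f w + - f z + - ((w + - z) * l)) <= eps * Cmod (w - z)) in Hw.
    replace (f w - f z - l * (w - z)) with (f w + - f z + - ((w + - z) * l)) by ring.
    exact Hw.
Qed.

Definition dif (f : C -> C) (z : C) : Prop := exists l, Cd f z l.

Lemma dif_cts f z : dif f z -> cts f z.
Proof. intros [l H]. eapply Cd_cts, H. Qed.

Lemma dif_ext_loc (f g : C -> C) (z : C) : locally z (fun w => f w = g w) -> dif f z -> dif g z.
Proof. intros H [l Hl]. exists l. eapply Cd_ext_loc; eassumption. Qed.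

Lemma dif_const c z : dif (fun _ => c) z.
Proof. exists 0. apply Cd_const. Qed.
Lemma dif_id z : dif (fun w => w) z.
Proof. exists 1. apply Cd_id. Qed.
Lemma dif_plus f g z : dif f z -> dif g z -> dif (fun w => f w + g w) z.
Proof. intros [a Ha] [b Hb]. eexists. apply Cd_plus; eassumption. Qed.
Lemma dif_opp f z : dif f z -> dif (fun w => - f w) z.
Proof. intros [a Ha]. eexists. apply Cd_opp; eassumption. Qed.
Lemma dif_minus f g z : dif f z -> dif g z -> dif (fun w => f w - g w) z.
Proof. intros [a Ha] [b Hb]. eexists. apply Cd_minus; eassumption. Qed.
Lemma dif_mult f g z : dif f z -> dif g z -> dif (fun w => f w * g w) z.
Proof. intros [a Ha] [b Hb]. eexists. apply Cd_mult; eassumption. Qed.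
Lemma dif_inv f z : dif f z -> f z <> 0 -> dif (fun w => / f w) z.
Proof. intros [a Ha] Hz. eexists. apply Cd_inv; eassumption. Qed.
Lemma dif_div f g z : dif f z -> dif g z -> g z <> 0 -> dif (fun w => f w / g w) z.
Proof. intros [a Ha] [b Hb] Hz. eexists. apply Cd_div; eassumption. Qed.
Lemma dif_pow f n z : dif f z -> dif (fun w => f w ^ n) z.
Proof. intros [a Ha]. eexists. apply Cd_pow; eassumption. Qed.
Lemma dif_comp f g z : dif g z -> dif f (g z) -> dif (fun w => f (g w)) z.
Proof. intros [b Hb] [a Ha]. eexists. eapply Cd_comp; eassumption. Qed.

Lemma holomorphic_at_dif (f : C -> C) (z : C) : holomorphic_at f z <-> locally z (dif f).
Proof.
  unfold holomorphic_at. split; apply filter_imp; intros w [l H]; exists l; apply Cd_is_derive; exact H.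
Qed.

(** * The complex exponential *)

Lemma Cexp_plus (a b : C) : Cexp (a + b) = Cexp a * Cexp b.
Proof.
  unfold Cexp. destruct a as [a1 a2], b as [b1 b2]. unfold Re, Im. simpl.
  rewrite exp_plus, cos_plus, sin_plus. apply injective_projections; simpl; ring.
Qed.

Lemma Cexp_0 : Cexp 0 = 1.
Proof. unfold Cexp, Re, Im. simpl. rewrite exp_0, cos_0, sin_0. apply injective_projections; simpl; ring. Qed.

Lemma Cexp_opp (a : C) : Cexp (- a) = / Cexp a.
Proof.
  assert (H : Cexp (- a) * Cexp a = 1) by (rewrite <- Cexp_plus; replace (- a + a) with (RtoC 0) by ring; apply Cexp_0).
  assert (Cexp a <> 0).
  { intros E. rewrite E, Cmult_0_r in H. apply C1_nz. symmetry. exact H. }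
  apply (Cmult_reg_r _ _ (Cexp a)); [assumption|]. rewrite H. field. assumption.
Qed.

Lemma Cmod_Cexp (a : C) : Cmod (Cexp a) = exp (Re a).
Proof.
  unfold Cmod, Cexp. simpl fst. simpl snd.
  replace ((exp (Re a) * cos (Im a)) ^ 2 + (exp (Re a) * sin (Im a)) ^ 2)%R with (exp (Re a) ^ 2)%R.
  - apply sqrt_pow2. apply Rlt_le, exp_pos.
  - pose proof (sin2_cos2 (Im a)) as E. unfold Rsqr in E.
    replace ((exp (Re a) * cos (Im a)) ^ 2 + (exp (Re a) * sin (Im a)) ^ 2)%R
      with (exp (Re a) ^ 2 * (sin (Im a) * sin (Im a) + cos (Im a) * cos (Im a)))%R by ring.
    rewrite E. ring.
Qed.

Lemma Cexp_neq_0 (a : C) : Cexp a <> 0.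
Proof. apply Cmod_gt_0. rewrite Cmod_Cexp. apply exp_pos. Qed.

Lemma Cexp_conj (a : C) : Cexp (Cconj a) = Cconj (Cexp a).
Proof.
  unfold Cexp, Cconj. destruct a as [x y]. unfold Re, Im. simpl.
  rewrite cos_neg, sin_neg. apply injective_projections; simpl; ring.
Qed.

Lemma Cexp_RtoC (x : R) : Cexp (RtoC x) = RtoC (exp x).
Proof. unfold Cexp, Re, Im. simpl. rewrite cos_0, sin_0. apply injective_projections; simpl; ring. Qed.

Lemma lin_approx (f : R -> R) (l : R) : is_derive f 0%R l ->
  forall eps, 0 < eps -> exists d, 0 < d /\ forall x, Rabs x < d ->
    Rabs (f x - f 0 - l * x) <= eps * Rabs x.
Proof.
  intros [_ H] eps He. specialize (H 0%R (fun P HP => HP) (mkposreal eps He)).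
  apply locallyR in H. destruct H as [d [Hd H]]. exists d. split; [exact Hd|].
  intros x Hx. specialize (H x). unfold norm, minus, plus, opp, scal in H; simpl in H.
  unfold abs, mult in H; simpl in H.
  replace (f x - f 0 - l * x)%R with (f x + - f 0 + - ((x + - 0) * l))%R by ring.
  replace (Rabs x) with (Rabs (x + - 0)) by (f_equal; ring). apply H.
  rewrite Rminus_0_r. exact Hx.
Qed.

Lemma Cmod_le_Rabs (a b : R) : Cmod (a, b) <= Rabs a + Rabs b.
Proof.
  replace (a, b) with (RtoC a + Ci * RtoC b).
  - eapply Rle_trans; [apply Cmod_triangle|]. rewrite Cmod_mult, Cmod_Ci, !Cmod_R. lra.
  - apply injective_projections; simpl; ring.
Qed.

Lemma im_le_Cmod (c : C) : Rabs (Im c) <= Cmod c.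
Proof. eapply Rle_trans; [|apply Rmax_Cmod]. apply Rmax_r. Qed.

(** The real and imaginary parts differ from those of [1 + x + i y] by the first-order errors of
    [exp], [cos] and [sin] at 0 and by products of two small increments. Other points are reached by
    the functional equation in [Cd_Cexp]. *)
Lemma Cd_Cexp_0 : Cd Cexp 0 1.
Proof.
  intros eps He.
  (* The error terms collected at the end have weights 1, 2, 4 and 1 in units of [eps / 8]. The cap
     at 1 keeps [1 + x] below 2 and absorbs the relative errors of [exp] and [sin] into factors
     2. *)
  destruct (lin_approx exp 1 (proj2 (is_derive_Reals _ _ _) derivable_pt_lim_exp_0) (Rmin 1 (eps / 8))) as [d1 [Hd1 H1]].
  { apply Rmin_pos; lra. }
  destruct (lin_approx cos 0) with (eps := (eps / 8)%R) as [d2 [Hd2 H2]]; [|lra|].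
  { pose proof (is_derive_cos 0) as E. rewrite sin_0, Ropp_0 in E. exact E. }
  destruct (lin_approx sin 1) with (eps := Rmin 1 (eps / 8)) as [d3 [Hd3 H3]]; [| |].
  { pose proof (is_derive_sin 0) as E. rewrite cos_0 in E. exact E. }
  { apply Rmin_pos; lra. }
  apply locallyC.
  exists (Rmin (Rmin d1 d2) (Rmin d3 (Rmin 1 (eps / 8)))). split.
  { repeat apply Rmin_pos; lra. }
  intros w Hw. replace (w - 0) with w in * by ring. rewrite Cexp_0.
  destruct w as [x y]. set (m := Cmod (x, y)) in *.
  assert (Hx : Rabs x <= m) by exact (re_le_Cmod (x, y)).
  assert (Hy : Rabs y <= m) by exact (im_le_Cmod (x, y)).
  assert (Hm1 : m < d1) by (eapply Rlt_le_trans; [exact Hw|]; eapply Rle_trans; [apply Rmin_l|apply Rmin_l]).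
  assert (Hm2 : m < d2) by (eapply Rlt_le_trans; [exact Hw|]; eapply Rle_trans; [apply Rmin_l|apply Rmin_r]).
  assert (Hm3 : m < d3) by (eapply Rlt_le_trans; [exact Hw|]; eapply Rle_trans; [apply Rmin_r|apply Rmin_l]).
  assert (Hm4 : m < Rmin 1 (eps / 8)) by (eapply Rlt_le_trans; [exact Hw|]; eapply Rle_trans; [apply Rmin_r|apply Rmin_r]).
  pose proof (Rmin_l 1 (eps / 8)) as Hr1. pose proof (Rmin_r 1 (eps / 8)) as Hr2.
  set (e := Rmin 1 (eps / 8)) in *.
  specialize (H1 x ltac:(lra)). specialize (H2 y ltac:(lra)). specialize (H3 y ltac:(lra)).
  rewrite exp_0 in H1. rewrite cos_0 in H2. rewrite sin_0 in H3.
  pose proof (Rabs_pos x). pose proof (Rabs_pos y).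
  assert (Hm0 : 0 <= m) by apply Cmod_ge_0.
  replace (Cexp (x, y) - 1 - 1 * (x, y)) with
    ((((exp x - 1 - 1 * x) * cos y + (1 + x) * (cos y - 1 - 0 * y))%R,
      ((exp x - 1 - 1 * x + x) * sin y + (sin y - 0 - 1 * y))%R) : C).
  2:{ unfold Cexp, Re, Im. apply injective_projections; simpl; ring. }
  eapply Rle_trans; [apply Cmod_le_Rabs|].
  assert (Hc : Rabs (cos y) <= 1) by (apply Rabs_le; pose proof (COS_bound y); lra).
  assert (A1 : Rabs ((exp x - 1 - 1 * x) * cos y + (1 + x) * (cos y - 1 - 0 * y))
     <= e * Rabs x + 2 * (eps / 8 * Rabs y)).
  { eapply Rle_trans; [apply Rabs_triang|]. rewrite !Rabs_mult. apply Rplus_le_compat.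
    - rewrite <- (Rmult_1_r (e * Rabs x)). apply Rmult_le_compat; try apply Rabs_pos; assumption.
    - apply Rmult_le_compat; try apply Rabs_pos; [|assumption].
      eapply Rle_trans; [apply Rabs_triang|]. rewrite Rabs_R1. lra. }
  assert (Hs : Rabs (sin y) <= 2 * Rabs y).
  { replace (sin y) with ((sin y - 0 - 1 * y) + y)%R by ring.
    eapply Rle_trans; [apply Rabs_triang|].
    assert (e * Rabs y <= 1 * Rabs y)%R by (apply Rmult_le_compat_r; lra). lra. }
  assert (He1 : Rabs (exp x - 1 - 1 * x + x) <= 2 * m).
  { eapply Rle_trans; [apply Rabs_triang|].
    assert (e * Rabs x <= 1 * Rabs x)%R by (apply Rmult_le_compat_r; lra). lra. }
  assert (A2 : Rabs ((exp x - 1 - 1 * x + x) * sin y + (sin y - 0 - 1 * y))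
     <= 2 * m * (2 * Rabs y) + e * Rabs y).
  { eapply Rle_trans; [apply Rabs_triang|]. rewrite !Rabs_mult. apply Rplus_le_compat; [|assumption].
    apply Rmult_le_compat; try apply Rabs_pos; assumption. }
  assert (B1 : (e * Rabs x <= eps / 8 * m)%R) by (apply Rmult_le_compat; lra).
  assert (B2 : (eps / 8 * Rabs y <= eps / 8 * m)%R) by (apply Rmult_le_compat_l; lra).
  assert (B3 : (e * Rabs y <= eps / 8 * m)%R) by (apply Rmult_le_compat; lra).
  assert (B4 : (m * Rabs y <= eps / 8 * m)%R) by (apply Rmult_le_compat; lra).
  lra.
Qed.

Lemma Cd_Cexp (z : C) : Cd Cexp z (Cexp z).
Proof.
  eapply Cd_ext with (fun w => Cexp z * Cexp (w - z)).
  { intros w. rewrite <- Cexp_plus. f_equal. ring. }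
  eapply Cd_eq.
  - apply Cd_scal. apply (Cd_comp Cexp (fun w => w - z)).
    + apply Cd_minus; [apply Cd_id|apply Cd_const].
    + replace (z - z) with (RtoC 0) by ring. apply Cd_Cexp_0.
  - ring.
Qed.

Lemma dif_Cexp z : dif Cexp z.
Proof. eexists. apply Cd_Cexp. Qed.
Lemma cts_Cexp z : cts Cexp z.
Proof. apply dif_cts, dif_Cexp. Qed.
Lemma cts_idR (x : R) : cts RtoC x.
Proof. apply (cts_RtoC (fun t => t)). apply continuous_id. Qed.

(** * Integrals of complex functions and Goursat's theorem *)

(** Componentwise, so that the real fundamental theorem and real integrability apply directly; the
    module-valued improper integral of the statement is reached from it in [line_is_RInt_gen]. *)
Definition CI (f : R -> C) (a b : R) : C :=
  (RInt (fun t => fst (f t)) a b, RInt (fun t => snd (f t)) a b).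

Section CI.
Variables (a b : R).
Hypothesis Hab : a <= b.

Definition ctsI (f : R -> C) : Prop := forall t, a <= t <= b -> cts f t.

Lemma ctsI_fst f : ctsI f -> ex_RInt (fun t => fst (f t)) a b.
Proof.
  intros H. apply (ex_RInt_continuous (V := R_CompleteNormedModule)). intros t.
  rewrite Rmin_left, Rmax_right by exact Hab. intros Ht. apply cts_fst, H, Ht.
Qed.

Lemma ctsI_snd f : ctsI f -> ex_RInt (fun t => snd (f t)) a b.
Proof.
  intros H. apply (ex_RInt_continuous (V := R_CompleteNormedModule)). intros t.
  rewrite Rmin_left, Rmax_right by exact Hab. intros Ht. apply cts_snd, H, Ht.
Qed.

Lemma CI_ext f g : (forall t, a <= t <= b -> f t = g t) -> CI f a b = CI g a b.
Proof.
  intros H. unfold CI. f_equal; apply RInt_ext; intros t;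
  rewrite Rmin_left, Rmax_right by exact Hab; intros Ht; rewrite H; auto; lra.
Qed.

Lemma CI_plus f g : ctsI f -> ctsI g -> CI (fun t => f t + g t) a b = CI f a b + CI g a b.
Proof.
  intros Hf Hg. unfold CI. apply injective_projections; simpl.
  - apply (RInt_plus (V := R_CompleteNormedModule)); apply ctsI_fst; assumption.
  - apply (RInt_plus (V := R_CompleteNormedModule)); apply ctsI_snd; assumption.
Qed.

Lemma CI_minus f g : ctsI f -> ctsI g -> CI (fun t => f t - g t) a b = CI f a b - CI g a b.
Proof.
  intros Hf Hg. unfold CI. apply injective_projections; simpl.
  - apply (RInt_minus (V := R_CompleteNormedModule)); apply ctsI_fst; assumption.
  - apply (RInt_minus (V := R_CompleteNormedModule)); apply ctsI_snd; assumption.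
Qed.

Lemma CI_scal (c : C) f : ctsI f -> CI (fun t => c * f t) a b = c * CI f a b.
Proof.
  intros Hf. pose proof (ctsI_fst f Hf) as H1. pose proof (ctsI_snd f Hf) as H2.
  unfold CI. apply injective_projections; simpl.
  - rewrite (RInt_minus (V := R_CompleteNormedModule) (fun t => (fst c * fst (f t))%R) (fun t => (snd c * snd (f t))%R)).
    + rewrite !(RInt_scal (V := R_CompleteNormedModule)) by assumption. reflexivity.
    + apply (ex_RInt_scal (V := R_NormedModule)); assumption.
    + apply (ex_RInt_scal (V := R_NormedModule)); assumption.
  - rewrite (RInt_plus (V := R_CompleteNormedModule) (fun t => (fst c * snd (f t))%R) (fun t => (snd c * fst (f t))%R)).
    + rewrite !(RInt_scal (V := R_CompleteNormedModule)) by assumption. reflexivity.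
    + apply (ex_RInt_scal (V := R_NormedModule)); assumption.
    + apply (ex_RInt_scal (V := R_NormedModule)); assumption.
Qed.

Lemma CI_const (c : C) : CI (fun _ => c) a b = c * RtoC (b - a).
Proof.
  unfold CI. rewrite !RInt_const. unfold scal; simpl. unfold mult; simpl.
  apply injective_projections; simpl; ring.
Qed.

Lemma CI_conj f : ctsI f -> CI (fun t => Cconj (f t)) a b = Cconj (CI f a b).
Proof.
  intros Hf. unfold CI, Cconj. apply injective_projections; simpl; [reflexivity|].
  apply (RInt_opp (V := R_CompleteNormedModule)). apply ctsI_snd; assumption.
Qed.

(** Multiplying by the unit [u = conj I / |I|] makes the integral real and equal to its modulus, so
    only [Re (u f) <= |f|] has to be integrated. The case [I = 0] is separate because [u] would not
    be a unit. *)
Lemma Cmod_CI_le f (g : R -> R) : ctsI f -> ex_RInt g a b ->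
  (forall t, a <= t <= b -> Cmod (f t) <= g t) -> Cmod (CI f a b) <= RInt g a b.
Proof.
  intros Hf Hg H. set (I := CI f a b).
  destruct (Req_dec (Cmod I) 0) as [E|E].
  - rewrite E. apply RInt_ge_0; [exact Hab|exact Hg|].
    intros t Ht. eapply Rle_trans; [apply Cmod_ge_0|apply H; lra].
  - set (u := Cconj I / RtoC (Cmod I)).
    assert (EI : RtoC (Cmod I) <> 0).
    { intros E2. apply E. apply RtoC_inj. exact E2. }
    assert (Hu : Cmod u = 1).
    { unfold u. rewrite Cmod_div by exact EI. rewrite Cmod_conj, Cmod_R, Rabs_pos_eq by apply Cmod_ge_0.
      field. exact E. }
    assert (E1 : u * I = RtoC (Cmod I)).
    { unfold u. replace (Cconj I / RtoC (Cmod I) * I) with (I * Cconj I / RtoC (Cmod I)) by (field; exact EI).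
      rewrite <- Cmod2_conj. rewrite <- RtoC_div by exact E. f_equal. field. exact E. }
    assert (E2 : Cmod I = RInt (fun t => fst (u * f t)) a b).
    { transitivity (fst (u * I)); [rewrite E1; reflexivity|].
      unfold I. rewrite <- CI_scal by exact Hf. reflexivity. }
    rewrite E2. apply RInt_le; [exact Hab| |exact Hg|].
    + apply ctsI_fst. intros t Ht. apply cts_mult; [apply cts_const|apply Hf, Ht].
    + intros t Ht. eapply Rle_trans; [|apply H; lra].
      eapply Rle_trans; [apply Rle_abs|]. eapply Rle_trans; [apply (re_le_Cmod (u * f t))|].
      rewrite Cmod_mult, Hu. lra.
Qed.

Lemma Cmod_CI_const f (M : R) : ctsI f ->
  (forall t, a <= t <= b -> Cmod (f t) <= M) -> Cmod (CI f a b) <= M * (b - a).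
Proof.
  intros Hf H. eapply Rle_trans.
  - apply (Cmod_CI_le f (fun _ => M)); [exact Hf|apply ex_RInt_const|exact H].
  - rewrite RInt_const. unfold scal; simpl. unfold mult; simpl. lra.
Qed.

End CI.

Lemma CI_Chasles f a b c : a <= b -> b <= c -> ctsI a c f -> CI f a b + CI f b c = CI f a c.
Proof.
  intros H1 H2 Hf. assert (A : ctsI a b f) by (intros t Ht; apply Hf; lra).
  assert (B : ctsI b c f) by (intros t Ht; apply Hf; lra).
  unfold CI. apply injective_projections; simpl.
  - apply (RInt_Chasles (V := R_CompleteNormedModule)); apply ctsI_fst; assumption.
  - apply (RInt_Chasles (V := R_CompleteNormedModule)); apply ctsI_snd; assumption.
Qed.

Lemma CI_point f a : CI f a a = 0.
Proof. unfold CI. rewrite !RInt_point. reflexivity. Qed.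

Lemma Cd_line (F : C -> C) (p q l : C) (t : R) : Cd F (p + RtoC t * q) l ->
  is_derive (fun s => fst (F (p + RtoC s * q))) t (fst (l * q)) /\
  is_derive (fun s => snd (F (p + RtoC s * q))) t (snd (l * q)).
Proof.
  intros H.
  assert (K : forall eps, 0 < eps -> locally t (fun s =>
     Cmod (F (p + RtoC s * q) - F (p + RtoC t * q) - RtoC (s - t) * (l * q)) <= eps * Rabs (s - t))).
  { intros eps He. pose proof (Cmod_ge_0 q) as Hq.
    (* Dividing by [Cmod q + 1] rather than by [Cmod q] admits the degenerate line [q = 0]. *)
    assert (He2 : 0 < eps / (Cmod q + 1)) by (apply Rdiv_lt_0_compat; lra).
    specialize (H _ He2).
    assert (Hc : cts (fun s => p + RtoC s * q) t).
    { apply cts_plus; [apply cts_const|]. apply cts_mult; [apply cts_idR|apply cts_const]. }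
    generalize (lim_locally _ _ _ _ Hc H). apply filter_imp. intros s Hs.
    replace (p + RtoC s * q - (p + RtoC t * q)) with (RtoC (s - t) * q) in Hs by (rewrite RtoC_minus; ring).
    replace (l * (RtoC (s - t) * q)) with (RtoC (s - t) * (l * q)) in Hs by ring.
    eapply Rle_trans; [exact Hs|]. rewrite Cmod_mult, Cmod_R.
    replace (eps * Rabs (s - t))%R with (eps / (Cmod q + 1) * (Rabs (s - t) * (Cmod q + 1)))%R by (field; lra).
    apply Rmult_le_compat_l; [lra|]. apply Rmult_le_compat_l; [apply Rabs_pos|lra]. }
  split; (split; [apply is_linear_scal_l|]); intros x Hx;
    pose proof (is_filter_lim_locally_unique (V := R_NormedModule) t x Hx) as E; subst x;
    intros eps; generalize (K eps (cond_pos eps)); apply filter_imp; intros s Hs;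
    (eapply Rle_trans; [|exact Hs]).
  - eapply Rle_trans; [|apply re_le_Cmod]. unfold norm, minus, plus, opp, scal; simpl.
    unfold abs, mult; simpl. right. f_equal. unfold Re. simpl. ring.
  - eapply Rle_trans; [|apply im_le_Cmod]. unfold norm, minus, plus, opp, scal; simpl.
    unfold abs, mult; simpl. right. f_equal. unfold Im. simpl. ring.
Qed.

Lemma CI_FTC (F f : R -> C) (a b : R) : a <= b -> ctsI a b f ->
  (forall t, a <= t <= b -> is_derive (fun s => fst (F s)) t (fst (f t)) /\
                            is_derive (fun s => snd (F s)) t (snd (f t))) ->
  CI f a b = F b - F a.
Proof.
  intros Hab Hf H. unfold CI. apply injective_projections; simpl; apply is_RInt_unique.
  - apply (is_RInt_derive (V := R_CompleteNormedModule) (fun s => fst (F s)) (fun s => fst (f s)));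
    intros t; rewrite Rmin_left, Rmax_right by exact Hab; intros Ht.
    + apply H, Ht.
    + apply cts_fst, Hf, Ht.
  - apply (is_RInt_derive (V := R_CompleteNormedModule) (fun s => snd (F s)) (fun s => snd (f s)));
    intros t; rewrite Rmin_left, Rmax_right by exact Hab; intros Ht.
    + apply H, Ht.
    + apply cts_snd, Hf, Ht.
Qed.

Lemma CI_FTC_line (F f : C -> C) (p q : C) (a b : R) : a <= b ->
  (forall t, a <= t <= b -> Cd F (p + RtoC t * q) (f (p + RtoC t * q))) ->
  ctsI a b (fun t => f (p + RtoC t * q)) ->
  q * CI (fun t => f (p + RtoC t * q)) a b = F (p + RtoC b * q) - F (p + RtoC a * q).
Proof.
  intros Hab HF Hf. rewrite <- CI_scal by assumption.
  apply (CI_FTC (fun t => F (p + RtoC t * q))); [exact Hab| |].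
  - intros t Ht. apply cts_mult; [apply cts_const|apply Hf, Ht].
  - intros t Ht. rewrite (Cmult_comm q). apply Cd_line, HF, Ht.
Qed.

Lemma hline (x c : R) : ((x, c) : C) = Ci * RtoC c + RtoC x * 1.
Proof. apply injective_projections; simpl; ring. Qed.
Lemma vline (a y : R) : ((a, y) : C) = RtoC a + RtoC y * Ci.
Proof. apply injective_projections; simpl; ring. Qed.

Lemma cts_h (c x : R) : cts (fun t => ((t, c) : C)) x.
Proof.
  apply cts_ext_loc with (fun t => Ci * RtoC c + RtoC t * 1).
  - apply filter_forall. intros t. symmetry. apply hline.
  - apply cts_plus; [apply cts_const|apply cts_mult; [apply cts_idR|apply cts_const]].
Qed.
Lemma cts_v (a y : R) : cts (fun t => ((a, t) : C)) y.
Proof.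
  apply cts_ext_loc with (fun t => RtoC a + RtoC t * Ci).
  - apply filter_forall. intros t. symmetry. apply vline.
  - apply cts_plus; [apply cts_const|apply cts_mult; [apply cts_idR|apply cts_const]].
Qed.

(** The counterclockwise integral over the boundary of [[a, b] x [c, d]]: bottom, right, top and
    left side, the vertical ones with [dz = i dy]. *)
Definition J (f : C -> C) (a b c d : R) : C :=
  CI (fun x => f (x, c)) a b + Ci * CI (fun y => f (b, y)) c d
  - CI (fun x => f (x, d)) a b - Ci * CI (fun y => f (a, y)) c d.

Definition rect (a b c d : R) (z : C) : Prop := a <= fst z <= b /\ c <= snd z <= d.

Definition ctsR (f : C -> C) a b c d : Prop := forall z, rect a b c d z -> cts f z.

Lemma ctsR_h f a b c d y : ctsR f a b c d -> c <= y <= d -> ctsI a b (fun x => f (x, y)).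
Proof. intros H Hy t Ht. apply (cts_comp f); [apply cts_h|]. apply H. split; simpl; lra. Qed.
Lemma ctsR_v f a b c d x : ctsR f a b c d -> a <= x <= b -> ctsI c d (fun y => f (x, y)).
Proof. intros H Hy t Ht. apply (cts_comp f); [apply cts_v|]. apply H. split; simpl; lra. Qed.

Lemma ctsR_sub f a b c d a' b' c' d' : ctsR f a b c d ->
  a <= a' -> b' <= b -> c <= c' -> d' <= d -> ctsR f a' b' c' d'.
Proof. intros H H1 H2 H3 H4 z [Hz1 Hz2]. apply H. split; lra. Qed.

Lemma J_split_x f a m b c d : a <= m <= b -> c <= d -> ctsR f a b c d ->
  J f a b c d = J f a m c d + J f m b c d.
Proof.
  intros Hm Hc Hf. unfold J.
  rewrite <- (CI_Chasles (fun x => f (x, c)) a m b) by (first [lra | eapply ctsR_h; [eassumption|lra]]).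
  rewrite <- (CI_Chasles (fun x => f (x, d)) a m b) by (first [lra | eapply ctsR_h; [eassumption|lra]]).
  ring.
Qed.

Lemma J_split_y f a b c m d : a <= b -> c <= m <= d -> ctsR f a b c d ->
  J f a b c d = J f a b c m + J f a b m d.
Proof.
  intros Hm Hc Hf. unfold J.
  rewrite <- (CI_Chasles (fun y => f (a, y)) c m d) by (first [lra | eapply ctsR_v; [eassumption|lra]]).
  rewrite <- (CI_Chasles (fun y => f (b, y)) c m d) by (first [lra | eapply ctsR_v; [eassumption|lra]]).
  ring.
Qed.

Lemma J_bound f a b c d M : a <= b -> c <= d -> ctsR f a b c d ->
  (forall z, rect a b c d z -> Cmod (f z) <= M) ->
  Cmod (J f a b c d) <= 2 * M * ((b - a) + (d - c)).
Proof.
  intros Hab Hcd Hf HM. unfold J.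
  assert (H1 : forall y, c <= y <= d -> Cmod (CI (fun x => f (x, y)) a b) <= M * (b - a)).
  { intros y Hy. apply Cmod_CI_const; [exact Hab|eapply ctsR_h; eassumption|].
    intros t Ht. apply HM. split; simpl; lra. }
  assert (H2 : forall x, a <= x <= b -> Cmod (Ci * CI (fun y => f (x, y)) c d) <= M * (d - c)).
  { intros x Hx. rewrite Cmod_mult, Cmod_Ci, Rmult_1_l.
    apply Cmod_CI_const; [exact Hcd|eapply ctsR_v; eassumption|].
    intros t Ht. apply HM. split; simpl; lra. }
  pose proof (H1 c ltac:(lra)). pose proof (H1 d ltac:(lra)).
  pose proof (H2 a ltac:(lra)). pose proof (H2 b ltac:(lra)).
  unfold Cminus.
  eapply Rle_trans; [apply Cmod_triangle|]. rewrite Cmod_opp.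
  eapply Rle_trans; [apply Rplus_le_compat_r, Cmod_triangle|]. rewrite Cmod_opp.
  eapply Rle_trans; [apply Rplus_le_compat_r, Rplus_le_compat_r, Cmod_triangle|]. lra.
Qed.

Lemma J_primitive (F f : C -> C) a b c d : a <= b -> c <= d -> ctsR f a b c d ->
  (forall z, rect a b c d z -> Cd F z (f z)) -> J f a b c d = 0.
Proof.
  intros Hab Hcd Hf HF.
  assert (H1 : forall y, c <= y <= d -> CI (fun x => f (x, y)) a b = F (b, y) - F (a, y)).
  { intros y Hy. rewrite (hline b y), (hline a y). rewrite <- (CI_FTC_line F f); [|exact Hab| |].
    - rewrite Cmult_1_l. apply CI_ext; [exact Hab|]. intros t Ht. rewrite <- hline. reflexivity.
    - intros t Ht. rewrite <- hline. apply HF. split; simpl; lra.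
    - intros t Ht. eapply cts_ext_loc; [|eapply (ctsR_h f a b c d y Hf Hy t Ht)].
      apply filter_forall. intros s. rewrite <- hline. reflexivity. }
  assert (H2 : forall x, a <= x <= b -> Ci * CI (fun y => f (x, y)) c d = F (x, d) - F (x, c)).
  { intros x Hx. rewrite (vline x d), (vline x c). rewrite <- (CI_FTC_line F f); [|exact Hcd| |].
    - f_equal. apply CI_ext; [exact Hcd|]. intros t Ht. rewrite <- vline. reflexivity.
    - intros t Ht. rewrite <- vline. apply HF. split; simpl; lra.
    - intros t Ht. eapply cts_ext_loc; [|eapply (ctsR_v f a b c d x Hf Hx t Ht)].
      apply filter_forall. intros s. rewrite <- vline. reflexivity. }
  unfold J. rewrite !H1, !H2 by lra. ring.
Qed.

Lemma J_minus f g a b c d : a <= b -> c <= d -> ctsR f a b c d -> ctsR g a b c d ->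
  J (fun z => f z - g z) a b c d = J f a b c d - J g a b c d.
Proof.
  intros Hab Hcd Hf Hg. unfold J.
  rewrite (CI_minus a b Hab (fun x => f (x, c)) (fun x => g (x, c))) by (eapply ctsR_h; [eassumption|lra]).
  rewrite (CI_minus a b Hab (fun x => f (x, d)) (fun x => g (x, d))) by (eapply ctsR_h; [eassumption|lra]).
  rewrite (CI_minus c d Hcd (fun x => f (a, x)) (fun x => g (a, x))) by (eapply ctsR_v; [eassumption|lra]).
  rewrite (CI_minus c d Hcd (fun x => f (b, x)) (fun x => g (b, x))) by (eapply ctsR_v; [eassumption|lra]).
  ring.
Qed.

Lemma half_pow_small (L d : R) : 0 <= L -> 0 < d -> exists n, L * (/ 2) ^ n < d.
Proof.
  intros HL Hd. destruct (pow_lt_1_zero (/ 2)) with (y := (d / (L + 1))%R) as [N HN].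
  - rewrite Rabs_pos_eq; lra.
  - apply Rdiv_lt_0_compat; lra.
  - exists N. specialize (HN N (le_n _)). rewrite Rabs_pos_eq in HN.
    2:{ apply pow_le. lra. }
    apply Rle_lt_trans with ((L + 1) * (/ 2) ^ N)%R.
    + apply Rmult_le_compat_r; [apply pow_le; lra|lra].
    + apply Rlt_le_trans with ((L + 1) * (d / (L + 1)))%R; [apply Rmult_lt_compat_l; lra|].
      right. field. lra.
Qed.

(** * Bisection of rectangles *)

Section Cousin.
Variable P : R -> R -> R -> R -> Prop.
Variables (a b c d : R).
Hypothesis (Hab : a <= b) (Hcd : c <= d).
Hypothesis quad : forall a' b' c' d', a <= a' <= b' -> b' <= b -> c <= c' <= d' -> d' <= d ->
  let m := ((a' + b') / 2)%R in let n := ((c' + d') / 2)%R in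
  P a' m c' n -> P m b' c' n -> P a' m n d' -> P m b' n d' -> P a' b' c' d'.
Hypothesis loc : forall x y, a <= x <= b -> c <= y <= d -> exists r, 0 < r /\
  forall a' b' c' d', a <= a' <= x -> x <= b' <= b -> c <= c' <= y -> y <= d' <= d ->
    b' - a' < r -> d' - c' < r -> P a' b' c' d'.

(** The fourth quarter is chosen untested: when the first three satisfy [P] and the whole does not,
    [quad] forces the fourth to fail. *)
Definition quarter (q : R * R * R * R) : R * R * R * R :=
  let '(a', b', c', d') := q in
  let m := ((a' + b') / 2)%R in let n := ((c' + d') / 2)%R in
  if excluded_middle_informative (P a' m c' n) then
    if excluded_middle_informative (P m b' c' n) then
      if excluded_middle_informative (P a' m n d') then (m, b', n, d')
      else (a', m, n, d')
    else (m, b', c', n)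
  else (a', m, c', n).

Definition bad (k : nat) (q : R * R * R * R) : Prop :=
  let '(a', b', c', d') := q in
  a <= a' <= b' /\ b' <= b /\ c <= c' <= d' /\ d' <= d /\
  (b' - a' = (b - a) * (/ 2) ^ k)%R /\ (d' - c' = (d - c) * (/ 2) ^ k)%R /\ ~ P a' b' c' d'.

Lemma quarter_bad k q : bad k q -> bad (S k) (quarter q).
Proof.
  destruct q as [[[a' b'] c'] d']. intros (H1 & H2 & H3 & H4 & H5 & H6 & H7).
  pose proof (quad a' b' c' d' H1 H2 H3 H4) as Q. simpl in Q.
  unfold quarter. destruct excluded_middle_informative as [E1|E1];
  [destruct excluded_middle_informative as [E2|E2];
  [destruct excluded_middle_informative as [E3|E3]|]|];
  unfold bad; simpl pow; repeat split; try lra; tauto.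
Qed.

Lemma quarter_nested k q : bad k q ->
  let '(a', b', c', d') := q in let '(a2, b2, c2, d2) := quarter q in
  a' <= a2 /\ b2 <= b' /\ c' <= c2 /\ d2 <= d'.
Proof.
  destruct q as [[[a' b'] c'] d']. intros (H1 & H2 & H3 & H4 & H5 & H6 & H7).
  unfold quarter. destruct excluded_middle_informative as [E1|E1];
  [destruct excluded_middle_informative as [E2|E2];
  [destruct excluded_middle_informative as [E3|E3]|]|];
  repeat split; lra.
Qed.

Lemma nested_point (u v : nat -> R) :
  (forall n, u n <= u (S n)) -> (forall n, v (S n) <= v n) -> (forall n, u n <= v n) ->
  exists x, forall n, u n <= x <= v n.
Proof.
  intros Hu Hv Huv.
  assert (Hu' : forall n k, u n <= u (n + k)%nat).
  { intros n k. induction k as [|k IH]; [rewrite Nat.add_0_r; lra|].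
    rewrite Nat.add_succ_r. eapply Rle_trans; [exact IH|apply Hu]. }
  assert (Hv' : forall n k, v (n + k)%nat <= v n).
  { intros n k. induction k as [|k IH]; [rewrite Nat.add_0_r; lra|].
    rewrite Nat.add_succ_r. eapply Rle_trans; [apply Hv|exact IH]. }
  assert (Huv' : forall n k, u n <= v k).
  { intros n k. eapply Rle_trans; [apply (Hu' n k)|]. eapply Rle_trans; [apply Huv|].
    rewrite Nat.add_comm. apply Hv'. }
  destruct (completeness (fun x => exists n, x = u n)) as [x [H1 H2]].
  - exists (v O). intros y [n ->]. apply Huv'.
  - exists (u O). exists O. reflexivity.
  - exists x. intros n. split; [apply H1; exists n; reflexivity|].
    apply H2. intros y [k ->]. apply Huv'.
Qed.

(** If the property failed, successive bad quarters would shrink to a point, where [loc] makes small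
    rectangles good. This form of compactness serves Goursat's theorem, its variant with exceptional
    points and the existence of maxima, each time with a different [P]. *)
Lemma cousin : P a b c d.
Proof.
  apply NNPP. intros Hn.
  set (s := fun n => Nat.iter n quarter (a, b, c, d)).
  assert (Hs : forall n, bad n (s n)).
  { intros n. induction n as [|n IH]; [simpl; repeat split; try lra; exact Hn|].
    apply (quarter_bad n (s n)). exact IH. }
  set (sa := fun n => fst (fst (fst (s n)))). set (sb := fun n => snd (fst (fst (s n)))).
  set (sc := fun n => snd (fst (s n))). set (sd := fun n => snd (s n)).
  assert (HB : forall n, bad n (sa n, sb n, sc n, sd n)).
  { intros n. specialize (Hs n). unfold sa, sb, sc, sd. destruct (s n) as [[[? ?] ?] ?]. exact Hs. }
  assert (HN : forall n, sa n <= sa (S n) /\ sb (S n) <= sb n /\ sc n <= sc (S n) /\ sd (S n) <= sd n).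
  { intros n. pose proof (quarter_nested n (s n) (Hs n)) as H.
    unfold sa, sb, sc, sd. change (s (S n)) with (quarter (s n)).
    destruct (s n) as [[[? ?] ?] ?]. destruct (quarter _) as [[[? ?] ?] ?]. simpl. exact H. }
  destruct (nested_point sa sb) as [x Hx]; [apply HN|apply HN| |].
  { intros n. destruct (HB n) as (H1 & _). lra. }
  destruct (nested_point sc sd) as [y Hy]; [apply HN|apply HN| |].
  { intros n. destruct (HB n) as (_ & _ & H1 & _). lra. }
  destruct (loc x y) as [r [Hr Hloc]].
  { specialize (Hx O). unfold sa, sb in Hx. simpl in Hx. exact Hx. }
  { specialize (Hy O). unfold sc, sd in Hy. simpl in Hy. exact Hy. }
  destruct (half_pow_small ((b - a) + (d - c)) r) as [n Hn2]; [lra|exact Hr|].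
  specialize (Hx n). specialize (Hy n). destruct (HB n) as (H1 & H2 & H3 & H4 & H5 & H6 & H7).
  apply H7. assert (0 <= (b - a) * (/ 2) ^ n)%R by lra. assert (0 <= (d - c) * (/ 2) ^ n)%R by lra.
  rewrite Rmult_plus_distr_r in Hn2.
  apply Hloc; lra.
Qed.
End Cousin.

Lemma Cmod_rect_le (a b c d : R) (z p : C) : rect a b c d z -> rect a b c d p ->
  Cmod (z - p) <= (b - a) + (d - c).
Proof.
  intros [H1 H2] [H3 H4]. destruct z as [x y], p as [u v]. simpl in *.
  eapply Rle_trans; [apply Cmod_le_Rabs|]. apply Rplus_le_compat; apply Rabs_le; simpl; lra.
Qed.

(** The property passed to [cousin] is [|J| <= eps (half-perimeter)^2]: the half-perimeter halves in
    each quarter, so the four bounds add up to the bound for the whole. Near a point, [f] is affine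
    up to a small multiple of the distance, and the affine part has a primitive. *)
Lemma goursat (f : C -> C) a b c d : a <= b -> c <= d ->
  (forall z, rect a b c d z -> dif f z) -> J f a b c d = 0.
Proof.
  intros Hab Hcd Hf.
  assert (Hc : ctsR f a b c d) by (intros z Hz; apply dif_cts, Hf, Hz).
  assert (K : forall eps, 0 < eps ->
     Cmod (J f a b c d) <= eps * ((b - a) + (d - c)) ^ 2).
  { intros eps He.
    apply (cousin (fun a b c d => Cmod (J f a b c d) <= eps * ((b - a) + (d - c)) ^ 2) a b c d Hab Hcd).
    - intros a' b' c' d' H1 H2 H3 H4 m n P1 P2 P3 P4.
      assert (Hc' : ctsR f a' b' c' d') by (eapply ctsR_sub; [exact Hc|lra..]).
      rewrite (J_split_x f a' m b' c' d'); [|unfold m; lra|lra|exact Hc'].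
      rewrite (J_split_y f a' m c' n d'); [|unfold m; lra|unfold n; lra|].
      2:{ eapply ctsR_sub; [exact Hc'|unfold m; lra..]. }
      rewrite (J_split_y f m b' c' n d'); [|unfold m; lra|unfold n; lra|].
      2:{ eapply ctsR_sub; [exact Hc'|unfold m; lra..]. }
      eapply Rle_trans; [apply Cmod_triangle|].
      eapply Rle_trans; [apply Rplus_le_compat; apply Cmod_triangle|].
      replace (eps * (b' - a' + (d' - c')) ^ 2)%R with (4 * (eps * ((b' - a')/2 + (d' - c')/2) ^ 2))%R by field.
      assert (E1 : (m - a' = (b' - a') / 2)%R) by (unfold m; field).
      assert (E2 : (b' - m = (b' - a') / 2)%R) by (unfold m; field).
      assert (E3 : (n - c' = (d' - c') / 2)%R) by (unfold n; field).
      assert (E4 : (d' - n = (d' - c') / 2)%R) by (unfold n; field).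
      rewrite E1, E3 in P1. rewrite E2, E3 in P2. rewrite E1, E4 in P3. rewrite E2, E4 in P4. lra.
    - intros x y Hx Hy. destruct (Hf (x, y)) as [l Hl]; [split; simpl; lra|].
      assert (He2 : 0 < eps / 2) by lra. specialize (Hl _ He2). apply locallyC in Hl.
      destruct Hl as [r [Hr Hl]]. exists (r / 2)%R. split; [lra|].
      intros a' b' c' d' H1 H2 H3 H4 H5 H6.
      assert (Hc' : ctsR f a' b' c' d') by (eapply ctsR_sub; [exact Hc|lra..]).
      set (p := ((x, y) : C)) in *.
      assert (Hcl : ctsR (fun z => f p + l * (z - p)) a' b' c' d').
      { intros z _. apply cts_plus; [apply cts_const|apply cts_mult; [apply cts_const|]].
        apply cts_minus; [apply cts_id|apply cts_const]. }
      assert (E : J f a' b' c' d' = J (fun z => f z - (f p + l * (z - p))) a' b' c' d').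
      { rewrite J_minus by (try assumption; lra).
        rewrite (J_primitive (fun z => f p * z + l * ((z - p) * (z - p) / 2))
                   (fun z => f p + l * (z - p))); [ring|lra|lra|assumption|].
        intros z _. eapply Cd_eq.
        - apply Cd_plus; [apply Cd_scal, Cd_id|]. apply Cd_scal.
          apply Cd_mult; [|apply Cd_const].
          apply Cd_mult; apply Cd_minus; try apply Cd_id; apply Cd_const.
        - cfield. }
      rewrite E. eapply Rle_trans; [apply J_bound with (M := (eps / 2 * ((b' - a') + (d' - c')))%R)|].
      + lra.
      + lra.
      + intros z Hz. apply cts_minus; [apply Hc', Hz|apply Hcl, Hz].
      + intros z Hz. assert (Hp : rect a' b' c' d' p) by (split; simpl; lra).
        pose proof (Cmod_rect_le _ _ _ _ _ _ Hz Hp) as Hd.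
        replace (f z - (f p + l * (z - p))) with (f z - f p - l * (z - p)) by ring.
        eapply Rle_trans; [apply Hl; lra|]. apply Rmult_le_compat_l; lra.
      + right. field. }
  apply Cmod_eq_0. apply Rle_antisym; [|apply Cmod_ge_0]. apply le_epsilon. intros eps He.
  rewrite Rplus_0_l. set (S := ((b - a + (d - c)) ^ 2)%R) in *.
  assert (HS : 0 <= S) by apply pow2_ge_0.
  assert (He2 : 0 < eps / (S + 1)) by (apply Rdiv_lt_0_compat; lra).
  eapply Rle_trans; [apply (K _ He2)|].
  replace (eps / (S + 1) * S)%R with (eps * (S / (S + 1)))%R by (field; lra).
  rewrite <- (Rmult_1_r eps) at 2. apply Rmult_le_compat_l; [lra|].
  apply Rmult_le_reg_r with (S + 1)%R; [lra|]. unfold Rdiv. rewrite Rmult_assoc, Rinv_l by lra. lra.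
Qed.

(** * Cauchy's formula and removable singularities *)

(** The class in which Cauchy's theorem is proved. Difference quotients with fixed base point belong
    to it, so Cauchy's formula and the removal of singularities come out of one argument. *)
Definition almost_dif (f : C -> C) (p : C) : Prop := cts f p /\ locally' p (dif f).

Lemma dif_almost f p : locally p (dif f) -> almost_dif f p.
Proof.
  intros H. split; [apply dif_cts, (locally_singleton _ _ H)|].
  unfold locally', within. revert H. apply filter_imp. auto.
Qed.

Lemma almost_dif_lin f g p : almost_dif f p -> almost_dif g p ->
  almost_dif (fun z => f z + g z) p.
Proof.
  intros [H1 H2] [H3 H4]. split; [apply cts_plus; assumption|].
  generalize (filter_and _ _ H2 H4). apply filter_imp. intros z [A B]. apply dif_plus; assumption.
Qed.

Lemma almost_dif_mult f g p : almost_dif f p -> almost_dif g p ->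
  almost_dif (fun z => f z * g z) p.
Proof.
  intros [H1 H2] [H3 H4]. split; [apply cts_mult; assumption|].
  generalize (filter_and _ _ H2 H4). apply filter_imp. intros z [A B]. apply dif_mult; assumption.
Qed.

(** Around an exceptional point a small rectangle is cut into a core with sides at most [2 e], whose
    integral is [O(e)] by continuity, and four strips without the point, to which [goursat] applies.
    As [e] is arbitrary, the integral vanishes. *)
Lemma goursat_almost (f : C -> C) a b c d : a <= b -> c <= d ->
  (forall z, rect a b c d z -> almost_dif f z) -> J f a b c d = 0.
Proof.
  intros Hab Hcd Hf.
  assert (Hc : ctsR f a b c d) by (intros z Hz; apply Hf, Hz).
  apply (cousin (fun a b c d => J f a b c d = 0) a b c d Hab Hcd).
  - intros a' b' c' d' H1 H2 H3 H4 m n P1 P2 P3 P4.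
    assert (Hc' : ctsR f a' b' c' d') by (eapply ctsR_sub; [exact Hc|lra..]).
    rewrite (J_split_x f a' m b' c' d'); [|unfold m; lra|lra|exact Hc'].
    rewrite (J_split_y f a' m c' n d'); [|unfold m; lra|unfold n; lra|].
    2:{ eapply ctsR_sub; [exact Hc'|unfold m; lra..]. }
    rewrite (J_split_y f m b' c' n d'); [|unfold m; lra|unfold n; lra|].
    2:{ eapply ctsR_sub; [exact Hc'|unfold m; lra..]. }
    rewrite P1, P2, P3, P4. ring.
  - intros x y Hx Hy. set (p := ((x, y) : C)).
    destruct (Hf p) as [Hfc Hfd]; [split; simpl; lra|].
    apply locallyC' in Hfd. destruct Hfd as [r1 [Hr1 Hfd]].
    pose proof (Hfc 1 Rlt_0_1) as Hb. apply locallyC in Hb. destruct Hb as [r2 [Hr2 Hb]].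
    exists (Rmin r1 r2 / 2)%R.
    assert (Hr : 0 < Rmin r1 r2) by (apply Rmin_pos; lra).
    pose proof (Rmin_l r1 r2). pose proof (Rmin_r r1 r2).
    split; [lra|]. intros a' b' c' d' H1 H2 H3 H4 H5 H6.
    assert (Hp : rect a' b' c' d' p) by (split; simpl; lra).
    assert (Hc' : ctsR f a' b' c' d') by (eapply ctsR_sub; [exact Hc|lra..]).
    assert (Z : forall a2 b2 c2 d2, a' <= a2 -> a2 <= b2 -> b2 <= b' -> c' <= c2 -> c2 <= d2 -> d2 <= d' ->
       ~ rect a2 b2 c2 d2 p -> J f a2 b2 c2 d2 = 0).
    { intros a2 b2 c2 d2 G1 G2 G3 G4 G5 G6 Hn. apply goursat; [lra|lra|].
      intros z Hz. apply Hfd; [|intros ->; exact (Hn Hz)].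
      eapply Rle_lt_trans; [apply (Cmod_rect_le a' b' c' d')|lra]; [|exact Hp].
      destruct Hz as [[? ?] [? ?]]. split; lra. }
    assert (Hxdeg : forall x0 c2 d2, J f x0 x0 c2 d2 = 0).
    { intros. unfold J. rewrite !CI_point. ring. }
    assert (Hydeg : forall y0 a2 b2, J f a2 b2 y0 y0 = 0).
    { intros. unfold J. rewrite !CI_point. ring. }
    assert (K : forall e, 0 < e -> Cmod (J f a' b' c' d') <= 8 * (Cmod (f p) + 1) * e).
    { intros e He.
      (* Cuts at distance [e] from the point, clamped to the rectangle. A clamped cut makes its
         strip degenerate, with zero integral; an unclamped one separates the strip from the
         point. *)
      set (a2 := Rmax a' (x - e)). set (b2 := Rmin b' (x + e)).
      set (c2 := Rmax c' (y - e)). set (d2 := Rmin d' (y + e)).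
      assert (A : a' <= a2 <= x /\ x - e <= a2 /\ (a2 = a' \/ a2 < x)).
      { unfold a2, Rmax. destruct Rle_dec; repeat split; try lra. }
      assert (B : x <= b2 <= b' /\ b2 <= x + e /\ (b2 = b' \/ x < b2)).
      { unfold b2, Rmin. destruct Rle_dec; repeat split; try lra. }
      assert (C0 : c' <= c2 <= y /\ y - e <= c2 /\ (c2 = c' \/ c2 < y)).
      { unfold c2, Rmax. destruct Rle_dec; repeat split; try lra. }
      assert (D0 : y <= d2 <= d' /\ d2 <= y + e /\ (d2 = d' \/ y < d2)).
      { unfold d2, Rmin. destruct Rle_dec; repeat split; try lra. }
      destruct A as (A1 & A2 & A3). destruct B as (B1 & B2 & B3).
      destruct C0 as (C1 & C2 & C3). destruct D0 as (D1 & D2 & D3).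
      assert (E1 : J f a' a2 c' d' = 0).
      { destruct A3 as [->|A3]; [apply Hxdeg|]. apply Z; try lra. intros [[? ?] ?]; simpl in *; lra. }
      assert (E2 : J f b2 b' c' d' = 0).
      { destruct B3 as [->|B3]; [apply Hxdeg|]. apply Z; try lra. intros [[? ?] ?]; simpl in *; lra. }
      assert (E3 : J f a2 b2 c' c2 = 0).
      { destruct C3 as [->|C3]; [apply Hydeg|]. apply Z; try lra. intros [? [? ?]]; simpl in *; lra. }
      assert (E4 : J f a2 b2 d2 d' = 0).
      { destruct D3 as [->|D3]; [apply Hydeg|]. apply Z; try lra. intros [? [? ?]]; simpl in *; lra. }
      rewrite (J_split_x f a' a2 b' c' d') by (try assumption; lra).
      rewrite (J_split_x f a2 b2 b' c' d'); [|lra|lra|eapply ctsR_sub; [exact Hc'|lra..]].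
      rewrite (J_split_y f a2 b2 c' c2 d'); [|lra|lra|eapply ctsR_sub; [exact Hc'|lra..]].
      rewrite (J_split_y f a2 b2 c2 d2 d'); [|lra|lra|eapply ctsR_sub; [exact Hc'|lra..]].
      rewrite E1, E2, E3, E4, !Cplus_0_l, !Cplus_0_r.
      eapply Rle_trans; [apply J_bound with (M := (Cmod (f p) + 1)%R)|].
      - lra.
      - lra.
      - eapply ctsR_sub; [exact Hc'|lra..].
      - intros z Hz. assert (Hz2 : Cmod (f z - f p) < 1).
        { apply Hb. eapply Rle_lt_trans; [apply (Cmod_rect_le a' b' c' d')|lra]; [|exact Hp].
          destruct Hz as [[? ?] [? ?]]. split; lra. }
        replace (f z) with (f p + (f z - f p)) by ring.
        eapply Rle_trans; [apply Cmod_triangle|]. lra.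
      - pose proof (Cmod_ge_0 (f p)).
        assert ((Cmod (f p) + 1) * (b2 - a2 + (d2 - c2)) <= (Cmod (f p) + 1) * (4 * e))%R
          by (apply Rmult_le_compat_l; lra). lra. }
    apply Cmod_eq_0. apply Rle_antisym; [|apply Cmod_ge_0]. apply le_epsilon. intros e He.
    rewrite Rplus_0_l. pose proof (Cmod_ge_0 (f p)).
    eapply Rle_trans; [apply (K (e / (8 * (Cmod (f p) + 1)))%R)|].
    + apply Rdiv_lt_0_compat; lra.
    + right. field. lra.
Qed.

Definition circ (c : C) (r t : R) : C := c + RtoC r * Cexp (Ci * RtoC t).

(** Integrated in the angle, so that dividing by [2 pi] gives the mean over the circle. Cauchy
    integrals below carry the factor [circ c r t - c], which stands for [dz / (i dt)]. *)
Definition circint (f : C -> C) (c : C) (r : R) : C := CI (fun t => f (circ c r t)) 0 (2 * PI).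

Lemma two_PI_pos : 0 < 2 * PI.
Proof. pose proof PI_RGT_0. lra. Qed.

Lemma Cmod_Cexp_Ci (t : R) : Cmod (Cexp (Ci * RtoC t)) = 1%R.
Proof. rewrite Cmod_Cexp. rewrite <- exp_0. f_equal. unfold Re. simpl. ring. Qed.

Lemma Cmod_circ c r t : 0 <= r -> Cmod (circ c r t - c) = r.
Proof.
  intros Hr. unfold circ. replace (c + RtoC r * Cexp (Ci * RtoC t) - c) with (RtoC r * Cexp (Ci * RtoC t)) by ring.
  rewrite Cmod_mult, Cmod_Cexp_Ci, Cmod_R, Rabs_pos_eq by exact Hr. ring.
Qed.

Lemma cts_circ c r t : cts (circ c r) t.
Proof.
  apply cts_plus; [apply cts_const|]. apply cts_mult; [apply cts_const|].
  apply (cts_comp Cexp); [|apply cts_Cexp]. apply cts_mult; [apply cts_const|apply cts_idR].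
Qed.

Lemma Cexp_locally_inj z : locally' z (fun w => Cexp w <> Cexp z).
Proof.
  pose proof (Cd_Cexp z) as H. pose proof (Cexp_neq_0 z) as Hz. apply Cmod_gt_0 in Hz.
  assert (He : 0 < Cmod (Cexp z) / 2) by lra. specialize (H _ He).
  unfold locally', within. revert H. apply filter_imp. intros w Hw Hwz E.
  rewrite E in Hw. replace (Cexp z - Cexp z - Cexp z * (w - z)) with (- (Cexp z * (w - z))) in Hw by ring.
  rewrite Cmod_opp, Cmod_mult in Hw.
  assert (0 < Cmod (w - z)) by (apply Cmod_gt_0, Cminus_eq_contra, Hwz).
  assert (0 < Cmod (Cexp z) * Cmod (w - z))%R by (apply Rmult_lt_0_compat; lra). lra.
Qed.

(** The exponential is locally injective, so an exceptional point of [F] pulls back to an isolated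
    exceptional point. *)
Lemma almost_dif_exp (F : C -> C) (c z : C) : almost_dif F (c + Cexp z) ->
  almost_dif (fun w => F (c + Cexp w)) z.
Proof.
  intros [H1 H2].
  assert (Hc : cts (fun w => c + Cexp w) z) by (apply cts_plus; [apply cts_const|apply cts_Cexp]).
  split; [apply (cts_comp F); assumption|].
  unfold locally', within in H2.
  pose proof (lim_locally _ _ _ _ Hc H2) as H3. simpl in H3.
  pose proof (Cexp_locally_inj z) as H4. unfold locally', within in *.
  generalize (filter_and _ _ H3 H4). apply filter_imp. intros w [A B] Hw.
  apply (dif_comp F (fun w => c + Cexp w)).
  - apply dif_plus; [apply dif_const|apply dif_Cexp].
  - apply A. intros E. apply (B Hw). replace (Cexp w) with (c + Cexp w - c) by ring. rewrite E. ring.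
Qed.

Lemma Cexp_xy (x y : R) : Cexp (x, y) = RtoC (exp x) * Cexp (Ci * RtoC y).
Proof.
  rewrite <- Cexp_RtoC, <- Cexp_plus. f_equal. apply injective_projections; simpl; ring.
Qed.

(** The map [z -> c + exp z] carries the rectangle [[ln r1, ln r2] x [0, 2 pi]] onto the annulus.
    Its vertical sides become the two circles, and its horizontal sides cancel by periodicity. *)
Lemma circint_annulus (F : C -> C) c r1 r2 : 0 < r1 -> r1 <= r2 ->
  (forall z, r1 <= Cmod (z - c) <= r2 -> almost_dif F z) -> circint F c r1 = circint F c r2.
Proof.
  intros H1 H2 HF. set (g := fun z => F (c + Cexp z)).
  assert (Hl : ln r1 <= ln r2).
  { destruct H2 as [H2|H2]; [left; apply ln_increasing; lra|subst; lra]. }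
  pose proof two_PI_pos as HP.
  assert (HJ : J g (ln r1) (ln r2) 0 (2 * PI) = 0).
  { apply goursat_almost; [exact Hl|lra|]. intros z [Hz1 Hz2]. apply almost_dif_exp, HF.
    replace (c + Cexp z - c) with (Cexp z) by ring. rewrite Cmod_Cexp. unfold Re. split.
    - rewrite <- (exp_ln r1) by lra. destruct (proj1 Hz1) as [Hz|Hz]; [left; apply exp_increasing, Hz|rewrite Hz; lra].
    - rewrite <- (exp_ln r2) by lra. destruct (proj2 Hz1) as [Hz|Hz]; [left; apply exp_increasing, Hz|rewrite Hz; lra]. }
  assert (E : forall r, 0 < r -> CI (fun y => g (ln r, y)) 0 (2 * PI) = circint F c r).
  { intros r Hr. apply CI_ext; [lra|]. intros t _. unfold g, circ. rewrite Cexp_xy, exp_ln by exact Hr. reflexivity. }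
  unfold J in HJ. rewrite !E in HJ by lra.
  assert (E2 : CI (fun x => g (x, 0%R)) (ln r1) (ln r2) = CI (fun x => g (x, (2 * PI)%R)) (ln r1) (ln r2)).
  { apply CI_ext; [exact Hl|]. intros t _. unfold g. do 2 f_equal. unfold Cexp, Re, Im. simpl.
    rewrite cos_2PI, sin_2PI, cos_0, sin_0. reflexivity. }
  rewrite E2 in HJ.
  assert (E3 : Ci * (circint F c r2 - circint F c r1) = 0) by (rewrite <- HJ; ring).
  symmetry. apply (proj2 (Ceq_minus _ _)).
  replace (circint F c r2 - circint F c r1) with (- Ci * (Ci * (circint F c r2 - circint F c r1))).
  - rewrite E3. ring.
  - replace (- Ci * (Ci * (circint F c r2 - circint F c r1))) with (- (Ci * Ci) * (circint F c r2 - circint F c r1)) by ring.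
    replace (Ci * Ci) with (- (1)) by (apply injective_projections; simpl; ring). ring.
Qed.

Lemma circint_ctsI (F : C -> C) c r : 0 <= r -> (forall z, Cmod (z - c) = r -> cts F z) ->
  ctsI 0 (2 * PI) (fun t => F (circ c r t)).
Proof.
  intros Hr H t _. apply (cts_comp F); [apply cts_circ|]. apply H, Cmod_circ, Hr.
Qed.

(** The mean does not depend on the radius, and it tends to [F c] as the radius shrinks, by
    continuity at the centre. *)
Lemma mean_value (F : C -> C) c r : 0 < r ->
  (forall z, Cmod (z - c) <= r -> almost_dif F z) -> circint F c r = RtoC (2 * PI) * F c.
Proof.
  intros Hr HF. pose proof two_PI_pos as HP.
  apply (proj2 (Ceq_minus _ _)). apply Cmod_eq_0. apply Rle_antisym; [|apply Cmod_ge_0].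
  apply le_epsilon. intros e He. rewrite Rplus_0_l.
  assert (Hc0 : cts F c).
  { apply HF. replace (c - c) with (RtoC 0) by ring. rewrite Cmod_0. lra. }
  assert (He2 : 0 < e / (2 * PI)) by (apply Rdiv_lt_0_compat; lra).
  pose proof (Hc0 _ He2) as H. apply locallyC in H. destruct H as [d [Hd H]].
  set (r1 := Rmin r (d / 2)). assert (Hr1 : 0 < r1) by (apply Rmin_pos; lra).
  pose proof (Rmin_l r (d / 2)) as Hm1. pose proof (Rmin_r r (d / 2)) as Hm2. fold r1 in Hm1, Hm2.
  rewrite <- (circint_annulus F c r1 r) by (try lra; intros z Hz; apply HF; lra).
  assert (Hct : ctsI 0 (2 * PI) (fun t => F (circ c r1 t))).
  { apply circint_ctsI; [lra|]. intros z Hz. apply HF. lra. }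
  replace (RtoC (2 * PI) * F c) with (CI (fun _ => F c) 0 (2 * PI)).
  2:{ rewrite CI_const. rewrite Rminus_0_r. ring. }
  unfold circint. rewrite <- CI_minus; [|lra|exact Hct|intros t _; apply cts_const].
  eapply Rle_trans; [apply Cmod_CI_const with (M := (e / (2 * PI))%R)|].
  - lra.
  - intros t Ht. apply cts_minus; [apply Hct, Ht|apply cts_const].
  - intros t Ht. left. apply H. rewrite Cmod_circ; lra.
  - right. field. pose proof PI_RGT_0. lra.
Qed.

Lemma Cmod_sub_ge (z c w : C) : Cmod (z - c) - Cmod (w - c) <= Cmod (z - w).
Proof.
  pose proof (Cmod_triangle (z - w) (w - c)) as H.
  replace (z - w + (w - c)) with (z - c) in H by ring. lra.
Qed.

Lemma Cconj_circ0 (r t : R) : r <> 0 ->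
  Cconj (circ 0 r t) = RtoC (r * r) / circ 0 r t.
Proof.
  intros Hr. unfold circ. rewrite !Cplus_0_l.
  rewrite Cmult_conj, <- Cexp_conj.
  replace (Cconj (Ci * RtoC t)) with (- (Ci * RtoC t)) by (apply injective_projections; simpl; ring).
  replace (Cconj (RtoC r)) with (RtoC r) by (apply injective_projections; simpl; ring).
  rewrite Cexp_opp, RtoC_mult. field. split; [apply Cexp_neq_0|].
  intros E. apply RtoC_inj in E. contradiction.
Qed.

Lemma circ_shift c r t : circ c r t = c + circ 0 r t.
Proof. unfold circ. ring. Qed.

Lemma circ0_neq_0 r t : 0 < r -> circ 0 r t <> 0.
Proof.
  intros Hr. apply Cmod_gt_0. replace (circ 0 r t) with (circ 0 r t - 0) by ring.
  rewrite Cmod_circ; lra.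
Qed.

Lemma circ_neq c r t w : Cmod (w - c) < r -> circ c r t - w <> 0.
Proof.
  intros H. pose proof (Cmod_ge_0 (w - c)). apply Cmod_gt_0.
  pose proof (Cmod_sub_ge (circ c r t) c w) as H1. rewrite Cmod_circ in H1; lra.
Qed.

(** On the circle [conj u = r^2 / u], so with [v = w - c] the kernel is the conjugate of
    [r^2 / (r^2 - conj v u)]. This is holomorphic on the closed disc and equals 1 at the centre,
    hence the mean value property gives the integral. *)
Lemma circint_kernel c r w : Cmod (w - c) < r ->
  CI (fun t => (circ c r t - c) / (circ c r t - w)) 0 (2 * PI) = RtoC (2 * PI).
Proof.
  intros Hw. pose proof two_PI_pos as HP. pose proof (Cmod_ge_0 (w - c)) as Hv0.
  assert (Hr : 0 < r) by lra. set (v := w - c) in *.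
  set (F := fun u => RtoC (r * r) / (RtoC (r * r) - Cconj v * u)).
  assert (HN : forall u, Cmod (u - 0) <= r -> RtoC (r * r) - Cconj v * u <> 0).
  { intros u Hu E. assert (E2 : Cmod (RtoC (r * r)) = Cmod (Cconj v * u)).
    { f_equal. apply (proj2 (Ceq_minus _ _)). exact E. }
    rewrite Cmod_mult, Cmod_conj, Cmod_R in E2.
    replace (u - 0) with u in Hu by ring.
    rewrite Rabs_pos_eq in E2 by (apply Rmult_le_pos; lra).
    assert (Cmod v * Cmod u <= Cmod v * r)%R by (apply Rmult_le_compat_l; lra).
    assert (Cmod v * r < r * r)%R by (apply Rmult_lt_compat_r; lra). lra. }
  assert (HF : forall u, Cmod (u - 0) <= r -> dif F u).
  { intros u Hu. apply dif_div; [apply dif_const| |apply HN, Hu].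
    apply dif_minus; [apply dif_const|]. apply dif_mult; [apply dif_const|apply dif_id]. }
  assert (HF2 : forall u, Cmod (u - 0) <= r -> almost_dif F u).
  { intros u Hu. apply dif_almost.
    assert (Hc : cts (fun u => RtoC (r * r) - Cconj v * u) u).
    { apply cts_minus; [apply cts_const|]. apply cts_mult; [apply cts_const|apply cts_id]. }
    generalize (lim_neq_0 _ _ _ Hc (HN u Hu)). apply filter_imp. intros u' Hu'.
    apply dif_div; [apply dif_const| |].
    - apply dif_minus; [apply dif_const|]. apply dif_mult; [apply dif_const|apply dif_id].
    - apply Cmod_gt_0. pose proof (Cmod_ge_0 (RtoC (r * r) - Cconj v * u)). lra. }
  pose proof (mean_value F 0 r Hr HF2) as HM.
  assert (E : forall t, (circ c r t - c) / (circ c r t - w) = Cconj (F (circ 0 r t))).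
  { intros t. pose proof (circ0_neq_0 r t Hr) as Hu.
    assert (HD : RtoC (r * r) - Cconj v * circ 0 r t <> 0).
    { apply HN. rewrite Cmod_circ; lra. }
    unfold F. rewrite Cdiv_conj by exact HD. rewrite Cminus_conj, Cmult_conj, Cconj_conj.
    rewrite Cconj_circ0 by lra.
    replace (Cconj (RtoC (r * r))) with (RtoC (r * r)) by (apply injective_projections; simpl; ring).
    rewrite (circ_shift c r t). replace (c + circ 0 r t - c) with (circ 0 r t) by ring.
    replace (c + circ 0 r t - w) with (circ 0 r t - v) by (unfold v; ring).
    assert (HR : RtoC (r * r) <> 0).
    { intros E. apply RtoC_inj in E. assert (0 < r * r)%R by (apply Rmult_lt_0_compat; lra). lra. }
    assert (HV : circ 0 r t - v <> 0).
    { unfold v. intros E. apply (circ_neq c r t w Hw). rewrite circ_shift.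
      replace (c + circ 0 r t - w) with (circ 0 r t - (w - c)) by ring. exact E. }
    field. repeat split; try assumption.
    replace (RtoC (r * r) * circ 0 r t - v * RtoC (r * r)) with (RtoC (r * r) * (circ 0 r t - v)) by ring.
    apply Cmult_neq_0; assumption. }
  rewrite (CI_ext 0 (2 * PI) ltac:(lra) _ (fun t => Cconj (F (circ 0 r t)))) by (intros t _; apply E).
  rewrite CI_conj; [|lra|].
  - unfold circint in HM. rewrite HM. unfold F. rewrite Cmult_0_r.
    assert (HR : RtoC (r * r) <> 0).
    { intros E2. apply RtoC_inj in E2. assert (0 < r * r)%R by (apply Rmult_lt_0_compat; lra). lra. }
    replace (RtoC (2 * PI) * (RtoC (r * r) / (RtoC (r * r) - 0))) with (RtoC (2 * PI)).
    + apply injective_projections; simpl; ring.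
    + field. replace (RtoC (r * r) - 0) with (RtoC (r * r)) by ring. exact HR.
  - apply circint_ctsI; [lra|]. intros z Hz. apply dif_cts, HF. lra.
Qed.

Lemma locally'_neq (p w : C) : locally' p (fun z => z <> w).
Proof.
  apply locallyC'. destruct (excluded_middle_informative (p = w)) as [->|E].
  - exists 1%R. split; [lra|auto].
  - exists (Cmod (p - w)). split; [apply Cmod_gt_0, Cminus_eq_contra, E|].
    intros z Hz _ ->. rewrite <- Cmod_opp in Hz. replace (- (w - p)) with (p - w) in Hz by ring. lra.
Qed.

Lemma locally_neq (p w : C) : p <> w -> locally p (fun z => z <> w).
Proof.
  intros E. apply locallyC. exists (Cmod (p - w)). split; [apply Cmod_gt_0, Cminus_eq_contra, E|].
  intros z Hz ->. rewrite <- Cmod_opp in Hz. replace (- (w - p)) with (p - w) in Hz by ring. lra.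
Qed.

Definition quot (f : C -> C) (w l : C) (z : C) : C :=
  if excluded_middle_informative (z = w) then l else (f z - f w) / (z - w).

Lemma quot_at f w l : quot f w l w = l.
Proof. unfold quot. destruct excluded_middle_informative; [reflexivity|congruence]. Qed.

Lemma quot_off f w l z : z <> w -> quot f w l z = (f z - f w) / (z - w).
Proof. intros H. unfold quot. destruct excluded_middle_informative; [congruence|reflexivity]. Qed.

Lemma quot_eq f w l z : f z = f w + (z - w) * quot f w l z.
Proof.
  unfold quot. destruct excluded_middle_informative as [->|E]; [ring|].
  field. apply Cminus_eq_contra, E.
Qed.

(** At [p = w] the quotient is continuous by the choice of [l], and it is differentiable on a
    punctured neighbourhood; at other points it inherits the property of [f]. The base point is
    simply a new exceptional point. *)
Lemma quot_almost f w l p : Cd f w l -> almost_dif f p -> almost_dif (quot f w l) p.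
Proof.
  intros Hw [H1 H2].
  assert (Hd : forall z, z <> w -> dif f z -> dif (quot f w l) z).
  { intros z Hz Hf. apply dif_ext_loc with (fun z => (f z - f w) / (z - w)).
    - generalize (locally_neq z w Hz). apply filter_imp. intros y Hy. symmetry. apply quot_off, Hy.
    - apply dif_div; [apply dif_minus; [exact Hf|apply dif_const]| |apply Cminus_eq_contra, Hz].
      apply dif_minus; [apply dif_id|apply dif_const]. }
  split.
  - destruct (excluded_middle_informative (p = w)) as [->|E].
    + intros eps He. rewrite quot_at. assert (He2 : 0 < eps / 2) by lra.
      generalize (Hw _ He2). apply filter_imp. intros z Hz.
      destruct (excluded_middle_informative (@eq C z w)) as [->|E].
      * rewrite quot_at. replace (l - l) with (RtoC 0) by ring. rewrite Cmod_0. exact He.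
      * rewrite quot_off by exact E. pose proof (Cminus_eq_contra _ _ E) as E2.
        replace ((f z - f w) / (z - w) - l) with ((f z - f w - l * (z - w)) / (z - w))
          by (field; exact E2).
        rewrite Cmod_div by exact E2. apply Cmod_gt_0 in E2.
        apply Rle_lt_trans with (eps / 2)%R; [|lra].
        apply Rmult_le_reg_r with (Cmod (z - w)); [exact E2|].
        unfold Rdiv at 1. rewrite Rmult_assoc, Rinv_l by lra. lra.
    + apply cts_ext_loc with (fun z => (f z - f w) / (z - w)).
      * generalize (locally_neq p w E). apply filter_imp. intros y Hy. symmetry. apply quot_off, Hy.
      * apply cts_div; [apply cts_minus; [exact H1|apply cts_const]| |apply Cminus_eq_contra, E].
        apply cts_minus; [apply cts_id|apply cts_const].
  - generalize (filter_and _ _ H2 (locally'_neq p w)). apply filter_imp.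
    intros z [A B]. apply Hd; assumption.
Qed.

(** The mean value property is applied to [z - c] times the difference quotient at [w], which
    vanishes at the centre; what is left over is the kernel integral of [circint_kernel]. *)
Lemma cauchy_formula_dif f c r w : (forall z, Cmod (z - c) <= r -> almost_dif f z) ->
  Cmod (w - c) < r -> dif f w ->
  CI (fun t => f (circ c r t) * (circ c r t - c) / (circ c r t - w)) 0 (2 * PI) = RtoC (2 * PI) * f w.
Proof.
  intros Hf Hw [l Hl]. pose proof two_PI_pos as HP. pose proof (Cmod_ge_0 (w - c)).
  assert (Hr : 0 < r) by lra.
  set (F := fun z => (z - c) * quot f w l z).
  assert (HF : forall z, Cmod (z - c) <= r -> almost_dif F z).
  { intros z Hz. apply almost_dif_mult.
    - apply dif_almost. apply filter_forall. intros y. apply dif_minus; [apply dif_id|apply dif_const].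
    - apply quot_almost; [exact Hl|apply Hf, Hz]. }
  pose proof (mean_value F c r Hr HF) as HM.
  assert (E0 : F c = 0) by (unfold F; ring). rewrite E0, Cmult_0_r in HM.
  assert (Hk : ctsI 0 (2 * PI) (fun t => (circ c r t - c) / (circ c r t - w))).
  { intros t _. apply cts_div; [| |apply circ_neq, Hw];
    (apply cts_minus; [apply cts_circ|apply cts_const]). }
  assert (Hfk : ctsI 0 (2 * PI) (fun t => f (circ c r t) * (circ c r t - c) / (circ c r t - w))).
  { intros t Ht. apply cts_ext_loc with (fun t => f (circ c r t) * ((circ c r t - c) / (circ c r t - w))).
    - apply filter_forall. intros s. unfold Cdiv. ring.
    - apply cts_mult; [|apply Hk, Ht]. apply (circint_ctsI f c r); [lra| |exact Ht].
      intros z Hz. apply Hf. lra. }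
  unfold circint in HM.
  rewrite (CI_ext 0 (2 * PI) ltac:(lra) _
    (fun t => f (circ c r t) * (circ c r t - c) / (circ c r t - w) - f w * ((circ c r t - c) / (circ c r t - w)))) in HM.
  - rewrite CI_minus in HM; [|lra|exact Hfk|intros t Ht; apply cts_mult; [apply cts_const|apply Hk, Ht]].
    rewrite CI_scal in HM; [|lra|exact Hk]. rewrite circint_kernel in HM by exact Hw.
    apply (proj2 (Ceq_minus _ _)). rewrite <- HM. ring.
  - intros t _. unfold F. rewrite quot_off.
    + field. apply circ_neq, Hw.
    + intros E. apply (circ_neq c r t w Hw). rewrite E. ring.
Qed.

Lemma ctsI_bounded f a b : a <= b -> ctsI a b f -> exists B, 0 <= B /\ forall t, a <= t <= b -> Cmod (f t) <= B.
Proof.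
  intros Hab Hf.
  destruct (continuity_ab_maj (fun t => Cmod (f t)) a b Hab) as [m [Hm1 Hm2]].
  - intros t Ht. apply continuity_pt_filterlim. apply filterlim_locally. intros eps.
    generalize (Hf t Ht eps (cond_pos eps)). apply filter_imp. intros s Hs.
    eapply Rle_lt_trans; [|exact Hs]. change (Rabs (Cmod (f s) - Cmod (f t)) <= Cmod (f s - f t)).
    apply Rabs_le. pose proof (Cmod_triangle (f s - f t) (f t)) as H1.
    pose proof (Cmod_triangle (- (f s - f t)) (f s)) as H2. rewrite Cmod_opp in H2.
    replace (f s - f t + f t) with (f s) in H1 by ring.
    replace (- (f s - f t) + f s) with (f t) in H2 by ring. lra.
  - exists (Cmod (f m)). split; [apply Cmod_ge_0|]. exact Hm1.
Qed.

(** Differentiation under the integral sign: a quadratic remainder that is uniform in the parameter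
    integrates to a quadratic remainder. *)
Lemma CI_Cd (K K' : R -> C -> C) a b w (B d : R) : a <= b -> 0 <= B -> 0 < d ->
  (forall t h, a <= t <= b -> Cmod h < d ->
     Cmod (K t (w + h) - K t w - h * K' t w) <= B * Cmod h ^ 2) ->
  (forall w', Cmod (w' - w) < d -> ctsI a b (fun t => K t w')) ->
  ctsI a b (fun t => K' t w) ->
  Cd (fun w => CI (fun t => K t w) a b) w (CI (fun t => K' t w) a b).
Proof.
  intros Hab HB Hd H HK HK' eps He. apply locallyC.
  set (A := (B * (b - a) + 1)%R).
  assert (HA0 : 0 <= B * (b - a)) by (apply Rmult_le_pos; lra).
  assert (HA : 0 < A) by (unfold A; lra).
  exists (Rmin d (eps / A)). split; [apply Rmin_pos; [exact Hd|apply Rdiv_lt_0_compat; lra]|].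
  intros w' Hw'. pose proof (Rmin_l d (eps / A)). pose proof (Rmin_r d (eps / A)).
  assert (Hw0 : ctsI a b (fun t => K t w)).
  { apply HK. replace (w - w) with (RtoC 0) by ring. rewrite Cmod_0. exact Hd. }
  assert (Hw1 : ctsI a b (fun t => K t w')) by (apply HK; lra).
  set (h := w' - w) in *.
  rewrite (Cmult_comm _ h), <- CI_scal by assumption.
  rewrite <- CI_minus by assumption.
  rewrite <- CI_minus; [|exact Hab| |].
  2:{ intros t Ht. apply cts_minus; [apply Hw1, Ht|apply Hw0, Ht]. }
  2:{ intros t Ht. apply cts_mult; [apply cts_const|apply HK', Ht]. }
  eapply Rle_trans; [apply Cmod_CI_const with (M := (B * Cmod h ^ 2)%R)|].
  - exact Hab.
  - intros t Ht. apply cts_minus; [apply cts_minus; [apply Hw1, Ht|apply Hw0, Ht]|].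
    apply cts_mult; [apply cts_const|apply HK', Ht].
  - intros t Ht. replace w' with (w + h) by (unfold h; ring). apply H; [exact Ht|lra].
  - pose proof (Cmod_ge_0 h) as Hh.
    replace (B * Cmod h ^ 2 * (b - a))%R with (B * (b - a) * Cmod h * Cmod h)%R by ring.
    apply Rmult_le_compat_r; [exact Hh|].
    apply Rle_trans with (A * Cmod h)%R; [apply Rmult_le_compat_r; [exact Hh|unfold A; lra]|].
    apply Rle_trans with (A * (eps / A))%R; [apply Rmult_le_compat_l; lra|]. right. field. lra.
Qed.

Lemma inv_remainder1 (u h : C) : u <> 0 -> u - h <> 0 ->
  / (u - h) - / u - h * / u ^ 2 = h ^ 2 * (/ (u - h) * / u ^ 2).
Proof. intros Hu Huh. field. split; assumption. Qed.

Lemma inv_remainder2 (u h : C) : u <> 0 -> u - h <> 0 ->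
  / (u - h) ^ 2 - / u ^ 2 - h * (2 / u ^ 3) = h ^ 2 * ((3 * u - 2 * h) * (/ (u - h) ^ 2 * / u ^ 3)).
Proof. intros Hu Huh. field. split; assumption. Qed.

Lemma Cmod_inv_le (u : C) (d : R) : 0 < d -> d <= Cmod u -> Cmod (/ u) <= / d.
Proof.
  intros Hd H. rewrite Cmod_inv by (apply Cmod_gt_0; lra). apply Rinv_le_contravar; assumption.
Qed.

Section CauchyIntegral.
Variables (phi : R -> C) (c : C) (r : R).
Hypothesis Hphi : ctsI 0 (2 * PI) phi.

(** Exponent 1 is the Cauchy integral up to the factor [2 pi], exponent 2 its derivative in [w]. The
    density [phi] is any continuous function, so the same lemmas serve the limit in [weierstrass]
    before it is known to be holomorphic. *)
Definition cauchy_int (k : nat) (w : C) : C :=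
  CI (fun t => phi t * / (circ c r t - w) ^ k) 0 (2 * PI).

Lemma cauchy_int_ctsI k w : Cmod (w - c) < r -> ctsI 0 (2 * PI) (fun t => phi t * / (circ c r t - w) ^ k).
Proof.
  intros Hw t Ht. apply cts_mult; [apply Hphi, Ht|]. apply cts_inv.
  - apply cts_pow. apply cts_minus; [apply cts_circ|apply cts_const].
  - apply Cpow_nz, circ_neq, Hw.
Qed.

Lemma circ_far w h t : Cmod (w - c) < r -> Cmod h < (r - Cmod (w - c)) / 2 ->
  (r - Cmod (w - c)) / 2 <= Cmod (circ c r t - w) /\
  (r - Cmod (w - c)) / 2 <= Cmod (circ c r t - w - h).
Proof.
  intros Hw Hh. pose proof (Cmod_ge_0 (w - c)).
  pose proof (Cmod_sub_ge (circ c r t) c w) as H1. rewrite Cmod_circ in H1 by lra.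
  split; [lra|]. pose proof (Cmod_triangle (circ c r t - w - h) h) as H2.
  replace (circ c r t - w - h + h) with (circ c r t - w) in H2 by ring. lra.
Qed.

Lemma cauchy_int_Cd1 w : Cmod (w - c) < r -> Cd (cauchy_int 1) w (cauchy_int 2 w).
Proof.
  intros Hw. pose proof two_PI_pos as HP.
  destruct (ctsI_bounded phi 0 (2 * PI)) as [B [HB0 HB]]; [lra|exact Hphi|].
  set (d := ((r - Cmod (w - c)) / 2)%R). assert (Hd : 0 < d) by (unfold d; lra).
  assert (Hid : 0 < / d) by (apply Rinv_0_lt_compat, Hd).
  apply (CI_Cd (fun t w => phi t * / (circ c r t - w) ^ 1) (fun t w => phi t * / (circ c r t - w) ^ 2)
           0 (2 * PI) w (B * (/ d * (/ d * / d)))%R d).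
  - lra.
  - repeat apply Rmult_le_pos; lra.
  - exact Hd.
  - intros t h Ht Hh. destruct (circ_far w h t Hw Hh) as [F1 F2]. fold d in F1, F2.
    set (u := circ c r t - w) in *.
    assert (Hu : u <> 0) by (apply Cmod_gt_0; lra).
    assert (Huh : u - h <> 0) by (apply Cmod_gt_0; lra).
    replace (circ c r t - (w + h)) with (u - h) by (unfold u; ring).
    replace (phi t * / (u - h) ^ 1 - phi t * / u ^ 1 - h * (phi t * / u ^ 2))
      with (phi t * (/ (u - h) - / u - h * / u ^ 2)) by (simpl; rewrite !Cmult_1_r; ring).
    rewrite inv_remainder1 by assumption. rewrite !Cmod_mult, Cmod_pow.
    replace (B * (/ d * (/ d * / d)) * Cmod h ^ 2)%R with (B * (Cmod h ^ 2 * (/ d * (/ d * / d))))%R by ring.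
    apply Rmult_le_compat; [apply Cmod_ge_0| |apply HB, Ht|].
    { repeat first [apply Cmod_ge_0 | apply pow_le | apply Rmult_le_pos]. }
    apply Rmult_le_compat_l; [apply pow_le, Cmod_ge_0|].
    apply Rmult_le_compat; [apply Cmod_ge_0|apply Cmod_ge_0|apply Cmod_inv_le; assumption|].
    replace (/ u ^ 2) with (/ u * / u) by (field; exact Hu). rewrite Cmod_mult.
    apply Rmult_le_compat; try apply Cmod_ge_0; apply Cmod_inv_le; assumption.
  - intros w' Hw'. apply (cauchy_int_ctsI 1).
    replace (w' - c) with ((w' - w) + (w - c)) by ring.
    eapply Rle_lt_trans; [apply Cmod_triangle|]. unfold d in Hw'. lra.
  - apply (cauchy_int_ctsI 2), Hw.
Qed.

(** Differentiability of the derivative; through [derive_holomorphic] it makes logarithmic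
    derivatives holomorphic. *)
Lemma cauchy_int_dif2 w : Cmod (w - c) < r -> dif (cauchy_int 2) w.
Proof.
  intros Hw. pose proof two_PI_pos as HP. pose proof (Cmod_ge_0 (w - c)).
  destruct (ctsI_bounded phi 0 (2 * PI)) as [B [HB0 HB]]; [lra|exact Hphi|].
  set (d := ((r - Cmod (w - c)) / 2)%R). assert (Hd : 0 < d) by (unfold d; lra).
  assert (Hid : 0 < / d) by (apply Rinv_0_lt_compat, Hd).
  exists (CI (fun t => phi t * (2 / (circ c r t - w) ^ 3)) 0 (2 * PI)).
  (* The factor [8 r] bounds [3 u - 2 h] from [inv_remainder2], since [|u| <= 2 r] and
     [|h| < r / 2]; the five inverse factors are each at most [/ d]. *)
  apply (CI_Cd (fun t w => phi t * / (circ c r t - w) ^ 2) (fun t w => phi t * (2 / (circ c r t - w) ^ 3))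
           0 (2 * PI) w (B * (8 * r * ((/ d * / d) * (/ d * (/ d * / d)))))%R d).
  - lra.
  - repeat apply Rmult_le_pos; lra.
  - exact Hd.
  - intros t h Ht Hh. destruct (circ_far w h t Hw Hh) as [F1 F2]. fold d in F1, F2.
    assert (F3 : Cmod (circ c r t - w) <= 2 * r).
    { replace (circ c r t - w) with ((circ c r t - c) + - (w - c)) by ring.
      eapply Rle_trans; [apply Cmod_triangle|]. rewrite Cmod_opp, Cmod_circ by lra. lra. }
    set (u := circ c r t - w) in *.
    assert (Hu : u <> 0) by (apply Cmod_gt_0; lra).
    assert (Huh : u - h <> 0) by (apply Cmod_gt_0; lra).
    replace (circ c r t - (w + h)) with (u - h) by (unfold u; ring).
    replace (phi t * / (u - h) ^ 2 - phi t * / u ^ 2 - h * (phi t * (2 / u ^ 3)))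
      with (phi t * (/ (u - h) ^ 2 - / u ^ 2 - h * (2 / u ^ 3))) by ring.
    rewrite inv_remainder2 by assumption. rewrite !Cmod_mult, Cmod_pow.
    replace (B * (8 * r * (/ d * / d * (/ d * (/ d * / d)))) * Cmod h ^ 2)%R
      with (B * (Cmod h ^ 2 * (8 * r * (/ d * / d * (/ d * (/ d * / d))))))%R by ring.
    apply Rmult_le_compat; [apply Cmod_ge_0| |apply HB, Ht|].
    { repeat first [apply Cmod_ge_0 | apply pow_le | apply Rmult_le_pos]. }
    apply Rmult_le_compat_l; [apply pow_le, Cmod_ge_0|].
    apply Rmult_le_compat; [apply Cmod_ge_0|repeat apply Rmult_le_pos; apply Cmod_ge_0| |].
    { eapply Rle_trans; [apply Cmod_triangle|]. rewrite Cmod_opp, !Cmod_mult, !Cmod_R, !Rabs_pos_eq by lra.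
      unfold d in Hh. lra. }
    apply Rmult_le_compat; try apply Cmod_ge_0.
    + replace (/ (u - h) ^ 2) with (/ (u - h) * / (u - h)) by (field; exact Huh). rewrite Cmod_mult.
      apply Rmult_le_compat; try apply Cmod_ge_0; apply Cmod_inv_le; assumption.
    + replace (/ u ^ 3) with (/ u * (/ u * / u)) by (field; exact Hu). rewrite !Cmod_mult.
      assert (Hiu : Cmod (/ u) <= / d) by (apply Cmod_inv_le; assumption).
      pose proof (Cmod_ge_0 (/ u)).
      apply Rmult_le_compat; [lra|apply Rmult_le_pos; lra|lra|apply Rmult_le_compat; lra].
  - intros w' Hw'. apply (cauchy_int_ctsI 2).
    replace (w' - c) with ((w' - w) + (w - c)) by ring.
    eapply Rle_lt_trans; [apply Cmod_triangle|]. unfold d in Hw'. lra.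
  - intros t Ht. apply cts_mult; [apply Hphi, Ht|]. apply cts_div; [apply cts_const| |].
    + apply cts_pow. apply cts_minus; [apply cts_circ|apply cts_const].
    + apply Cpow_nz, circ_neq, Hw.
Qed.
End CauchyIntegral.

Lemma cts_eq_off (f g : C -> C) (w : C) : cts f w -> cts g w -> locally' w (fun z => f z = g z) -> f w = g w.
Proof.
  intros Hf Hg H. apply (proj2 (Ceq_minus _ _)). apply Cmod_eq_0. apply Rle_antisym; [|apply Cmod_ge_0].
  apply le_epsilon. intros e He. rewrite Rplus_0_l. assert (He2 : 0 < e / 2) by lra.
  pose proof (filter_and _ _ (filter_and _ _ (Hf _ He2) (Hg _ He2)) H) as H2. simpl in H2.
  apply locallyC in H2. destruct H2 as [d [Hd H2]].
  assert (Hw : Cmod (w + RtoC (d / 2) - w) = (d / 2)%R).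
  { replace (w + RtoC (d / 2) - w) with (RtoC (d / 2)) by ring. rewrite Cmod_R, Rabs_pos_eq; lra. }
  destruct (H2 (w + RtoC (d / 2))) as [[A B] E]; [lra|].
  specialize (E ltac:(intros E2; rewrite E2 in Hw; replace (w - w) with (RtoC 0) in Hw by ring; rewrite Cmod_0 in Hw; lra)).
  rewrite E in A. set (y := g (w + RtoC (d/2))) in *.
  replace (f w - g w) with (- (y - f w) + (y - g w)) by ring.
  eapply Rle_trans; [apply Cmod_triangle|]. rewrite Cmod_opp. lra.
Qed.

Definition cauchy_phi (f : C -> C) (c : C) (r t : R) : C := f (circ c r t) * (circ c r t - c).

Lemma cauchy_phi_ctsI f c r : 0 <= r -> (forall z, Cmod (z - c) = r -> cts f z) ->
  ctsI 0 (2 * PI) (cauchy_phi f c r).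
Proof.
  intros Hr H t Ht. apply cts_mult; [apply (circint_ctsI f); assumption|].
  apply cts_minus; [apply cts_circ|apply cts_const].
Qed.

(** Where [f] is differentiable this is [cauchy_formula_dif]. At an exceptional point both sides are
    continuous and agree on a punctured neighbourhood. *)
Lemma cauchy_formula f c r w : (forall z, Cmod (z - c) <= r -> almost_dif f z) ->
  Cmod (w - c) < r -> f w = / RtoC (2 * PI) * cauchy_int (cauchy_phi f c r) c r 1 w.
Proof.
  intros Hf Hw. pose proof two_PI_pos as HP. pose proof (Cmod_ge_0 (w - c)).
  assert (HPn : RtoC (2 * PI) <> 0) by (intros E; apply RtoC_inj in E; lra).
  assert (Hphi : ctsI 0 (2 * PI) (cauchy_phi f c r)).
  { apply cauchy_phi_ctsI; [lra|]. intros z Hz. apply Hf. lra. }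
  apply (cts_eq_off f (fun w => / RtoC (2 * PI) * cauchy_int (cauchy_phi f c r) c r 1 w)).
  - apply Hf. lra.
  - apply cts_mult; [apply cts_const|]. eapply Cd_cts, cauchy_int_Cd1; assumption.
  - assert (Hn : locally w (fun z => Cmod (z - c) < r)).
    { apply locallyC. exists (r - Cmod (w - c))%R. split; [lra|]. intros z Hz.
      replace (z - c) with ((z - w) + (w - c)) by ring. eapply Rle_lt_trans; [apply Cmod_triangle|lra]. }
    destruct (Hf w ltac:(lra)) as [_ Hd]. unfold locally', within in *.
    generalize (filter_and _ _ Hn Hd). apply filter_imp. intros z [A B] Hz.
    pose proof (cauchy_formula_dif f c r z Hf A (B Hz)) as E.
    apply (Cmult_reg_r _ _ (RtoC (2 * PI))); [exact HPn|]. rewrite Cmult_comm, <- E.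
    unfold cauchy_int, cauchy_phi.
    rewrite (CI_ext 0 (2 * PI) ltac:(lra) (fun t => f (circ c r t) * (circ c r t - c) * / (circ c r t - z) ^ 1)
      (fun t => f (circ c r t) * (circ c r t - c) / (circ c r t - z))).
    + field. exact HPn.
    + intros t _. simpl. rewrite Cmult_1_r. reflexivity.
Qed.

Lemma cauchy_derivative f c r w : (forall z, Cmod (z - c) <= r -> almost_dif f z) ->
  Cmod (w - c) < r ->
  Cd f w (/ RtoC (2 * PI) * cauchy_int (cauchy_phi f c r) c r 2 w).
Proof.
  intros Hf Hw. pose proof (Cmod_ge_0 (w - c)).
  apply Cd_ext_loc with (fun w => / RtoC (2 * PI) * cauchy_int (cauchy_phi f c r) c r 1 w).
  - apply locallyC. exists (r - Cmod (w - c))%R. split; [lra|]. intros z Hz.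
    symmetry. apply cauchy_formula; [exact Hf|].
    replace (z - c) with ((z - w) + (w - c)) by ring. eapply Rle_lt_trans; [apply Cmod_triangle|lra].
  - apply Cd_scal. apply cauchy_int_Cd1; [|exact Hw].
    apply cauchy_phi_ctsI; [lra|]. intros z Hz. apply Hf. lra.
Qed.

Lemma almost_dif_nbhd f z : almost_dif f z -> exists r, 0 < r /\ forall w, Cmod (w - z) <= r -> almost_dif f w.
Proof.
  intros [H1 H2]. pose proof H2 as H3. apply locallyC' in H2. destruct H2 as [d [Hd H2]].
  exists (d / 2)%R. split; [lra|]. intros w Hw.
  destruct (excluded_middle_informative (w = z)) as [->|E]; [split; assumption|].
  apply dif_almost. generalize (locally_neq w z E). intros Hn.
  assert (Hn2 : locally w (fun y => Cmod (y - z) < d)).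
  { apply locallyC. exists (d / 2)%R. split; [lra|]. intros y Hy.
    replace (y - z) with ((y - w) + (w - z)) by ring. eapply Rle_lt_trans; [apply Cmod_triangle|lra]. }
  generalize (filter_and _ _ Hn Hn2). apply filter_imp. intros y [A B]. apply H2; assumption.
Qed.

Lemma removable f z : almost_dif f z -> locally z (dif f).
Proof.
  intros H. destruct (almost_dif_nbhd f z H) as [r [Hr Hf]]. apply locallyC. exists r.
  split; [exact Hr|]. intros w Hw. eexists. apply (cauchy_derivative f z r w); assumption.
Qed.

Lemma C_derive_Cd f z l : Cd f z l -> C_derive f z = l.
Proof. intros H. apply is_C_derive_unique. apply Cd_is_derive, H. Qed.

Lemma dif_C_derive f z : dif f z -> Cd f z (C_derive f z).
Proof. intros [l H]. rewrite (C_derive_Cd f z l H). exact H. Qed.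

Lemma derive_holomorphic f z : locally z (dif f) -> dif (C_derive f) z.
Proof.
  intros H. destruct (almost_dif_nbhd f z (dif_almost f z H)) as [r [Hr Hf]].
  apply dif_ext_loc with (fun w => / RtoC (2 * PI) * cauchy_int (cauchy_phi f z r) z r 2 w).
  - apply locallyC. exists r. split; [exact Hr|]. intros w Hw. symmetry.
    apply C_derive_Cd, cauchy_derivative; assumption.
  - apply dif_mult; [apply dif_const|]. apply cauchy_int_dif2.
    + apply cauchy_phi_ctsI; [lra|]. intros w Hw. apply Hf. lra.
    + replace (z - z) with (RtoC 0) by ring. rewrite Cmod_0. exact Hr.
Qed.

(** * The maximum principle, Weierstrass and Borel-Caratheodory *)

Lemma circle_re (H : C -> C) p r : 0 < r -> (forall z, Cmod (z - p) <= r -> almost_dif H z) ->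
  exists q, Cmod (q - p) = r /\ Re (H p) <= Re (H q).
Proof.
  intros Hr HH. pose proof two_PI_pos as HP. apply NNPP. intros Hn.
  pose proof (mean_value H p r Hr HH) as HM.
  assert (Hc : ctsI 0 (2 * PI) (fun t => H (circ p r t))).
  { apply circint_ctsI; [lra|]. intros z Hz. apply HH. lra. }
  assert (E : RInt (fun t => fst (H (circ p r t))) 0 (2 * PI) = (2 * PI * Re (H p))%R).
  { transitivity (fst (circint H p r)); [reflexivity|]. rewrite HM. simpl. unfold Re. ring. }
  assert (Hlt : RInt (fun t => fst (H (circ p r t))) 0 (2 * PI) < RInt (fun _ => Re (H p)) 0 (2 * PI)).
  { apply RInt_lt; [exact HP|..].
    - intros t Ht. apply continuous_const.
    - intros t Ht. apply (cts_fst (fun t => H (circ p r t))), Hc, Ht.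
    - intros t Ht. apply Rnot_le_lt. intros Hle. apply Hn. exists (circ p r t).
      split; [apply Cmod_circ; lra|exact Hle]. }
  rewrite RInt_const in Hlt. unfold scal in Hlt; simpl in Hlt. unfold mult in Hlt; simpl in Hlt. lra.
Qed.

Definition closed_set (K : C -> Prop) : Prop := forall z, ~ K z -> locally z (fun w => ~ K w).

Lemma locally_box (x y : R) (P : C -> Prop) : locally ((x, y) : C) P ->
  exists r, 0 < r /\ forall a b c d, a <= x <= b -> c <= y <= d -> b - a < r -> d - c < r ->
    forall z, rect a b c d z -> P z.
Proof.
  intros H. apply locallyC in H. destruct H as [r [Hr H]]. exists (r / 2)%R. split; [lra|].
  intros a b c d H1 H2 H3 H4 z Hz. apply H.
  eapply Rle_lt_trans; [apply (Cmod_rect_le a b c d); [exact Hz|split; simpl; lra]|lra].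
Qed.

Lemma rect_quarters a b c d z : rect a b c d z ->
  let m := ((a + b) / 2)%R in let n := ((c + d) / 2)%R in
  rect a m c n z \/ rect m b c n z \/ rect a m n d z \/ rect m b n d z.
Proof.
  intros [H1 H2] m n. unfold rect. destruct (Rle_dec (fst z) m), (Rle_dec (snd z) n); lra.
Qed.

(** Two runs of [cousin]: the first bounds [u] on [K]. In the second, if the supremum [S] were not
    attained, each point would leave a local margin [e] with [u <= S - e], and bisection makes the
    margin uniform. Points outside the closed set [K] have neighbourhoods missing it. *)
Lemma compact_max (K : C -> Prop) (u : C -> R) a b c d : a <= b -> c <= d ->
  (forall z, K z -> rect a b c d z) -> closed_set K -> (exists z, K z) ->
  (forall z, K z -> cts (fun w => RtoC (u w)) z) ->
  exists p, K p /\ forall z, K z -> u z <= u p.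
Proof.
  intros Hab Hcd HK Hcl [z0 Hz0] Hu.
  assert (Hnear : forall z e, K z -> 0 < e -> locally z (fun w => u w < u z + e)).
  { intros z e Hz He. generalize (Hu z Hz e He). apply filter_imp. intros w Hw.
    rewrite <- RtoC_minus, Cmod_R in Hw. apply Rabs_lt_between in Hw. lra. }
  assert (HB : exists B, forall z, rect a b c d z -> K z -> u z <= B).
  { apply (cousin (fun a b c d => exists B, forall z, rect a b c d z -> K z -> u z <= B) a b c d Hab Hcd).
    - intros a' b' c' d' _ _ _ _ m n [B1 H1] [B2 H2] [B3 H3] [B4 H4].
      exists (Rmax (Rmax B1 B2) (Rmax B3 B4)). intros z Hz Kz.
      pose proof (Rmax_l (Rmax B1 B2) (Rmax B3 B4)). pose proof (Rmax_r (Rmax B1 B2) (Rmax B3 B4)).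
      pose proof (Rmax_l B1 B2). pose proof (Rmax_r B1 B2).
      pose proof (Rmax_l B3 B4). pose proof (Rmax_r B3 B4).
      destruct (rect_quarters _ _ _ _ _ Hz) as [Q|[Q|[Q|Q]]];
      [specialize (H1 z Q Kz)|specialize (H2 z Q Kz)|specialize (H3 z Q Kz)|specialize (H4 z Q Kz)]; lra.
    - intros x y Hx Hy. destruct (excluded_middle_informative (K (x, y))) as [E|E].
      + destruct (locally_box x y _ (Hnear _ 1%R E Rlt_0_1)) as [r [Hr H]]. exists r. split; [exact Hr|].
        intros a' b' c' d' G1 G2 G3 G4 G5 G6. exists (u (x, y) + 1)%R. intros z Hz _. left.
        apply (H a' b' c' d'); try lra; assumption.
      + destruct (locally_box x y _ (Hcl _ E)) as [r [Hr H]]. exists r. split; [exact Hr|].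
        intros a' b' c' d' G1 G2 G3 G4 G5 G6. exists 0%R. intros z Hz Kz. exfalso.
        apply (H a' b' c' d' ltac:(lra) ltac:(lra) G5 G6 z Hz Kz). }
  destruct HB as [B HB].
  destruct (completeness (fun y => exists z, K z /\ y = u z)) as [S [HS1 HS2]].
  { exists B. intros y [z [Hz ->]]. apply HB; [apply HK, Hz|exact Hz]. }
  { exists (u z0), z0. auto. }
  apply NNPP. intros Hn.
  assert (Hlt : forall z, K z -> u z < S).
  { intros z Hz. destruct (HS1 (u z)) as [H|H]; [exists z; auto|exact H|].
    exfalso. apply Hn. exists z. split; [exact Hz|]. intros w Hw. rewrite H. apply HS1. exists w. auto. }
  assert (HE : exists e, 0 < e /\ forall z, rect a b c d z -> K z -> u z <= S - e).
  { apply (cousin (fun a b c d => exists e, 0 < e /\ forall z, rect a b c d z -> K z -> u z <= S - e) a b c d Hab Hcd).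
    - intros a' b' c' d' _ _ _ _ m n [B1 [P1 H1]] [B2 [P2 H2]] [B3 [P3 H3]] [B4 [P4 H4]].
      exists (Rmin (Rmin B1 B2) (Rmin B3 B4)). split; [repeat apply Rmin_pos; assumption|]. intros z Hz Kz.
      pose proof (Rmin_l (Rmin B1 B2) (Rmin B3 B4)). pose proof (Rmin_r (Rmin B1 B2) (Rmin B3 B4)).
      pose proof (Rmin_l B1 B2). pose proof (Rmin_r B1 B2).
      pose proof (Rmin_l B3 B4). pose proof (Rmin_r B3 B4).
      destruct (rect_quarters _ _ _ _ _ Hz) as [Q|[Q|[Q|Q]]];
      [specialize (H1 z Q Kz)|specialize (H2 z Q Kz)|specialize (H3 z Q Kz)|specialize (H4 z Q Kz)]; lra.
    - intros x y Hx Hy. destruct (excluded_middle_informative (K (x, y))) as [E|E].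
      + pose proof (Hlt _ E) as Hl. assert (He : 0 < (S - u (x, y)) / 2) by lra.
        destruct (locally_box x y _ (Hnear _ _ E He)) as [r [Hr H]]. exists r. split; [exact Hr|].
        intros a' b' c' d' G1 G2 G3 G4 G5 G6. exists ((S - u (x, y)) / 2)%R. split; [exact He|].
        intros z Hz _. specialize (H a' b' c' d' ltac:(lra) ltac:(lra) G5 G6 z Hz). simpl in H. lra.
      + destruct (locally_box x y _ (Hcl _ E)) as [r [Hr H]]. exists r. split; [exact Hr|].
        intros a' b' c' d' G1 G2 G3 G4 G5 G6. exists 1%R. split; [lra|]. intros z Hz Kz. exfalso.
        apply (H a' b' c' d' ltac:(lra) ltac:(lra) G5 G6 z Hz Kz). }
  destruct HE as [e [He HE]].
  assert (S <= S - e); [|lra]. apply HS2. intros y [z [Hz ->]]. apply HE; [apply HK, Hz|exact Hz].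
Qed.

Lemma Cmod2 (z : C) : (Cmod z ^ 2 = fst z ^ 2 + snd z ^ 2)%R.
Proof. apply Cmod2_alt. Qed.

Lemma RtoC_Cmod2 (z : C) : RtoC (Cmod z ^ 2) = z * Cconj z.
Proof. apply Cmod2_conj. Qed.

(* The perturbation [eps |z|^2] turns an interior maximum of [|f|] into a contradiction
   with the mean value property. *)
Lemma max_principle (K B : C -> Prop) (f : C -> C) (M : R) a b c d : 0 <= M -> a <= b -> c <= d ->
  (forall z, K z -> rect a b c d z) -> closed_set K ->
  (forall z, K z -> cts f z) ->
  (forall z, K z -> B z \/ exists r, 0 < r /\ forall w, Cmod (w - z) <= r -> K w /\ almost_dif f w) ->
  (forall z, K z -> B z -> Cmod (f z) <= M) -> forall z, K z -> Cmod (f z) <= M.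
Proof.
  intros HM Hab Hcd HK Hcl Hf Hint HB z0 Hz0. apply Rnot_lt_le. intros Hlt.
  set (D := ((Rabs a + Rabs b + Rabs c + Rabs d) ^ 2 + 1)%R).
  assert (HD0 : 0 < D) by (unfold D; pose proof (pow2_ge_0 (Rabs a + Rabs b + Rabs c + Rabs d)); lra).
  assert (HD : forall z, K z -> Cmod z ^ 2 <= D).
  { intros z Hz. unfold D. apply Rle_trans with ((Rabs a + Rabs b + Rabs c + Rabs d) ^ 2)%R; [|lra].
    apply pow_incr. split; [apply Cmod_ge_0|]. destruct z as [x y]. destruct (HK _ Hz) as [H1 H2]. simpl in *.
    eapply Rle_trans; [apply Cmod_le_Rabs|].
    assert (Rabs x <= Rabs a + Rabs b).
    { unfold Rabs. repeat destruct Rcase_abs; lra. }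
    assert (Rabs y <= Rabs c + Rabs d).
    { unfold Rabs. repeat destruct Rcase_abs; lra. } lra. }
  assert (Hgap : 0 < Cmod (f z0) ^ 2 - M ^ 2).
  { assert (M ^ 2 < Cmod (f z0) ^ 2)%R; [|lra]. simpl. rewrite !Rmult_1_r.
    apply Rmult_le_0_lt_compat; lra. }
  set (e := ((Cmod (f z0) ^ 2 - M ^ 2) / (2 * D))%R).
  assert (He : 0 < e) by (apply Rdiv_lt_0_compat; lra).
  assert (HeD : (e * D < Cmod (f z0) ^ 2 - M ^ 2)%R).
  { unfold e. replace ((Cmod (f z0) ^ 2 - M ^ 2) / (2 * D) * D)%R with ((Cmod (f z0) ^ 2 - M ^ 2) / 2)%R by (field; lra). lra. }
  set (u := fun z => (Cmod (f z) ^ 2 + e * Cmod z ^ 2)%R).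
  destruct (compact_max K u a b c d Hab Hcd HK Hcl (ex_intro _ z0 Hz0)) as [p [Kp Hp]].
  { intros z Hz. apply cts_ext_loc with (fun w => f w * Cconj (f w) + RtoC e * (w * Cconj w)).
    - apply filter_forall. intros w. unfold u. rewrite RtoC_plus, RtoC_mult, !RtoC_Cmod2. reflexivity.
    - apply cts_plus; [apply cts_mult; [apply Hf, Hz|apply cts_conj, Hf, Hz]|].
      apply cts_mult; [apply cts_const|]. apply cts_mult; [apply cts_id|apply cts_conj, cts_id]. }
  assert (Hu0 : Cmod (f z0) ^ 2 <= u p).
  { eapply Rle_trans; [|apply Hp, Hz0]. unfold u.
    assert (0 <= e * Cmod z0 ^ 2)%R by (apply Rmult_le_pos; [lra|apply pow2_ge_0]). lra. }
  destruct (Hint p Kp) as [Bp|[r [Hr Hd]]].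
  - pose proof (HB p Kp Bp) as HMp.
    assert (Cmod (f p) ^ 2 <= M ^ 2)%R by (apply pow_incr; split; [apply Cmod_ge_0|exact HMp]).
    assert (e * Cmod p ^ 2 <= e * D)%R by (apply Rmult_le_compat_l; [lra|apply HD, Kp]).
    unfold u in Hu0. lra.
  (* The holomorphic first-order part of [|f|^2 + e |z|^2] at the maximum [p]. [circle_re] finds [q]
     on the circle where its real part does not decrease, while the exact second-order terms
     [|f q - f p|^2 + e r^2] are positive. *)
  - set (H := fun z => 2 * Cconj (f p) * f z + 2 * RtoC e * Cconj p * (z - p)).
    destruct (circle_re H p r Hr) as [q [Hq1 Hq2]].
    { intros z Hz. apply almost_dif_lin.
      - apply almost_dif_mult; [|apply Hd, Hz]. apply dif_almost, filter_forall. intros y. apply dif_const.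
      - apply dif_almost, filter_forall. intros y. apply dif_mult; [apply dif_const|].
        apply dif_minus; [apply dif_id|apply dif_const]. }
    pose proof (Hp q (proj1 (Hd q ltac:(lra)))) as Hqp. unfold u in Hqp.
    assert (E1 : (Cmod (q - p) ^ 2 = r ^ 2)%R) by (rewrite Hq1; reflexivity).
    pose proof (pow2_ge_0 (Cmod (f q - f p))) as E2.
    rewrite Cmod2 in E1, E2. rewrite !Cmod2 in Hqp. unfold H, Re in Hq2.
    assert (0 < e * r ^ 2)%R by (apply Rmult_lt_0_compat; [lra|apply pow_lt, Hr]).
    destruct (f p) as [fp1 fp2], (f q) as [fq1 fq2], p as [p1 p2], q as [q1 q2]. simpl in *.
    rewrite <- E1 in H0. ring_simplify in Hq2. ring_simplify in E2. ring_simplify in Hqp. ring_simplify in H0.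
    lra.
Qed.

Lemma cts_Cmod {T : UniformSpace} (f : T -> C) x : cts f x -> cts (fun t => RtoC (Cmod (f t))) x.
Proof.
  intros Hf eps He. generalize (Hf eps He). apply filter_imp. intros w Hw.
  rewrite <- RtoC_minus, Cmod_R. eapply Rle_lt_trans; [|exact Hw].
  apply Rabs_le. pose proof (Cmod_triangle (f w - f x) (f x)) as T1.
  pose proof (Cmod_triangle (- (f w - f x)) (f w)) as T2. rewrite Cmod_opp in T2.
  replace (f w - f x + f x) with (f w) in T1 by ring.
  replace (- (f w - f x) + f w) with (f x) in T2 by ring. lra.
Qed.

Lemma locally_lt (u : C -> R) (z : C) (M : R) : cts (fun w => RtoC (u w)) z -> u z < M ->
  locally z (fun w => u w < M).
Proof.
  intros Hu HM. assert (He : 0 < M - u z) by lra. generalize (Hu _ He). apply filter_imp.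
  intros w Hw. rewrite <- RtoC_minus, Cmod_R in Hw. apply Rabs_lt_between in Hw. lra.
Qed.

Lemma locally_gt (u : C -> R) (z : C) (M : R) : cts (fun w => RtoC (u w)) z -> M < u z ->
  locally z (fun w => M < u w).
Proof.
  intros Hu HM. assert (He : 0 < u z - M) by lra. generalize (Hu _ He). apply filter_imp.
  intros w Hw. rewrite <- RtoC_minus, Cmod_R in Hw. apply Rabs_lt_between in Hw. lra.
Qed.

Lemma cts_Cmod_sub c z : cts (fun w => RtoC (Cmod (w - c))) z.
Proof. apply cts_Cmod, cts_minus; [apply cts_id|apply cts_const]. Qed.

Lemma max_principle_disc f c r M : 0 < r -> 0 <= M ->
  (forall z, Cmod (z - c) <= r -> almost_dif f z) ->
  (forall z, Cmod (z - c) = r -> Cmod (f z) <= M) ->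
  forall z, Cmod (z - c) <= r -> Cmod (f z) <= M.
Proof.
  intros Hr HM Hf HB.
  apply (max_principle (fun z => Cmod (z - c) <= r) (fun z => Cmod (z - c) = r) f M
           (fst c - r) (fst c + r) (snd c - r) (snd c + r)); try lra.
  - intros z Hz. pose proof (re_le_Cmod (z - c)) as H1. pose proof (im_le_Cmod (z - c)) as H2.
    pose proof (Rabs_le_between (Re (z - c)) r) as [A1 _]. pose proof (Rabs_le_between (Im (z - c)) r) as [A2 _].
    specialize (A1 ltac:(lra)). specialize (A2 ltac:(lra)).
    unfold Re, Im in A1, A2. simpl in A1, A2. split; lra.
  - intros z Hz. generalize (locally_gt (fun w => Cmod (w - c)) z r (cts_Cmod_sub c z) ltac:(lra)).
    apply filter_imp. intros w Hw. lra.
  - intros z Hz. apply Hf, Hz.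
  - intros z Hz. destruct (Req_dec (Cmod (z - c)) r) as [E|E]; [left; exact E|right].
    exists (r - Cmod (z - c))%R. split; [lra|]. intros w Hw.
    assert (Cmod (w - c) <= r).
    { replace (w - c) with ((w - z) + (z - c)) by ring. eapply Rle_trans; [apply Cmod_triangle|lra]. }
    split; [assumption|apply Hf; assumption].
  - intros z _ Hz. apply HB, Hz.
Qed.

(* The limit inherits Cauchy's formula. *)
Lemma weierstrass (F : nat -> C -> C) f c r : 0 < r ->
  (forall n z, Cmod (z - c) <= r -> locally z (dif (F n))) ->
  (forall eps, 0 < eps -> exists N : nat, forall n, (N <= n)%nat -> forall z, Cmod (z - c) <= r ->
     Cmod (F n z - f z) < eps) ->
  forall w, Cmod (w - c) < r ->
    dif f w /\ lim eventually (fun n => C_derive (F n) w) (C_derive f w).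
Proof.
  intros Hr HF Hu. pose proof two_PI_pos as HP.
  assert (HPn : RtoC (2 * PI) <> 0) by (intros E; apply RtoC_inj in E; lra).
  assert (HFn : forall n, ctsI 0 (2 * PI) (cauchy_phi (F n) c r)).
  { intros n. apply cauchy_phi_ctsI; [lra|]. intros z Hz. apply dif_cts, (locally_singleton _ _ (HF n z ltac:(lra))). }
  assert (Hf : ctsI 0 (2 * PI) (cauchy_phi f c r)).
  { intros t _. apply (cts_mult (fun t => f (circ c r t))); [|apply cts_minus; [apply cts_circ|apply cts_const]].
    intros eps He. assert (He3 : 0 < eps / 3) by lra. destruct (Hu _ He3) as [N HN].
    specialize (HN N (le_n _)).
    assert (Hc : cts (fun t => F N (circ c r t)) t).
    { apply (cts_comp (F N)); [apply cts_circ|]. apply dif_cts, (locally_singleton _ _ (HF N (circ c r t) ltac:(rewrite Cmod_circ; lra))). }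
    generalize (Hc _ He3). apply filter_imp. intros s Hs.
    pose proof (HN (circ c r s) ltac:(rewrite Cmod_circ; lra)) as H1.
    pose proof (HN (circ c r t) ltac:(rewrite Cmod_circ; lra)) as H2.
    replace (f (circ c r s) - f (circ c r t)) with
      (- (F N (circ c r s) - f (circ c r s)) + ((F N (circ c r s) - F N (circ c r t)) + (F N (circ c r t) - f (circ c r t)))) by ring.
    eapply Rle_lt_trans; [apply Cmod_triangle|]. rewrite Cmod_opp.
    pose proof (Cmod_triangle (F N (circ c r s) - F N (circ c r t)) (F N (circ c r t) - f (circ c r t))). lra. }
  assert (Hlim : forall k w, Cmod (w - c) < r ->
     lim eventually (fun n => cauchy_int (cauchy_phi (F n) c r) c r k w) (cauchy_int (cauchy_phi f c r) c r k w)).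
  { intros k w Hw eps He. set (d := (r - Cmod (w - c))%R). assert (Hd : 0 < d) by (unfold d; lra).
    assert (Hid : 0 < / d) by (apply Rinv_0_lt_compat, Hd).
    set (A := (r * (/ d) ^ k * (2 * PI))%R).
    assert (HA : 0 < A) by (unfold A; apply Rmult_lt_0_compat; [|lra]; apply Rmult_lt_0_compat; [lra|apply pow_lt, Hid]).
    destruct (Hu (eps / (2 * A))%R) as [N HN]; [apply Rdiv_lt_0_compat; lra|].
    exists N. intros n Hn. unfold cauchy_int. rewrite <- CI_minus; [|lra|apply cauchy_int_ctsI; auto..].
    eapply Rle_lt_trans; [apply Cmod_CI_const with (M := (eps / (2 * A) * (r * (/ d) ^ k))%R)|].
    - lra.
    - intros t Ht. apply cts_minus; apply (cauchy_int_ctsI _ c r); auto.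
    - intros t Ht.
      replace (cauchy_phi (F n) c r t * / (circ c r t - w) ^ k - cauchy_phi f c r t * / (circ c r t - w) ^ k)
        with ((F n (circ c r t) - f (circ c r t)) * ((circ c r t - c) * / (circ c r t - w) ^ k))
        by (unfold cauchy_phi; ring).
      rewrite !Cmod_mult, Cmod_circ by lra.
      apply Rmult_le_compat; [apply Cmod_ge_0|apply Rmult_le_pos; [lra|apply Cmod_ge_0]| |].
      + left. apply HN; [exact Hn|rewrite Cmod_circ; lra].
      + apply Rmult_le_compat_l; [lra|].
        rewrite <- Cpow_inv by (apply circ_neq, Hw). rewrite Cmod_pow.
        apply pow_incr. split; [apply Cmod_ge_0|]. apply Cmod_inv_le; [exact Hd|].
        pose proof (Cmod_sub_ge (circ c r t) c w) as H1. rewrite Cmod_circ in H1; unfold d; lra.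
    - replace (eps / (2 * A) * (r * (/ d) ^ k) * (2 * PI - 0))%R with (eps / (2 * A) * A)%R by (unfold A; ring).
      replace (eps / (2 * A) * A)%R with (eps / 2)%R by (field; lra). lra. }
  assert (HE : forall w, Cmod (w - c) < r -> f w = / RtoC (2 * PI) * cauchy_int (cauchy_phi f c r) c r 1 w).
  { intros w Hw. apply (lim_unique eventually (fun n => F n w)).
    - intros eps He. destruct (Hu eps He) as [N HN]. exists N. intros n Hn. apply HN; [exact Hn|lra].
    - apply lim_ext_loc with (fun n => / RtoC (2 * PI) * cauchy_int (cauchy_phi (F n) c r) c r 1 w).
      + typeclasses eauto.
      + apply filter_forall. intros n. symmetry. apply cauchy_formula; [|exact Hw].
        intros z Hz. apply dif_almost, HF, Hz.
      + apply lim_mult; [typeclasses eauto|apply lim_const; typeclasses eauto|apply Hlim, Hw]. }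
  intros w Hw.
  assert (HD : Cd f w (/ RtoC (2 * PI) * cauchy_int (cauchy_phi f c r) c r 2 w)).
  { apply Cd_ext_loc with (fun w => / RtoC (2 * PI) * cauchy_int (cauchy_phi f c r) c r 1 w).
    - generalize (locally_lt (fun w => Cmod (w - c)) w r (cts_Cmod_sub c w) Hw).
      apply filter_imp. intros z Hz. symmetry. apply HE, Hz.
    - apply Cd_scal, cauchy_int_Cd1; assumption. }
  split; [eexists; exact HD|]. rewrite (C_derive_Cd _ _ _ HD).
  apply lim_ext_loc with (fun n => / RtoC (2 * PI) * cauchy_int (cauchy_phi (F n) c r) c r 2 w).
  - typeclasses eauto.
  - apply filter_forall. intros n. symmetry. apply C_derive_Cd, cauchy_derivative; [|exact Hw].
    intros z Hz. apply dif_almost, HF, Hz.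
  - apply lim_mult; [typeclasses eauto|apply lim_const; typeclasses eauto|apply Hlim, Hw].
Qed.

(** Both bounds are uniform over the smaller disc, as [CI_Cd] requires for the integrand in
    [primitive_disc], whose argument runs over a whole segment. *)
Lemma cauchy_remainder f c r r1 : 0 < r1 < r -> (forall z, Cmod (z - c) <= r -> almost_dif f z) ->
  exists A, 0 <= A /\ forall w h, Cmod (w - c) <= r1 -> Cmod h < (r - r1) / 2 ->
    Cmod (f (w + h) - f w - h * C_derive f w) <= A * Cmod h ^ 2 /\ Cmod (C_derive f w) <= A.
Proof.
  intros Hr Hf. pose proof two_PI_pos as HP.
  assert (HPi : 0 < / (2 * PI)) by (apply Rinv_0_lt_compat, HP).
  assert (HPn : RtoC (2 * PI) <> 0) by (intros E; apply RtoC_inj in E; lra).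
  set (phi := cauchy_phi f c r).
  assert (Hphi : ctsI 0 (2 * PI) phi) by (apply cauchy_phi_ctsI; [lra|intros z Hz; apply Hf; lra]).
  destruct (ctsI_bounded phi 0 (2 * PI)) as [B [HB0 HB]]; [lra|exact Hphi|].
  set (d := ((r - r1) / 2)%R). assert (Hd : 0 < d) by (unfold d; lra).
  assert (Hid : 0 < / d) by (apply Rinv_0_lt_compat, Hd).
  assert (Hid2 : 0 < / d * / d) by (apply Rmult_lt_0_compat; lra).
  assert (Hid3 : 0 < / d * (/ d * / d)) by (apply Rmult_lt_0_compat; lra).
  set (A1 := (B * (/ d * (/ d * / d)))%R). set (A2 := (B * (/ d * / d))%R).
  assert (HA1 : 0 <= A1) by (apply Rmult_le_pos; lra).
  assert (HA2 : 0 <= A2) by (apply Rmult_le_pos; lra).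
  exists (A1 + A2)%R. split; [lra|]. intros w h Hw Hh.
  assert (Hh' : Cmod h < (r - r1) / 2) by exact Hh.
  assert (Hwr : Cmod (w - c) < r) by lra.
  assert (Hwhr : Cmod (w + h - c) < r).
  { replace (w + h - c) with (h + (w - c)) by ring. eapply Rle_lt_trans; [apply Cmod_triangle|lra]. }
  rewrite (C_derive_Cd _ _ _ (cauchy_derivative f c r w Hf Hwr)).
  rewrite (cauchy_formula f c r w Hf Hwr), (cauchy_formula f c r _ Hf Hwhr). fold phi.
  assert (HF : forall t, d <= Cmod (circ c r t - w) /\ d <= Cmod (circ c r t - w - h)).
  { intros t. pose proof (Cmod_sub_ge (circ c r t) c w) as H1. rewrite Cmod_circ in H1 by lra.
    split; [unfold d; lra|]. pose proof (Cmod_triangle (circ c r t - w - h) h) as H2.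
    replace (circ c r t - w - h + h) with (circ c r t - w) in H2 by ring. unfold d. lra. }
  assert (H2PI : Cmod (/ RtoC (2 * PI)) = (/ (2 * PI))%R).
  { rewrite Cmod_inv by exact HPn. rewrite Cmod_R, Rabs_pos_eq; lra. }
  split.
  - replace (/ RtoC (2 * PI) * cauchy_int phi c r 1 (w + h) - / RtoC (2 * PI) * cauchy_int phi c r 1 w -
      h * (/ RtoC (2 * PI) * cauchy_int phi c r 2 w)) with
      (/ RtoC (2 * PI) * (cauchy_int phi c r 1 (w + h) - cauchy_int phi c r 1 w - h * cauchy_int phi c r 2 w)) by ring.
    unfold cauchy_int. rewrite <- CI_scal; [|lra|apply (cauchy_int_ctsI _ c r); assumption].
    rewrite <- CI_minus; [|lra|apply cauchy_int_ctsI; assumption..].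
    rewrite <- CI_minus; [|lra| |].
    2:{ intros t Ht. apply cts_minus; apply (cauchy_int_ctsI _ c r); assumption. }
    2:{ intros t Ht. apply cts_mult; [apply cts_const|apply (cauchy_int_ctsI _ c r); assumption]. }
    rewrite Cmod_mult, H2PI.
    apply Rle_trans with (/ (2 * PI) * (A1 * Cmod h ^ 2 * (2 * PI - 0)))%R.
    + apply Rmult_le_compat_l; [lra|]. apply Cmod_CI_const; [lra| |].
      * intros t Ht. apply cts_minus; [apply cts_minus; apply (cauchy_int_ctsI _ c r); assumption|].
        apply cts_mult; [apply cts_const|apply (cauchy_int_ctsI _ c r); assumption].
      * intros t Ht. destruct (HF t) as [F1 F2]. set (u := circ c r t - w) in *.
        assert (Hu : u <> 0) by (apply Cmod_gt_0; lra).
        assert (Huh : u - h <> 0) by (apply Cmod_gt_0; lra).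
        replace (circ c r t - (w + h)) with (u - h) by (unfold u; ring).
        replace (phi t * / (u - h) ^ 1 - phi t * / u ^ 1 - h * (phi t * / u ^ 2))
          with (phi t * (/ (u - h) - / u - h * / u ^ 2)) by (simpl; rewrite !Cmult_1_r; ring).
        rewrite inv_remainder1 by assumption. rewrite !Cmod_mult, Cmod_pow.
        replace (A1 * Cmod h ^ 2)%R with (B * (Cmod h ^ 2 * (/ d * (/ d * / d))))%R by (unfold A1; ring).
        apply Rmult_le_compat; [apply Cmod_ge_0| |apply HB, Ht|].
        { repeat first [apply Cmod_ge_0 | apply pow_le | apply Rmult_le_pos]. }
        apply Rmult_le_compat_l; [apply pow_le, Cmod_ge_0|].
        apply Rmult_le_compat; [apply Cmod_ge_0|apply Cmod_ge_0|apply Cmod_inv_le; assumption|].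
        replace (/ u ^ 2) with (/ u * / u) by (field; exact Hu). rewrite Cmod_mult.
        apply Rmult_le_compat; try apply Cmod_ge_0; apply Cmod_inv_le; assumption.
    + replace (/ (2 * PI) * (A1 * Cmod h ^ 2 * (2 * PI - 0)))%R with (A1 * Cmod h ^ 2)%R by (field; pose proof PI_RGT_0; lra).
      apply Rmult_le_compat_r; [apply pow_le, Cmod_ge_0|lra].
  - rewrite Cmod_mult, H2PI.
    apply Rle_trans with (/ (2 * PI) * (A2 * (2 * PI - 0)))%R.
    + apply Rmult_le_compat_l; [lra|]. apply Cmod_CI_const; [lra|apply cauchy_int_ctsI; assumption|].
      intros t Ht. destruct (HF t) as [F1 F2]. set (u := circ c r t - w) in *.
      assert (Hu : u <> 0) by (apply Cmod_gt_0; lra).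
      rewrite Cmod_mult. apply Rmult_le_compat; [apply Cmod_ge_0|apply Cmod_ge_0|apply HB, Ht|].
      replace (/ u ^ 2) with (/ u * / u) by (field; exact Hu). rewrite Cmod_mult.
      apply Rmult_le_compat; try apply Cmod_ge_0; apply Cmod_inv_le; assumption.
    + replace (/ (2 * PI) * (A2 * (2 * PI - 0)))%R with A2 by (field; pose proof PI_RGT_0; lra). lra.
Qed.

Lemma zero_derivative_const f c w : (forall t, 0 <= t <= 1 -> Cd f (c + RtoC t * (w - c)) 0) -> f w = f c.
Proof.
  intros H. pose proof (CI_FTC_line f (fun _ => 0) c (w - c) 0 1 ltac:(lra) H) as E.
  specialize (E ltac:(intros t _; apply cts_const)). cbv beta in E. rewrite CI_const in E.
  replace (c + RtoC 1 * (w - c)) with w in E by ring.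
  replace (c + RtoC 0 * (w - c)) with c in E by ring.
  apply (proj2 (Ceq_minus _ _)). rewrite <- E. ring.
Qed.

(** The primitive is the integral along the radius from [c], differentiated under the integral sign
    by [CI_Cd]. *)
Lemma primitive_disc k c R0 : (forall z, Cmod (z - c) < R0 -> locally z (dif k)) ->
  exists H : C -> C, H c = 0 /\ forall z, Cmod (z - c) < R0 -> Cd H z (k z).
Proof.
  intros Hk. exists (fun s => CI (fun t => (s - c) * k (c + RtoC t * (s - c))) 0 1).
  assert (Hseg : forall s t, 0 <= t <= 1 -> Cmod (c + RtoC t * (s - c) - c) <= Cmod (s - c)).
  { intros s t Ht. replace (c + RtoC t * (s - c) - c) with (RtoC t * (s - c)) by ring.
    rewrite Cmod_mult, Cmod_R, Rabs_pos_eq by lra. pose proof (Cmod_ge_0 (s - c)) as H1.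
    rewrite <- (Rmult_1_l (Cmod (s - c))) at 2. apply Rmult_le_compat_r; lra. }
  assert (Hcl : forall s t, cts (fun t => c + RtoC t * (s - c)) t).
  { intros s t. apply cts_plus; [apply cts_const|apply cts_mult; [apply cts_idR|apply cts_const]]. }
  split.
  - rewrite (CI_ext 0 1 ltac:(lra) _ (fun _ => 0)); [rewrite CI_const; ring|]. intros t _. ring.
  - intros z Hz. pose proof (Cmod_ge_0 (z - c)) as Hz0.
    set (r1 := ((Cmod (z - c) + R0) / 3 + Cmod (z - c) / 3)%R).
    set (r := ((Cmod (z - c) + R0) / 2)%R).
    assert (Hr1 : Cmod (z - c) < R0) by exact Hz.
    assert (Hr : 0 < r1 < r) by (unfold r1, r; lra).
    assert (Hrz : Cmod (z - c) <= r1) by (unfold r1; lra).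
    assert (HrR : r < R0) by (unfold r; lra).
    destruct (cauchy_remainder k c r r1 Hr) as [A [HA HR]].
    { intros y Hy. apply dif_almost, Hk. lra. }
    set (k' := C_derive k).
    assert (HkC : forall y, Cmod (y - c) < R0 -> Cd k y (k' y)).
    { intros y Hy. apply dif_C_derive, (locally_singleton _ _ (Hk y Hy)). }
    assert (Hk'c : forall y, Cmod (y - c) < R0 -> cts k' y).
    { intros y Hy. apply dif_cts, derive_holomorphic, Hk, Hy. }
    set (d := ((r - r1) / 2)%R). assert (Hd : 0 < d) by (unfold d; lra).
    eapply Cd_eq.
    + apply (CI_Cd (fun t s => (s - c) * k (c + RtoC t * (s - c)))
         (fun t s => k (c + RtoC t * (s - c)) + (s - c) * (RtoC t * k' (c + RtoC t * (s - c))))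
         0 1 z (A * (r1 + d) + A)%R d).
      * lra.
      * assert (0 <= A * (r1 + d))%R by (apply Rmult_le_pos; lra). lra.
      * exact Hd.
      * intros t h Ht Hh. set (p := c + RtoC t * (z - c)).
        assert (Hp : Cmod (p - c) <= r1) by (eapply Rle_trans; [apply Hseg, Ht|exact Hrz]).
        assert (Hth : Cmod (RtoC t * h) <= Cmod h).
        { rewrite Cmod_mult, Cmod_R, Rabs_pos_eq by lra. rewrite <- (Rmult_1_l (Cmod h)) at 2.
          apply Rmult_le_compat_r; [apply Cmod_ge_0|lra]. }
        destruct (HR p (RtoC t * h) Hp ltac:(fold d; lra)) as [R1 R2]. fold k' in R1, R2.
        replace (c + RtoC t * (z + h - c)) with (p + RtoC t * h) by (unfold p; ring).
        replace ((z + h - c) * k (p + RtoC t * h) - (z - c) * k p - h * (k p + (z - c) * (RtoC t * k' p)))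
          with ((z - c + h) * (k (p + RtoC t * h) - k p - RtoC t * h * k' p) + h * (RtoC t * h) * k' p) by ring.
        eapply Rle_trans; [apply Cmod_triangle|]. rewrite !Cmod_mult.
        pose proof (Cmod_ge_0 h) as Hh0.
        rewrite Rmult_plus_distr_r. apply Rplus_le_compat.
        -- replace (A * (r1 + d) * Cmod h ^ 2)%R with ((r1 + d) * (A * Cmod h ^ 2))%R by ring.
           apply Rmult_le_compat; [apply Cmod_ge_0|apply Cmod_ge_0| |].
           ++ eapply Rle_trans; [apply Cmod_triangle|lra].
           ++ eapply Rle_trans; [exact R1|]. apply Rmult_le_compat_l; [exact HA|].
              apply pow_incr. split; [apply Cmod_ge_0|exact Hth].
        -- rewrite <- Cmod_mult. replace (A * Cmod h ^ 2)%R with (Cmod h * Cmod h * A)%R by ring.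
           apply Rmult_le_compat; [apply Rmult_le_pos; apply Cmod_ge_0|apply Cmod_ge_0| |exact R2].
           apply Rmult_le_compat_l; [apply Cmod_ge_0|exact Hth].
      * intros s Hs t Ht. apply cts_mult; [apply cts_const|]. apply (cts_comp k); [apply Hcl|].
        apply dif_cts, (locally_singleton _ _ (Hk _ ltac:(eapply Rle_lt_trans; [apply Hseg, Ht|];
          replace (s - c) with ((s - z) + (z - c)) by ring; eapply Rle_lt_trans; [apply Cmod_triangle|unfold d in Hs; lra]))).
      * intros t Ht.
        assert (Hin : Cmod (c + RtoC t * (z - c) - c) < R0) by (eapply Rle_lt_trans; [apply Hseg, Ht|exact Hz]).
        apply cts_plus; [|apply cts_mult; [apply cts_const|apply cts_mult; [apply cts_idR|]]].
        -- apply (cts_comp k); [apply Hcl|]. eapply Cd_cts, HkC, Hin.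
        -- apply (cts_comp k'); [apply Hcl|]. apply Hk'c, Hin.
    + cbv beta.
      (* [k (c + t u) + u t k' (c + t u)] is the derivative of [t k (c + t u)] in [t]. *)
      destruct (excluded_middle_informative (z = c)) as [->|E].
      { rewrite (CI_ext 0 1 ltac:(lra) _ (fun _ => k c)); [rewrite CI_const; rewrite Rminus_0_r; ring|].
        intros t _. replace (c + RtoC t * (c - c)) with c by ring. ring. }
      set (u := z - c) in *. assert (Hu : u <> 0) by (apply Cminus_eq_contra, E).
      pose proof (CI_FTC_line (fun s => (s - c) / u * k s)
         (fun s => / u * k s + (s - c) / u * k' s) c u 0 1 ltac:(lra)) as HF.
      rewrite (CI_ext 0 1 ltac:(lra) _ (fun t => u * (/ u * k (c + RtoC t * u) + (c + RtoC t * u - c) / u * k' (c + RtoC t * u)))).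
      2:{ intros t _. field. exact Hu. }
      assert (HcI : ctsI 0 1 (fun t => / u * k (c + RtoC t * u) + (c + RtoC t * u - c) / u * k' (c + RtoC t * u))).
      { intros t Ht. assert (Hin : Cmod (c + RtoC t * u - c) < R0) by (eapply Rle_lt_trans; [apply Hseg, Ht|exact Hz]).
        apply cts_plus; apply cts_mult.
        - apply cts_const.
        - apply (cts_comp k); [apply Hcl|]. eapply Cd_cts, HkC, Hin.
        - apply cts_mult; [|apply cts_const]. apply cts_minus; [apply Hcl|apply cts_const].
        - apply (cts_comp k'); [apply Hcl|]. apply Hk'c, Hin. }
      rewrite CI_scal; [|lra|exact HcI]. rewrite HF.
      * replace (c + RtoC 1 * u) with z by (unfold u; ring). replace (c + RtoC 0 * u) with c by ring.
        fold u. field. exact Hu.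
      * intros t Ht. assert (Hin : Cmod (c + RtoC t * u - c) < R0) by (eapply Rle_lt_trans; [apply Hseg, Ht|exact Hz]).
        eapply Cd_eq.
        -- apply Cd_mult; [|apply HkC, Hin].
           apply (Cd_mult (fun s => s - c) (fun _ => / u)); [|apply Cd_const].
           apply Cd_minus; [apply Cd_id|apply Cd_const].
        -- cfield. exact Hu.
      * exact HcI.
Qed.

(** With [H] a primitive of [g'/g], the function [g exp(-H)] has zero derivative. The normalisation
    [H c = 0] is the one that [borel_caratheodory] expects. *)
Lemma log_disc g c R0 : 0 < R0 -> (forall z, Cmod (z - c) < R0 -> locally z (dif g)) ->
  (forall z, Cmod (z - c) < R0 -> g z <> 0) ->
  exists H : C -> C, H c = 0 /\ (forall z, Cmod (z - c) < R0 -> Cd H z (C_derive g z / g z)) /\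
    forall z, Cmod (z - c) < R0 -> g z = g c * Cexp (H z).
Proof.
  intros HR Hg Hn.
  destruct (primitive_disc (fun z => C_derive g z / g z) c R0) as [H [H0 HH]].
  { intros z Hz. generalize (locally_lt (fun w => Cmod (w - c)) z R0 (cts_Cmod_sub c z) Hz).
    apply filter_imp. intros w Hw. apply dif_div; [|apply (locally_singleton _ _ (Hg w Hw))|apply Hn, Hw].
    apply derive_holomorphic, Hg, Hw. }
  exists H. split; [exact H0|]. split; [exact HH|]. intros z Hz.
  assert (E : g z * Cexp (- H z) = g c * Cexp (- H c)).
  { apply (zero_derivative_const (fun z => g z * Cexp (- H z))). intros t Ht.
    set (p := c + RtoC t * (z - c)).
    assert (Hp : Cmod (p - c) < R0).
    { unfold p. replace (c + RtoC t * (z - c) - c) with (RtoC t * (z - c)) by ring.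
      rewrite Cmod_mult, Cmod_R, Rabs_pos_eq by lra. eapply Rle_lt_trans; [|exact Hz].
      rewrite <- (Rmult_1_l (Cmod (z - c))) at 2. apply Rmult_le_compat_r; [apply Cmod_ge_0|lra]. }
    eapply Cd_eq.
    - apply Cd_mult; [apply dif_C_derive, (locally_singleton _ _ (Hg p Hp))|].
      apply (Cd_comp Cexp (fun s => - H s)); [apply Cd_opp, HH, Hp|apply Cd_Cexp].
    - cfield. apply Hn, Hp. }
  rewrite H0 in E. replace (- (RtoC 0)) with (RtoC 0) in E by ring. rewrite Cexp_0, Cmult_1_r in E.
  rewrite <- E. rewrite Cexp_opp. field. apply Cexp_neq_0.
Qed.

(** On the circle [conj u = r^2 / u], so the integrand is the conjugate of a holomorphic function
    with the factor [z - c], whose mean is its value 0 at the centre. Adding this zero integral to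
    Cauchy's formula for the derivative replaces [F] by [2 Re F]. *)
Lemma circint_conj_kernel (F : C -> C) c r w : (forall z, Cmod (z - c) <= r -> locally z (dif F)) ->
  Cmod (w - c) < r -> cauchy_int (fun t => Cconj (F (circ c r t)) * (circ c r t - c)) c r 2 w = 0.
Proof.
  intros HF Hw. pose proof two_PI_pos as HP. pose proof (Cmod_ge_0 (w - c)).
  assert (Hr : 0 < r) by lra. set (v := w - c) in *.
  assert (HR : RtoC (r * r) <> 0).
  { intros E. apply RtoC_inj in E. assert (0 < r * r)%R by (apply Rmult_lt_0_compat; lra). lra. }
  assert (HN : forall u, Cmod u <= r -> RtoC (r * r) - Cconj v * u <> 0).
  { intros u Hu E. assert (E2 : Cmod (RtoC (r * r)) = Cmod (Cconj v * u)).
    { f_equal. apply (proj2 (Ceq_minus _ _)). exact E. }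
    rewrite Cmod_mult, Cmod_conj, Cmod_R in E2.
    rewrite Rabs_pos_eq in E2 by (apply Rmult_le_pos; lra).
    assert (Cmod v * Cmod u <= Cmod v * r)%R by (apply Rmult_le_compat_l; lra).
    assert (Cmod v * r < r * r)%R by (apply Rmult_lt_compat_r; lra). lra. }
  set (G := fun z => F z * (RtoC (r * r) * (z - c) / (RtoC (r * r) - Cconj v * (z - c)) ^ 2)).
  assert (HG : forall z, Cmod (z - c) <= r -> almost_dif G z).
  { intros z Hz. apply almost_dif_mult; [apply dif_almost, HF, Hz|]. apply dif_almost.
    assert (Hc : cts (fun z => RtoC (r * r) - Cconj v * (z - c)) z).
    { apply cts_minus; [apply cts_const|]. apply cts_mult; [apply cts_const|].
      apply cts_minus; [apply cts_id|apply cts_const]. }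
    generalize (lim_neq_0 _ _ _ Hc (HN (z - c) Hz)). apply filter_imp. intros y Hy.
    assert (Hy0 : RtoC (r * r) - Cconj v * (y - c) <> 0).
    { apply Cmod_gt_0. pose proof (Cmod_ge_0 (RtoC (r * r) - Cconj v * (z - c))). lra. }
    assert (D1 : dif (fun y => y - c) y) by (apply dif_minus; [apply dif_id|apply dif_const]).
    apply dif_div.
    - apply dif_mult; [apply dif_const|exact D1].
    - apply dif_pow. apply dif_minus; [apply dif_const|]. apply dif_mult; [apply dif_const|exact D1].
    - apply Cpow_nz, Hy0. }
  pose proof (mean_value G c r Hr HG) as HM.
  replace (G c) with (RtoC 0) in HM.
  2:{ unfold G. replace (c - c) with (RtoC 0) by ring. rewrite Cmult_0_r. unfold Cdiv. ring. }
  rewrite Cmult_0_r in HM.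
  assert (HMc : Cconj (circint G c r) = 0) by (rewrite HM; apply injective_projections; simpl; ring).
  rewrite <- HMc. unfold circint. rewrite <- CI_conj.
  - apply CI_ext; [lra|]. intros t _.
    set (u := circ c r t - c). assert (Hu : Cmod u = r) by (apply Cmod_circ; lra).
    assert (Hu0 : u <> 0) by (apply Cmod_gt_0; lra).
    pose proof (HN u ltac:(lra)) as Hd.
    assert (Ecu : Cconj u = RtoC (r * r) / u).
    { unfold u. rewrite circ_shift. replace (c + circ 0 r t - c) with (circ 0 r t) by ring.
      apply Cconj_circ0. lra. }
    unfold G. fold u. rewrite Cmult_conj. rewrite Cdiv_conj by (apply Cpow_nz, Hd).
    rewrite Cpow_conj, Cminus_conj, !Cmult_conj, Cconj_conj.
    replace (Cconj (RtoC (r * r))) with (RtoC (r * r)) by (apply injective_projections; simpl; ring).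
    rewrite Ecu. replace (circ c r t - w) with (u - v) by (unfold u, v; ring).
    assert (Huv : u - v <> 0).
    { unfold u, v. replace (circ c r t - c - (w - c)) with (circ c r t - w) by ring. apply circ_neq, Hw. }
    field. repeat split; try assumption.
    replace (RtoC (r * r) * u - v * RtoC (r * r)) with (RtoC (r * r) * (u - v)) by ring.
    apply Cmult_neq_0; assumption.
  - lra.
  - apply circint_ctsI; [lra|]. intros z Hz. apply HG. lra.
Qed.

(* Borel-Caratheodory: [H'] is the integral of [A - Re H >= 0] against a kernel. *)
Lemma borel_caratheodory H c r A w : 0 < r -> (forall z, Cmod (z - c) <= r -> locally z (dif H)) ->
  H c = 0 -> (forall z, Cmod (z - c) = r -> Re (H z) <= A) -> Cmod (w - c) <= r / 2 ->
  Cmod (C_derive H w - C_derive H c) <= 20 * A * Cmod (w - c) / r ^ 2.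
Proof.
  intros Hr HH H0 HA Hw. pose proof two_PI_pos as HP.
  assert (HPn : RtoC (2 * PI) <> 0) by (intros E; apply RtoC_inj in E; lra).
  assert (HHa : forall z, Cmod (z - c) <= r -> almost_dif H z) by (intros z Hz; apply dif_almost, HH, Hz).
  assert (HHc : ctsI 0 (2 * PI) (fun t => H (circ c r t))).
  { apply circint_ctsI; [lra|]. intros z Hz. apply HHa. lra. }
  set (P := fun t => RtoC (A - Re (H (circ c r t)))).
  assert (HPc : ctsI 0 (2 * PI) P).
  { intros t Ht. apply cts_ext_loc with (fun t => RtoC A - RtoC (Re (H (circ c r t)))).
    - apply filter_forall. intros s. unfold P. rewrite RtoC_minus. reflexivity.
    - apply cts_minus; [apply cts_const|]. apply cts_re, HHc, Ht. }
  (* [2 Re H] replaces [H] by [circint_conj_kernel]; the same lemma for the constant 1 shows that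
     the kernel has integral 0, so [A] may be inserted. What remains is an integral against
     [P = A - Re H], which is nonnegative on the circle. *)
  assert (HD : forall y, Cmod (y - c) < r -> C_derive H y =
     - / RtoC PI * CI (fun t => P t * ((circ c r t - c) * / (circ c r t - y) ^ 2)) 0 (2 * PI)).
  { intros y Hy.
    rewrite (C_derive_Cd _ _ _ (cauchy_derivative H c r y HHa Hy)).
    pose proof (circint_conj_kernel H c r y HH Hy) as E1.
    pose proof (circint_conj_kernel (fun _ => 1) c r y (fun z _ => filter_forall _ (fun w => dif_const 1 w)) Hy) as E2.
    assert (X1 : ctsI 0 (2 * PI) (fun t => cauchy_phi H c r t * / (circ c r t - y) ^ 2)).
    { apply cauchy_int_ctsI; [|exact Hy]. apply cauchy_phi_ctsI; [lra|]. intros z Hz. apply HHa. lra. }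
    assert (X2 : ctsI 0 (2 * PI) (fun t => Cconj (H (circ c r t)) * (circ c r t - c) * / (circ c r t - y) ^ 2)).
    { apply (cauchy_int_ctsI (fun t => Cconj (H (circ c r t)) * (circ c r t - c))); [|exact Hy].
      intros t Ht. apply cts_mult; [apply cts_conj, HHc, Ht|]. apply cts_minus; [apply cts_circ|apply cts_const]. }
    assert (X3 : ctsI 0 (2 * PI) (fun t => Cconj 1 * (circ c r t - c) * / (circ c r t - y) ^ 2)).
    { apply (cauchy_int_ctsI (fun t => Cconj 1 * (circ c r t - c))); [|exact Hy].
      intros t Ht. apply cts_mult; [apply cts_const|]. apply cts_minus; [apply cts_circ|apply cts_const]. }
    unfold cauchy_int in *.
    rewrite (CI_ext 0 (2 * PI) ltac:(lra) (fun t => P t * _)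
      (fun t => RtoC A * (Cconj 1 * (circ c r t - c) * / (circ c r t - y) ^ 2)
         - / 2 * (cauchy_phi H c r t * / (circ c r t - y) ^ 2
                  + Cconj (H (circ c r t)) * (circ c r t - c) * / (circ c r t - y) ^ 2))).
    - rewrite CI_minus; [|lra| |].
      + rewrite !CI_scal; [|lra| |lra|exact X3].
        * rewrite CI_plus; [|lra|exact X1|exact X2]. rewrite E1, E2. rewrite RtoC_mult. field.
          intros E. apply RtoC_inj in E. pose proof PI_RGT_0. lra.
        * intros t Ht. apply cts_plus; [apply X1, Ht|apply X2, Ht].
      + intros t Ht. apply cts_mult; [apply cts_const|apply X3, Ht].
      + intros t Ht. apply cts_mult; [apply cts_const|apply cts_plus; [apply X1, Ht|apply X2, Ht]].
    - intros t _. unfold P, cauchy_phi. rewrite RtoC_minus, re_alt.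
      replace (Cconj 1) with (RtoC 1) by (apply injective_projections; simpl; ring). field.
      apply circ_neq, Hy. }
  assert (Hcc : Cmod (c - c) < r) by (replace (c - c) with (RtoC 0) by ring; rewrite Cmod_0; exact Hr).
  assert (Hwr : Cmod (w - c) < r) by lra.
  rewrite (HD w Hwr), (HD c Hcc).
  assert (Y : forall y, Cmod (y - c) < r -> ctsI 0 (2 * PI) (fun t => P t * ((circ c r t - c) * / (circ c r t - y) ^ 2))).
  { intros y Hy t Ht. apply cts_mult; [apply HPc, Ht|]. apply cts_mult.
    - apply cts_minus; [apply cts_circ|apply cts_const].
    - apply cts_inv; [apply cts_pow, cts_minus; [apply cts_circ|apply cts_const]|apply Cpow_nz, circ_neq, Hy]. }
  match goal with |- Cmod (?a * ?x - ?a * ?y) <= _ => replace (a * x - a * y) with (a * (x - y)) by ring end.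
  rewrite <- CI_minus; [|lra|apply Y; assumption..].
  (* With [u = z - c] and [v = w - c], the difference of the kernels is
     [v (2u - v) / (u (u - v)^2)]; from [|2u - v| <= 5r/2] and [|u - v| >= r/2] it is at most
     [10 |v| / r^2]. Comparing two points gains the second power of [r], which makes a growth
     exponent [o(r^2)] sufficient later. *)
  set (Q := (10 * Cmod (w - c) / r ^ 2)%R).
  assert (Hr2 : 0 < r ^ 2) by (apply pow_lt, Hr).
  assert (HI : Cmod (CI (fun t => P t * ((circ c r t - c) * / (circ c r t - w) ^ 2)
       - P t * ((circ c r t - c) * / (circ c r t - c) ^ 2)) 0 (2 * PI))
     <= RInt (fun t => (Q * (A - Re (H (circ c r t))))%R) 0 (2 * PI)).
  { apply Cmod_CI_le.
    - lra.
    - intros t Ht. apply cts_minus; apply Y; assumption.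
    - apply (ex_RInt_scal (V := R_NormedModule)). apply (ctsI_fst 0 (2 * PI) ltac:(lra) P HPc).
    - intros t Ht. set (u := circ c r t - c). set (v := w - c) in *.
      assert (Hu : Cmod u = r) by (apply Cmod_circ; lra).
      assert (Hu0 : u <> 0) by (apply Cmod_gt_0; lra).
      assert (Huv : r / 2 <= Cmod (u - v)).
      { pose proof (Cmod_sub_ge (circ c r t) c w) as S. rewrite Cmod_circ in S by lra.
        replace (u - v) with (circ c r t - w) by (unfold u, v; ring). fold v in S. lra. }
      assert (Huv0 : u - v <> 0) by (apply Cmod_gt_0; lra).
      replace (circ c r t - w) with (u - v) by (unfold u, v; ring).
      replace (P t * (u * / (u - v) ^ 2) - P t * (u * / u ^ 2)) with
        (P t * (v * (2 * u - v) * (/ u * (/ (u - v) * / (u - v))))) by (field; split; assumption).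
      assert (HPt : Cmod (P t) = (A - Re (H (circ c r t)))%R).
      { unfold P. rewrite Cmod_R. apply Rabs_pos_eq.
        pose proof (HA (circ c r t) ltac:(apply Cmod_circ; lra)). lra. }
      rewrite Cmod_mult, HPt, Rmult_comm. apply Rmult_le_compat_r.
      { rewrite <- HPt. apply Cmod_ge_0. }
      rewrite !Cmod_mult.
      assert (Hi : Cmod (/ (u - v)) <= / (r / 2)) by (apply Cmod_inv_le; lra).
      assert (Hi2 : Cmod (/ u) = (/ r)%R) by (rewrite Cmod_inv, Hu by exact Hu0; reflexivity).
      rewrite Hi2.
      assert (H2 : Cmod (2 * u - v) <= 5 / 2 * r).
      { eapply Rle_trans; [apply Cmod_triangle|]. rewrite Cmod_opp, Cmod_mult, Hu, Cmod_R, Rabs_pos_eq; lra. }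
      pose proof (Cmod_ge_0 v) as Hv0. pose proof (Cmod_ge_0 (/ (u - v))) as Hi0.
      assert (Hir : 0 < / r) by (apply Rinv_0_lt_compat, Hr).
      assert (Hir2 : 0 < / (r / 2)) by (apply Rinv_0_lt_compat; lra).
      replace Q with (Cmod v * (5 / 2 * r) * (/ r * (/ (r / 2) * / (r / 2))))%R by (unfold Q; fold v; field; lra).
      apply Rmult_le_compat.
      + apply Rmult_le_pos; apply Cmod_ge_0.
      + repeat apply Rmult_le_pos; lra.
      + apply Rmult_le_compat_l; lra.
      + apply Rmult_le_compat_l; [lra|]. apply Rmult_le_compat; lra. }
  assert (HRI : RInt (fun t => (Q * (A - Re (H (circ c r t))))%R) 0 (2 * PI) = (Q * (A * (2 * PI)))%R).
  { rewrite (RInt_scal (V := R_CompleteNormedModule) (fun t => (A - Re (H (circ c r t)))%R)).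
    - unfold scal; simpl. unfold mult; simpl. f_equal.
      rewrite (RInt_minus (V := R_CompleteNormedModule) (fun _ => A) (fun t => Re (H (circ c r t)))).
      + rewrite RInt_const. pose proof (mean_value H c r Hr HHa) as HM. rewrite H0, Cmult_0_r in HM.
        assert (E : RInt (fun t => Re (H (circ c r t))) 0 (2 * PI) = 0%R).
        { transitivity (fst (circint H c r)); [reflexivity|]. rewrite HM. reflexivity. }
        rewrite E. unfold minus, plus, opp, scal; simpl. unfold mult; simpl. ring.
      + apply ex_RInt_const.
      + apply (ctsI_fst 0 (2 * PI) ltac:(lra) _ HHc).
    - apply (ctsI_fst 0 (2 * PI) ltac:(lra) P HPc). }
  rewrite HRI in HI. pose proof PI_RGT_0 as HPI.
  rewrite Cmod_mult, Cmod_opp, Cmod_inv, Cmod_R, Rabs_pos_eq; [|lra|intros E; apply RtoC_inj in E; lra].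
  apply Rle_trans with (/ PI * (Q * (A * (2 * PI))))%R.
  - apply Rmult_le_compat_l; [left; apply Rinv_0_lt_compat, HPI|exact HI].
  - right. unfold Q. field. split; lra.
Qed.

(** * Unordered sums *)

Definition eq_decC (T : Type) (x y : T) : {x = y} + {x <> y} := excluded_middle_informative (x = y).

Section Usum.
Context {T : Type}.
Implicit Types (P : T -> Prop) (f g : T -> C) (u : T -> R) (l : list T).

Definition Rsum u l : R := fold_right (fun x acc => (u x + acc)%R) 0%R l.

Lemma Csum_app f l1 l2 : Csum f (l1 ++ l2) = Csum f l1 + Csum f l2.
Proof.
  induction l1 as [|x l1 IH]; simpl; [ring|]. unfold Csum in *. simpl. rewrite IH. ring.
Qed.

Lemma Rsum_app u l1 l2 : Rsum u (l1 ++ l2) = (Rsum u l1 + Rsum u l2)%R.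
Proof.
  induction l1 as [|x l1 IH]; simpl; [ring|]. rewrite IH. ring.
Qed.

Lemma Csum_cons f x l : Csum f (x :: l) = f x + Csum f l.
Proof. reflexivity. Qed.

Lemma Csum_plus f g l : Csum (fun x => f x + g x) l = Csum f l + Csum g l.
Proof. induction l as [|x l IH]; [simpl; ring|]. rewrite !Csum_cons, IH. ring. Qed.

Lemma Csum_scal (c : C) f l : Csum (fun x => c * f x) l = c * Csum f l.
Proof. induction l as [|x l IH]; [simpl; ring|]. rewrite !Csum_cons, IH. ring. Qed.

Lemma Csum_ext f g l : (forall x, In x l -> f x = g x) -> Csum f l = Csum g l.
Proof.
  induction l as [|x l IH]; intros H; [reflexivity|]. rewrite !Csum_cons, IH, H; auto with datatypes.
Qed.

Lemma Csum_RtoC u l : Csum (fun x => RtoC (u x)) l = RtoC (Rsum u l).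
Proof. induction l as [|x l IH]; [reflexivity|]. rewrite Csum_cons, IH, <- RtoC_plus. reflexivity. Qed.

Lemma Re_Csum f l : Re (Csum f l) = Rsum (fun x => Re (f x)) l.
Proof. induction l as [|x l IH]; [reflexivity|]. rewrite Csum_cons. simpl. rewrite <- IH. reflexivity. Qed.

Lemma Cmod_Csum_le f u l : (forall x, In x l -> Cmod (f x) <= u x) -> Cmod (Csum f l) <= Rsum u l.
Proof.
  induction l as [|x l IH]; intros H; [simpl; rewrite Cmod_0; lra|].
  rewrite Csum_cons. simpl. eapply Rle_trans; [apply Cmod_triangle|].
  apply Rplus_le_compat; [apply H; left; reflexivity|apply IH; intros y Hy; apply H; right; exact Hy].
Qed.

Lemma Rsum_le u v l : (forall x, In x l -> u x <= v x) -> Rsum u l <= Rsum v l.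
Proof.
  induction l as [|x l IH]; intros H; [simpl; lra|]. simpl.
  apply Rplus_le_compat; [apply H; left; reflexivity|apply IH; intros y Hy; apply H; right; exact Hy].
Qed.

Lemma Rsum_scal c u l : Rsum (fun x => (c * u x)%R) l = (c * Rsum u l)%R.
Proof. induction l as [|x l IH]; simpl; [ring|]. rewrite IH. ring. Qed.

Lemma Rsum_const c l : Rsum (fun _ => c) l = (c * INR (length l))%R.
Proof. induction l as [|x l IH]; [simpl; ring|]. cbn [Rsum fold_right length]. rewrite S_INR. unfold Rsum in IH. rewrite IH. ring. Qed.

(** The induction removes one element of [l] from [l'] at a time. Elements where [u] vanishes may be
    missing from [l']: this is the situation of a sum over all positive reals supported on a
    sequence. *)
Lemma Rsum_incl u l l' : (forall x, 0 <= u x) -> NoDup l ->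
  (forall x, In x l -> u x <> 0%R -> In x l') -> Rsum u l <= Rsum u l'.
Proof.
  intros Hu Hl. revert l'. induction Hl as [|x l Hx Hl IH]; intros l' Hi.
  - simpl. induction l' as [|y l' IH]; simpl; [lra|]. specialize (Hu y).
    assert (0 <= Rsum u l') by (apply IH; intros z []). lra.
  - destruct (Req_dec (u x) 0) as [E|E].
    + simpl. rewrite E, Rplus_0_l. apply IH. intros y Hy. apply Hi. right. exact Hy.
    + destruct (in_split x l') as [l1 [l2 ->]]; [apply Hi; [left; reflexivity|exact E]|].
      assert (H : Rsum u l <= Rsum u (l1 ++ l2)).
      { apply IH. intros y Hy Ey. specialize (Hi y (or_intror Hy) Ey).
        apply in_app_or in Hi. apply in_or_app. destruct Hi as [Hi|[Hi|Hi]]; auto.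
        subst y. contradiction. }
      rewrite Rsum_app in *. simpl. lra.
Qed.

Lemma Rsum_incl_NoDup u l l' : (forall x, 0 <= u x) -> NoDup l -> incl l l' -> Rsum u l <= Rsum u l'.
Proof. intros Hu Hl Hi. apply Rsum_incl; auto. Qed.

Lemma union_lists P l1 l2 : NoDup l1 -> NoDup l2 -> List.Forall P l1 -> List.Forall P l2 ->
  exists l, NoDup l /\ List.Forall P l /\ incl l1 l /\ incl l2 l.
Proof.
  intros H1 H2 F1 F2. exists (nodup (eq_decC T) (l1 ++ l2)). split; [apply NoDup_nodup|].
  rewrite !List.Forall_forall in *. split; [|split].
  - intros x Hx. apply nodup_In, in_app_or in Hx. destruct Hx; auto.
  - intros x Hx. apply nodup_In, in_or_app. auto.
  - intros x Hx. apply nodup_In, in_or_app. auto.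
Qed.

Lemma is_usum_unique_val P f s1 s2 : is_usum P f s1 -> is_usum P f s2 -> s1 = s2.
Proof.
  intros H1 H2. apply (proj2 (Ceq_minus _ _)). apply Cmod_eq_0. apply Rle_antisym; [|apply Cmod_ge_0].
  apply le_epsilon. intros e He. rewrite Rplus_0_l. assert (He2 : 0 < e / 2) by lra.
  destruct (H1 (mkposreal _ He2)) as [l1 [A1 [B1 C1]]]. destruct (H2 (mkposreal _ He2)) as [l2 [A2 [B2 C2]]].
  destruct (union_lists P l1 l2 A1 A2 B1 B2) as [l [D1 [D2 [D3 D4]]]].
  specialize (C1 l D1 D2 D3). specialize (C2 l D1 D2 D4). simpl in *.
  replace (s1 - s2) with (- (Csum f l - s1) + (Csum f l - s2)) by ring.
  eapply Rle_trans; [apply Cmod_triangle|]. rewrite Cmod_opp. lra.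
Qed.

Lemma usum_eq P f s : is_usum P f s -> usum P f = s.
Proof.
  intros H. apply (iota_unique (V := C_R_CompleteNormedModule)).
  - intros y Hy. eapply is_usum_unique_val; eassumption.
  - exact H.
Qed.

Lemma is_usum_plus P f g a b : is_usum P f a -> is_usum P g b -> is_usum P (fun x => f x + g x) (a + b).
Proof.
  intros H1 H2 e. assert (He2 : 0 < e / 2) by (pose proof (cond_pos e); lra).
  destruct (H1 (mkposreal _ He2)) as [l1 [A1 [B1 C1]]]. destruct (H2 (mkposreal _ He2)) as [l2 [A2 [B2 C2]]].
  destruct (union_lists P l1 l2 A1 A2 B1 B2) as [l [D1 [D2 [D3 D4]]]].
  exists l. split; [exact D1|]. split; [exact D2|]. intros l' E1 E2 E3.
  specialize (C1 l' E1 E2 (incl_tran D3 E3)). specialize (C2 l' E1 E2 (incl_tran D4 E3)). simpl in *.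
  rewrite Csum_plus. replace (Csum f l' + Csum g l' - (a + b)) with ((Csum f l' - a) + (Csum g l' - b)) by ring.
  eapply Rle_lt_trans; [apply Cmod_triangle|lra].
Qed.

Lemma is_usum_scal P f (c a : C) : is_usum P f a -> is_usum P (fun x => c * f x) (c * a).
Proof.
  intros H e. pose proof (Cmod_ge_0 c).
  assert (He : 0 < e / (Cmod c + 1)) by (apply Rdiv_lt_0_compat; [apply cond_pos|lra]).
  destruct (H (mkposreal _ He)) as [l [A [B D]]]. exists l. split; [exact A|]. split; [exact B|].
  intros l' E1 E2 E3. specialize (D l' E1 E2 E3). simpl in D.
  rewrite Csum_scal. replace (c * Csum f l' - c * a) with (c * (Csum f l' - a)) by ring. rewrite Cmod_mult.
  apply Rle_lt_trans with ((Cmod c) * (e / (Cmod c + 1)))%R; [apply Rmult_le_compat_l; lra|].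
  pose proof (cond_pos e) as He'.
  replace (Cmod c * (e / (Cmod c + 1)))%R with (e - e / (Cmod c + 1))%R by (field; lra). lra.
Qed.

Lemma is_usum_ext P f g a : (forall x, P x -> f x = g x) -> is_usum P f a -> is_usum P g a.
Proof.
  intros Hfg H e. destruct (H e) as [l [A [B D]]]. exists l. split; [exact A|]. split; [exact B|].
  intros l' E1 E2 E3. rewrite <- (Csum_ext f g); [apply D; assumption|].
  intros x Hx. apply Hfg. rewrite List.Forall_forall in E2. apply E2, Hx.
Qed.

Lemma is_usum_pos P u B : (forall x, 0 <= u x) ->
  (forall l, NoDup l -> List.Forall P l -> Rsum u l <= B) ->
  exists s, is_usum P (fun x => RtoC (u x)) (RtoC s).
Proof.
  intros Hu HB.
  destruct (completeness (fun y => exists l, NoDup l /\ List.Forall P l /\ y = Rsum u l)) as [S [H1 H2]].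
  - exists B. intros y [l [A [F ->]]]. apply HB; assumption.
  - exists 0%R, nil. split; [constructor|]. split; [constructor|reflexivity].
  - exists S. intros e. apply NNPP. intros Hn.
    assert (S <= S - e); [|pose proof (cond_pos e); lra]. apply H2. intros y [l0 [A [F ->]]].
    apply Rnot_lt_le. intros Hlt. apply Hn. exists l0. split; [exact A|]. split; [exact F|].
    intros l G1 G2 G3. rewrite Csum_RtoC, <- RtoC_minus, Cmod_R.
    pose proof (Rsum_incl_NoDup u l0 l Hu A G3).
    assert (Rsum u l <= S) by (apply H1; exists l; auto).
    apply Rabs_lt_between. lra.
Qed.

Lemma summable_bounded P f B :
  (forall l, NoDup l -> List.Forall P l -> Rsum (fun x => Cmod (f x)) l <= B) -> summable P f.
Proof.
  intros HB.
  assert (K : forall h : T -> R, (forall x, Rabs (h x) <= Cmod (f x)) ->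
    exists s, is_usum P (fun x => RtoC (h x)) s).
  { intros h Hh.
    destruct (is_usum_pos P (fun x => Rmax (h x) 0) B) as [s1 H1].
    { intros x. apply Rmax_r. }
    { intros l A F. eapply Rle_trans; [|apply (HB l A F)]. apply Rsum_le. intros x _.
      eapply Rle_trans; [|apply Hh]. unfold Rmax, Rabs. destruct Rle_dec, Rcase_abs; lra. }
    destruct (is_usum_pos P (fun x => Rmax (- h x) 0) B) as [s2 H2].
    { intros x. apply Rmax_r. }
    { intros l A F. eapply Rle_trans; [|apply (HB l A F)]. apply Rsum_le. intros x _.
      eapply Rle_trans; [|apply Hh]. unfold Rmax, Rabs. destruct Rle_dec, Rcase_abs; lra. }
    eexists. eapply is_usum_ext; [|apply (is_usum_plus P _ _ _ _ H1 (is_usum_scal P _ (- (1)) _ H2))].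
    intros x _. simpl. rewrite <- (RtoC_opp 1), <- RtoC_mult, <- RtoC_plus. f_equal.
    unfold Rmax. destruct Rle_dec, Rle_dec; lra. }
  destruct (K (fun x => Re (f x))) as [s1 H1]; [intros x; apply re_le_Cmod|].
  destruct (K (fun x => Im (f x))) as [s2 H2]; [intros x; apply im_le_Cmod|].
  exists (s1 + Ci * s2). eapply is_usum_ext; [|apply (is_usum_plus P _ _ _ _ H1 (is_usum_scal P _ Ci _ H2))].
  intros x _. simpl. destruct (f x). unfold Re, Im. apply injective_projections; simpl; ring.
Qed.

End Usum.

Lemma NoDup_map_seq {T : Type} (e : nat -> T) (inj : forall i j, e i = e j -> i = j) k n :
  NoDup (map e (seq k n)).
Proof.
  revert k. induction n as [|n IH]; intros k; [constructor|]. simpl. constructor; [|apply IH].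
  intros H. apply in_map_iff in H. destruct H as [j [E Hj]]. apply inj in E. subst j.
  apply in_seq in Hj. lia.
Qed.

Lemma Csum_map_seq {T : Type} (e : nat -> T) (f : T -> C) n :
  Csum f (map e (seq 0 (S n))) = sum_n (G := C_AbelianMonoid) (fun k => f (e k)) n.
Proof.
  induction n as [|n IH].
  - rewrite sum_O. simpl. ring.
  - rewrite seq_S, map_app, Csum_app, IH, sum_Sn. simpl. change (plus (sum_n (fun k => f (e k)) n) (f (e (S n)))) with (sum_n (G := C_AbelianMonoid) (fun k => f (e k)) n + f (e (S n))). ring.
Qed.

Lemma Rsum_map_seq {T : Type} (e : nat -> T) (u : T -> R) n :
  Rsum u (map e (seq 0 (S n))) = sum_n (fun k => u (e k)) n.
Proof.
  induction n as [|n IH].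
  - rewrite sum_O. simpl. ring.
  - rewrite seq_S, map_app, Rsum_app, IH, sum_Sn. simpl. unfold plus; simpl. ring.
Qed.

(** Passes from a series over an injective enumeration to the sum over a possibly uncountable index
    set. Beyond an initial segment, the nonzero terms of any finite list belong to the tail of the
    absolutely convergent series. *)
Lemma is_usum_series {T : Type} (P : T -> Prop) (f : T -> C) (e : nat -> T) (s : C) :
  (forall i j, e i = e j -> i = j) -> (forall k, P (e k)) ->
  (forall x, P x -> f x <> 0 -> exists k, x = e k) ->
  ex_series (fun k => Cmod (f (e k))) ->
  is_series (K := C_AbsRing) (V := C_NormedModule) (fun k => f (e k)) s ->
  is_usum P f s.
Proof.
  intros Hinj HP Hsup Habs Hs eps.
  assert (He2 : 0 < eps / 2) by (pose proof (cond_pos eps); lra).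
  destruct Habs as [A HA].
  assert (HA' : is_lim_seq (sum_n (fun k => Cmod (f (e k)))) A) by exact HA.
  assert (HL : forall n, sum_n (fun k => Cmod (f (e k))) n <= A).
  { intros n. apply (is_lim_seq_incr_compare _ _ HA'). intros m. rewrite sum_Sn. unfold plus; simpl.
    pose proof (Cmod_ge_0 (f (e (S m)))). lra. }
  destruct (proj2 (is_lim_seq_spec _ _) HA' (mkposreal _ He2)) as [N1 HN1]. simpl in HN1.
  assert (HS : exists N2 : nat, forall n, (N2 <= n)%nat -> Cmod (sum_n (G := C_AbelianMonoid) (fun k => f (e k)) n - s) < eps / 2).
  { assert (Hloc : locally (T := C_UniformSpace) s (fun y => Cmod (y - s) < eps / 2)).
    { apply locallyC. exists (eps / 2)%R. split; [exact He2|auto]. }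
    destruct (Hs _ Hloc) as [N2 HN2]. exists N2. intros n Hn. apply (HN2 n Hn). }
  destruct HS as [N2 HN2]. set (N := max N1 N2).
  exists (map e (seq 0 (S N))). split; [apply NoDup_map_seq, Hinj|]. split.
  { rewrite List.Forall_forall. intros x Hx. apply in_map_iff in Hx. destruct Hx as [k [<- _]]. apply HP. }
  intros l G1 G2 G3.
  (* split [l] into the initial segment and a remainder bounded by the tail of the series *)
  set (l0 := map e (seq 0 (S N))) in *.
  set (l1 := filter (fun x => if in_dec (eq_decC T) x l0 then false else true) l).
  assert (HE : Csum f l = Csum f l0 + Csum f l1).
  { assert (Gen : forall l, NoDup l -> forall l0, NoDup l0 -> incl l0 l ->
      Csum f l = Csum f l0 + Csum f (filter (fun x => if in_dec (eq_decC T) x l0 then false else true) l)).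
    { clear. intros l Hl. induction Hl as [|x l Hx Hl IH]; intros l0 H0 Hi.
      - destruct l0 as [|y l0]; [simpl; ring|]. exfalso. apply (Hi y). left. reflexivity.
      - simpl. destruct (in_dec (eq_decC T) x l0) as [I|I].
        + destruct (in_split x l0 I) as [a [b ->]].
          pose proof (NoDup_remove_1 _ _ _ H0) as Hab. pose proof (NoDup_remove_2 _ _ _ H0) as Hxab.
          rewrite (IH (a ++ b) Hab).
          * rewrite !Csum_app, Csum_cons.
            rewrite (filter_ext_in (fun y => if in_dec (eq_decC T) y (a ++ b) then false else true)
                   (fun y => if in_dec (eq_decC T) y (a ++ x :: b) then false else true)); [ring|].
            intros y Hy. destruct in_dec as [I1|I1], in_dec as [I2|I2]; try reflexivity.
            -- exfalso. apply I2. apply in_app_or in I1. apply in_or_app. destruct I1; [left|right; right]; assumption.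
            -- exfalso. apply I1. apply in_app_or in I2. apply in_or_app. destruct I2 as [I2|[I2|I2]]; auto.
               subst y. contradiction.
          * intros y Hy. destruct (Hi y) as [E|E]; [|subst y; contradiction|exact E].
            apply in_app_or in Hy. apply in_or_app. destruct Hy; [left|right; right]; assumption.
        + rewrite Csum_cons. rewrite (IH l0 H0); [ring|].
          intros y Hy. destruct (Hi y Hy) as [E|E]; [subst y; contradiction|exact E]. }
    apply Gen; [exact G1|apply NoDup_map_seq, Hinj|exact G3]. }
  assert (HR : Rsum (fun x => Cmod (f x)) l1 <= eps / 2).
  { assert (exists M, forall x, In x l -> f x <> 0 -> exists k, (k < M)%nat /\ x = e k) as [M HM].
    { clear - Hsup G2. induction G2 as [|x l Px _ IH].
      - exists O. intros x [].
      - destruct IH as [M HM]. destruct (excluded_middle_informative (f x = 0)) as [E|E].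
        + exists M. intros y [<-|Hy] Ey; [contradiction|auto].
        + destruct (Hsup x Px E) as [k Hk]. exists (max M (S k)). intros y [<-|Hy] Ey.
          * exists k. split; [lia|exact Hk].
          * destruct (HM y Hy Ey) as [j [J1 J2]]. exists j. split; [lia|exact J2]. }
    set (M' := max M N).
    assert (Hl1 : Rsum (fun x => Cmod (f x)) (l0 ++ l1) <= Rsum (fun x => Cmod (f x)) (map e (seq 0 (S M')))).
    { apply Rsum_incl.
      - intros x. apply Cmod_ge_0.
      - apply NoDup_app; [apply NoDup_map_seq, Hinj|apply NoDup_filter, G1|].
        intros x Hx Hx1. apply filter_In in Hx1. destruct Hx1 as [_ Hx1]. destruct in_dec; [discriminate|contradiction].
      - intros x Hx Ex. apply in_map_iff. apply in_app_or in Hx. destruct Hx as [Hx|Hx].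
        + apply in_map_iff in Hx. destruct Hx as [k [<- Hk]]. exists k. split; [reflexivity|].
          apply in_seq in Hk. apply in_seq. lia.
        + apply filter_In in Hx. destruct Hx as [Hx _].
          destruct (HM x Hx) as [k [K1 K2]]; [intros E; rewrite E, Cmod_0 in Ex; lra|].
          exists k. split; [auto|]. apply in_seq. lia. }
    rewrite Rsum_app in Hl1. unfold l0 in Hl1. rewrite !Rsum_map_seq in Hl1.
    specialize (HN1 N ltac:(lia)). apply Rabs_lt_between in HN1. specialize (HL M'). lra. }
  rewrite HE. unfold l0. rewrite Csum_map_seq.
  replace (sum_n (G := C_AbelianMonoid) (fun k => f (e k)) N + Csum f l1 - s) with
    ((sum_n (G := C_AbelianMonoid) (fun k => f (e k)) N - s) + Csum f l1) by ring.
  eapply Rle_lt_trans; [apply Cmod_triangle|].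
  pose proof (HN2 N ltac:(lia)).
  pose proof (Cmod_Csum_le f (fun x => Cmod (f x)) l1 (fun x _ => Rle_refl _)). lra.
Qed.

(** * Logarithmic derivatives and Jensen's inequality *)

Lemma log_derive_mult f g z : dif f z -> dif g z -> f z <> 0 -> g z <> 0 ->
  log_derive (fun w => f w * g w) z = log_derive f z + log_derive g z.
Proof.
  intros Hf Hg Nf Ng. unfold log_derive.
  rewrite (C_derive_Cd _ _ _ (Cd_mult _ _ _ _ _ (dif_C_derive _ _ Hf) (dif_C_derive _ _ Hg))).
  field. split; assumption.
Qed.

Lemma log_derive_ext_loc f g z : locally z (fun w => f w = g w) -> dif f z ->
  log_derive f z = log_derive g z.
Proof.
  intros H Hf. unfold log_derive.
  rewrite (C_derive_Cd g z (C_derive f z)).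
  - rewrite (locally_singleton _ _ H). reflexivity.
  - eapply Cd_ext_loc; [exact H|apply dif_C_derive, Hf].
Qed.

Lemma log_derive_Cd f z l : Cd f z l -> log_derive f z = l / f z.
Proof. intros H. unfold log_derive. rewrite (C_derive_Cd _ _ _ H). reflexivity. Qed.

Lemma log_derive_pow (n : nat) (s a : C) : s <> a -> log_derive (fun s => (s - a) ^ n) s = RtoC (INR n) / (s - a).
Proof.
  intros H. pose proof (Cminus_eq_contra _ _ H) as H1.
  assert (HC : Cd (fun s => s - a) s (1 - 0)) by (apply Cd_minus; [apply Cd_id|apply Cd_const]).
  rewrite (log_derive_Cd _ _ _ (Cd_pow _ _ _ n HC)).
  destruct n as [|n]; [simpl; unfold Cdiv; ring|]. simpl pred. simpl Cpow. field.
  split; [exact H1|apply Cpow_nz, H1].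
Qed.

Lemma Cprod_cons {T : Type} (f : T -> C) x l : Cprod f (x :: l) = f x * Cprod f l.
Proof. reflexivity. Qed.

Lemma Cprod_neq_0 {T : Type} (f : T -> C) l : (forall x, In x l -> f x <> 0) -> Cprod f l <> 0.
Proof.
  induction l as [|x l IH]; intros H; [exact C1_nz|]. rewrite Cprod_cons. apply Cmult_neq_0.
  - apply H. left. reflexivity.
  - apply IH. intros y Hy. apply H. right. exact Hy.
Qed.

Lemma Cmod_Cprod_le {T : Type} (f g : T -> C) l : (forall x, In x l -> Cmod (f x) <= Cmod (g x)) ->
  Cmod (Cprod f l) <= Cmod (Cprod g l).
Proof.
  induction l as [|x l IH]; intros H; [apply Rle_refl|]. rewrite !Cprod_cons, !Cmod_mult.
  apply Rmult_le_compat; try apply Cmod_ge_0; [apply H; left; reflexivity|].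
  apply IH. intros y Hy. apply H. right. exact Hy.
Qed.

Lemma dif_Cprod {T : Type} (F : T -> C -> C) l z : (forall x, In x l -> dif (F x) z) ->
  dif (fun w => Cprod (fun x => F x w) l) z.
Proof.
  induction l as [|x l IH]; intros H; [apply (dif_const 1)|].
  apply (dif_mult (F x) (fun w => Cprod (fun x => F x w) l)).
  - apply H. left. reflexivity.
  - apply IH. intros y Hy. apply H. right. exact Hy.
Qed.

Lemma log_derive_Cprod {T : Type} (F : T -> C -> C) l z :
  (forall x, In x l -> dif (F x) z /\ F x z <> 0) ->
  log_derive (fun w => Cprod (fun x => F x w) l) z = Csum (fun x => log_derive (F x) z) l.
Proof.
  induction l as [|x l IH]; intros H.
  - simpl. rewrite (log_derive_Cd _ _ _ (Cd_const 1 z)). unfold Cdiv. ring.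
  - rewrite Csum_cons, <- IH by (intros y Hy; apply H; right; exact Hy).
    apply (log_derive_mult (F x) (fun w => Cprod (fun x => F x w) l)).
    + apply H. left. reflexivity.
    + apply dif_Cprod. intros y Hy. apply H. right. exact Hy.
    + apply H. left. reflexivity.
    + apply Cprod_neq_0. intros y Hy. apply H. right. exact Hy.
Qed.

Definition entire_dif (f : C -> C) : Prop := forall z, dif f z.

Lemma entire_locally f z : entire_dif f -> locally z (dif f).
Proof. intros H. apply filter_forall. exact H. Qed.

Definition linprod (l : list C) (z : C) : C := Cprod (fun rho => z - rho) l.

Lemma dif_linprod l z : dif (linprod l) z.
Proof.
  apply (dif_Cprod (fun rho w => w - rho)). intros x _. apply dif_minus; [apply dif_id|apply dif_const].
Qed.

Section Blaschke.
Variables (c : C) (r : R).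
Hypothesis Hr : 0 < r.

(** The linear factor [z - rho] divided by the Blaschke factor of the disc: on the circle it has the
    modulus of [z - rho], while its zero, if any, is the mirror image of [rho] in the circle. *)
Definition blaschke_factor (rho z : C) : C := (RtoC (r * r) - Cconj (rho - c) * (z - c)) / RtoC r.
Definition blaschke (l : list C) (z : C) : C := Cprod (fun rho => blaschke_factor rho z) l.

Lemma RtoCr_neq_0 : RtoC r <> 0.
Proof. intros E. apply RtoC_inj in E. lra. Qed.

Lemma blaschke_factor_circle rho z : Cmod (z - c) = r -> Cmod (blaschke_factor rho z) = Cmod (z - rho).
Proof.
  intros Hz. unfold blaschke_factor. rewrite Cmod_div by exact RtoCr_neq_0.
  assert (E : RtoC (r * r) = (z - c) * Cconj (z - c)).
  { rewrite <- RtoC_Cmod2, Hz. f_equal. ring. }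
  replace (RtoC (r * r) - Cconj (rho - c) * (z - c)) with ((z - c) * Cconj (z - rho)).
  - rewrite Cmod_mult, Hz, Cmod_conj, Cmod_R, Rabs_pos_eq by lra. field. lra.
  - rewrite E, !Cminus_conj. ring.
Qed.

Lemma blaschke_factor_neq_0 rho z : Cmod (rho - c) < r -> Cmod (z - c) <= r -> blaschke_factor rho z <> 0.
Proof.
  intros Hrho Hz E. unfold blaschke_factor in E.
  assert (E2 : RtoC (r * r) = Cconj (rho - c) * (z - c)).
  { apply (proj2 (Ceq_minus _ _)). apply (Cmult_reg_r _ _ (/ RtoC r)).
    - intros E3. apply C1_nz. rewrite <- (Cinv_r (RtoC r)) by exact RtoCr_neq_0. rewrite E3. ring.
    - rewrite Cmult_0_l. exact E. }
  assert (E3 : Cmod (RtoC (r * r)) = Cmod (Cconj (rho - c) * (z - c))) by (rewrite E2; reflexivity).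
  rewrite Cmod_mult, Cmod_conj, Cmod_R, Rabs_pos_eq in E3 by (apply Rmult_le_pos; lra).
  pose proof (Cmod_ge_0 (rho - c)).
  assert (Cmod (rho - c) * Cmod (z - c) <= Cmod (rho - c) * r)%R by (apply Rmult_le_compat_l; lra).
  assert (Cmod (rho - c) * r < r * r)%R by (apply Rmult_lt_compat_r; lra). lra.
Qed.

Lemma blaschke_factor_center rho : blaschke_factor rho c = RtoC r.
Proof.
  unfold blaschke_factor. replace (c - c) with (RtoC 0) by ring. rewrite RtoC_mult. field. exact RtoCr_neq_0.
Qed.

Lemma Cd_blaschke_factor rho z : Cd (blaschke_factor rho) z (- Cconj (rho - c) / RtoC r).
Proof.
  eapply Cd_eq.
  - apply (Cd_mult (fun z => RtoC (r * r) - Cconj (rho - c) * (z - c)) (fun _ => / RtoC r)); [|apply Cd_const].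
    apply Cd_minus; [apply Cd_const|]. apply Cd_scal. apply Cd_minus; [apply Cd_id|apply Cd_const].
  - cfield. exact RtoCr_neq_0.
Qed.

Lemma dif_blaschke l z : dif (blaschke l) z.
Proof.
  apply (dif_Cprod blaschke_factor). intros x _. eexists. apply Cd_blaschke_factor.
Qed.

(* Jensen's inequality: the zeros are moved to the outside by Blaschke factors. *)
Lemma blaschke_bound f g l M : 0 <= M -> entire_dif g -> (forall z, f z = linprod l z * g z) ->
  (forall z, Cmod (z - c) = r -> Cmod (f z) <= M) ->
  forall z, Cmod (z - c) <= r -> Cmod (blaschke l z * g z) <= M.
Proof.
  intros HM Hg Hf HB. apply (max_principle_disc (fun z => blaschke l z * g z)).
  - exact Hr.
  - exact HM.
  - intros z _. apply dif_almost, entire_locally. intros w. apply dif_mult; [apply dif_blaschke|apply Hg].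
  - intros z Hz. eapply Rle_trans; [|apply (HB z Hz)]. rewrite Hf, !Cmod_mult.
    apply Rmult_le_compat_r; [apply Cmod_ge_0|]. apply Cmod_Cprod_le. intros x _.
    right. apply blaschke_factor_circle, Hz.
Qed.

(** At the centre each replaced factor has modulus [r] and each original one at most [r / 2], so
    every zero costs a factor 2 in the bound for [|f c|]. *)
Lemma jensen f g l M : entire_dif g -> (forall z, f z = linprod l z * g z) ->
  (forall z, Cmod (z - c) = r -> Cmod (f z) <= M) ->
  (forall x, In x l -> Cmod (x - c) <= r / 2) ->
  2 ^ length l * Cmod (f c) <= M.
Proof.
  intros Hg Hf HB Hl.
  assert (HM : 0 <= M).
  { eapply Rle_trans; [apply Cmod_ge_0|apply (HB (c + RtoC r))].
    replace (c + RtoC r - c) with (RtoC r) by ring. rewrite Cmod_R, Rabs_pos_eq; lra. }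
  pose proof (blaschke_bound f g l M HM Hg Hf HB c) as H.
  replace (c - c) with (RtoC 0) in H by ring. rewrite Cmod_0 in H. specialize (H ltac:(lra)).
  eapply Rle_trans; [|exact H]. rewrite Hf, !Cmod_mult, <- Rmult_assoc.
  apply Rmult_le_compat_r; [apply Cmod_ge_0|].
  unfold blaschke, linprod. clear - Hl Hr. induction l as [|x l IH]; [simpl; lra|].
  rewrite !Cprod_cons, !Cmod_mult. simpl length.
  rewrite blaschke_factor_center, Cmod_R, Rabs_pos_eq by lra.
  replace (2 ^ S (length l) * (Cmod (c - x) * Cmod (Cprod (fun rho => c - rho)%C l)))%R
    with ((2 * Cmod (c - x)) * (2 ^ length l * Cmod (Cprod (fun rho => c - rho)%C l)))%R by (simpl; ring).
  apply Rmult_le_compat.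
  - pose proof (Cmod_ge_0 (c - x)). lra.
  - apply Rmult_le_pos; [apply pow_le; lra|apply Cmod_ge_0].
  - pose proof (Hl x (or_introl eq_refl)) as Hx. rewrite <- Cmod_opp in Hx.
    replace (- (x - c)) with (c - x) in Hx by ring. lra.
  - apply IH. intros y Hy. apply Hl. right. exact Hy.
Qed.
End Blaschke.

Lemma entire_bounded f c r : entire_dif f -> 0 < r -> exists M, 0 <= M /\ forall z, Cmod (z - c) = r -> Cmod (f z) <= M.
Proof.
  intros Hf Hr.
  destruct (compact_max (fun z => Cmod (z - c) <= r) (fun z => Cmod (f z))
     (fst c - r) (fst c + r) (snd c - r) (snd c + r)) as [p [_ Hp]]; try lra.
  - intros z Hz. pose proof (re_le_Cmod (z - c)) as H1. pose proof (im_le_Cmod (z - c)) as H2.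
    pose proof (Rabs_le_between (Re (z - c)) r) as [A1 _]. pose proof (Rabs_le_between (Im (z - c)) r) as [A2 _].
    specialize (A1 ltac:(lra)). specialize (A2 ltac:(lra)).
    unfold Re, Im in A1, A2. simpl in A1, A2. split; lra.
  - intros z Hz. generalize (locally_gt (fun w => Cmod (w - c)) z r (cts_Cmod_sub c z) ltac:(lra)).
    apply filter_imp. intros w Hw. lra.
  - exists c. replace (c - c) with (RtoC 0) by ring. rewrite Cmod_0. lra.
  - intros z _. apply cts_Cmod, dif_cts, Hf.
  - exists (Cmod (f p)). split; [apply Cmod_ge_0|]. intros z Hz. apply Hp. lra.
Qed.

Lemma entire_quot g z0 : entire_dif g -> g z0 = 0 ->
  exists g2, entire_dif g2 /\ forall z, g z = (z - z0) * g2 z.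
Proof.
  intros Hg H0. pose proof (dif_C_derive g z0 (Hg z0)) as Hd.
  exists (quot g z0 (C_derive g z0)). split.
  - intros z. apply locally_singleton, removable, quot_almost; [exact Hd|].
    apply dif_almost, entire_locally, Hg.
  - intros z. rewrite (quot_eq g z0 (C_derive g z0) z) at 1. rewrite H0. ring.
Qed.

Definition zero_list (f : C -> C) (c : C) (r : R) (l : list C) (g : C -> C) : Prop :=
  List.Forall (fun x => Cmod (x - c) < r) l /\ entire_dif g /\
  (forall z, f z = linprod l z * g z) /\ forall z, Cmod (z - c) < r -> g z <> 0.

Lemma pow2_ge_n n : (INR n <= 2 ^ n)%R.
Proof.
  induction n as [|n IH]; [simpl; lra|]. rewrite S_INR. simpl.
  assert (1 <= 2 ^ n)%R by (apply pow_R1_Rle; lra). lra.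
Qed.

(** Zeros are divided out one at a time. The process stops because [jensen] on the doubled radius,
    where all these zeros lie in the inner half, bounds their number by [M / |f c|]. *)
Lemma zero_list_exists f c r : entire_dif f -> f c <> 0 -> 0 < r -> exists l g, zero_list f c r l g.
Proof.
  intros Hf Hc Hr.
  destruct (entire_bounded f c (2 * r) Hf ltac:(lra)) as [M [HM0 HM]].
  apply Cmod_gt_0 in Hc.
  set (Q := fun n => exists l g, length l = n /\ List.Forall (fun x => Cmod (x - c) < r) l /\
     entire_dif g /\ forall z, f z = linprod l z * g z).
  assert (HQ : forall n, Q n -> INR n <= M / Cmod (f c)).
  { intros n [l [g [Hn [Hl [Hg Hfg]]]]].
    assert (H := jensen c (2 * r) ltac:(lra) f g l M Hg Hfg HM).
    rewrite List.Forall_forall in Hl.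
    specialize (H ltac:(intros x Hx; specialize (Hl x Hx); simpl in Hl; lra)).
    rewrite Hn in H. apply Rle_trans with (2 ^ n)%R; [apply pow2_ge_n|].
    apply Rmult_le_reg_r with (Cmod (f c)); [exact Hc|].
    unfold Rdiv. rewrite Rmult_assoc, Rinv_l by lra. lra. }
  apply NNPP. intros Hn.
  assert (Hall : forall n, Q n).
  { intros n. induction n as [|n [l [g [Hl [Hfl [Hg Hfg]]]]]].
    - exists nil, f. split; [reflexivity|]. split; [constructor|]. split; [exact Hf|].
      intros z. unfold linprod. simpl. ring.
    - assert (Hz : exists z0, Cmod (z0 - c) < r /\ g z0 = 0).
      { apply NNPP. intros Hnz. apply Hn. exists l, g. repeat split; try assumption.
        intros z Hz E. apply Hnz. exists z. auto. }
      destruct Hz as [z0 [Hz0 Ez0]]. destruct (entire_quot g z0 Hg Ez0) as [g2 [Hg2 Eg2]].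
      exists (z0 :: l), g2. split; [simpl; rewrite Hl; reflexivity|].
      split; [constructor; assumption|]. split; [exact Hg2|].
      intros z. rewrite Hfg, Eg2. unfold linprod. rewrite Cprod_cons. ring. }
  destruct (nfloor_ex (M / Cmod (f c))) as [N [_ HN]].
  { apply Rdiv_le_0_compat; lra. }
  specialize (HQ (S N) (Hall _)). rewrite S_INR in HQ. lra.
Qed.

(** * Multiplicities *)

Definition Ceq_dec : forall x y : C, {x = y} + {x <> y} := eq_decC C.

Lemma multiplicity_unique f z0 m n : zero_of_multiplicity f z0 m -> zero_of_multiplicity f z0 n -> m = n.
Proof.
  assert (K : forall m n, (m < n)%nat -> zero_of_multiplicity f z0 m -> zero_of_multiplicity f z0 n -> False).
  { intros i j Hij [_ [g [Hg [Ng Eg]]]] [_ [h [Hh [Nh Eh]]]].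
    apply holomorphic_at_dif in Hg. apply holomorphic_at_dif in Hh.
    apply Ng.
    assert (E : g z0 = (z0 - z0) ^ (j - i) * h z0).
    { apply (cts_eq_off g (fun z => (z - z0) ^ (j - i) * h z)).
      - apply dif_cts, (locally_singleton _ _ Hg).
      - apply cts_mult; [apply cts_pow, cts_minus; [apply cts_id|apply cts_const]|].
        apply dif_cts, (locally_singleton _ _ Hh).
      - unfold locally', within. generalize (filter_and _ _ Eg Eh). apply filter_imp.
        intros z [E1 E2] Hz. rewrite E1 in E2.
        assert (Hp : (z - z0) ^ i <> 0) by (apply Cpow_nz, Cminus_eq_contra, Hz).
        apply (Cmult_reg_r _ _ ((z - z0) ^ i) Hp). rewrite (Cmult_comm (g z)), E2.
        replace j with (i + (j - i))%nat at 1 by lia.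
        assert (EP : forall (a : C) p q, a ^ (p + q) = a ^ p * a ^ q).
        { intros a p q. induction p as [|p IH]; simpl; [ring|]. rewrite IH. ring. }
        rewrite EP. ring. }
    rewrite E. replace (z0 - z0) with (RtoC 0) by ring.
    destruct (j - i)%nat eqn:Ed; [lia|]. simpl. ring. }
  intros H1 H2. destruct (Nat.lt_trichotomy m n) as [H|[H|H]]; [|exact H|];
  exfalso; eapply K; eassumption.
Qed.

Lemma linprod_split l z0 : exists h, (forall z, dif h z) /\ h z0 <> 0 /\
  forall z, linprod l z = (z - z0) ^ (count_occ Ceq_dec l z0) * h z.
Proof.
  induction l as [|x l [h [H1 [H2 H3]]]].
  - exists (fun _ => 1). split; [intros z; apply dif_const|]. split; [exact C1_nz|].
    intros z. unfold linprod. simpl. ring.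
  - destruct (Ceq_dec x z0) as [->|E].
    + exists h. split; [exact H1|]. split; [exact H2|]. intros z. rewrite count_occ_cons_eq by reflexivity.
      unfold linprod in *. rewrite Cprod_cons, H3. simpl. ring.
    + exists (fun z => (z - x) * h z). split; [|split].
      * intros z. apply dif_mult; [apply dif_minus; [apply dif_id|apply dif_const]|apply H1].
      * apply Cmult_neq_0; [apply Cminus_eq_contra; congruence|exact H2].
      * intros z. rewrite count_occ_cons_neq by exact E.
        unfold linprod in *. rewrite Cprod_cons, H3. ring.
Qed.

Lemma zero_list_multiplicity f c r l g z0 : zero_list f c r l g -> Cmod (z0 - c) < r ->
  (1 <= count_occ Ceq_dec l z0)%nat -> zero_of_multiplicity f z0 (count_occ Ceq_dec l z0).
Proof.
  intros [_ [Hg [Hfg Ng]]] Hz Hc. split; [exact Hc|].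
  destruct (linprod_split l z0) as [h [H1 [H2 H3]]].
  exists (fun z => h z * g z). split; [|split].
  - apply holomorphic_at_dif, filter_forall. intros z. apply dif_mult; [apply H1|apply Hg].
  - apply Cmult_neq_0; [exact H2|apply Ng, Hz].
  - apply filter_forall. intros z. rewrite Hfg, H3. ring.
Qed.

Lemma multiplicity_zero f z0 m : zero_of_multiplicity f z0 m -> f z0 = 0.
Proof.
  intros [Hm [g [_ [_ H]]]]. apply locally_singleton in H. rewrite H.
  replace (z0 - z0) with (RtoC 0) by ring. destruct m; [lia|]. simpl. ring.
Qed.

Lemma count_occ_multiplicity f c r l g z0 m : zero_list f c r l g -> Cmod (z0 - c) < r ->
  zero_of_multiplicity f z0 m -> m = count_occ Ceq_dec l z0.
Proof.
  intros Hl Hz Hm. destruct (Nat.eq_0_gt_0_cases (count_occ Ceq_dec l z0)) as [E|E].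
  - exfalso. apply multiplicity_zero in Hm. destruct Hl as [_ [_ [Hfg Ng]]].
    rewrite Hfg in Hm. revert Hm. apply Cmult_neq_0; [|apply Ng, Hz].
    apply Cprod_neq_0. intros x Hx. apply Cminus_eq_contra. intros ->.
    apply (count_occ_not_In Ceq_dec l x) in E. contradiction.
  - eapply multiplicity_unique; [exact Hm|]. eapply zero_list_multiplicity; eassumption.
Qed.

(* Zeros of [f] repeated according to multiplicity, as in [nontrivial_zeros]. *)
Definition zpairs (f : C -> C) (p : C * nat) : Prop :=
  exists m : nat, zero_of_multiplicity f (fst p) m /\ (snd p < m)%nat.

(** The second component counts the occurrences still to come, so the copies of a zero of
    multiplicity [n] receive the labels [n - 1] down to 0. A list with repetitions becomes a
    duplicate-free list indexed as in [nontrivial_zeros]. *)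
Fixpoint number_list (l : list C) : list (C * nat) :=
  match l with
  | nil => nil
  | x :: l => (x, count_occ Ceq_dec l x) :: number_list l
  end.

Lemma In_number_list l p : In p (number_list l) <-> (snd p < count_occ Ceq_dec l (fst p))%nat.
Proof.
  destruct p as [z k]. induction l as [|x l IH].
  - simpl. split; [intros []|lia].
  - cbn [number_list fst snd In]. simpl in IH. rewrite IH. destruct (Ceq_dec x z) as [->|E].
    + rewrite count_occ_cons_eq by reflexivity. split.
      * intros [H|H]; [inversion H; lia|lia].
      * intros H. destruct (Nat.eq_dec k (count_occ Ceq_dec l z)) as [->|]; [left; reflexivity|right; lia].
    + rewrite count_occ_cons_neq by exact E. split; [|auto].
      intros [H|H]; [inversion H; contradiction|exact H].
Qed.

Lemma NoDup_number_list l : NoDup (number_list l).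
Proof.
  induction l as [|x l IH]; [constructor|]. simpl. constructor; [|exact IH].
  rewrite In_number_list. simpl. lia.
Qed.

Lemma Csum_number_list (F : C -> C) l : Csum (fun p => F (fst p)) (number_list l) = Csum F l.
Proof. induction l as [|x l IH]; [reflexivity|]. cbn [number_list]. rewrite !Csum_cons, IH. reflexivity. Qed.

Lemma zero_list_In f c r l g p : zero_list f c r l g -> zpairs f p -> Cmod (fst p - c) < r -> In p (number_list l).
Proof.
  intros Hl [m [Hm Hk]] Hp. apply In_number_list. rewrite <- (count_occ_multiplicity f c r l g (fst p) m); assumption.
Qed.

Lemma zero_list_Forall f c r l g : zero_list f c r l g -> List.Forall (zpairs f) (number_list l).
Proof.
  intros Hl. rewrite List.Forall_forall. intros p Hp. apply In_number_list in Hp.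
  exists (count_occ Ceq_dec l (fst p)). split; [|exact Hp].
  eapply zero_list_multiplicity; [exact Hl| |lia].
  destruct Hl as [Hl _]. rewrite List.Forall_forall in Hl. apply Hl.
  apply (count_occ_In Ceq_dec). lia.
Qed.

(** * The partial fraction expansion *)

(** The exponent [o(|z|^2)] is what partial fractions with a single subtraction consume: their error
    on a disc of radius [r] is of the order of [log max |f|] divided by [r^2]. *)
Definition small_growth (f : C -> C) : Prop :=
  forall eps, 0 < eps -> exists K, forall z, Cmod (f z) <= K * exp (eps * Cmod z ^ 2).

(** The shift of centre doubles the radius at most, which turns [eps / 8] into [eps / 2]; the other
    half of [eps] absorbs the constant for large [r]. *)
Lemma small_growth_disc f c eps : small_growth f -> 0 < eps -> exists R0, 0 < R0 /\
  forall r z, R0 <= r -> Cmod (z - c) <= r -> Cmod (f z) <= exp (eps * r ^ 2).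
Proof.
  intros Hf He. destruct (Hf (eps / 8)%R) as [K HK]; [lra|]. pose proof (Cmod_ge_0 c) as Hc0.
  set (K' := Rmax K 1). assert (HK1 : 1 <= K') by apply Rmax_r.
  assert (HlK : 0 <= ln K') by (rewrite <- ln_1; destruct HK1 as [H|H]; [left; apply ln_increasing; lra|rewrite H; lra]).
  set (R0 := (1 + Cmod c + 2 * ln K' / eps)%R).
  assert (Hle : 0 <= 2 * ln K' / eps) by (apply Rdiv_le_0_compat; lra).
  exists R0. split; [unfold R0; lra|]. intros r z Hr Hz.
  eapply Rle_trans; [apply HK|].
  apply Rle_trans with (K' * exp (eps / 8 * Cmod z ^ 2))%R.
  { apply Rmult_le_compat_r; [left; apply exp_pos|apply Rmax_l]. }
  rewrite <- (exp_ln K') at 1 by lra. rewrite <- exp_plus.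
  assert (Hzz : Cmod z <= 2 * r).
  { replace z with ((z - c) + c) by ring. eapply Rle_trans; [apply Cmod_triangle|]. unfold R0 in Hr. lra. }
  assert (H1 : (eps / 8 * Cmod z ^ 2 <= eps / 2 * r ^ 2)%R).
  { replace (eps / 2 * r ^ 2)%R with (eps / 8 * (2 * r) ^ 2)%R by field.
    apply Rmult_le_compat_l; [lra|]. apply pow_incr. split; [apply Cmod_ge_0|exact Hzz]. }
  assert (H2 : (ln K' <= eps / 2 * r ^ 2)%R).
  { assert (Hr1 : 1 <= r) by (unfold R0 in Hr; lra).
    assert (Hr2 : 2 * ln K' / eps <= r) by (unfold R0 in Hr; lra).
    apply Rle_trans with (eps / 2 * r)%R.
    - replace (ln K') with (eps / 2 * (2 * ln K' / eps))%R at 1 by (field; lra). apply Rmult_le_compat_l; lra.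
    - apply Rmult_le_compat_l; [lra|]. simpl. rewrite Rmult_1_r. rewrite <- (Rmult_1_r r) at 1. apply Rmult_le_compat_l; lra. }
  assert (H3 : (ln K' + eps / 8 * Cmod z ^ 2 <= eps * r ^ 2)%R) by lra.
  destruct H3 as [H3|H3]; [left; apply exp_increasing, H3|right; rewrite H3; reflexivity].
Qed.

Lemma exp_le (x y : R) : x <= y -> exp x <= exp y.
Proof. intros [H|H]; [left; apply exp_increasing, H|rewrite H; lra]. Qed.

Lemma exp_half_le_2 : exp (/ 2) <= 2.
Proof.
  pose proof exp_le_3. assert (E : (exp (/ 2) * exp (/ 2) = exp 1)%R) by (rewrite <- exp_plus; f_equal; field).
  pose proof (exp_pos (/ 2)). apply Rnot_lt_le. intros Hlt.
  assert (2 * 2 < exp (/ 2) * exp (/ 2))%R by (apply Rmult_le_0_lt_compat; lra). lra.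
Qed.

(** Converts Jensen's [2^n <= exp Y] into [n <= 2 Y]. *)
Lemma exp_half_pow n : exp (INR n / 2) <= 2 ^ n.
Proof.
  induction n as [|n IH]; [simpl; replace (0 / 2)%R with 0%R by field; rewrite exp_0; lra|].
  rewrite S_INR. replace ((INR n + 1) / 2)%R with (/ 2 + INR n / 2)%R by field. rewrite exp_plus. simpl.
  apply Rmult_le_compat; [left; apply exp_pos|left; apply exp_pos|apply exp_half_le_2|exact IH].
Qed.

Definition pf_term (c s rho : C) : C := / (s - rho) - / (c - rho).

Lemma log_derive_linprod l z : (forall x, In x l -> z <> x) ->
  log_derive (linprod l) z = Csum (fun rho => / (z - rho)) l.
Proof.
  intros H. unfold linprod. rewrite (log_derive_Cprod (fun rho w => w - rho)).
  - apply Csum_ext. intros x Hx.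
    assert (HC : Cd (fun w => w - x) z (1 - 0)) by (apply Cd_minus; [apply Cd_id|apply Cd_const]).
    rewrite (log_derive_Cd _ _ _ HC). field. apply Cminus_eq_contra, H, Hx.
  - intros x Hx. split; [apply dif_minus; [apply dif_id|apply dif_const]|apply Cminus_eq_contra, H, Hx].
Qed.

Lemma Csum_minus {T : Type} (f g : T -> C) l : Csum (fun x => f x - g x) l = Csum f l - Csum g l.
Proof. induction l as [|x l IH]; [simpl; ring|]. rewrite !Csum_cons, IH. ring. Qed.

Lemma zero_list_neq f c r l g s : zero_list f c r l g -> f s <> 0 -> g s <> 0 /\ forall x, In x l -> s <> x.
Proof.
  intros [_ [_ [Hfg _]]] Hs. split.
  - intros E. apply Hs. rewrite Hfg, E. ring.
  - intros x Hx ->. apply Hs. rewrite Hfg. unfold linprod.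
    assert (E : Cprod (fun rho => x - rho) l = 0); [|rewrite E; ring].
    clear - Hx. induction l as [|y l IH]; [destruct Hx|]. rewrite Cprod_cons. destruct Hx as [->|Hx].
    + replace (x - x) with (RtoC 0) by ring. ring.
    + rewrite IH by exact Hx. ring.
Qed.

(** Replacing the zeros in the disc by Blaschke factors gives a zero-free [G] with the bound of [f]
    and with [|G c| >= |f c|]. Its logarithm obeys [borel_caratheodory], and [G'/G] differs from
    [g'/g] only by logarithmic derivatives of Blaschke factors, which have no poles in the disc. *)
Lemma pf_estimate f c r l g s Y : zero_list f c r l g -> 0 < r -> f c <> 0 -> f s <> 0 ->
  Cmod (s - c) <= r / 4 ->
  (forall z, Cmod (z - c) <= r -> Cmod (f z) <= exp Y * Cmod (f c)) ->
  Cmod (log_derive f s - log_derive f c - Csum (pf_term c s) l)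
    <= (80 * Y + 2 * INR (length l)) * Cmod (s - c) / r ^ 2.
Proof.
  intros Hl Hr Hc Hs Hsc HM.
  destruct (zero_list_neq f c r l g s Hl Hs) as [Gs Ls].
  destruct (zero_list_neq f c r l g c Hl Hc) as [Gc Lc].
  pose proof Hl as [Hlr [Hg [Hfg Ng]]]. rewrite List.Forall_forall in Hlr.
  pose proof Hc as Hc'. apply Cmod_gt_0 in Hc'.
  set (w := s - c) in *. pose proof (Cmod_ge_0 w) as Hw0.
  set (G := fun z => blaschke c r l z * g z).
  assert (HG : entire_dif G) by (intros z; apply dif_mult; [apply dif_blaschke, Hr|apply Hg]).
  assert (HB0 : forall z, Cmod (z - c) <= r -> blaschke c r l z <> 0).
  { intros z Hz. apply Cprod_neq_0. intros x Hx. apply blaschke_factor_neq_0; [exact Hr|apply Hlr, Hx|exact Hz]. }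
  destruct (log_disc G c r Hr) as [H [H0 [HH HE]]].
  { intros z _. apply entire_locally, HG. }
  { intros z Hz. apply Cmult_neq_0; [apply HB0; lra|apply Ng, Hz]. }
  assert (HGM : forall z, Cmod (z - c) <= r -> Cmod (G z) <= exp Y * Cmod (f c)).
  { apply (blaschke_bound c r Hr f g l); [|exact Hg|exact Hfg|intros z Hz; apply HM; lra].
    apply Rmult_le_pos; [left; apply exp_pos|lra]. }
  assert (HGc : Cmod (f c) <= Cmod (G c)).
  { unfold G. rewrite Hfg, !Cmod_mult. apply Rmult_le_compat_r; [apply Cmod_ge_0|].
    apply Cmod_Cprod_le. intros x Hx. rewrite blaschke_factor_center by exact Hr.
    rewrite Cmod_R, Rabs_pos_eq by lra. rewrite <- Cmod_opp. replace (- (c - x)) with (x - c) by ring.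
    specialize (Hlr x Hx). simpl in Hlr. lra. }
  assert (HRe : forall z, Cmod (z - c) = (r / 2)%R -> Re (H z) <= Y).
  { intros z Hz. assert (Hz1 : Cmod (z - c) < r) by lra. specialize (HE z Hz1).
    specialize (HGM z ltac:(lra)). rewrite HE, Cmod_mult, Cmod_Cexp in HGM.
    assert (Hle : exp (Re (H z)) <= exp Y).
    { apply Rmult_le_reg_l with (Cmod (f c)); [exact Hc'|].
      eapply Rle_trans; [|rewrite Rmult_comm; exact HGM].
      apply Rmult_le_compat_r; [left; apply exp_pos|exact HGc]. }
    apply Rnot_lt_le. intros Hlt. apply exp_increasing in Hlt. lra. }
  assert (Hsr : Cmod (s - c) < r) by (fold w; lra).
  assert (Hcr : Cmod (c - c) < r) by (replace (c - c) with (RtoC 0) by ring; rewrite Cmod_0; exact Hr).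
  (* Applied on radius [r / 2], inside the open disc where [H] exists; [s] lies within [r / 4], half
     of that. The constant 20 thus becomes 80. *)
  assert (HBC : Cmod (C_derive H s - C_derive H c) <= 20 * Y * Cmod (s - c) / (r / 2) ^ 2).
  { apply borel_caratheodory.
    - lra.
    - intros z Hz. generalize (locally_lt (fun w => Cmod (w - c)) z r (cts_Cmod_sub c z) ltac:(lra)).
      apply filter_imp. intros y Hy. eexists. apply HH, Hy.
    - exact H0.
    - exact HRe.
    - fold w. lra. }
  rewrite (C_derive_Cd _ _ _ (HH s Hsr)), (C_derive_Cd _ _ _ (HH c Hcr)) in HBC.
  change (C_derive G s / G s) with (log_derive G s) in HBC.
  change (C_derive G c / G c) with (log_derive G c) in HBC.
  set (bf := fun x z => - Cconj (x - c) / RtoC r / blaschke_factor c r x z).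
  assert (EG : forall z, Cmod (z - c) < r -> g z <> 0 -> log_derive G z = Csum (fun x => bf x z) l + log_derive g z).
  { intros z Hz Hgz. unfold G. rewrite log_derive_mult; [|apply dif_blaschke, Hr|apply Hg|apply HB0; lra|exact Hgz].
    f_equal. unfold blaschke. rewrite (log_derive_Cprod (blaschke_factor c r)).
    - apply Csum_ext. intros x Hx. apply log_derive_Cd, Cd_blaschke_factor, Hr.
    - intros x Hx. split; [eexists; apply Cd_blaschke_factor, Hr|].
      apply blaschke_factor_neq_0; [exact Hr|apply Hlr, Hx|lra]. }
  assert (Ef : forall z, g z <> 0 -> (forall x, In x l -> z <> x) ->
     log_derive f z = Csum (fun rho => / (z - rho)) l + log_derive g z).
  { intros z Hgz Hlz. rewrite <- log_derive_linprod by exact Hlz.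
    rewrite <- log_derive_mult; [|apply dif_linprod|apply Hg| |exact Hgz].
    - apply log_derive_ext_loc; [apply filter_forall; exact Hfg|].
      apply dif_ext_loc with (fun z => linprod l z * g z).
      + apply filter_forall. intros y. symmetry. apply Hfg.
      + apply dif_mult; [apply dif_linprod|apply Hg].
    - apply Cprod_neq_0. intros x Hx. apply Cminus_eq_contra, Hlz, Hx. }
  rewrite (EG s Hsr Gs), (EG c Hcr Gc) in HBC. rewrite (Ef s Gs Ls), (Ef c Gc Lc).
  unfold pf_term. rewrite Csum_minus.
  set (S1 := Csum (fun x => bf x s) l) in *. set (S2 := Csum (fun x => bf x c) l) in *.
  match goal with |- Cmod ?X <= _ => replace X with
    ((S1 + log_derive g s - (S2 + log_derive g c)) - (S1 - S2)) by ring end.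
  unfold Cminus at 1. eapply Rle_trans; [apply Cmod_triangle|]. rewrite Cmod_opp.
  (* For [a = x - c], the difference of the two logarithmic derivatives is
     [- (conj a)^2 w / (r^2 (r^2 - conj a w))], with [|a| < r] and [|r^2 - conj a w| >= r^2 / 2]. *)
  assert (HS : Cmod (S1 - S2) <= 2 * INR (length l) * Cmod w / r ^ 2).
  { unfold S1, S2. rewrite <- Csum_minus.
    eapply Rle_trans; [apply (Cmod_Csum_le _ (fun _ => (2 * Cmod w / r ^ 2)%R))|].
    - intros x Hx. unfold bf. rewrite blaschke_factor_center by exact Hr.
      specialize (Hlr x Hx). simpl in Hlr.
      pose proof (blaschke_factor_neq_0 c r Hr x s Hlr ltac:(lra)) as Hbn.
      unfold blaschke_factor in Hbn |- *. fold w in Hbn |- *. set (a := x - c) in *.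
      assert (HR := RtoCr_neq_0 r Hr).
      assert (Hd : RtoC (r * r) - Cconj a * w <> 0).
      { intros E. apply Hbn. rewrite E. unfold Cdiv. ring. }
      rewrite RtoC_mult in *.
      replace (- Cconj a / RtoC r / ((RtoC r * RtoC r - Cconj a * w) / RtoC r) - - Cconj a / RtoC r / RtoC r)
        with (- (Cconj a * Cconj a * w) * (/ (RtoC r * RtoC r - Cconj a * w) * (/ RtoC r * / RtoC r)))
        by (field; split; assumption).
      rewrite !Cmod_mult, Cmod_opp, !Cmod_mult, Cmod_conj.
      pose proof (Cmod_ge_0 a) as Ha0.
      assert (Hden : Cmod (/ (RtoC r * RtoC r - Cconj a * w)) <= / (r * r / 2)).
      { apply Cmod_inv_le; [apply Rdiv_lt_0_compat; [apply Rmult_lt_0_compat; lra|lra]|].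
        pose proof (Cmod_triangle (RtoC r * RtoC r - Cconj a * w) (Cconj a * w)) as Ht.
        replace (RtoC r * RtoC r - Cconj a * w + Cconj a * w) with (RtoC r * RtoC r) in Ht by ring.
        rewrite !Cmod_mult, Cmod_conj, Cmod_R, Rabs_pos_eq in Ht by lra.
        assert (Cmod a * Cmod w <= r * (r / 2))%R by (apply Rmult_le_compat; lra). lra. }
      assert (Hri : Cmod (/ RtoC r) = (/ r)%R) by (rewrite Cmod_inv, Cmod_R, Rabs_pos_eq by (assumption || lra); reflexivity).
      rewrite Hri.
      assert (Hir : 0 < / r) by (apply Rinv_0_lt_compat, Hr).
      replace (2 * Cmod w / r ^ 2)%R with (r * r * Cmod w * (/ (r * r / 2) * (/ r * / r)))%R by (field; lra).
      apply Rmult_le_compat.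
      + repeat apply Rmult_le_pos; lra.
      + repeat apply Rmult_le_pos; try lra. apply Cmod_ge_0.
      + apply Rmult_le_compat_r; [lra|]. apply Rmult_le_compat; lra.
      + apply Rmult_le_compat_r; [apply Rmult_le_pos; lra|exact Hden].
    - rewrite Rsum_const. right. field. lra. }
  fold w in HBC.
  replace ((80 * Y + 2 * INR (length l)) * Cmod w / r ^ 2)%R with
    (20 * Y * Cmod w / (r / 2) ^ 2 + 2 * INR (length l) * Cmod w / r ^ 2)%R by (field; lra).
  apply Rplus_le_compat; assumption.
Qed.

Lemma pf_limit f c s : entire_dif f -> small_growth f -> f c <> 0 -> f s <> 0 ->
  forall eps, 0 < eps -> exists R0, 0 < R0 /\ forall r l g, R0 <= r -> zero_list f c r l g ->
    Cmod (log_derive f s - log_derive f c - Csum (pf_term c s) l) <= eps.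
Proof.
  intros Hf Hgr Hc Hs eps He. pose proof Hc as Hc'. apply Cmod_gt_0 in Hc'.
  pose proof (Cmod_ge_0 (s - c)) as Hw0.
  (* [pf_estimate] with [Y = e r^2] and at most [2 e r^2] zeros gives [(80 + 4) e |s - c|]; the 400
     leaves room. *)
  set (e := (eps / (400 * (Cmod (s - c) + 1)))%R).
  assert (He0 : 0 < e) by (apply Rdiv_lt_0_compat; lra).
  destruct (small_growth_disc f c (e / 8) Hgr ltac:(lra)) as [R1 [HR1 HM]].
  set (R2 := (Rabs (ln (Cmod (f c))) * (8 / e) + 1)%R).
  assert (HR2 : 1 <= R2).
  { unfold R2. assert (0 <= Rabs (ln (Cmod (f c))) * (8 / e))%R; [|lra].
    apply Rmult_le_pos; [apply Rabs_pos|]. left. apply Rdiv_lt_0_compat; lra. }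
  exists (R1 + R2 + 4 * Cmod (s - c))%R. split; [lra|]. intros r l g Hr Hl.
  assert (Hr1 : R1 <= r) by lra. assert (Hr2 : R2 <= r) by lra. assert (Hr4 : Cmod (s - c) <= r / 4) by lra.
  assert (Hr0 : 0 < r) by lra.
  assert (Hrr : r <= r ^ 2) by (simpl; rewrite Rmult_1_r; rewrite <- (Rmult_1_r r) at 1; apply Rmult_le_compat_l; lra).
  assert (Hln : - ln (Cmod (f c)) <= e / 8 * r ^ 2).
  { eapply Rle_trans; [|apply Rmult_le_compat_l; [lra|exact Hrr]].
    apply Rle_trans with (e / 8 * (Rabs (ln (Cmod (f c))) * (8 / e)))%R.
    - replace (e / 8 * (Rabs (ln (Cmod (f c))) * (8 / e)))%R with (Rabs (ln (Cmod (f c)))) by (field; lra).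
      rewrite <- Rabs_Ropp. apply Rle_abs.
    - apply Rmult_le_compat_l; [lra|]. unfold R2 in Hr2. lra. }
  (* The radius is [2 r] because [jensen] counts zeros in half the radius; [pf_estimate] uses the
     part within [r]. *)
  assert (HY : forall z, Cmod (z - c) <= 2 * r -> Cmod (f z) <= exp (e * r ^ 2) * Cmod (f c)).
  { intros z Hz. eapply Rle_trans; [apply (HM (2 * r)%R z); lra|].
    rewrite <- (exp_ln (Cmod (f c))) at 1 by exact Hc'. rewrite <- exp_plus. apply exp_le.
    replace (e / 8 * (2 * r) ^ 2)%R with (e / 2 * r ^ 2)%R by field.
    assert (0 <= e * r ^ 2)%R by (apply Rmult_le_pos; lra). lra. }
  assert (Hn : INR (length l) <= 2 * (e * r ^ 2)).
  { pose proof Hl as [Hlr [Hg [Hfg Ng]]]. rewrite List.Forall_forall in Hlr.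
    assert (HJ := jensen c (2 * r) ltac:(lra) f g l _ Hg Hfg (fun z Hz => HY z (Req_le _ _ Hz))).
    specialize (HJ ltac:(intros x Hx; specialize (Hlr x Hx); simpl in Hlr; lra)).
    apply Rmult_le_reg_r in HJ; [|exact Hc'].
    pose proof (exp_half_pow (length l)) as HE.
    apply Rnot_lt_le. intros Hlt. assert (Hlt2 : (e * r ^ 2 < INR (length l) / 2)%R) by lra.
    apply exp_increasing in Hlt2. lra. }
  eapply Rle_trans; [apply (pf_estimate f c r l g s (e * r ^ 2)); try assumption|].
  { intros z Hz. apply HY. lra. }
  assert (Hr20 : 0 < r ^ 2) by lra.
  apply Rle_trans with ((84 * (e * r ^ 2)) * Cmod (s - c) / r ^ 2)%R.
  - apply Rmult_le_compat_r; [left; apply Rinv_0_lt_compat, Hr20|].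
    apply Rmult_le_compat_r; [exact Hw0|]. lra.
  - replace (84 * (e * r ^ 2) * Cmod (s - c) / r ^ 2)%R with (84 * e * Cmod (s - c))%R by (field; lra).
    unfold e. apply Rle_trans with (84 * (eps / (400 * (Cmod (s - c) + 1))) * (Cmod (s - c) + 1))%R.
    + apply Rmult_le_compat_l; [|lra]. fold e. lra.
    + replace (84 * (eps / (400 * (Cmod (s - c) + 1))) * (Cmod (s - c) + 1))%R with (84 / 400 * eps)%R by (field; lra). lra.
Qed.

Lemma finite_in_disc c (l0 : list (C * nat)) : exists R0, forall r, R0 <= r -> forall p, In p l0 -> Cmod (fst p - c) < r.
Proof.
  induction l0 as [|p l0 [R0 IH]].
  - exists 0%R. intros r _ p [].
  - exists (Rmax R0 (Cmod (fst p - c) + 1)). intros r Hr q [<-|Hq].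
    + pose proof (Rmax_r R0 (Cmod (fst p - c) + 1)). lra.
    + apply IH; [|exact Hq]. pose proof (Rmax_l R0 (Cmod (fst p - c) + 1)). lra.
Qed.

(** Discs provide only some of the finite sums. Since every finite set of zeros lies in a large
    disc, these sums are cofinal, which suffices once the unordered sum is known to converge or its
    terms to have a sign. *)
Lemma exhausting_list f c s (l0 : list (C * nat)) : entire_dif f -> small_growth f -> f c <> 0 -> f s <> 0 ->
  List.Forall (zpairs f) l0 -> forall eps, 0 < eps ->
  exists l, NoDup l /\ List.Forall (zpairs f) l /\ incl l0 l /\
    Cmod (log_derive f s - log_derive f c - Csum (fun p => pf_term c s (fst p)) l) <= eps.
Proof.
  intros Hf Hgr Hc Hs Hl0 eps He. destruct (pf_limit f c s Hf Hgr Hc Hs eps He) as [R1 [HR1 H1]].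
  destruct (finite_in_disc c l0) as [R2 HR2]. set (r := Rmax R1 R2).
  assert (Hr1 : R1 <= r) by apply Rmax_l. assert (Hr2 : R2 <= r) by apply Rmax_r.
  destruct (zero_list_exists f c r Hf Hc ltac:(lra)) as [l [g Hl]].
  exists (number_list l). split; [apply NoDup_number_list|]. split; [eapply zero_list_Forall, Hl|]. split.
  - intros p Hp. eapply zero_list_In; [exact Hl| |apply (HR2 r Hr2 p Hp)].
    rewrite List.Forall_forall in Hl0. apply Hl0, Hp.
  - rewrite Csum_number_list. apply (H1 r l g Hr1 Hl).
Qed.

(** Summability is kept as a hypothesis: the approximation by discs identifies the value of the
    unordered sum, while its existence comes from positivity. *)
Lemma partial_fraction_usum f c s : entire_dif f -> small_growth f -> f c <> 0 -> f s <> 0 ->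
  summable (zpairs f) (fun p => pf_term c s (fst p)) ->
  is_usum (zpairs f) (fun p => pf_term c s (fst p)) (log_derive f s - log_derive f c).
Proof.
  intros Hf Hgr Hc Hs [S HS].
  replace (log_derive f s - log_derive f c) with S; [exact HS|].
  apply (proj2 (Ceq_minus _ _)). apply Cmod_eq_0. apply Rle_antisym; [|apply Cmod_ge_0].
  apply le_epsilon. intros e He. rewrite Rplus_0_l. assert (He2 : 0 < e / 2) by lra.
  destruct (HS (mkposreal _ He2)) as [l0 [A [B D]]].
  destruct (exhausting_list f c s l0 Hf Hgr Hc Hs B (e / 2)%R He2) as [l [L1 [L2 [L3 L4]]]].
  specialize (D l L1 L2 L3). simpl in D.
  set (X := Csum (fun p => pf_term c s (fst p)) l) in *.
  replace (S - (log_derive f s - log_derive f c)) with (- (X - S) + - (log_derive f s - log_derive f c - X)) by ring.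
  eapply Rle_trans; [apply Cmod_triangle|]. rewrite !Cmod_opp. lra.
Qed.

(* Positivity of the real parts at a single pair of points gives absolute convergence. *)
Lemma partial_fraction_bounded f c s kappa : entire_dif f -> small_growth f -> f c <> 0 -> f s <> 0 ->
  0 < kappa -> (forall p, zpairs f p -> kappa * Cmod (pf_term c s (fst p)) <= - Re (pf_term c s (fst p))) ->
  exists B, forall l, NoDup l -> List.Forall (zpairs f) l -> Rsum (fun p => Cmod (pf_term c s (fst p))) l <= B.
Proof.
  intros Hf Hgr Hc Hs Hk Hp. set (D := log_derive f s - log_derive f c).
  exists ((Cmod D + 1) / kappa)%R. intros l0 N0 F0.
  destruct (exhausting_list f c s l0 Hf Hgr Hc Hs F0 1%R Rlt_0_1) as [l [L1 [L2 [L3 L4]]]]. fold D in L4.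
  eapply Rle_trans; [apply (Rsum_incl_NoDup _ l0 l (fun p => Cmod_ge_0 _) N0 L3)|].
  apply Rmult_le_reg_l with kappa; [exact Hk|].
  replace (kappa * ((Cmod D + 1) / kappa))%R with (Cmod D + 1)%R by (field; lra).
  rewrite <- Rsum_scal.
  apply Rle_trans with (Rsum (fun p => (-1 * Re (pf_term c s (fst p)))%R) l).
  - apply Rsum_le. intros p Hpl. rewrite List.Forall_forall in L2. specialize (Hp p (L2 p Hpl)). lra.
  - rewrite Rsum_scal, <- Re_Csum. set (X := Csum (fun p => pf_term c s (fst p)) l) in *.
    pose proof (re_le_Cmod X) as H1. apply Rabs_le_between in H1.
    + pose proof (Cmod_triangle D (- (D - X))) as H2. rewrite Cmod_opp in H2.
      replace (D + - (D - X)) with X in H2 by ring. lra.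
Qed.

Lemma pf_term_eq c s rho : s <> rho -> c <> rho -> pf_term c s rho = (c - s) / ((s - rho) * (c - rho)).
Proof. intros H1 H2. unfold pf_term. field. split; apply Cminus_eq_contra; assumption. Qed.

(** The terms at [s] and at [s1] have the quotient [(c - s) / (c - s1)] times
    [(s1 - rho) / (s - rho)]. The latter is bounded because [s] keeps a distance [d] from all
    zeros. *)
Lemma partial_fraction_summable f c s s1 B : entire_dif f -> f c <> 0 -> f s <> 0 -> f s1 <> 0 -> s1 <> c ->
  (forall l, NoDup l -> List.Forall (zpairs f) l -> Rsum (fun p => Cmod (pf_term c s1 (fst p))) l <= B) ->
  summable (zpairs f) (fun p => pf_term c s (fst p)).
Proof.
  intros Hf Hc Hs Hs1 Hne HB.
  assert (Hcts : cts f s) by apply dif_cts, Hf.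
  pose proof (lim_neq_0 _ _ _ Hcts Hs) as Hn. apply locallyC in Hn. destruct Hn as [d [Hd Hn]].
  pose proof (Cminus_eq_contra _ _ Hne) as Hne2.
  assert (Hne3 : 0 < Cmod (c - s1)).
  { rewrite <- Cmod_opp. replace (- (c - s1)) with (s1 - c) by ring. apply Cmod_gt_0, Hne2. }
  set (A := (Cmod (c - s) / Cmod (c - s1) * (1 + Cmod (s1 - s) / d))%R).
  apply summable_bounded with (A * B)%R. intros l N F.
  assert (HA : 0 <= A).
  { apply Rmult_le_pos; [apply Rdiv_le_0_compat; [apply Cmod_ge_0|exact Hne3]|].
    assert (0 <= Cmod (s1 - s) / d) by (apply Rdiv_le_0_compat; [apply Cmod_ge_0|exact Hd]). lra. }
  eapply Rle_trans; [|apply Rmult_le_compat_l; [exact HA|apply (HB l N F)]].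
  rewrite <- Rsum_scal. apply Rsum_le. intros p Hp. rewrite List.Forall_forall in F.
  destruct (F p Hp) as [m [Hm _]]. apply multiplicity_zero in Hm. set (rho := fst p) in *.
  assert (Q1 : s <> rho) by (intros E; rewrite <- E in Hm; contradiction).
  assert (Q2 : c <> rho) by (intros E; rewrite <- E in Hm; contradiction).
  assert (Q3 : s1 <> rho) by (intros E; rewrite <- E in Hm; contradiction).
  rewrite !pf_term_eq by assumption.
  pose proof (Cminus_eq_contra _ _ Q1) as Q1'. pose proof (Cminus_eq_contra _ _ Q2) as Q2'.
  pose proof (Cminus_eq_contra _ _ Q3) as Q3'.
  rewrite !Cmod_div, !Cmod_mult by (apply Cmult_neq_0; assumption).
  apply Cmod_gt_0 in Q1', Q2', Q3'.
  assert (Hdr : d <= Cmod (s - rho)).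
  { apply Rnot_lt_le. intros Hlt. rewrite <- Cmod_opp in Hlt. replace (- (s - rho)) with (rho - s) in Hlt by ring.
    specialize (Hn rho Hlt). rewrite Hm, Cmod_0 in Hn. pose proof (Cmod_ge_0 (f s)). lra. }
  assert (Hratio : Cmod (s1 - rho) <= (1 + Cmod (s1 - s) / d) * Cmod (s - rho)).
  { replace (s1 - rho) with ((s1 - s) + (s - rho)) by ring. eapply Rle_trans; [apply Cmod_triangle|].
    assert (Cmod (s1 - s) <= Cmod (s1 - s) / d * Cmod (s - rho)); [|lra].
    replace (Cmod (s1 - s)) with (Cmod (s1 - s) / d * d)%R at 1 by (field; lra).
    apply Rmult_le_compat_l; [|exact Hdr]. apply Rdiv_le_0_compat; [apply Cmod_ge_0|exact Hd]. }
  unfold A.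
  apply Rle_trans with (Cmod (c - s) / (Cmod (s1 - rho) * Cmod (c - rho)) * (Cmod (s1 - rho) / Cmod (s - rho)))%R.
  - right. field. repeat split; lra.
  - apply Rle_trans with (Cmod (c - s) / (Cmod (s1 - rho) * Cmod (c - rho)) * (1 + Cmod (s1 - s) / d))%R.
    + apply Rmult_le_compat_l.
      * apply Rdiv_le_0_compat; [apply Cmod_ge_0|]. apply Rmult_lt_0_compat; lra.
      * apply Rmult_le_reg_r with (Cmod (s - rho)); [lra|]. unfold Rdiv at 1.
        rewrite Rmult_assoc, Rinv_l by lra. lra.
    + right. field. repeat split; lra.
Qed.

(** * Series of holomorphic functions *)

Lemma lim_Cmod_le {T : Type} (F : (T -> Prop) -> Prop) {FF : ProperFilter F} (f : T -> C) (l a : C) B :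
  lim F f l -> F (fun x => Cmod (f x - a) <= B) -> Cmod (l - a) <= B.
Proof.
  intros Hf HB. apply le_epsilon. intros e He.
  destruct (filter_ex _ (filter_and _ _ (Hf e He) HB)) as [x [H1 H2]].
  replace (l - a) with (- (f x - l) + (f x - a)) by ring.
  eapply Rle_trans; [apply Cmod_triangle|]. rewrite Cmod_opp. lra.
Qed.

Definition Cser (u : nat -> C) : C := (Series (fun n => fst (u n)), Series (fun n => snd (u n))).

Lemma Csum_seq_S (u : nat -> C) N : Csum u (seq 0 (S N)) = Csum u (seq 0 N) + u N.
Proof. rewrite seq_S, Csum_app. simpl. ring. Qed.

Lemma Rsum_seq_S (u : nat -> R) N : Rsum u (seq 0 (S N)) = (Rsum u (seq 0 N) + u N)%R.
Proof. rewrite seq_S, Rsum_app. simpl. ring. Qed.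

Lemma Rsum_seq_sum_n (u : nat -> R) N : Rsum u (seq 0 (S N)) = sum_n u N.
Proof. rewrite <- (map_id (seq 0 (S N))). apply (Rsum_map_seq (fun n => n)). Qed.

Lemma Csum_seq_sum_n (u : nat -> C) N : Csum u (seq 0 (S N)) = sum_n (G := C_AbelianMonoid) u N.
Proof. rewrite <- (map_id (seq 0 (S N))). apply (Csum_map_seq (fun n => n)). Qed.

Lemma fst_Csum_seq (u : nat -> C) N : fst (Csum u (seq 0 N)) = Rsum (fun n => fst (u n)) (seq 0 N).
Proof. apply Re_Csum. Qed.

Lemma snd_Csum_seq (u : nat -> C) N : snd (Csum u (seq 0 N)) = Rsum (fun n => snd (u n)) (seq 0 N).
Proof. induction N as [|N IH]; [reflexivity|]. rewrite Csum_seq_S, Rsum_seq_S, <- IH. reflexivity. Qed.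

Lemma Rsum_series_lim (u : nat -> R) : ex_series u -> is_lim_seq (fun N => Rsum u (seq 0 N)) (Series u).
Proof.
  intros H. apply is_lim_seq_incr_1. eapply is_lim_seq_ext; [|apply (Series_correct u H)].
  intros n. symmetry. apply Rsum_seq_sum_n.
Qed.

Section MTest.
Variables (u : nat -> C) (M : nat -> R).
Hypothesis (Hu : forall n, Cmod (u n) <= M n) (HM : ex_series M).

Lemma MTest_lim : lim eventually (fun N => Csum u (seq 0 N)) (Cser u).
Proof.
  assert (H1 : ex_series (fun n => fst (u n))).
  { apply (ex_series_le (K := R_AbsRing) (V := R_CompleteNormedModule) _ M); [|exact HM].
    intros n. eapply Rle_trans; [apply (re_le_Cmod (u n))|apply Hu]. }
  assert (H2 : ex_series (fun n => snd (u n))).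
  { apply (ex_series_le (K := R_AbsRing) (V := R_CompleteNormedModule) _ M); [|exact HM].
    intros n. eapply Rle_trans; [apply (im_le_Cmod (u n))|apply Hu]. }
  intros eps He. assert (He2 : 0 < eps / 2) by lra.
  generalize (filter_and _ _ (proj2 (is_lim_seq_spec _ _) (Rsum_series_lim _ H1) (mkposreal _ He2))
                             (proj2 (is_lim_seq_spec _ _) (Rsum_series_lim _ H2) (mkposreal _ He2))).
  apply filter_imp. intros N [A B]. simpl in A, B.
  rewrite <- fst_Csum_seq in A. rewrite <- snd_Csum_seq in B.
  destruct (Csum u (seq 0 N)) as [x y]. simpl in A, B.
  eapply Rle_lt_trans; [apply (Cmod_le_Rabs (x - Series (fun n => fst (u n))) (y - Series (fun n => snd (u n))))|]. lra.
Qed.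

Lemma Mseq_ge_0 n : 0 <= M n.
Proof. eapply Rle_trans; [apply Cmod_ge_0|apply Hu]. Qed.

Lemma Rsum_M_le N : Rsum M (seq 0 N) <= Series M.
Proof.
  apply (is_lim_seq_incr_compare (fun N => Rsum M (seq 0 N))).
  - apply Rsum_series_lim, HM.
  - intros n. rewrite Rsum_seq_S. pose proof (Mseq_ge_0 n). lra.
Qed.

Lemma Csum_tail_le N k : Cmod (Csum u (seq 0 (N + k)) - Csum u (seq 0 N)) <= Rsum M (seq 0 (N + k)) - Rsum M (seq 0 N).
Proof.
  induction k as [|k IH].
  - rewrite Nat.add_0_r. replace (Csum u (seq 0 N) - Csum u (seq 0 N)) with (RtoC 0) by ring. rewrite Cmod_0. lra.
  - rewrite Nat.add_succ_r, Csum_seq_S, Rsum_seq_S.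
    replace (Csum u (seq 0 (N + k)) + u (N + k)%nat - Csum u (seq 0 N))
      with ((Csum u (seq 0 (N + k)) - Csum u (seq 0 N)) + u (N + k)%nat) by ring.
    eapply Rle_trans; [apply Cmod_triangle|]. pose proof (Hu (N + k)). lra.
Qed.

Lemma MTest_tail N : Cmod (Cser u - Csum u (seq 0 N)) <= Series M - Rsum M (seq 0 N).
Proof.
  apply (lim_Cmod_le eventually (fun N => Csum u (seq 0 N))); [apply MTest_lim|].
  exists N. intros n Hn. replace n with (N + (n - N))%nat by lia.
  eapply Rle_trans; [apply Csum_tail_le|]. pose proof (Rsum_M_le (N + (n - N))). lra.
Qed.

Lemma Cmod_Cser_le : Cmod (Cser u) <= Series M.
Proof.
  pose proof (MTest_tail 0) as H. simpl in H. replace (Cser u - 0) with (Cser u) in H by ring. lra.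
Qed.
End MTest.

Lemma dif_Csum {T : Type} (f : T -> C -> C) l z : (forall x, In x l -> dif (f x) z) ->
  dif (fun w => Csum (fun x => f x w) l) z.
Proof.
  induction l as [|x l IH]; intros H; [apply (dif_const 0)|].
  apply (dif_plus (f x) (fun w => Csum (fun x => f x w) l)); [apply H; left; reflexivity|].
  apply IH. intros y Hy. apply H. right. exact Hy.
Qed.

Lemma Cd_Csum {T : Type} (f : T -> C -> C) (d : T -> C) l z : (forall x, In x l -> Cd (f x) z (d x)) ->
  Cd (fun w => Csum (fun x => f x w) l) z (Csum d l).
Proof.
  induction l as [|x l IH]; intros H; [apply (Cd_const 0)|].
  apply (Cd_plus (f x) (fun w => Csum (fun x => f x w) l)); [apply H; left; reflexivity|].
  apply IH. intros y Hy. apply H. right. exact Hy.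
Qed.

Lemma series_holomorphic (f : nat -> C -> C) (M : nat -> R) c r : 0 < r ->
  (forall n z, Cmod (z - c) <= r -> locally z (dif (f n))) ->
  (forall n z, Cmod (z - c) <= r -> Cmod (f n z) <= M n) -> ex_series M ->
  forall w, Cmod (w - c) < r ->
    dif (fun z => Cser (fun n => f n z)) w /\
    lim eventually (fun N => Csum (fun n => C_derive (f n) w) (seq 0 N)) (C_derive (fun z => Cser (fun n => f n z)) w).
Proof.
  intros Hr Hf HM HMs w Hw.
  destruct (weierstrass (fun N z => Csum (fun n => f n z) (seq 0 N)) (fun z => Cser (fun n => f n z)) c r Hr) with (w := w) as [A B].
  - intros N z Hz. generalize (seq 0 N). intros l. induction l as [|x l IH].
    + apply filter_forall. intros y. apply (dif_const 0).
    + generalize (filter_and _ _ (Hf x z Hz) IH). apply filter_imp. intros y [H1 H2].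
      apply (dif_plus (f x) (fun w => Csum (fun x => f x w) l)); assumption.
  - intros eps He.
    destruct (proj2 (is_lim_seq_spec _ _) (Rsum_series_lim M HMs) (mkposreal eps He)) as [N HN]. simpl in HN.
    exists N. intros n Hn z Hz.
    replace (Csum (fun n => f n z) (seq 0 n) - Cser (fun n => f n z)) with (- (Cser (fun n => f n z) - Csum (fun n => f n z) (seq 0 n))) by ring.
    rewrite Cmod_opp. eapply Rle_lt_trans; [apply (MTest_tail _ M); [intros k; apply HM, Hz|exact HMs]|].
    specialize (HN n Hn). apply Rabs_lt_between in HN. lra.
  - exact Hw.
  - split; [exact A|]. refine (lim_ext_loc _ _ _ _ _ B).
    apply filter_forall. intros N. apply C_derive_Cd. apply Cd_Csum.
    intros n _. apply dif_C_derive. apply (locally_singleton _ _ (Hf n w ltac:(lra))).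
Qed.

(** * The complex logarithm on the right half-plane *)

(** The principal branch, in a form that is correct on the half-plane [Re z > 0], where the Gamma
    function is studied. *)
Definition Clog (z : C) : C := (ln (Cmod z), atan (Im z / Re z)).

Lemma cts_real_comp {T : UniformSpace} (u : T -> R) (h : R -> R) x :
  cts (fun t => RtoC (u t)) x -> continuous h (u x) -> cts (fun t => RtoC (h (u t))) x.
Proof.
  intros Hu Hh eps He.
  pose proof (proj1 (filterlim_locally h (h (u x))) Hh (mkposreal eps He)) as H.
  apply locallyR in H. destruct H as [d [Hd H]].
  generalize (Hu d Hd). apply filter_imp. intros y Hy.
  rewrite <- RtoC_minus, Cmod_R in Hy |- *. apply (H (u y) Hy).
Qed.

Lemma Cmod_pos_Re z : 0 < Re z -> 0 < Cmod z.
Proof. intros H. pose proof (re_le_Cmod z) as H1. pose proof (Rle_abs (Re z)). lra. Qed.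

Lemma neq0_Re z : 0 < Re z -> z <> 0.
Proof. intros H. apply Cmod_gt_0, Cmod_pos_Re, H. Qed.

Lemma Cexp_Clog z : 0 < Re z -> Cexp (Clog z) = z.
Proof.
  intros H. pose proof (Cmod_pos_Re z H) as Hm. destruct z as [x y]. unfold Cexp, Clog, Re, Im in *. simpl in *.
  rewrite exp_ln, cos_atan, sin_atan by exact Hm.
  assert (E : Cmod (x, y) = (x * sqrt (1 + (y / x)²))%R).
  { unfold Cmod. simpl fst. simpl snd. rewrite <- (sqrt_pow2 x) at 2 by lra.
    rewrite <- sqrt_mult; [|apply pow2_ge_0|pose proof (Rle_0_sqr (y / x)); lra].
    f_equal. unfold Rsqr. field. lra. }
  assert (Hs : 0 < sqrt (1 + (y / x)²)) by (apply sqrt_lt_R0; pose proof (Rle_0_sqr (y / x)); lra).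
  rewrite E. apply injective_projections; simpl; field; lra.
Qed.

Lemma locally_Re_gt z a : a < Re z -> locally z (fun w => a < Re w).
Proof. intros H. apply (locally_gt Re z a); [|exact H]. apply cts_re, cts_id. Qed.

Lemma cts_Clog z : 0 < Re z -> cts Clog z.
Proof.
  intros H. apply cts_ext_loc with (fun w => RtoC (ln (Cmod w)) + Ci * RtoC (atan (Im w / Re w))).
  - apply filter_forall. intros w. unfold Clog. apply injective_projections; simpl; ring.
  - apply cts_plus.
    + apply (cts_real_comp (fun w => Cmod w) ln); [apply cts_Cmod, cts_id|apply continuous_ln, Cmod_pos_Re, H].
    + apply cts_mult; [apply cts_const|].
      apply (cts_real_comp (fun w => Im w / Re w)%R atan); [|apply continuous_atan].
      apply cts_ext_loc with (fun w => RtoC (Im w) / RtoC (Re w)).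
      * generalize (locally_Re_gt z 0 H). apply filter_imp. intros w Hw. rewrite RtoC_div by lra. reflexivity.
      * apply cts_div; [apply cts_im, cts_id|apply cts_re, cts_id|]. intros E. apply RtoC_inj in E. lra.
Qed.

(** A continuous right inverse of the exponential is differentiable: [w - z = (L w - L z) q w],
    where the difference quotient [q] of the exponential tends to [exp (L z) = z]. *)
Lemma Cd_log (L : C -> C) (z : C) : cts L z -> locally z (fun w => Cexp (L w) = w) -> z <> 0 -> Cd L z (/ z).
Proof.
  intros HL HE Hz. pose proof (locally_singleton _ _ HE) as E0. simpl in E0.
  destruct (quot_almost Cexp (L z) (Cexp (L z)) (L z) (Cd_Cexp (L z))) as [Hq _].
  { apply dif_almost, filter_forall. intros w. apply dif_Cexp. }
  pose proof (cts_comp _ L z HL Hq) as HqL. set (q := fun w => quot Cexp (L z) (Cexp (L z)) (L w)) in *.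
  assert (Eq : q z = z) by (unfold q; rewrite quot_at; exact E0).
  assert (Hqn : q z <> 0) by (rewrite Eq; exact Hz).
  apply Cd_cara. exists (fun w => / q w). split.
  - generalize (filter_and _ _ HE (lim_neq_0 (locally z) q (q z) HqL Hqn)). apply filter_imp. intros w [E1 E2].
    assert (Hqw : q w <> 0) by (apply Cmod_gt_0; pose proof (Cmod_ge_0 (q z)); lra).
    pose proof (quot_eq Cexp (L z) (Cexp (L z)) (L w)) as E3. rewrite E1, E0 in E3.
    replace (quot Cexp (L z) z (L w)) with (q w) in E3 by (unfold q; rewrite E0; reflexivity).
    pose proof (f_equal (fun x : C => x - z) E3) as E4. cbv beta in E4.
    rewrite E4. cfield. exact Hqw.
  - replace (/ z) with (/ q z) by (rewrite Eq; reflexivity). apply lim_inv; [typeclasses eauto|exact HqL|exact Hqn].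
Qed.

Lemma Cd_Clog z : 0 < Re z -> Cd Clog z (/ z).
Proof.
  intros H. apply Cd_log; [apply cts_Clog, H| |apply neq0_Re, H].
  generalize (locally_Re_gt z 0 H). apply filter_imp. intros w Hw. apply Cexp_Clog, Hw.
Qed.

(** * The Gamma function *)

(* The factor [(1 + 1/(n+1))^z / (1 + z/(n+1))] of Euler's product, in logarithmic form. *)
Definition gterm (n : nat) (z : C) : C :=
  z * RtoC (ln (1 + / INR (S n))) - Clog (1 + z * RtoC (/ INR (S n))).

Definition gterm' (n : nat) (z : C) : C := RtoC (ln (1 + / INR (S n))) - / (RtoC (INR (S n)) + z).

Lemma INR_S_pos n : 0 < INR (S n).
Proof. apply lt_0_INR. lia. Qed.

Lemma Re_gterm_arg n z : 0 <= Re z -> 0 < Re (1 + z * RtoC (/ INR (S n))).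
Proof.
  intros H. pose proof (Rinv_0_lt_compat _ (INR_S_pos n)).
  assert (0 <= Re z * / INR (S n))%R by (apply Rmult_le_pos; lra).
  unfold Re in *. simpl fst in *. lra || (destruct z; simpl in *; lra).
Qed.

Lemma Cd_gterm n z : 0 <= Re z -> Cd (gterm n) z (gterm' n z).
Proof.
  intros H. pose proof (INR_S_pos n) as Hn. pose proof (Re_gterm_arg n z H) as Ha.
  assert (Hn0 : RtoC (INR (S n)) <> 0) by (intros E; apply RtoC_inj in E; lra).
  eapply Cd_eq.
  - apply Cd_minus.
    + apply Cd_mult; [apply Cd_id|apply Cd_const].
    + apply (Cd_comp Clog (fun z => 1 + z * RtoC (/ INR (S n)))); [|apply Cd_Clog, Ha].
      apply Cd_plus; [apply Cd_const|]. apply Cd_mult; [apply Cd_id|apply Cd_const].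
  - cbv beta. unfold gterm'. apply neq0_Re in Ha. rewrite RtoC_inv in * by lra.
    assert (Hs : RtoC (INR (S n)) + z <> 0).
    { intros E. apply Ha. replace (1 + z * / RtoC (INR (S n))) with ((RtoC (INR (S n)) + z) / RtoC (INR (S n))) by (field; exact Hn0).
      rewrite E. unfold Cdiv. ring. }
    field. repeat split; assumption.
Qed.

Lemma gterm_0 n : gterm n 0 = 0.
Proof.
  unfold gterm. replace (1 + 0 * RtoC (/ INR (S n))) with (RtoC 1) by ring. unfold Clog.
  rewrite Cmod_1, ln_1. unfold Im, Re. simpl. replace (0 / 1)%R with 0%R by field. rewrite atan_0.
  apply injective_projections; simpl; ring.
Qed.

Lemma ln_1_plus_bounds x : 0 < x -> x - x ^ 2 <= ln (1 + x) <= x.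
Proof.
  intros Hx. assert (K : forall y, 0 < y -> ln y <= y - 1).
  { intros y Hy. pose proof (exp_ineq1_le (ln y)) as H. rewrite exp_ln in H by exact Hy. lra. }
  split.
  - pose proof (K (/ (1 + x))%R ltac:(apply Rinv_0_lt_compat; lra)) as H. rewrite ln_Rinv in H by lra.
    assert (E : (/ (1 + x) - 1 = - x / (1 + x))%R) by (field; lra). rewrite E in H.
    assert (x - x ^ 2 <= x / (1 + x)); [|lra].
    apply Rmult_le_reg_r with (1 + x)%R; [lra|]. unfold Rdiv. rewrite Rmult_assoc, Rinv_l by lra.
    assert (0 < x ^ 3) by (apply pow_lt, Hx). nra.
  - pose proof (K (1 + x)%R ltac:(lra)). lra.
Qed.

(** The power [(n + 1)^(-3/2)] is the compromise of [gterm'_bound] between summability in [n] and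
    growth in [z]. *)
Definition qn (n : nat) : R := (/ (INR (S n) * sqrt (INR (S n))))%R.

Lemma qn_pos n : 0 < qn n.
Proof.
  pose proof (INR_S_pos n). apply Rinv_0_lt_compat, Rmult_lt_0_compat; [assumption|apply sqrt_lt_R0; assumption].
Qed.

(* Comparison with the telescoping series of [1/sqrt(n+1) - 1/sqrt(n+2)]. *)
Lemma qn_series : ex_series qn.
Proof.
  assert (HB : forall n, sum_n qn n <= 6 * (1 - / sqrt (INR (S (S n))))).
  { assert (K : forall n, qn n <= 6 * (/ sqrt (INR (S n)) - / sqrt (INR (S (S n))))).
    { intros n. unfold qn. pose proof (INR_S_pos n) as Hn. pose proof (INR_S_pos (S n)) as Hn1.
      set (a := sqrt (INR (S n))). set (b := sqrt (INR (S (S n)))).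
      assert (Ha : 0 < a) by (apply sqrt_lt_R0, Hn). assert (Hb : 0 < b) by (apply sqrt_lt_R0, Hn1).
      assert (Ea : (a * a = INR (S n))%R) by (apply sqrt_sqrt; lra).
      assert (Eb : (b * b = INR (S (S n)))%R) by (apply sqrt_sqrt; lra).
      assert (Eab : (b * b = a * a + 1)%R) by (rewrite Ea, Eb, (S_INR (S n)); ring).
      assert (H1 : 1 <= a * a) by (rewrite Ea, S_INR; pose proof (pos_INR n); lra).
      assert (Hab : b <= 2 * a) by nra.
      rewrite <- Ea.
      replace (6 * (/ a - / b))%R with (6 * (b * b - a * a) / (a * b * (a + b)))%R by (field; lra).
      replace (b * b - a * a)%R with 1%R by lra.
      (* The origin of the constant 6: [b <= 2 a] gives [a b <= 2 a^2] and [a + b <= 3 a]. *)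
      assert (Hden : a * b * (a + b) <= 6 * (a * a * a)).
      { assert (a * b <= a * (2 * a))%R by (apply Rmult_le_compat_l; lra).
        assert (a * b * (a + b) <= (a * (2 * a)) * (a + 2 * a))%R.
        { apply Rmult_le_compat; try lra. apply Rmult_le_pos; lra. } lra. }
      assert (Hp : 0 < a * b * (a + b)) by (repeat apply Rmult_lt_0_compat; lra).
      assert (Hp3 : 0 < a * a * a) by (repeat apply Rmult_lt_0_compat; lra).
      apply Rmult_le_reg_r with (a * a * a)%R; [exact Hp3|]. rewrite Rinv_l by lra.
      apply Rmult_le_reg_r with (a * b * (a + b))%R; [exact Hp|].
      replace (6 * 1 / (a * b * (a + b)) * (a * a * a) * (a * b * (a + b)))%R with (6 * (a * a * a))%R by (field; lra). lra. }
    intros n. induction n as [|n IH].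
    - rewrite sum_O. specialize (K O). change (INR 1) with 1%R in K. rewrite sqrt_1, Rinv_1 in K. exact K.
    - rewrite sum_Sn. specialize (K (S n)). change (plus (sum_n qn n) (qn (S n))) with (sum_n qn n + qn (S n))%R. lra. }
  destruct (ex_finite_lim_seq_incr (sum_n qn) 6) as [l Hl].
  - intros n. rewrite sum_Sn. unfold plus; simpl. pose proof (qn_pos (S n)). lra.
  - intros n. eapply Rle_trans; [apply HB|].
    assert (0 < / sqrt (INR (S (S n)))); [|lra]. apply Rinv_0_lt_compat, sqrt_lt_R0, INR_S_pos.
  - exists l. exact Hl.
Qed.

(** There are two elementary bounds, [(1 + |z|) / N^2] and [2 / N] with [N = n + 1]; their geometric
    mean is summable in [n] and grows only like [|z|^(1/2)]. This is the source of the square-root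
    growth of [digamma] and [Gline]. *)
Lemma gterm'_bound n z : 0 <= Re z -> Cmod (gterm' n z) <= sqrt (2 * (1 + Cmod z)) * qn n.
Proof.
  intros H. pose proof (INR_S_pos n) as Hn. unfold gterm'. set (N := INR (S n)) in *.
  assert (HN1 : 1 <= N) by (unfold N; rewrite S_INR; pose proof (pos_INR n); lra).
  assert (HiN : 0 < / N) by (apply Rinv_0_lt_compat, Hn).
  pose proof (ln_1_plus_bounds (/ N) HiN) as [L1 L2].
  assert (Hi2 : / N ^ 2 <= / N).
  { apply Rinv_le_contravar; [exact Hn|]. simpl. rewrite Rmult_1_r. rewrite <- (Rmult_1_r N) at 1. apply Rmult_le_compat_l; lra. }
  assert (Ei2 : ((/ N) ^ 2 = / N ^ 2)%R) by (field; lra). rewrite Ei2 in L1.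
  assert (HNz : N <= Cmod (RtoC N + z)).
  { eapply Rle_trans; [|apply re_le_Cmod]. eapply Rle_trans; [|apply Rle_abs].
    unfold Re in *. simpl. lra. }
  assert (HNz0 : RtoC N + z <> 0) by (apply Cmod_gt_0; lra).
  assert (HN0 : RtoC N <> 0) by (intros E; apply RtoC_inj in E; lra).
  assert (Hinv : Cmod (/ (RtoC N + z)) <= / N) by (apply Cmod_inv_le; lra).
  pose proof (Cmod_ge_0 z) as Hz0.
  set (X := Cmod (RtoC (ln (1 + / N)) - / (RtoC N + z))).
  assert (B1 : X <= (1 + Cmod z) * / N ^ 2).
  { unfold X. replace (RtoC (ln (1 + / N)) - / (RtoC N + z)) with
      (RtoC (ln (1 + / N) - / N) + z * (/ (RtoC N + z) * RtoC (/ N))).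
    - eapply Rle_trans; [apply Cmod_triangle|]. rewrite Rmult_plus_distr_r, Rmult_1_l. apply Rplus_le_compat.
      + rewrite Cmod_R. apply Rabs_le. lra.
      + rewrite !Cmod_mult, Cmod_R, (Rabs_pos_eq (/ N)) by lra. apply Rmult_le_compat_l; [exact Hz0|].
        replace (/ N ^ 2)%R with (/ N * / N)%R by (field; lra). apply Rmult_le_compat_r; lra.
    - rewrite RtoC_minus, RtoC_inv by lra. field. split; assumption. }
  assert (B2 : X <= 2 * / N).
  { unfold X. eapply Rle_trans; [apply Cmod_triangle|]. rewrite Cmod_opp, Cmod_R.
    assert (0 <= ln (1 + / N)) by lra. rewrite Rabs_pos_eq by assumption. lra. }
  assert (HX0 : 0 <= X) by apply Cmod_ge_0.
  assert (HsN : 0 < sqrt N) by (apply sqrt_lt_R0, Hn).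
  assert (EsN : (sqrt N * sqrt N = N)%R) by (apply sqrt_sqrt; lra).
  apply Rle_trans with (sqrt (2 * (1 + Cmod z) * (/ N ^ 2 * / N))).
  - rewrite <- (sqrt_pow2 X) by exact HX0. apply sqrt_le_1_alt.
    replace (2 * (1 + Cmod z) * (/ N ^ 2 * / N))%R with (((1 + Cmod z) * / N ^ 2) * (2 * / N))%R by ring.
    simpl. rewrite Rmult_1_r. apply Rmult_le_compat; assumption.
  - rewrite sqrt_mult_alt by lra. apply Rmult_le_compat_l; [apply sqrt_pos|]. right.
    unfold qn. fold N. rewrite <- (sqrt_pow2 (/ (N * sqrt N))).
    + f_equal. replace ((/ (N * sqrt N)) ^ 2)%R with (/ N ^ 2 * / (sqrt N * sqrt N))%R by (field; lra). rewrite EsN. reflexivity.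
    + left. apply Rinv_0_lt_compat, Rmult_lt_0_compat; lra.
Qed.

(** Integrates [gterm'_bound] along the segment from 0, where [gterm] vanishes; this costs the
    factor [|z|]. *)
Lemma gterm_bound n z : 0 <= Re z -> Cmod (gterm n z) <= Cmod z * sqrt (2 * (1 + Cmod z)) * qn n.
Proof.
  intros H.
  assert (Hre : forall t, 0 <= t <= 1 -> 0 <= Re (0 + RtoC t * z)).
  { intros t Ht. replace (Re (0 + RtoC t * z)) with (t * Re z)%R by (destruct z; unfold Re; simpl; ring).
    apply Rmult_le_pos; lra. }
  assert (Hct : ctsI 0 1 (fun t => gterm' n (0 + RtoC t * z))).
  { intros t Ht. unfold gterm'. apply cts_minus; [apply cts_const|]. apply cts_inv.
    - apply cts_plus; [apply cts_const|]. apply cts_plus; [apply cts_const|].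
      apply cts_mult; [apply cts_idR|apply cts_const].
    - apply neq0_Re. pose proof (INR_S_pos n). specialize (Hre t Ht).
      change (Re (RtoC (INR (S n)) + (0 + RtoC t * z))) with (INR (S n) + Re (0 + RtoC t * z))%R. lra. }
  pose proof (CI_FTC_line (gterm n) (gterm' n) 0 z 0 1 ltac:(lra)
     (fun t Ht => Cd_gterm n _ (Hre t Ht)) Hct) as E.
  replace (0 + RtoC 1 * z) with z in E by ring. replace (0 + RtoC 0 * z) with (RtoC 0) in E by ring.
  rewrite gterm_0 in E. replace (gterm n z) with (gterm n z - 0) by ring. rewrite <- E, Cmod_mult, Rmult_assoc.
  apply Rmult_le_compat_l; [apply Cmod_ge_0|].
  eapply Rle_trans; [apply Cmod_CI_const with (M := (sqrt (2 * (1 + Cmod z)) * qn n)%R)|].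
  - lra.
  - exact Hct.
  - intros t Ht. eapply Rle_trans; [apply gterm'_bound, Hre, Ht|].
    apply Rmult_le_compat_r; [left; apply qn_pos|]. apply sqrt_le_1_alt.
    apply Rmult_le_compat_l; [lra|]. apply Rplus_le_compat_l.
    rewrite Cplus_0_l, Cmod_mult, Cmod_R, Rabs_pos_eq by lra.
    rewrite <- (Rmult_1_l (Cmod z)) at 2. apply Rmult_le_compat_r; [apply Cmod_ge_0|lra].
  - lra.
Qed.

(** The logarithm of [Gamma (1 + z)] from Euler's product. Splitting off the factor [1 / z] leaves
    terms that stay bounded up to the line [Re z = 0]. *)
Definition lGamma1 (z : C) : C := Cser (fun n => gterm n z).
Definition lGamma (z : C) : C := lGamma1 z - Clog z.
Definition digamma (z : C) : C := C_derive lGamma1 z - / z.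

Definition Sq : R := Series qn.

Lemma Sq_pos : 0 <= Sq.
Proof.
  pose proof (Rsum_M_le (fun n => RtoC (qn n)) qn) as H.
  specialize (H ltac:(intros n; cbv beta; rewrite Cmod_R, Rabs_pos_eq; [lra|left; apply qn_pos]) qn_series O).
  simpl in H. exact H.
Qed.

Lemma ex_series_scal_qn c : ex_series (fun n => (c * qn n)%R).
Proof. apply (ex_series_scal (V := R_NormedModule) c qn qn_series). Qed.

Lemma lGamma1_bound z : 0 <= Re z -> Cmod (lGamma1 z) <= Cmod z * sqrt (2 * (1 + Cmod z)) * Sq.
Proof.
  intros H. unfold Sq. rewrite <- Series_scal_l.
  apply Cmod_Cser_le; [intros n; apply gterm_bound, H|apply ex_series_scal_qn].
Qed.

Lemma lGamma1_holo w : 0 < Re w -> dif lGamma1 w /\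
  lim eventually (fun N => Csum (fun n => gterm' n w) (seq 0 N)) (C_derive lGamma1 w).
Proof.
  intros Hw. set (r := (Re w / 2)%R). assert (Hr : 0 < r) by (unfold r; lra).
  assert (Hd : forall z, Cmod (z - w) <= r -> 0 < Re z).
  { intros z Hz. pose proof (re_le_Cmod (z - w)) as H1. apply Rabs_le_between in H1.
    change (Re (z - w)) with (Re z - Re w)%R in H1. unfold r in Hz. lra. }
  set (A := (Cmod w + r)%R).
  assert (HA : forall z, Cmod (z - w) <= r -> Cmod z <= A).
  { intros z Hz. replace z with ((z - w) + w) by ring. eapply Rle_trans; [apply Cmod_triangle|unfold A; lra]. }
  destruct (series_holomorphic gterm (fun n => (A * sqrt (2 * (1 + A)) * qn n)%R) w r Hr) with (w := w) as [D1 D2].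
  - intros n z Hz. generalize (locally_Re_gt z 0 (Hd z Hz)). apply filter_imp. intros y Hy.
    eexists. apply Cd_gterm. lra.
  - intros n z Hz. eapply Rle_trans; [apply gterm_bound; left; apply Hd, Hz|].
    apply Rmult_le_compat_r; [left; apply qn_pos|].
    apply Rmult_le_compat; [apply Cmod_ge_0|apply sqrt_pos|apply HA, Hz|].
    apply sqrt_le_1_alt. specialize (HA z Hz). lra.
  - apply ex_series_scal_qn.
  - replace (w - w) with (RtoC 0) by ring. rewrite Cmod_0. exact Hr.
  - split; [exact D1|]. refine (lim_ext_loc _ _ _ _ _ D2).
    apply filter_forall. intros N. apply Csum_ext. intros n _. apply C_derive_Cd, Cd_gterm. lra.
Qed.

Lemma Cd_lGamma z : 0 < Re z -> Cd lGamma z (digamma z).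
Proof.
  intros H. apply Cd_minus; [|apply Cd_Clog, H]. apply dif_C_derive, lGamma1_holo, H.
Qed.

Lemma dif_digamma z : 0 < Re z -> dif digamma z.
Proof.
  intros H. apply dif_minus; [|apply dif_inv; [apply dif_id|apply neq0_Re, H]].
  apply derive_holomorphic. generalize (locally_Re_gt z 0 H). apply filter_imp.
  intros w Hw. apply lGamma1_holo, Hw.
Qed.

Lemma digamma_bound z : 0 < Re z -> Cmod (digamma z) <= / Re z + sqrt (2 * (1 + Cmod z)) * Sq.
Proof.
  intros H. unfold digamma. rewrite Rplus_comm. eapply Rle_trans; [apply Cmod_triangle|].
  apply Rplus_le_compat.
  - replace (C_derive lGamma1 z) with (C_derive lGamma1 z - 0) by ring.
    apply (lim_Cmod_le eventually _ _ _ _ (proj2 (lGamma1_holo z H))).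
    apply filter_forall. intros N. replace (Csum (fun n => gterm' n z) (seq 0 N) - 0) with (Csum (fun n => gterm' n z) (seq 0 N)) by ring.
    eapply Rle_trans; [apply (Cmod_Csum_le _ (fun n => (sqrt (2 * (1 + Cmod z)) * qn n)%R))|].
    + intros n _. apply gterm'_bound. lra.
    + rewrite Rsum_scal. apply Rmult_le_compat_l; [apply sqrt_pos|].
      apply (Rsum_M_le (fun n => RtoC (qn n)) qn).
      * intros n. rewrite Cmod_R, Rabs_pos_eq; [lra|left; apply qn_pos].
      * apply qn_series.
  - rewrite Cmod_opp. apply Cmod_inv_le; [exact H|].
    pose proof (re_le_Cmod z). pose proof (Rle_abs (Re z)). lra.
Qed.

(** The exponentials of the partial sums telescope to Gauss's quotient, but with base [n + 2] where
    [gauss_seq z (S n)] has [n + 1]; the last summand corrects the base and tends to 0. *)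
Lemma gauss_seq_eq z n : 0 < Re z ->
  gauss_seq z (S n) = Cexp (Csum (fun k => gterm k z) (seq 0 (S n)) - Clog z
     + z * RtoC (ln (INR (S n)) - ln (INR (S (S n))))).
Proof.
  intros Hz.
  assert (K : forall n, Cexp (Csum (fun k => gterm k z) (seq 0 n) - Clog z) =
     RtoC (INR (fact n)) * rpow (INR (S n)) z / Cprod (fun k : nat => z + RtoC (INR k)) (seq 0 (S n))).
  { assert (HP : forall m, z + RtoC (INR m) <> 0).
    { intros m. apply neq0_Re. change (Re (z + RtoC (INR m))) with (Re z + INR m)%R. pose proof (pos_INR m). lra. }
    assert (HPr : forall l, Cprod (fun k : nat => z + RtoC (INR k)) l <> 0) by (intros l; apply Cprod_neq_0; auto).
    assert (Happ : forall (l1 l2 : list nat) (h : nat -> C), Cprod h (l1 ++ l2) = Cprod h l1 * Cprod h l2).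
    { intros l1 l2 h. induction l1 as [|x l1 IH]; [simpl; ring|]. change ((x :: l1) ++ l2)%list with (x :: (l1 ++ l2))%list.
      rewrite !Cprod_cons, IH. ring. }
    intros m. induction m as [|m IH].
    - unfold Cprod, rpow. simpl. rewrite ln_1.
      replace (0 - Clog z) with (- Clog z) by ring. rewrite Cexp_opp, Cexp_Clog by exact Hz.
      replace (z * 0) with (RtoC 0) by ring. rewrite Cexp_0.
      specialize (HP O). simpl in HP. replace (z + 0) with z in * by ring. field. exact HP.
    - rewrite Csum_seq_S. replace (Csum (fun k => gterm k z) (seq 0 m) + gterm m z - Clog z)
        with ((Csum (fun k => gterm k z) (seq 0 m) - Clog z) + gterm m z) by ring.
      rewrite Cexp_plus, IH. rewrite (seq_S (S m) 0), Happ. simpl (0 + S m)%nat.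
      change (Cprod (fun k => z + RtoC (INR k)) (S m :: nil)) with ((z + RtoC (INR (S m))) * 1).
      pose proof (INR_S_pos m) as Hm. pose proof (INR_S_pos (S m)) as Hm1.
      pose proof (Re_gterm_arg m z ltac:(lra)) as Ha.
      assert (EG : Cexp (gterm m z) = rpow (INR (S (S m))) z / rpow (INR (S m)) z * (RtoC (INR (S m)) / (z + RtoC (INR (S m))))).
      { unfold gterm, rpow, Cminus. rewrite Cexp_plus, Cexp_opp, Cexp_Clog by exact Ha.
        replace (ln (1 + / INR (S m)))%R with (ln (INR (S (S m))) - ln (INR (S m)))%R.
        - rewrite RtoC_minus. replace (z * (RtoC (ln (INR (S (S m)))) - RtoC (ln (INR (S m)))))
            with (z * RtoC (ln (INR (S (S m)))) + - (z * RtoC (ln (INR (S m))))) by ring.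
          rewrite Cexp_plus, Cexp_opp. apply neq0_Re in Ha. rewrite RtoC_inv in * by lra.
          assert (Hm0 : RtoC (INR (S m)) <> 0) by (intros E; apply RtoC_inj in E; lra).
          specialize (HP (S m)).
          assert (HP' : RtoC (INR (S m)) + z <> 0) by (rewrite Cplus_comm; exact HP).
          field. repeat split; try assumption; try apply Cexp_neq_0.
        - rewrite <- ln_div by assumption. f_equal. rewrite (S_INR (S m)). field. lra. }
      rewrite EG. change (fact (S m)) with (S m * fact m)%nat. rewrite mult_INR, RtoC_mult.
      specialize (HP (S m)). specialize (HPr (seq 0 (S m))).
      assert (Hrp : rpow (INR (S m)) z <> 0) by apply Cexp_neq_0.
      field. repeat split; assumption. }
  rewrite Cexp_plus, K. unfold gauss_seq.
  replace (rpow (INR (S n)) z) with (rpow (INR (S (S n))) z * Cexp (z * RtoC (ln (INR (S n)) - ln (INR (S (S n)))))).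
  - unfold Cdiv. ring.
  - unfold rpow. rewrite <- Cexp_plus. f_equal. rewrite RtoC_minus. ring.
Qed.

Lemma lim_is_lim_seq (u : nat -> C) l : lim eventually u l ->
  is_lim_seq (fun n => Re (u n)) (Re l) /\ is_lim_seq (fun n => Im (u n)) (Im l).
Proof.
  intros H. split; apply is_lim_seq_spec; intros eps; generalize (H eps (cond_pos eps)); apply filter_imp;
  intros n Hn; eapply Rle_lt_trans; try exact Hn.
  - apply (re_le_Cmod (u n - l)).
  - apply (im_le_Cmod (u n - l)).
Qed.

Lemma CGamma_exp z : 0 < Re z -> CGamma z = Cexp (lGamma z).
Proof.
  intros Hz.
  assert (HL : lim eventually (fun n => gauss_seq z (S n)) (Cexp (lGamma z))).
  { apply lim_ext_loc with (fun n => Cexp (Csum (fun k => gterm k z) (seq 0 (S n)) - Clog z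
     + z * RtoC (ln (INR (S n)) - ln (INR (S (S n)))))).
    - typeclasses eauto.
    - apply filter_forall. intros n. symmetry. apply gauss_seq_eq, Hz.
    - apply (lim_comp eventually Cexp); [|apply cts_Cexp].
      replace (lGamma z) with (lGamma1 z - Clog z + z * 0) by (unfold lGamma; ring).
      apply lim_plus; [typeclasses eauto| |].
      + apply lim_minus; [typeclasses eauto| |apply lim_const; typeclasses eauto].
        assert (HM : lim eventually (fun N => Csum (fun k => gterm k z) (seq 0 N)) (lGamma1 z)).
        { eapply MTest_lim; [intros n; apply gterm_bound; lra|apply ex_series_scal_qn]. }
        intros eps He. destruct (HM eps He) as [N HN]. exists N. intros n Hn. apply HN. lia.
      + apply lim_mult; [typeclasses eauto|apply lim_const; typeclasses eauto|].
        intros eps He. destruct (nfloor_ex (/ eps)) as [N [_ HN]].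
        { left. apply Rinv_0_lt_compat, He. }
        exists N. intros n Hn. rewrite <- RtoC_minus, Cmod_R, Rminus_0_r, <- Rabs_Ropp.
        pose proof (INR_S_pos n) as Hn0. pose proof (INR_S_pos (S n)).
        replace (- (ln (INR (S n)) - ln (INR (S (S n)))))%R with (ln (1 + / INR (S n)))%R.
        * assert (Hi : 0 < / INR (S n)) by (apply Rinv_0_lt_compat, Hn0).
          assert (0 < ln (1 + / INR (S n))) by (rewrite <- ln_1; apply ln_increasing; lra).
          pose proof (ln_1_plus_bounds _ Hi). rewrite Rabs_pos_eq by lra.
          eapply Rle_lt_trans; [apply H1|]. rewrite <- (Rinv_inv eps).
          apply Rinv_lt_contravar.
          -- apply Rmult_lt_0_compat; [apply Rinv_0_lt_compat, He|exact Hn0].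
          -- apply le_INR in Hn. rewrite S_INR. lra.
        * replace (- (ln (INR (S n)) - ln (INR (S (S n)))))%R with (ln (INR (S (S n))) - ln (INR (S n)))%R by ring.
          rewrite <- ln_div by assumption. f_equal. rewrite (S_INR (S n)). field. lra. }
  apply lim_is_lim_seq in HL. destruct HL as [H1 H2].
  apply (is_lim_seq_incr_1 (fun n => Re (gauss_seq z n))) in H1.
  apply (is_lim_seq_incr_1 (fun n => Im (gauss_seq z n))) in H2.
  unfold CGamma. rewrite (is_lim_seq_unique _ _ H1), (is_lim_seq_unique _ _ H2).
  destruct (Cexp (lGamma z)). reflexivity.
Qed.

Lemma Cd_CGamma z : 0 < Re z -> Cd CGamma z (digamma z * CGamma z).
Proof.
  intros H. apply Cd_ext_loc with (fun z => Cexp (lGamma z)).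
  - generalize (locally_Re_gt z 0 H). apply filter_imp. intros w Hw. symmetry. apply CGamma_exp, Hw.
  - rewrite CGamma_exp by exact H. rewrite Cmult_comm. apply (Cd_comp Cexp lGamma); [apply Cd_lGamma, H|apply Cd_Cexp].
Qed.

Lemma CGamma_neq_0 z : 0 < Re z -> CGamma z <> 0.
Proof. intros H. rewrite CGamma_exp by exact H. apply Cexp_neq_0. Qed.

Lemma log_derive_CGamma z : 0 < Re z -> log_derive CGamma z = digamma z.
Proof.
  intros H. rewrite (log_derive_Cd _ _ _ (Cd_CGamma z H)). field. apply CGamma_neq_0, H.
Qed.

(** The estimate [O(|z|^(3/2))] for [lGamma1] drops below every [eps |z|^2] after completing
    squares; the distance [delta] from the imaginary axis controls the factor [1 / |z|]. *)
Lemma CGamma_growth delta eps : 0 < delta -> 0 < eps -> exists K, 0 < K /\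
  forall z, delta <= Re z -> Cmod (CGamma z) <= K * exp (eps * Cmod z ^ 2).
Proof.
  intros Hd He. pose proof Sq_pos as HS.
  set (A := (Sq ^ 2 / eps)%R).
  assert (HA : 0 <= A) by (apply Rdiv_le_0_compat; [apply pow2_ge_0|exact He]).
  set (B := (A + A ^ 2 / (2 * eps))%R).
  exists (/ delta * exp B)%R. split; [apply Rmult_lt_0_compat; [apply Rinv_0_lt_compat, Hd|apply exp_pos]|].
  intros z Hz. assert (Hz0 : 0 < Re z) by lra. pose proof (Cmod_pos_Re z Hz0) as Hm.
  rewrite CGamma_exp, Cmod_Cexp by exact Hz0. unfold lGamma.
  change (Re (lGamma1 z - Clog z)) with (Re (lGamma1 z) - ln (Cmod z))%R.
  unfold Rminus. rewrite Rplus_comm, exp_plus, exp_Ropp, exp_ln by exact Hm.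
  rewrite Rmult_assoc. apply Rmult_le_compat.
  - left. apply Rinv_0_lt_compat, Hm.
  - left. apply exp_pos.
  - apply Rinv_le_contravar; [exact Hd|]. pose proof (re_le_Cmod z). pose proof (Rle_abs (Re z)). lra.
  - rewrite <- exp_plus. apply exp_le.
    pose proof (lGamma1_bound z ltac:(lra)) as H1. pose proof (re_le_Cmod (lGamma1 z)) as H2.
    pose proof (Rle_abs (Re (lGamma1 z))) as H3.
    set (m := Cmod z) in *. set (q := sqrt (2 * (1 + m))) in *.
    assert (Hq : (q ^ 2 = 2 * (1 + m))%R) by (unfold q; apply pow2_sqrt; lra).
    assert (E1 : (Sq = sqrt (eps * A))%R).
    { unfold A. replace (eps * (Sq ^ 2 / eps))%R with (Sq ^ 2)%R by (field; lra). symmetry. apply sqrt_pow2, HS. }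
    assert (E2 : (eps * A = Sq ^ 2)%R) by (unfold A; field; lra).
    (* [2 (m q Sq) <= eps m^2 + A q^2 = eps m^2 + 2 A (1 + m)] and [2 A m <= eps m^2 + A^2 / eps] *)
    assert (F1 : (2 * (m * q * Sq) <= eps * m ^ 2 + A * q ^ 2)%R).
    { apply Rmult_le_reg_l with eps; [exact He|].
      replace (eps * (eps * m ^ 2 + A * q ^ 2))%R with ((eps * m) ^ 2 + (eps * A) * q ^ 2)%R by ring. rewrite E2.
      pose proof (pow2_ge_0 (eps * m - Sq * q)). nra. }
    assert (F2 : (2 * A * m <= eps * m ^ 2 + A ^ 2 / eps)%R).
    { apply Rmult_le_reg_l with eps; [exact He|].
      replace (eps * (eps * m ^ 2 + A ^ 2 / eps))%R with ((eps * m) ^ 2 + A ^ 2)%R by (field; lra).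
      pose proof (pow2_ge_0 (eps * m - A)). nra. }
    rewrite Hq in F1. unfold B.
    assert (E3 : (A ^ 2 / (2 * eps) = A ^ 2 / eps / 2)%R) by (field; lra). rewrite E3. lra.
Qed.

(** * Dirichlet series *)

Lemma lim_filterlim {T : Type} (F : (T -> Prop) -> Prop) {FF : Filter F} (f : T -> C) (l : C) :
  lim F f l <-> filterlim f F (locally (T := C_UniformSpace) l).
Proof.
  split.
  - intros H P HP. apply (lim_locally F f l P H HP).
  - intros H eps He. apply (H (fun y => Cmod (y - l) < eps)). apply locallyC. exists eps. auto.
Qed.

Lemma is_series_lim (u : nat -> C) l : is_series (K := C_AbsRing) (V := C_NormedModule) u l <->
  lim eventually (fun N => Csum u (seq 0 N)) l.
Proof.
  split.
  - intros H. assert (H2 : lim eventually (sum_n (G := C_AbelianMonoid) u) l) by (apply lim_filterlim; [typeclasses eauto|exact H]).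
    intros eps He. destruct (H2 eps He) as [N HN]. exists (S N). intros n Hn. destruct n as [|n]; [lia|].
    rewrite Csum_seq_sum_n. apply HN. lia.
  - intros H. apply (lim_filterlim eventually (sum_n (G := C_AbelianMonoid) u)).
    intros eps He. destruct (H eps He) as [N HN]. exists N. intros n Hn.
    rewrite <- Csum_seq_sum_n. apply HN. lia.
Qed.

Lemma is_series_Cser (u : nat -> C) l : ex_series (fun n => Cmod (u n)) ->
  is_series (K := C_AbsRing) (V := C_NormedModule) u l -> l = Cser u.
Proof.
  intros Ha H. apply is_series_lim in H. apply (lim_unique eventually _ _ _ H).
  apply (MTest_lim u (fun n => Cmod (u n))); [intros n; lra|exact Ha].
Qed.

Lemma Cmod_rpow x s : Cmod (rpow x s) = exp (Re s * ln x).
Proof. unfold rpow. rewrite Cmod_Cexp. f_equal. apply re_scal_r. Qed.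

Lemma rpow_neq_0 x s : rpow x s <> 0.
Proof. apply Cexp_neq_0. Qed.

Lemma rpow_opp x s : rpow x (- s) = / rpow x s.
Proof. unfold rpow. rewrite <- Cexp_opp. f_equal. ring. Qed.

Lemma ln_INR_ge_0 n : (1 <= n)%nat -> 0 <= ln (INR n).
Proof. intros H. rewrite <- ln_1. apply ln_le; [lra|]. apply (le_INR 1), H. Qed.

Lemma Cmod_rpow_opp_le n s sigma : (1 <= n)%nat -> sigma <= Re s ->
  Cmod (rpow (INR n) (- s)) <= Cmod (rpow (INR n) (- RtoC sigma)).
Proof.
  intros Hn H. rewrite !Cmod_rpow. apply exp_le. apply Rmult_le_compat_r; [apply ln_INR_ge_0, Hn|].
  change (- Re s <= - sigma). lra.
Qed.

Lemma Cd_rpow x s : Cd (rpow x) s (RtoC (ln x) * rpow x s).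
Proof.
  eapply Cd_eq; [apply (Cd_comp Cexp (fun s => s * RtoC (ln x))); [|apply Cd_Cexp]|].
  - apply Cd_mult; [apply Cd_id|apply Cd_const].
  - unfold rpow. ring.
Qed.

Lemma Cd_rpow_opp x s : Cd (fun s => rpow x (- s)) s (- RtoC (ln x) * rpow x (- s)).
Proof.
  eapply Cd_eq; [apply (Cd_comp (rpow x) (fun s => - s)); [apply Cd_opp, Cd_id|apply Cd_rpow]|]. ring.
Qed.

Section Selberg.
Variable L : selberg_class.

Definition bterm (k : nat) (s : C) : C := b_coef L (S (S k)) * rpow (INR (S (S k))) (- s).
Definition logL (s : C) : C := Cser (fun k => bterm k s).

Lemma Cexp_logL s : 1 < Re s -> Cexp (logL s) = L s.
Proof.
  intros Hs. destruct (@logL_dirichlet L s Hs) as [l [H1 H2]]. unfold logL.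
  rewrite <- (is_series_Cser (fun k => bterm k s) l (@logL_abs_convergent L s Hs) H1). exact H2.
Qed.

Lemma L_neq_0 s : 1 < Re s -> L s <> 0.
Proof. intros Hs. rewrite <- Cexp_logL by exact Hs. apply Cexp_neq_0. Qed.

Lemma logL_holo s : 1 < Re s -> dif logL s /\
  lim eventually (fun N => Csum (fun k => - (Lambda L (S (S k)) * rpow (INR (S (S k))) (- s))) (seq 0 N)) (C_derive logL s).
Proof.
  (* The disc of radius [r] around [s] stays in [Re z >= 1 + r], where the absolute series at the
     real point [1 + r] dominates. *)
  intros Hs. set (r := ((Re s - 1) / 2)%R). assert (Hr : 0 < r) by (unfold r; lra).
  assert (Hsig : 1 < Re (RtoC (1 + r))) by (simpl; lra).
  destruct (series_holomorphic bterm (fun k => Cmod (bterm k (RtoC (1 + r)))) s r Hr) with (w := s) as [D1 D2].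
  - intros k z _. apply filter_forall. intros w. apply dif_mult; [apply dif_const|]. eexists. apply Cd_rpow_opp.
  - intros k z Hz. unfold bterm. rewrite !Cmod_mult. apply Rmult_le_compat_l; [apply Cmod_ge_0|].
    apply Cmod_rpow_opp_le; [lia|]. pose proof (re_le_Cmod (z - s)) as H1. apply Rabs_le_between in H1.
    change (Re (z - s)) with (Re z - Re s)%R in H1. unfold r in *. lra.
  - apply (@logL_abs_convergent L (RtoC (1 + r)) Hsig).
  - replace (s - s) with (RtoC 0) by ring. rewrite Cmod_0. exact Hr.
  - split; [exact D1|]. refine (lim_ext_loc _ _ _ _ _ D2). apply filter_forall. intros N.
    apply Csum_ext. intros k _. apply C_derive_Cd. unfold Lambda. eapply Cd_eq.
    + apply Cd_scal, Cd_rpow_opp.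
    + ring.
Qed.

Lemma Cd_L s : 1 < Re s -> Cd L s (C_derive logL s * L s).
Proof.
  intros Hs. apply Cd_ext_loc with (fun s => Cexp (logL s)).
  - generalize (locally_Re_gt s 1 Hs). apply filter_imp. intros w Hw. apply Cexp_logL, Hw.
  - rewrite <- Cexp_logL, Cmult_comm by exact Hs. apply (Cd_comp Cexp logL); [|apply Cd_Cexp].
    apply dif_C_derive, logL_holo, Hs.
Qed.

Lemma log_derive_L s : 1 < Re s -> log_derive L s = C_derive logL s.
Proof. intros Hs. rewrite (log_derive_Cd _ _ _ (Cd_L s Hs)). field. apply L_neq_0, Hs. Qed.

Lemma Lambda_series s : 1 < Re s ->
  is_series (K := C_AbsRing) (V := C_NormedModule)
    (fun k => Lambda L (k + 2) / rpow (INR (k + 2)) s) (- log_derive L s).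
Proof.
  intros Hs. apply is_series_lim. rewrite log_derive_L by exact Hs.
  refine (lim_ext_loc _ _ _ _ _ (lim_opp _ _ _ (proj2 (logL_holo s Hs)))).
  apply filter_forall. intros N. generalize (seq 0 N). intros l.
  induction l as [|k l IH]; [simpl; ring|]. rewrite !Csum_cons, <- IH.
  replace (k + 2)%nat with (S (S k)) by lia. rewrite rpow_opp. unfold Cdiv. ring.
Qed.

(** The factor [ln n] is absorbed by [e ln n <= n^e]: with [Re s = 1 + 2 e], the terms are dominated
    by those of the series for [log L] at [1 + e]. *)
Lemma Lambda_abs s : 1 < Re s ->
  ex_series (fun k => Cmod (Lambda L (k + 2) / rpow (INR (k + 2)) s)).
Proof.
  intros Hs. set (e := ((Re s - 1) / 2)%R). assert (He : 0 < e) by (unfold e; lra).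
  assert (Hsig : 1 < Re (RtoC (1 + e))) by (simpl; lra).
  apply (ex_series_le (K := R_AbsRing) (V := R_CompleteNormedModule) _ (fun k => (/ e * Cmod (bterm k (RtoC (1 + e))))%R)).
  - intros k. replace (k + 2)%nat with (S (S k)) by lia.
    change (norm (Cmod (Lambda L (S (S k)) / rpow (INR (S (S k))) s))) with (Rabs (Cmod (Lambda L (S (S k)) / rpow (INR (S (S k))) s))).
    rewrite Rabs_pos_eq by apply Cmod_ge_0.
    unfold Cdiv. rewrite <- rpow_opp. unfold Lambda, bterm. rewrite !Cmod_mult.
    set (n := S (S k)). pose proof (ln_INR_ge_0 n ltac:(unfold n; lia)) as Hln.
    rewrite Cmod_R, Rabs_pos_eq by exact Hln. rewrite !Cmod_rpow.
    replace (/ e * (Cmod (b_coef L n) * exp (Re (- RtoC (1 + e)) * ln (INR n))))%R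
      with (Cmod (b_coef L n) * (/ e * exp (Re (- RtoC (1 + e)) * ln (INR n))))%R by ring.
    rewrite Rmult_assoc. apply Rmult_le_compat_l; [apply Cmod_ge_0|].
    change (Re (- s)) with (- Re s)%R. change (Re (- RtoC (1 + e))) with (- (1 + e))%R.
    apply Rle_trans with (/ e * exp (e * ln (INR n)) * exp (- Re s * ln (INR n)))%R.
    + apply Rmult_le_compat_r; [left; apply exp_pos|].
      apply Rmult_le_reg_l with e; [exact He|]. rewrite <- Rmult_assoc, Rinv_r, Rmult_1_l by lra.
      pose proof (exp_ineq1_le (e * ln (INR n))). lra.
    + rewrite Rmult_assoc, <- exp_plus. apply Rmult_le_compat_l; [left; apply Rinv_0_lt_compat, He|].
      apply exp_le. unfold e. right. field.
  - apply (ex_series_scal (V := R_NormedModule)). apply (@logL_abs_convergent L (RtoC (1 + e)) Hsig).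
Qed.

Lemma L_bounded : exists K, 0 < K /\ forall s, 2 <= Re s -> Cmod (L s) <= K.
Proof.
  assert (H2 : 1 < Re (RtoC 2)) by (simpl; lra).
  set (M := fun k => Cmod (a_coef L (S k) * rpow (INR (S k)) (- RtoC 2))).
  assert (HM : ex_series M) by apply (@L_abs_convergent L _ H2).
  exists (Series M + 1)%R. split.
  { pose proof (Rsum_M_le (fun k => RtoC (M k)) M) as H.
    specialize (H ltac:(intros n; cbv beta; rewrite Cmod_R, Rabs_pos_eq; [lra|apply Cmod_ge_0]) HM O). simpl in H. lra. }
  intros s Hs. pose proof (@L_dirichlet L s ltac:(lra)) as H. apply is_series_lim in H.
  replace (L s) with (L s - 0) by ring. apply Rle_trans with (Series M); [|lra].
  apply (lim_Cmod_le eventually _ _ _ _ H). apply filter_forall. intros N.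
  replace (Csum _ (seq 0 N) - 0) with (Csum (fun k => a_coef L (S k) * rpow (INR (S k)) (- s)) (seq 0 N)) by ring.
  eapply Rle_trans; [apply (Cmod_Csum_le _ M)|].
  - intros k _. unfold M. rewrite !Cmod_mult. apply Rmult_le_compat_l; [apply Cmod_ge_0|].
    apply Cmod_rpow_opp_le; [lia|exact Hs].
  - apply (Rsum_M_le (fun k => RtoC (M k)) M); [|exact HM].
    intros n. rewrite Cmod_R, Rabs_pos_eq; [lra|apply Cmod_ge_0].
Qed.

(** * The generating function as a Dirichlet series *)

Section GeneratingFunction.
Variable a : R -> C.
Hypothesis Ha : explicit_formula_coef L a.

Lemma ln_INR_pos n : (2 <= n)%nat -> 0 < ln (INR n).
Proof. intros H. rewrite <- ln_1. apply ln_increasing; [lra|]. apply (lt_INR 1). lia. Qed.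

Lemma freq_pos n : (2 <= n)%nat -> 0 < ln (INR n) / (2 * PI).
Proof. intros H. apply Rdiv_lt_0_compat; [apply ln_INR_pos, H|apply two_PI_pos]. Qed.

Lemma coef_0 : a 0%R = 0.
Proof.
  apply (proj2 Ha). intros n Hn. pose proof (freq_pos n Hn). split; lra.
Qed.

(** The weight [1 / sqrt n] of the coefficient and the exponential [exp (i z ln n)] combine to the
    power [n^(-(1/2 - i z))]. *)
Lemma generating_term_eq z n : (2 <= n)%nat ->
  generating_term a z (ln (INR n) / (2 * PI)) = 1 / (2 * RtoC PI) * (Lambda L n / rpow (INR n) (1 / 2 - Ci * z)).
Proof.
  intros Hn. unfold generating_term. rewrite (proj1 (proj1 Ha n Hn)).
  assert (Hn0 : 0 < INR n) by (apply lt_0_INR; lia).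
  pose proof PI_RGT_0 as HPI.
  assert (HPn : RtoC PI <> 0) by (intros E; apply RtoC_inj in E; lra).
  assert (H2 : RtoC 2 <> 0) by (intros E; apply RtoC_inj in E; lra).
  assert (Hs : 0 < sqrt (INR n)) by (apply sqrt_lt_R0, Hn0).
  assert (Hsn : RtoC (sqrt (INR n)) <> 0) by (intros E; apply RtoC_inj in E; lra).
  assert (Er : rpow (INR n) (1 / 2 - Ci * z) = RtoC (sqrt (INR n)) * / Cexp (Ci * z * RtoC (ln (INR n)))).
  { unfold rpow. rewrite <- Cexp_opp.
    replace (RtoC (sqrt (INR n))) with (Cexp (1 / 2 * RtoC (ln (INR n)))).
    - rewrite <- Cexp_plus. f_equal. ring.
    - replace (1 / 2 * RtoC (ln (INR n))) with (RtoC (/ 2 * ln (INR n))) by (rewrite RtoC_mult, RtoC_inv by lra; field; exact H2).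
      rewrite Cexp_RtoC. f_equal. rewrite <- Rpower_sqrt by exact Hn0. reflexivity. }
  rewrite Er.
  replace (2 * RtoC PI * Ci * RtoC (ln (INR n) / (2 * PI)) * z) with (Ci * z * RtoC (ln (INR n))).
  - rewrite !RtoC_mult. field. repeat split; try assumption. apply Cexp_neq_0.
  - rewrite RtoC_div by lra. rewrite RtoC_mult. field; repeat split; assumption.
Qed.

(** The condition [Im z > 1/2] puts [1/2 - i z] into the half-plane of absolute convergence; among
    all positive [lam] only the frequencies [ln n / (2 pi)] can carry a nonzero coefficient. *)
Lemma generating_usum z : 1 / 2 < Im z ->
  is_usum (fun lam : R => 0 < lam) (generating_term a z) (1 / (2 * RtoC PI) * (- log_derive L (1 / 2 - Ci * z))).
Proof.
  intros Hz.
  assert (Hs : 1 < Re (1 / 2 - Ci * z)).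
  { replace (Re (1 / 2 - Ci * z)) with (1 / 2 + Im z)%R by (destruct z; unfold Re, Im; simpl; field). lra. }
  pose proof two_PI_pos as HP.
  apply (is_usum_series _ _ (fun k => (ln (INR (k + 2)) / (2 * PI))%R)).
  - intros i j E. apply Rmult_eq_reg_r in E; [|apply Rgt_not_eq, Rinv_0_lt_compat, HP].
    apply ln_inv in E; [|apply lt_0_INR; lia|apply lt_0_INR; lia]. apply INR_eq in E. lia.
  - intros k. apply freq_pos. lia.
  - intros x Hx Hf. apply NNPP. intros Hn. apply Hf. unfold generating_term.
    replace (a x) with (RtoC 0); [ring|]. symmetry. apply (proj2 Ha). intros n Hn2. pose proof (freq_pos n Hn2). split; [|lra].
    intros E. apply Hn. exists (n - 2)%nat. replace (n - 2 + 2)%nat with n by lia. exact E.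
  - eapply ex_series_ext; [|apply (ex_series_scal (V := R_NormedModule) (Cmod (1 / (2 * RtoC PI))) _ (Lambda_abs _ Hs))].
    intros k. cbv beta. rewrite (generating_term_eq z (k + 2)) by lia. rewrite Cmod_mult. reflexivity.
  - apply is_series_lim. pose proof (Lambda_series _ Hs) as H. apply is_series_lim in H.
    refine (lim_ext_loc _ _ _ _ _ (lim_mult _ _ _ _ _ (lim_const _ (1 / (2 * RtoC PI))) H)).
    apply filter_forall. intros N. rewrite <- Csum_scal. apply Csum_ext. intros k _.
    symmetry. apply generating_term_eq. lia.
Qed.

Lemma generating_function_eq z : 1 / 2 < Im z ->
  generating_function a z = - (1 / (2 * RtoC PI)) * log_derive L (1 / 2 - Ci * z).
Proof.
  intros Hz. unfold generating_function. rewrite coef_0, (usum_eq _ _ _ (generating_usum z Hz)). ring.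
Qed.
End GeneratingFunction.
End Selberg.

(** * Growth and the Phragmén-Lindelöf principle *)

Lemma max_principle_rect f M a b c d : 0 <= M -> a < b -> c < d ->
  (forall z, rect a b c d z -> locally z (dif f)) ->
  (forall z, rect a b c d z -> fst z = a \/ fst z = b \/ snd z = c \/ snd z = d -> Cmod (f z) <= M) ->
  forall z, rect a b c d z -> Cmod (f z) <= M.
Proof.
  intros HM Hab Hcd Hf HB.
  apply (max_principle (rect a b c d) (fun z => fst z = a \/ fst z = b \/ snd z = c \/ snd z = d) f M a b c d); try lra.
  - intros z Hz. exact Hz.
  - intros z Hz. unfold rect in Hz.
    assert (H : fst z < a \/ b < fst z \/ snd z < c \/ d < snd z) by lra.
    destruct H as [H|[H|[H|H]]].
    + generalize (locally_lt Re z a (cts_re _ _ (cts_id z)) H). apply filter_imp. intros w Hw [H1 H2]. unfold Re in Hw. lra.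
    + generalize (locally_gt Re z b (cts_re _ _ (cts_id z)) H). apply filter_imp. intros w Hw [H1 H2]. unfold Re in Hw. lra.
    + generalize (locally_lt Im z c (cts_im _ _ (cts_id z)) H). apply filter_imp. intros w Hw [H1 H2]. unfold Im in Hw. lra.
    + generalize (locally_gt Im z d (cts_im _ _ (cts_id z)) H). apply filter_imp. intros w Hw [H1 H2]. unfold Im in Hw. lra.
  - intros z Hz. apply dif_cts, (locally_singleton _ _ (Hf z Hz)).
  - intros z Hz. destruct Hz as [H1 H2].
    destruct (excluded_middle_informative (fst z = a \/ fst z = b \/ snd z = c \/ snd z = d)) as [E|E]; [left; exact E|right].
    assert (I : a < fst z < b /\ c < snd z < d).
    { repeat split; apply Rnot_le_lt; intros Hle; apply E; lra. }
    destruct I as [[I1 I2] [I3 I4]].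
    set (r := Rmin (Rmin (fst z - a) (b - fst z)) (Rmin (snd z - c) (d - snd z))).
    pose proof (Rmin_l (Rmin (fst z - a) (b - fst z)) (Rmin (snd z - c) (d - snd z))) as M1.
    pose proof (Rmin_r (Rmin (fst z - a) (b - fst z)) (Rmin (snd z - c) (d - snd z))) as M2. fold r in M1, M2.
    pose proof (Rmin_l (fst z - a) (b - fst z)). pose proof (Rmin_r (fst z - a) (b - fst z)).
    pose proof (Rmin_l (snd z - c) (d - snd z)). pose proof (Rmin_r (snd z - c) (d - snd z)).
    exists r. split; [unfold r; repeat apply Rmin_pos; lra|]. intros w Hw.
    assert (HR : rect a b c d w).
    { pose proof (re_le_Cmod (w - z)) as G1. pose proof (im_le_Cmod (w - z)) as G2.
      apply Rabs_le_between in G1. apply Rabs_le_between in G2.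
      change (Re (w - z)) with (fst w - fst z)%R in G1. change (Im (w - z)) with (snd w - snd z)%R in G2.
      split; lra. }
    split; [exact HR|apply dif_almost, Hf, HR].
  - intros z Hz. apply HB, Hz.
Qed.

Lemma exp_ge_pow (n : nat) x : 0 <= x -> (x / INR (S n)) ^ (S n) <= exp x.
Proof.
  intros Hx. pose proof (INR_S_pos n) as Hn.
  assert (E : exp x = (exp (x / INR (S n)) ^ (S n))%R).
  { assert (K : forall m y, (exp y ^ m = exp (INR m * y))%R).
    { intros m y. induction m as [|m IH]; [simpl; rewrite Rmult_0_l, exp_0; reflexivity|].
      rewrite S_INR. simpl. rewrite IH, <- exp_plus. f_equal. ring. }
    rewrite K. f_equal. field. lra. }
  rewrite E. apply pow_incr. split; [apply Rdiv_le_0_compat; lra|].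
  pose proof (exp_ineq1_le (x / INR (S n))). lra.
Qed.

(** The degree [k] is arbitrary because only finite order is known; [exp x >= (x / (k + 1))^(k + 1)]
    supplies one power of [T] to spare. *)
Lemma exp_beats_pow (k : nat) A B a d : 0 <= A -> 0 < a -> 0 < d ->
  exists T0, forall T, T0 <= T -> A * (T + 6) ^ k + B <= d * exp (a * T).
Proof.
  intros HA Ha Hd. set (N := INR (S k)). assert (HN : 0 < N) by apply INR_S_pos.
  set (q := (d * (a / N) ^ (S k))%R).
  assert (Hq : 0 < q) by (apply Rmult_lt_0_compat; [exact Hd|apply pow_lt, Rdiv_lt_0_compat; assumption]).
  set (A2 := (A * 2 ^ k + Rabs B)%R).
  assert (HA2 : 0 <= A2).
  { assert (0 <= A * 2 ^ k)%R by (apply Rmult_le_pos; [exact HA|apply pow_le; lra]). unfold A2. pose proof (Rabs_pos B). lra. }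
  assert (HAq : 0 <= A2 / q) by (apply Rdiv_le_0_compat; assumption).
  exists (6 + A2 / q)%R. intros T HT.
  assert (HT1 : 1 <= T ^ k) by (apply pow_R1_Rle; lra).
  apply Rle_trans with (A2 * T ^ k)%R.
  - unfold A2. rewrite Rmult_plus_distr_r. apply Rplus_le_compat.
    + rewrite Rmult_assoc, <- Rpow_mult_distr. apply Rmult_le_compat_l; [exact HA|]. apply pow_incr. lra.
    + apply Rle_trans with (Rabs B * 1)%R; [rewrite Rmult_1_r; apply Rle_abs|]. apply Rmult_le_compat_l; [apply Rabs_pos|exact HT1].
  - apply Rle_trans with (q * T * T ^ k)%R.
    + apply Rmult_le_compat_r; [lra|]. apply Rle_trans with (q * (A2 / q))%R; [right; field; lra|]. apply Rmult_le_compat_l; lra.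
    + replace (q * T * T ^ k)%R with (d * (a * T / N) ^ (S k))%R.
      * apply Rmult_le_compat_l; [lra|]. apply exp_ge_pow. apply Rmult_le_pos; lra.
      * unfold q. replace (a * T / N)%R with (a / N * T)%R by (field; lra). rewrite Rpow_mult_distr. simpl. ring.
Qed.

(** This is [cos (pi w / 6)]. For [|Re w| <= 3/2] the angle [pi Re w / 6] stays within [pi / 4], so
    the real part is at least a quarter of [exp (pi |Im w| / 6)]. On the strip of width 3 its
    exponential therefore outgrows every function of finite order. *)
Definition Ccosh_aux (w : C) : C := (Cexp (Ci * (RtoC (PI / 6) * w)) + Cexp (- (Ci * (RtoC (PI / 6) * w)))) / 2.

Lemma Re_Ccosh_aux w : Re (Ccosh_aux w) = (cos (PI / 6 * Re w) * ((exp (PI / 6 * Im w) + exp (- (PI / 6 * Im w))) / 2))%R.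
Proof.
  unfold Ccosh_aux. replace ((Cexp (Ci * (RtoC (PI / 6) * w)) + Cexp (- (Ci * (RtoC (PI / 6) * w)))) / 2)
    with (RtoC (/ 2) * (Cexp (Ci * (RtoC (PI / 6) * w)) + Cexp (- (Ci * (RtoC (PI / 6) * w))))).
  2:{ rewrite RtoC_inv by lra. field. }
  rewrite re_scal_l. destruct w as [x y]. unfold Cexp, Re, Im. simpl.
  replace (0 * (PI / 6 * x - 0 * y) - 1 * (PI / 6 * y + 0 * x))%R with (- (PI / 6 * y))%R by ring.
  replace (- - (PI / 6 * y))%R with (PI / 6 * y)%R by ring.
  replace (0 * (PI / 6 * y + 0 * x) + 1 * (PI / 6 * x - 0 * y))%R with (PI / 6 * x)%R by ring.
  rewrite cos_neg. field.
Qed.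

Lemma Re_Ccosh_aux_ge w : Rabs (Re w) <= 3 / 2 -> exp (PI / 6 * Rabs (Im w)) / 4 <= Re (Ccosh_aux w).
Proof.
  intros H. rewrite Re_Ccosh_aux. pose proof PI_RGT_0 as HP.
  assert (Hc : / 2 <= cos (PI / 6 * Re w)).
  { rewrite <- (Rabs_pos_eq (PI / 6)) by lra.
    assert (E : cos (Rabs (PI / 6) * Re w) = cos (PI / 6 * Rabs (Re w))).
    { rewrite Rabs_pos_eq by lra. unfold Rabs. destruct Rcase_abs; [|reflexivity].
      rewrite <- cos_neg. f_equal. ring. }
    rewrite E.
    replace (/ 2)%R with (1 / 2)%R by field. rewrite <- cos_PI3.
    pose proof (Rabs_pos (Re w)) as Hp.
    assert (PI / 6 * Rabs (Re w) <= PI / 6 * (3 / 2))%R by (apply Rmult_le_compat_l; lra).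
    assert (0 <= PI / 6 * Rabs (Re w))%R by (apply Rmult_le_pos; lra).
    apply cos_decr_1; lra. }
  set (y := Im w) in *.
  assert (He : exp (PI / 6 * Rabs y) <= exp (PI / 6 * y) + exp (- (PI / 6 * y))).
  { pose proof (exp_pos (PI / 6 * y)). pose proof (exp_pos (- (PI / 6 * y))).
    unfold Rabs. destruct Rcase_abs; [replace (PI / 6 * - y)%R with (- (PI / 6 * y))%R by ring|]; lra. }
  pose proof (exp_pos (PI / 6 * Rabs y)).
  apply Rle_trans with (/ 2 * ((exp (PI / 6 * y) + exp (- (PI / 6 * y))) / 2))%R; [lra|].
  apply Rmult_le_compat_r; lra.
Qed.

Lemma entire_Ccosh_aux : entire_dif Ccosh_aux.
Proof.
  intros w. unfold Ccosh_aux. apply dif_mult; [|apply dif_const].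
  apply dif_plus; apply (dif_comp Cexp); try apply dif_Cexp; [|apply dif_opp];
  (apply dif_mult; [apply dif_const|apply dif_mult; [apply dif_const|apply dif_id]]).
Qed.

Lemma Cmod_le_xy (z : C) : Cmod z <= Rabs (Re z) + Rabs (Im z).
Proof. destruct z as [x y]. apply Cmod_le_Rabs. Qed.

(* Phragmen-Lindelof on the strip [-1 <= Re s <= 2], with auxiliary function [exp (- d cos (pi/6 (s - 1/2)))]. *)
Lemma phragmen_lindelof Y M K (k : nat) A : 0 < M -> 0 < K -> 0 <= A -> entire_dif Y ->
  (forall s, -1 <= Re s <= 2 -> Cmod (Y s) <= K * exp (A * (2 + Cmod s) ^ k)) ->
  (forall s, Re s = (-1)%R \/ Re s = 2%R -> Cmod (Y s) <= M) ->
  forall s, -1 <= Re s <= 2 -> Cmod (Y s) <= M.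
Proof.
  intros HM HK HA HY Hg Hb s Hs. pose proof PI_RGT_0 as HP.
  assert (Hdelta : forall d, 0 < d -> Cmod (Y s) <= M * exp (d * Re (Ccosh_aux (s - 1 / 2)))).
  { intros d Hd.
    destruct (exp_beats_pow k A (Rabs (ln (K / M))) (PI / 6) (d / 4) HA ltac:(lra) ltac:(lra)) as [T0 HT0].
    (* The rectangle of height [T] contains [s], and on its horizontal sides the factor with
       [Ccosh_aux] outweighs the finite-order bound. *)
    set (T := (Rabs T0 + Rabs (Im s) + 1)%R).
    assert (HT : T0 <= T) by (unfold T; pose proof (Rle_abs T0); pose proof (Rabs_pos (Im s)); lra).
    assert (HTp : 1 <= T) by (unfold T; pose proof (Rabs_pos T0); pose proof (Rabs_pos (Im s)); lra).
    specialize (HT0 T HT).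
    set (F := fun s => Y s * Cexp (- (RtoC d * Ccosh_aux (s - 1 / 2)))).
    assert (HF : entire_dif F).
    { intros w. apply dif_mult; [apply HY|]. apply (dif_comp Cexp); [|apply dif_Cexp].
      apply dif_opp, dif_mult; [apply dif_const|]. apply (dif_comp Ccosh_aux); [|apply entire_Ccosh_aux].
      apply dif_minus; [apply dif_id|apply dif_const]. }
    assert (EF : forall w, Cmod (F w) = (Cmod (Y w) * exp (- (d * Re (Ccosh_aux (w - 1 / 2)))))%R).
    { intros w. unfold F. rewrite Cmod_mult, Cmod_Cexp. do 2 f_equal.
      change (Re (- (RtoC d * Ccosh_aux (w - 1 / 2)))) with (- Re (RtoC d * Ccosh_aux (w - 1 / 2)))%R. rewrite re_scal_l. reflexivity. }
    assert (Hre : forall w, -1 <= Re w <= 2 -> exp (PI / 6 * Rabs (Im w)) / 4 <= Re (Ccosh_aux (w - 1 / 2))).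
    { intros w Hw.
      assert (E1 : Re (w - 1 / 2) = (Re w - 1 / 2)%R) by (destruct w; unfold Re; simpl; field).
      assert (E2 : Im (w - 1 / 2) = Im w) by (destruct w; unfold Im; simpl; field).
      rewrite <- E2. apply Re_Ccosh_aux_ge. rewrite E1. apply Rabs_le. lra. }
    assert (HB : Cmod (F s) <= M).
    { apply (max_principle_rect F M (-1) 2 (- T) T); try lra.
      - intros w _. apply entire_locally, HF.
      - intros w [H1 H2] Hw. rewrite EF.
        pose proof (Hre w H1) as Hrw. pose proof (exp_pos (PI / 6 * Rabs (Im w))) as Hep.
        destruct Hw as [Hw|[Hw|Hw]].
        + apply Rle_trans with (M * 1)%R; [|lra]. apply Rmult_le_compat; [apply Cmod_ge_0|left; apply exp_pos|apply Hb; auto|].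
          apply Rle_trans with (exp 0); [|rewrite exp_0; lra]. apply exp_le.
          assert (0 <= d * Re (Ccosh_aux (w - 1 / 2)))%R by (apply Rmult_le_pos; lra). lra.
        + apply Rle_trans with (M * 1)%R; [|lra]. apply Rmult_le_compat; [apply Cmod_ge_0|left; apply exp_pos|apply Hb; auto|].
          apply Rle_trans with (exp 0); [|rewrite exp_0; lra]. apply exp_le.
          assert (0 <= d * Re (Ccosh_aux (w - 1 / 2)))%R by (apply Rmult_le_pos; lra). lra.
        + assert (Ha : Rabs (Im w) = T).
          { unfold Im. destruct Hw as [->| ->]; [rewrite Rabs_Ropp|]; apply Rabs_pos_eq; lra. }
          rewrite Ha in Hrw.
          assert (Hmw : Cmod w <= T + 2).
          { eapply Rle_trans; [apply Cmod_le_xy|]. rewrite Ha.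
            assert (Rabs (Re w) <= 2) by (apply Rabs_le; unfold Re; lra). lra. }
          eapply Rle_trans; [apply Rmult_le_compat_r; [left; apply exp_pos|apply Hg, H1]|].
          rewrite Rmult_assoc, <- exp_plus.
          assert (Hpw : (A * (2 + Cmod w) ^ k <= A * (T + 6) ^ k)%R).
          { apply Rmult_le_compat_l; [exact HA|]. apply pow_incr. pose proof (Cmod_ge_0 w). lra. }
          assert (Hdr : (d / 4 * exp (PI / 6 * T) <= d * Re (Ccosh_aux (w - 1 / 2)))%R).
          { replace (d / 4 * exp (PI / 6 * T))%R with (d * (exp (PI / 6 * T) / 4))%R by field. apply Rmult_le_compat_l; lra. }
          assert (HKM : 0 < K / M) by (apply Rdiv_lt_0_compat; assumption).
          pose proof (Rle_abs (ln (K / M))) as Hla.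
          apply Rle_trans with (K * exp (- ln (K / M)))%R.
          * apply Rmult_le_compat_l; [lra|]. apply exp_le. lra.
          * rewrite exp_Ropp, exp_ln by exact HKM. right. field. split; lra.
      - split; [exact Hs|]. pose proof (Rle_abs (Im s)). pose proof (Rle_abs (- Im s)). rewrite Rabs_Ropp in H0.
        pose proof (Rabs_pos T0). change (snd s) with (Im s). unfold T. lra. }
    rewrite EF in HB. apply Rmult_le_reg_r with (exp (- (d * Re (Ccosh_aux (s - 1 / 2))))); [apply exp_pos|].
    rewrite Rmult_assoc, <- exp_plus. replace (d * Re (Ccosh_aux (s - 1 / 2)) + - (d * Re (Ccosh_aux (s - 1 / 2))))%R with 0%R by ring.
    rewrite exp_0, Rmult_1_r. exact HB. }
  (* With [q] fixed, the bound [M exp (d q)] holds for every [d > 0]. If [|Y s|] exceeded [M], the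
     [d] chosen below would give [d q <= g / 2], which is less than the gap [g = ln (|Y s| / M)]. *)
  apply Rnot_lt_le. intros Hlt. set (q := Re (Ccosh_aux (s - 1 / 2))) in *.
  set (g := ln (Cmod (Y s) / M)).
  assert (Hr : 1 < Cmod (Y s) / M).
  { apply Rmult_lt_reg_r with M; [exact HM|]. unfold Rdiv. rewrite Rmult_assoc, Rinv_l by lra. lra. }
  assert (Hg0 : 0 < g) by (unfold g; rewrite <- ln_1; apply ln_increasing; lra).
  pose proof (Rabs_pos q) as Hq0.
  assert (Hd : 0 < g / (2 * (Rabs q + 1))) by (apply Rdiv_lt_0_compat; lra).
  specialize (Hdelta _ Hd).
  assert (Hx : (g / (2 * (Rabs q + 1)) * q <= g / 2)%R).
  { apply Rle_trans with (g / (2 * (Rabs q + 1)) * (Rabs q + 1))%R.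
    - apply Rmult_le_compat_l; [lra|]. pose proof (Rle_abs q). lra.
    - right. field. lra. }
  assert (Hy : exp (g / (2 * (Rabs q + 1)) * q) < Cmod (Y s) / M).
  { rewrite <- (exp_ln (Cmod (Y s) / M)) by lra. fold g. apply exp_increasing. lra. }
  apply (Rmult_lt_compat_l M) in Hy; [|exact HM].
  replace (M * (Cmod (Y s) / M))%R with (Cmod (Y s)) in Hy by (field; lra). lra.
Qed.

(** The growth [o(|s|^2)] in the exponent on a part of the plane. It is closed under products, so
    the factors of the completed function are estimated one by one. *)
Definition small_on (D : C -> Prop) (f : C -> C) : Prop :=
  forall eps, 0 < eps -> exists K, 0 < K /\ forall s, D s -> Cmod (f s) <= K * exp (eps * Cmod s ^ 2).

Lemma small_on_mult D f g : small_on D f -> small_on D g -> small_on D (fun s => f s * g s).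
Proof.
  intros Hf Hg eps He. destruct (Hf (eps / 2)%R) as [K1 [K1p H1]]; [lra|].
  destruct (Hg (eps / 2)%R) as [K2 [K2p H2]]; [lra|].
  exists (K1 * K2)%R. split; [apply Rmult_lt_0_compat; assumption|]. intros s Hs.
  rewrite Cmod_mult. replace (eps * Cmod s ^ 2)%R with (eps / 2 * Cmod s ^ 2 + eps / 2 * Cmod s ^ 2)%R by field.
  rewrite exp_plus.
  replace (K1 * K2 * (exp (eps / 2 * Cmod s ^ 2) * exp (eps / 2 * Cmod s ^ 2)))%R with
    ((K1 * exp (eps / 2 * Cmod s ^ 2)) * (K2 * exp (eps / 2 * Cmod s ^ 2)))%R by ring.
  apply Rmult_le_compat; try apply Cmod_ge_0; auto.
Qed.

Lemma small_on_bounded D f B : 0 < B -> (forall s, D s -> Cmod (f s) <= B) -> small_on D f.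
Proof.
  intros HB H eps He. exists B. split; [exact HB|]. intros s Hs. eapply Rle_trans; [apply H, Hs|].
  rewrite <- (Rmult_1_r B) at 1. apply Rmult_le_compat_l; [lra|]. rewrite <- exp_0. apply exp_le.
  apply Rmult_le_pos; [lra|apply pow2_ge_0].
Qed.

Lemma small_on_exp D f c : 0 <= c -> (forall s, D s -> Cmod (f s) <= exp (c * Cmod s)) -> small_on D f.
Proof.
  intros Hc H eps He. exists (exp (c ^ 2 / (4 * eps))). split; [apply exp_pos|]. intros s Hs.
  eapply Rle_trans; [apply H, Hs|]. rewrite <- exp_plus. apply exp_le. set (x := Cmod s).
  apply Rmult_le_reg_l with (4 * eps)%R; [lra|].
  replace (4 * eps * (c ^ 2 / (4 * eps) + eps * x ^ 2))%R with (c ^ 2 + (2 * eps * x) ^ 2)%R by (field; lra).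
  pose proof (pow2_ge_0 (c - 2 * eps * x)). nra.
Qed.

Lemma small_on_pow D f n : small_on D f -> small_on D (fun s => f s ^ n).
Proof.
  intros Hf. induction n as [|n IH].
  - apply small_on_bounded with 1%R; [lra|]. intros s _. simpl. rewrite Cmod_1. lra.
  - apply (small_on_mult D f (fun s => f s ^ n)); assumption.
Qed.

Lemma small_on_linear D a : small_on D (fun s => s - a).
Proof.
  intros eps He. destruct (small_on_exp D (fun s => s) 1 ltac:(lra)) with (eps := eps) as [K [HK H]].
  - intros s _. rewrite Rmult_1_l. pose proof (exp_ineq1_le (Cmod s)). lra.
  - exact He.
  - exists (K + Cmod a)%R. pose proof (Cmod_ge_0 a). split; [lra|]. intros s Hs.
    eapply Rle_trans; [apply Cmod_triangle|]. rewrite Cmod_opp, Rmult_plus_distr_r.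
    apply Rplus_le_compat; [apply H, Hs|]. rewrite <- (Rmult_1_r (Cmod a)) at 1. apply Rmult_le_compat_l; [lra|].
    rewrite <- exp_0. apply exp_le. apply Rmult_le_pos; [lra|apply pow2_ge_0].
Qed.

Lemma small_on_Cprod {T : Type} D (f : T -> C -> C) l : (forall x, In x l -> small_on D (f x)) ->
  small_on D (fun s => Cprod (fun x => f x s) l).
Proof.
  induction l as [|x l IH]; intros H.
  - apply small_on_bounded with 1%R; [lra|]. intros s _. simpl. rewrite Cmod_1. lra.
  - apply (small_on_mult D (f x) (fun s => Cprod (fun x => f x s) l)); [apply H; left; reflexivity|].
    apply IH. intros y Hy. apply H. right. exact Hy.
Qed.

Lemma small_on_rpow D Q : small_on D (rpow Q).
Proof.
  apply small_on_exp with (Rabs (ln Q)); [apply Rabs_pos|]. intros s _. rewrite Cmod_rpow. apply exp_le.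
  eapply Rle_trans; [apply Rle_abs|]. rewrite Rabs_mult, Rmult_comm. apply Rmult_le_compat_l; [apply Rabs_pos|apply re_le_Cmod].
Qed.

Lemma small_on_CGamma (lam : R) (mu : C) a : 0 < lam -> 0 <= Re mu -> 0 < a ->
  small_on (fun s => a <= Re s) (fun s => CGamma (RtoC lam * s + mu)).
Proof.
  intros Hl Hm Ha eps He.
  assert (Hl2 : 0 < lam ^ 2) by (apply pow_lt, Hl).
  set (e := (eps / (2 * lam ^ 2))%R).
  assert (He2 : 0 < e) by (apply Rdiv_lt_0_compat; lra).
  assert (Hla : 0 < lam * a) by (apply Rmult_lt_0_compat; assumption).
  destruct (CGamma_growth (lam * a) e Hla He2) as [K [HK H]].
  exists (K * exp (2 * e * Cmod mu ^ 2))%R. split; [apply Rmult_lt_0_compat; [exact HK|apply exp_pos]|].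
  intros s Hs. eapply Rle_trans; [apply H|].
  - change (Re (RtoC lam * s + mu)) with (Re (RtoC lam * s) + Re mu)%R. rewrite re_scal_l.
    assert (lam * a <= lam * Re s)%R by (apply Rmult_le_compat_l; lra). lra.
  - rewrite Rmult_assoc, <- exp_plus. apply Rmult_le_compat_l; [lra|]. apply exp_le.
    replace (eps * Cmod s ^ 2)%R with (e * (2 * (lam * Cmod s) ^ 2))%R by (unfold e; field; lra).
    replace (2 * e * Cmod mu ^ 2)%R with (e * (2 * Cmod mu ^ 2))%R by ring. rewrite <- Rmult_plus_distr_l.
    apply Rmult_le_compat_l; [lra|].
    assert (Ht : Cmod (RtoC lam * s + mu) <= lam * Cmod s + Cmod mu).
    { eapply Rle_trans; [apply Cmod_triangle|]. rewrite Cmod_mult, Cmod_R, Rabs_pos_eq; lra. }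
    apply Rle_trans with ((lam * Cmod s + Cmod mu) ^ 2)%R; [apply pow_incr; split; [apply Cmod_ge_0|exact Ht]|].
    pose proof (pow2_ge_0 (lam * Cmod s - Cmod mu)). nra.
Qed.

(** * The completed function *)

Lemma Cmod_reflect_sub s w : Cmod (1 - Cconj w - (1 - Cconj s)) = Cmod (w - s).
Proof.
  replace (1 - Cconj w - (1 - Cconj s)) with (- Cconj (w - s)) by (rewrite Cminus_conj; ring).
  rewrite Cmod_opp, Cmod_conj. reflexivity.
Qed.

(** The two conjugations compensate, so the reflected function is again holomorphic; the sign comes
    from [1 - conj s]. *)
Lemma Cd_reflect f s l : Cd f (1 - Cconj s) l -> Cd (fun s => Cconj (f (1 - Cconj s))) s (- Cconj l).
Proof.
  intros H eps He. specialize (H eps He). apply locallyC in H. destruct H as [d [Hd H]].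
  apply locallyC. exists d. split; [exact Hd|]. intros w Hw.
  specialize (H (1 - Cconj w)). rewrite Cmod_reflect_sub in H. specialize (H Hw).
  replace (Cconj (f (1 - Cconj w)) - Cconj (f (1 - Cconj s)) - - Cconj l * (w - s)) with
    (Cconj (f (1 - Cconj w) - f (1 - Cconj s) - l * (1 - Cconj w - (1 - Cconj s)))).
  - rewrite Cmod_conj. exact H.
  - rewrite !Cminus_conj, Cmult_conj, !Cminus_conj, !Cconj_conj. ring.
Qed.

Lemma Re_reflect s : Re (1 - Cconj s) = (1 - Re s)%R.
Proof. destruct s; unfold Re; simpl; ring. Qed.

Lemma reflect_invol s : 1 - Cconj (1 - Cconj s) = s.
Proof.
  rewrite Cminus_conj, Cconj_conj. replace (Cconj 1) with (RtoC 1) by (apply injective_projections; simpl; ring). ring.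
Qed.

(** Integers [k > |w| + 1] keep distance 1, and only finitely many others remain. This makes the
    points excluded from the functional equation isolated. *)
Lemma nat_shift_gap (w : C) : exists d, 0 < d /\ forall k : nat, w <> - RtoC (INR k) -> d <= Cmod (w + RtoC (INR k)).
Proof.
  assert (K : forall N : nat, exists d, 0 < d /\ forall k : nat, (k < N)%nat -> w <> - RtoC (INR k) -> d <= Cmod (w + RtoC (INR k))).
  { intros N. induction N as [|N [d [Hd H]]].
    - exists 1%R. split; [lra|]. intros k Hk. lia.
    - destruct (excluded_middle_informative (w = - RtoC (INR N))) as [E|E].
      + exists d. split; [exact Hd|]. intros k Hk Hw. destruct (Nat.eq_dec k N) as [->|]; [contradiction|]. apply H; [lia|exact Hw].
      + assert (E2 : 0 < Cmod (w + RtoC (INR N))).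
        { apply Cmod_gt_0. intros E3. apply E. replace w with (w + RtoC (INR N) - RtoC (INR N)) by ring. rewrite E3. ring. }
        exists (Rmin d (Cmod (w + RtoC (INR N)))). split; [apply Rmin_pos; assumption|]. intros k Hk Hw.
        destruct (Nat.eq_dec k N) as [->|]; [apply Rmin_r|]. eapply Rle_trans; [apply Rmin_l|]. apply H; [lia|exact Hw]. }
  destruct (nfloor_ex (Cmod w + 1)) as [N [_ HN]]; [pose proof (Cmod_ge_0 w); lra|].
  destruct (K (S N)) as [d [Hd H]]. exists (Rmin d 1). split; [apply Rmin_pos; lra|]. intros k Hw.
  destruct (le_lt_dec (S N) k) as [Hk|Hk].
  - eapply Rle_trans; [apply Rmin_r|]. apply le_INR in Hk. rewrite S_INR in Hk.
    pose proof (Cmod_triangle (w + RtoC (INR k)) (- w)) as Ht. rewrite Cmod_opp in Ht.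
    replace (w + RtoC (INR k) + - w) with (RtoC (INR k)) in Ht by ring.
    rewrite Cmod_R, Rabs_pos_eq in Ht by apply pos_INR. lra.
  - eapply Rle_trans; [apply Rmin_l|]. apply H; assumption.
Qed.

Section Xi.
Variable L : selberg_class.
Variable E : C -> C.
Hypothesis HEe : entire E.
Hypothesis HEo : finite_order E.
Hypothesis HEL : forall s : C, s <> 1 \/ m_pole L = 0%nat -> E s = (s - 1) ^ m_pole L * L s.

Notation m := (m_pole L).

Lemma dif_E s : dif E s.
Proof. apply (locally_singleton _ _ (proj1 (holomorphic_at_dif E s) (HEe s))). Qed.

Lemma gam_pos p : In p (gammas L) -> 0 < fst p /\ 0 <= Re (snd p).
Proof. apply gammas_pos. Qed.

Definition gprod (s : C) : C := Cprod (fun p : R * C => CGamma (RtoC (fst p) * s + snd p)) (gammas L).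

Lemma Re_garg p s : In p (gammas L) -> 0 < Re s -> 0 < Re (RtoC (fst p) * s + snd p).
Proof.
  intros Hp Hs. destruct (gam_pos p Hp) as [H1 H2].
  change (Re (RtoC (fst p) * s + snd p)) with (Re (RtoC (fst p) * s) + Re (snd p))%R. rewrite re_scal_l.
  assert (0 < fst p * Re s)%R by (apply Rmult_lt_0_compat; assumption). lra.
Qed.

Lemma Cd_garg (p : R * C) s : Cd (fun s => RtoC (fst p) * s + snd p) s (RtoC (fst p)).
Proof.
  eapply Cd_eq; [apply Cd_plus; [apply Cd_scal, Cd_id|apply Cd_const]|]. ring.
Qed.

Lemma Cd_gfactor (p : R * C) s : In p (gammas L) -> 0 < Re s ->
  Cd (fun s => CGamma (RtoC (fst p) * s + snd p)) s
     (digamma (RtoC (fst p) * s + snd p) * CGamma (RtoC (fst p) * s + snd p) * RtoC (fst p)).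
Proof.
  intros Hp Hs. apply (Cd_comp CGamma (fun s => RtoC (fst p) * s + snd p)); [apply Cd_garg|].
  apply Cd_CGamma, Re_garg; assumption.
Qed.

Lemma dif_gprod s : 0 < Re s -> dif gprod s.
Proof.
  intros Hs. apply (dif_Cprod (fun (p : R * C) s => CGamma (RtoC (fst p) * s + snd p))).
  intros p Hp. eexists. apply Cd_gfactor; assumption.
Qed.

Lemma gprod_neq_0 s : 0 < Re s -> gprod s <> 0.
Proof. intros Hs. apply Cprod_neq_0. intros p Hp. apply CGamma_neq_0, Re_garg; assumption. Qed.

(** Everything in [xi] except [E = (s - 1)^m L], which absorbs the pole at 1; the sign [(-1)^m]
    comes from writing [(1 - s)^m] through [(s - 1)^m]. *)
Definition Xp_factor (s : C) : C := s ^ m * (- (1)) ^ m * (rpow (Qcond L) s * gprod s).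
Definition Xp (s : C) : C := Xp_factor s * E s.
Definition Xm (s : C) : C := omega L * Cconj (Xp (1 - Cconj s)).
(** The completed function glued from two formulas: for [Re s > 0] the Gamma factors have no poles,
    and for [Re s < 1] the functional equation reflects to that side. Agreement on the open strip
    ([Xp_Xm]) makes the result entire, and Gamma only has to be studied on the right half-plane. *)
Definition X (s : C) : C := if excluded_middle_informative (0 < Re s) then Xp s else Xm s.

Lemma dif_Xp s : 0 < Re s -> dif Xp s.
Proof.
  intros Hs. apply dif_mult; [|apply dif_E]. apply dif_mult; [apply dif_mult; [apply dif_pow, dif_id|apply dif_const]|].
  apply dif_mult; [eexists; apply Cd_rpow|apply dif_gprod, Hs].
Qed.

Lemma dif_Xm s : Re s < 1 -> dif Xm s.
Proof.
  intros Hs. apply dif_mult; [apply dif_const|]. destruct (dif_Xp (1 - Cconj s)) as [l Hl].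
  - rewrite Re_reflect. lra.
  - eexists. apply Cd_reflect, Hl.
Qed.

Lemma Cpow_mult_l (a b : C) n : (a * b) ^ n = a ^ n * b ^ n.
Proof. induction n as [|n IH]; [simpl; ring|]. simpl. rewrite IH. ring. Qed.

Lemma Xp_completed (s : C) : s <> 1 -> s ^ m * (1 - s) ^ m * completed L (Qcond L) (gammas L) s = Xp s.
Proof.
  intros Hs. unfold Xp, Xp_factor, completed. rewrite HEL by auto.
  replace (1 - s) with (- (1) * (s - 1)) by ring. rewrite Cpow_mult_l. unfold gprod. ring.
Qed.

Lemma regular_right (s : C) : 0 < Re s -> s <> 1 -> regular_point (gammas L) s.
Proof.
  intros Hs H1. split; [exact H1|]. intros p k Hp Eq. pose proof (Re_garg p s Hp Hs) as H. rewrite Eq in H.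
  change (Re (- RtoC (INR k))) with (- INR k)%R in H. pose proof (pos_INR k). lra.
Qed.

Lemma functional_X s : regular_point (gammas L) s -> regular_point (gammas L) (1 - Cconj s) ->
  s ^ m * (1 - s) ^ m * completed L (Qcond L) (gammas L) s = Xm s.
Proof.
  intros H1 H2. rewrite (functional_equation H1 H2). unfold Xm.
  rewrite <- Xp_completed by exact (proj1 H2). rewrite !Cmult_conj, !Cpow_conj, !Cminus_conj, Cconj_conj.
  replace (Cconj 1) with (RtoC 1) by (apply injective_projections; simpl; ring).
  replace (1 - (1 - s)) with s by ring. ring.
Qed.

Lemma Xp_Xm s : 0 < Re s < 1 -> Xp s = Xm s.
Proof.
  intros Hs. assert (N1 : s <> 1) by (intros ->; simpl in Hs; lra).
  rewrite <- Xp_completed by exact N1. apply functional_X.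
  - apply regular_right; [lra|exact N1].
  - apply regular_right; [rewrite Re_reflect; lra|]. intros Eq. apply (f_equal Re) in Eq. rewrite Re_reflect in Eq. simpl in Eq. lra.
Qed.

Lemma X_right s : 0 < Re s -> X s = Xp s.
Proof. intros H. unfold X. destruct excluded_middle_informative; [reflexivity|contradiction]. Qed.

Lemma X_left s : Re s < 1 -> X s = Xm s.
Proof.
  intros H. unfold X. destruct excluded_middle_informative as [H1|H1]; [apply Xp_Xm; lra|reflexivity].
Qed.

Lemma locally_Re_lt z a : Re z < a -> locally z (fun w => Re w < a).
Proof. intros H. apply (locally_lt Re z a); [|exact H]. apply cts_re, cts_id. Qed.

Lemma entire_X : entire_dif X.
Proof.
  intros s. destruct (Rlt_dec 0 (Re s)) as [H|H].
  - apply dif_ext_loc with Xp; [|apply dif_Xp, H].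
    generalize (locally_Re_gt s 0 H). apply filter_imp. intros w Hw. symmetry. apply X_right, Hw.
  - apply dif_ext_loc with Xm; [|apply dif_Xm; lra].
    generalize (locally_Re_lt s 1 ltac:(lra)). apply filter_imp. intros w Hw. symmetry. apply X_left, Hw.
Qed.

(** The functional equation is assumed only off the poles of the Gamma factors. These are isolated,
    so the punctured limit in the definition of [xi] passes over them. *)
Lemma locally'_regular s0 : locally' s0 (fun s => forall (p : R * C) (k : nat), In p (gammas L) ->
    RtoC (fst p) * s + snd p <> - RtoC (INR k)).
Proof.
  assert (K : forall l, (forall p, In p l -> 0 < fst p) -> locally' s0 (fun s => forall (p : R * C) (k : nat), In p l ->
    RtoC (fst p) * s + snd p <> - RtoC (INR k))).
  { intros l. induction l as [|p l IH]; intros Hl.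
    - apply filter_forall. intros s p k [].
    - specialize (IH (fun q Hq => Hl q (or_intror Hq))). pose proof (Hl p (or_introl eq_refl)) as Hp.
      destruct (nat_shift_gap (RtoC (fst p) * s0 + snd p)) as [d [Hd H]].
      assert (H2 : locally' s0 (fun s => forall k : nat, RtoC (fst p) * s + snd p <> - RtoC (INR k))).
      { apply locallyC'. exists (d / fst p)%R. split; [apply Rdiv_lt_0_compat; assumption|].
        intros s Hs Hne k Eq.
        assert (Eq2 : RtoC (fst p) * s0 + snd p + RtoC (INR k) = - (RtoC (fst p) * (s - s0))).
        { replace (RtoC (INR k)) with (- (RtoC (fst p) * s + snd p)) by (rewrite Eq; ring). ring. }
        assert (Hlam : RtoC (fst p) <> 0) by (intros E0; apply RtoC_inj in E0; lra).
        destruct (excluded_middle_informative (RtoC (fst p) * s0 + snd p = - RtoC (INR k))) as [E0|E0].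
        - rewrite E0 in Eq2. replace (- RtoC (INR k) + RtoC (INR k)) with (RtoC 0) in Eq2 by ring.
          symmetry in Eq2. revert Eq2. replace (- (RtoC (fst p) * (s - s0))) with (- RtoC (fst p) * (s - s0)) by ring.
          apply Cmult_neq_0; [|apply Cminus_eq_contra, Hne].
          intros E1. apply Hlam. replace (RtoC (fst p)) with (- - RtoC (fst p)) by ring. rewrite E1. ring.
        - specialize (H k E0). rewrite Eq2, Cmod_opp, Cmod_mult, Cmod_R, Rabs_pos_eq in H by lra.
          apply (Rmult_lt_compat_l (fst p)) in Hs; [|exact Hp].
          replace (fst p * (d / fst p))%R with d in Hs by (field; lra). lra. }
      generalize (filter_and _ _ IH H2). apply filter_imp. intros s [A B] q k [<-|Hq]; auto. }
  apply K. intros p Hp. apply gam_pos, Hp.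
Qed.

Lemma locally_locally' (z : C) P : locally z P -> locally' z P.
Proof. intros H. unfold locally', within. revert H. apply filter_imp. auto. Qed.

Lemma xi_X s : xi L s = X s.
Proof.
  unfold xi. apply is_C_lim_unique. apply (lim_filterlim (locally' s)).
  assert (HX : lim (locally' s) X (X s)).
  { intros eps He. apply locally_locally'. apply (dif_cts X s (entire_X s) eps He). }
  refine (lim_ext_loc _ _ _ _ _ HX).
  destruct (Rlt_dec 0 (Re s)) as [H|H].
  - generalize (filter_and _ _ (locally'_neq s 1) (locally_locally' s _ (locally_Re_gt s 0 H))).
    apply filter_imp. intros w [A B]. rewrite X_right by exact B. symmetry. apply Xp_completed, A.
  - assert (H0 : Re s < 1) by lra.
    pose proof (locally_locally' s _ (locally_Re_lt s 1 H0)) as H1.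
    generalize (filter_and _ _ (filter_and _ _ H1 (locally'_neq s 0)) (locally'_regular s)).
    apply filter_imp. intros w [[A B] D]. rewrite X_left by exact A. symmetry. apply functional_X.
    + split; [|exact D]. intros ->. simpl in A. lra.
    + apply regular_right; [rewrite Re_reflect; lra|]. intros Eq. apply B.
      rewrite <- (reflect_invol w), Eq. apply injective_projections; simpl; ring.
Qed.

Lemma omega_conj : omega L * Cconj (omega L) = 1.
Proof. rewrite <- RtoC_Cmod2, omega_unit. f_equal. ring. Qed.

Lemma omega_neq_0 : omega L <> 0.
Proof. apply Cmod_gt_0. rewrite omega_unit. lra. Qed.

Lemma X_sym s : X s = omega L * Cconj (X (1 - Cconj s)).
Proof.
  destruct (Rlt_dec (Re s) 1) as [H|H].
  - rewrite X_left by exact H. unfold Xm. rewrite (X_right (1 - Cconj s)) by (rewrite Re_reflect; lra). reflexivity.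
  - rewrite (X_left (1 - Cconj s)) by (rewrite Re_reflect; lra). unfold Xm. rewrite reflect_invol.
    rewrite Cmult_conj, Cconj_conj, Cmult_assoc, omega_conj, Cmult_1_l. apply X_right. lra.
Qed.

Lemma X_neq_0_right s : 1 < Re s -> X s <> 0.
Proof.
  intros Hs. rewrite X_right by lra. unfold Xp, Xp_factor.
  assert (H0 : s <> 0) by (intros ->; simpl in Hs; lra).
  assert (H1 : s <> 1) by (intros ->; simpl in Hs; lra).
  rewrite HEL by auto.
  assert (Hm1 : - (1) <> (0 : C)) by (intros E0; apply (f_equal Re) in E0; simpl in E0; lra).
  repeat apply Cmult_neq_0; try apply Cpow_nz; auto.
  - apply rpow_neq_0.
  - apply gprod_neq_0. lra.
  - apply Cminus_eq_contra, H1.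
  - apply L_neq_0, Hs.
Qed.

Lemma X_zero_strip s : X s = 0 -> 0 <= Re s <= 1.
Proof.
  intros Hs. split; apply Rnot_lt_le; intros H.
  - rewrite X_sym in Hs. revert Hs. apply Cmult_neq_0; [apply omega_neq_0|].
    intros E0. apply (X_neq_0_right (1 - Cconj s)); [rewrite Re_reflect; lra|].
    rewrite <- (Cconj_conj (X (1 - Cconj s))), E0. apply injective_projections; simpl; ring.
  - exact (X_neq_0_right s H Hs).
Qed.

Lemma log_derive_X_sym s : X s <> 0 -> log_derive X s = - Cconj (log_derive X (1 - Cconj s)).
Proof.
  intros Hs. pose proof (dif_C_derive X (1 - Cconj s) (entire_X _)) as H. apply Cd_reflect in H.
  assert (HX : Cd X s (omega L * - Cconj (C_derive X (1 - Cconj s)))).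
  { eapply Cd_ext; [|apply (Cd_scal (omega L) _ _ _ H)]. intros w. symmetry. apply X_sym. }
  rewrite (log_derive_Cd _ _ _ HX). rewrite X_sym at 1. unfold log_derive.
  assert (HN : X (1 - Cconj s) <> 0).
  { intros E0. apply Hs. rewrite X_sym, E0. replace (Cconj 0) with (RtoC 0) by (apply injective_projections; simpl; ring). ring. }
  assert (HN2 : Cconj (X (1 - Cconj s)) <> 0).
  { intros E0. apply HN. rewrite <- (Cconj_conj (X (1 - Cconj s))), E0. apply injective_projections; simpl; ring. }
  rewrite Cdiv_conj by exact HN. field. split; [exact HN2|apply omega_neq_0].
Qed.

(** * Growth of the completed function *)

Lemma small_Xp_factor : small_on (fun s => / 2 <= Re s) Xp_factor.
Proof.
  unfold Xp_factor. apply small_on_mult; [apply small_on_mult|apply small_on_mult].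
  - apply (small_on_pow _ (fun s => s)). intros eps He. destruct (small_on_linear (fun s => / 2 <= Re s) 0 eps He) as [K [HK H]].
    exists K. split; [exact HK|]. intros s Hs. specialize (H s Hs). replace (s - 0) with s in H by ring. exact H.
  - apply small_on_bounded with 1%R; [lra|]. intros s _. rewrite Cmod_pow, Cmod_m1, pow1. lra.
  - apply small_on_rpow.
  - apply (small_on_Cprod _ (fun (p : R * C) s => CGamma (RtoC (fst p) * s + snd p))).
    intros p Hp. destruct (gam_pos p Hp) as [H1 H2]. apply small_on_CGamma; [exact H1|exact H2|lra].
Qed.

Lemma small_E_right : small_on (fun s => 2 <= Re s) E.
Proof.
  destruct (L_bounded L) as [K [HK HL]].
  assert (H : small_on (fun s => 2 <= Re s) (fun s => (s - 1) ^ m * L s)).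
  { apply small_on_mult; [apply small_on_pow, small_on_linear|apply small_on_bounded with K; assumption]. }
  intros eps He. destruct (H eps He) as [K2 [HK2 H2]]. exists K2. split; [exact HK2|]. intros s Hs.
  rewrite HEL; [apply H2, Hs|]. left. intros ->. simpl in Hs. lra.
Qed.

Lemma small_X_right : small_on (fun s => 2 <= Re s) X.
Proof.
  intros eps He.
  assert (H : small_on (fun s => 2 <= Re s) (fun s => Xp_factor s * E s)).
  { apply small_on_mult; [|apply small_E_right]. intros e He2. destruct (small_Xp_factor e He2) as [K [HK H]].
    exists K. split; [exact HK|]. intros s Hs. apply H. lra. }
  destruct (H eps He) as [K [HK H2]]. exists K. split; [exact HK|]. intros s Hs. rewrite X_right by lra. apply H2, Hs.
Qed.

Lemma Cmod_X_sym s : Cmod (X s) = Cmod (X (1 - Cconj s)).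
Proof. rewrite X_sym, Cmod_mult, omega_unit, Cmod_conj. ring. Qed.

Lemma Cmod_reflect_le s : Cmod (1 - Cconj s) <= 1 + Cmod s.
Proof. eapply Rle_trans; [apply Cmod_triangle|]. rewrite Cmod_1, Cmod_opp, Cmod_conj. lra. Qed.

Lemma small_X_left : small_on (fun s => Re s <= -1) X.
Proof.
  intros eps He. destruct (small_X_right (eps / 2)%R ltac:(lra)) as [K [HK H]].
  exists (K * exp eps)%R. split; [apply Rmult_lt_0_compat; [exact HK|apply exp_pos]|]. intros s Hs.
  rewrite Cmod_X_sym. eapply Rle_trans; [apply H; rewrite Re_reflect; lra|].
  rewrite Rmult_assoc, <- exp_plus. apply Rmult_le_compat_l; [lra|]. apply exp_le.
  apply Rle_trans with (eps / 2 * (1 + Cmod s) ^ 2)%R.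
  - apply Rmult_le_compat_l; [lra|]. apply pow_incr. split; [apply Cmod_ge_0|apply Cmod_reflect_le].
  - replace (eps + eps * Cmod s ^ 2)%R with (eps / 2 * (2 + 2 * Cmod s ^ 2))%R by field.
    apply Rmult_le_compat_l; [lra|]. pose proof (pow2_ge_0 (1 - Cmod s)). nra.
Qed.

(** A crude bound that meets the growth condition of [phragmen_lindelof]: the factors are multiplied
    for [Re s >= 1/2], and the symmetry of [|X|] covers the rest at the cost of a shift by 1. *)
Lemma finite_order_X : exists (k : nat) K, 0 < K /\ forall s, Cmod (X s) <= K * exp (2 * (2 + Cmod s) ^ k).
Proof.
  destruct HEo as [k [M HM]]. destruct (small_Xp_factor 1 Rlt_0_1) as [K [HK H]].
  set (M' := Rmax M 1). assert (HM1 : 1 <= M') by apply Rmax_r.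
  assert (A : forall s, / 2 <= Re s -> Cmod (X s) <= K * M' * exp (2 * (1 + Cmod s) ^ (k + 2))).
  { intros s Hs. rewrite X_right by lra. unfold Xp. rewrite Cmod_mult. pose proof (Cmod_ge_0 s) as Hs0.
    apply Rle_trans with ((K * exp (1 * Cmod s ^ 2)) * (M' * exp (Cmod s ^ k)))%R.
    - apply Rmult_le_compat; try apply Cmod_ge_0; [apply H, Hs|]. eapply Rle_trans; [apply HM|].
      apply Rmult_le_compat_r; [left; apply exp_pos|apply Rmax_l].
    - replace (K * exp (1 * Cmod s ^ 2) * (M' * exp (Cmod s ^ k)))%R with (K * M' * (exp (1 * Cmod s ^ 2) * exp (Cmod s ^ k)))%R by ring.
      rewrite <- exp_plus. apply Rmult_le_compat_l; [apply Rmult_le_pos; lra|]. apply exp_le.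
      assert (B1 : (Cmod s ^ 2 <= (1 + Cmod s) ^ (k + 2))%R).
      { apply Rle_trans with ((1 + Cmod s) ^ 2)%R; [apply pow_incr; lra|]. apply Rle_pow; [lra|lia]. }
      assert (B2 : (Cmod s ^ k <= (1 + Cmod s) ^ (k + 2))%R).
      { apply Rle_trans with ((1 + Cmod s) ^ k)%R; [apply pow_incr; lra|]. apply Rle_pow; [lra|lia]. }
      lra. }
  exists (k + 2)%nat, (K * M')%R. assert (HKM : 0 < K * M') by (apply Rmult_lt_0_compat; lra).
  split; [exact HKM|]. intros s. pose proof (Cmod_ge_0 s) as Hs0.
  destruct (Rle_dec (/ 2) (Re s)) as [Hs|Hs].
  - eapply Rle_trans; [apply A, Hs|]. apply Rmult_le_compat_l; [lra|]. apply exp_le.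
    apply Rmult_le_compat_l; [lra|]. apply pow_incr. lra.
  - rewrite Cmod_X_sym. eapply Rle_trans; [apply A; rewrite Re_reflect; lra|].
    apply Rmult_le_compat_l; [lra|]. apply exp_le. apply Rmult_le_compat_l; [lra|]. apply pow_incr.
    pose proof (Cmod_reflect_le s). pose proof (Cmod_ge_0 (1 - Cconj s)). lra.
Qed.

Lemma Cmod_Cexp_sq eps s : Cmod (Cexp (RtoC eps * s ^ 2)) = exp (eps * (Re s ^ 2 - Im s ^ 2)).
Proof. rewrite Cmod_Cexp. f_equal. destruct s; unfold Re, Im; simpl; ring. Qed.

(** Both half-planes outside the strip are already controlled. Inside, [exp (eps s^2)] decays like
    [exp (- eps (Im s)^2)], so multiplying by it makes [X] bounded on the two edges, and
    [phragmen_lindelof] carries the bound across. *)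
Lemma small_growth_X : small_growth X.
Proof.
  intros eps He. destruct (small_X_right eps He) as [K1 [HK1 H1]]. destruct (small_X_left eps He) as [K2 [HK2 H2]].
  destruct finite_order_X as [k [K [HK HX]]].
  (* On the edges [|s|^2 + (Re s)^2 - (Im s)^2 = 2 (Re s)^2 <= 8]. *)
  set (M := ((K1 + K2) * exp (8 * eps))%R).
  assert (HM : 0 < M) by (apply Rmult_lt_0_compat; [lra|apply exp_pos]).
  assert (H3 : forall s, -1 <= Re s <= 2 -> Cmod (X s * Cexp (RtoC eps * s ^ 2)) <= M).
  { apply (phragmen_lindelof (fun s => X s * Cexp (RtoC eps * s ^ 2)) M (K * exp (4 * eps)) k 2).
    - exact HM.
    - apply Rmult_lt_0_compat; [exact HK|apply exp_pos].
    - lra.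
    - intros s. apply dif_mult; [apply entire_X|]. apply (dif_comp Cexp); [|apply dif_Cexp].
      apply dif_mult; [apply dif_const|apply (dif_pow (fun s => s)), dif_id].
    - intros s Hs. rewrite Cmod_mult, Cmod_Cexp_sq.
      replace (K * exp (4 * eps) * exp (2 * (2 + Cmod s) ^ k))%R with (K * exp (2 * (2 + Cmod s) ^ k) * exp (4 * eps))%R by ring.
      apply Rmult_le_compat; [apply Cmod_ge_0|left; apply exp_pos|apply HX|]. apply exp_le.
      replace (4 * eps)%R with (eps * 4)%R by ring. apply Rmult_le_compat_l; [lra|]. pose proof (pow2_ge_0 (Im s)). nra.
    - intros s Hs. rewrite Cmod_mult, Cmod_Cexp_sq.
      assert (HXs : Cmod (X s) <= (K1 + K2) * exp (eps * Cmod s ^ 2)).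
      { pose proof (exp_pos (eps * Cmod s ^ 2)) as Hep. rewrite Rmult_plus_distr_r.
        assert (0 < K1 * exp (eps * Cmod s ^ 2))%R by (apply Rmult_lt_0_compat; assumption).
        assert (0 < K2 * exp (eps * Cmod s ^ 2))%R by (apply Rmult_lt_0_compat; assumption).
        destruct Hs as [Hs|Hs]; [specialize (H2 s ltac:(lra))|specialize (H1 s ltac:(lra))]; lra. }
      eapply Rle_trans; [apply Rmult_le_compat_r; [left; apply exp_pos|exact HXs]|].
      rewrite Rmult_assoc, <- exp_plus. unfold M. apply Rmult_le_compat_l; [lra|]. apply exp_le.
      rewrite Cmod2_alt. replace (eps * (Re s ^ 2 + Im s ^ 2) + eps * (Re s ^ 2 - Im s ^ 2))%R with (eps * (2 * Re s ^ 2))%R by ring.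
      replace (8 * eps)%R with (eps * 8)%R by ring. apply Rmult_le_compat_l; [lra|]. destruct Hs as [-> | ->]; lra. }
  exists (K1 + K2 + M)%R. intros s. pose proof (exp_pos (eps * Cmod s ^ 2)) as Hep.
  rewrite !Rmult_plus_distr_r.
  assert (0 < K1 * exp (eps * Cmod s ^ 2))%R by (apply Rmult_lt_0_compat; assumption).
  assert (0 < K2 * exp (eps * Cmod s ^ 2))%R by (apply Rmult_lt_0_compat; assumption).
  assert (0 < M * exp (eps * Cmod s ^ 2))%R by (apply Rmult_lt_0_compat; assumption).
  destruct (Rle_dec 2 (Re s)) as [Ha|Ha]; [specialize (H1 s Ha); lra|].
  destruct (Rle_dec (Re s) (-1)) as [Hb|Hb]; [specialize (H2 s Hb); lra|].
  specialize (H3 s ltac:(lra)). rewrite Cmod_mult, Cmod_Cexp_sq in H3.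
  assert (Cmod (X s) <= M * exp (eps * Cmod s ^ 2)); [|lra].
  apply Rmult_le_reg_r with (exp (eps * (Re s ^ 2 - Im s ^ 2))); [apply exp_pos|].
  eapply Rle_trans; [exact H3|]. rewrite Rmult_assoc, <- exp_plus. rewrite <- (Rmult_1_r M) at 1.
  apply Rmult_le_compat_l; [lra|]. rewrite <- exp_0. apply exp_le. rewrite Cmod2_alt.
  replace (eps * (Re s ^ 2 + Im s ^ 2) + eps * (Re s ^ 2 - Im s ^ 2))%R with (eps * (2 * Re s ^ 2))%R by ring.
  apply Rmult_le_pos; [lra|]. pose proof (pow2_ge_0 (Re s)). lra.
Qed.

(** * Logarithmic derivatives *)

Definition Gsum (s : C) : C :=
  RtoC (ln (Qcond L)) + Csum (fun p : R * C => RtoC (fst p) * digamma (RtoC (fst p) * s + snd p)) (gammas L).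

Lemma Csub_0_r (w : C) : w - 0 = w.
Proof. ring. Qed.

Lemma log_derive_Xp_factor s : 0 < Re s -> log_derive Xp_factor s = RtoC (INR m) / s + Gsum s.
Proof.
  intros Hs. assert (H0 : s <> 0) by (apply neq0_Re, Hs). unfold Xp_factor.
  assert (Hm1 : (- (1)) ^ m <> (0 : C)).
  { apply Cpow_nz. intros E0; apply (f_equal Re) in E0; simpl in E0; lra. }
  rewrite (log_derive_mult (fun s => s ^ m * (- (1)) ^ m) (fun s => rpow (Qcond L) s * gprod s)).
  - rewrite (log_derive_mult (fun s => s ^ m) (fun _ => (- (1)) ^ m)); [|apply (dif_pow (fun s => s)), dif_id|apply dif_const|apply Cpow_nz, H0|exact Hm1].
    rewrite (log_derive_Cd _ _ _ (Cd_const ((- (1)) ^ m) s)).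
    rewrite (log_derive_mult (rpow (Qcond L)) gprod); [|eexists; apply Cd_rpow|apply dif_gprod, Hs|apply rpow_neq_0|apply gprod_neq_0, Hs].
    rewrite (log_derive_Cd _ _ _ (Cd_rpow (Qcond L) s)). unfold Gsum.
    assert (E1 : log_derive (fun s => s ^ m) s = RtoC (INR m) / s).
    { rewrite <- (log_derive_ext_loc (fun s => (s - 0) ^ m)).
      - rewrite log_derive_pow by exact H0. replace (s - 0) with s by ring. reflexivity.
      - apply filter_forall. intros w. rewrite (Csub_0_r w). reflexivity.
      - apply dif_pow, dif_minus; [apply dif_id|apply dif_const]. }
    rewrite E1. unfold gprod at 1.
    rewrite (log_derive_Cprod (fun (p : R * C) s => CGamma (RtoC (fst p) * s + snd p))).
    + rewrite (Csum_ext _ (fun p : R * C => RtoC (fst p) * digamma (RtoC (fst p) * s + snd p))).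
      * field. repeat split; try assumption; apply rpow_neq_0.
      * intros p Hp. rewrite (log_derive_Cd _ _ _ (Cd_gfactor p s Hp Hs)). field. apply CGamma_neq_0, Re_garg; assumption.
    + intros p Hp. split; [eexists; apply Cd_gfactor; assumption|apply CGamma_neq_0, Re_garg; assumption].
  - apply dif_mult; [apply (dif_pow (fun s => s)), dif_id|apply dif_const].
  - apply dif_mult; [eexists; apply Cd_rpow|apply dif_gprod, Hs].
  - apply Cmult_neq_0; [apply Cpow_nz, H0|exact Hm1].
  - apply Cmult_neq_0; [apply rpow_neq_0|apply gprod_neq_0, Hs].
Qed.

Lemma Xp_factor_neq_0 s : 0 < Re s -> Xp_factor s <> 0.
Proof.
  intros Hs. pose proof (neq0_Re s Hs) as H0. unfold Xp_factor.
  repeat apply Cmult_neq_0; try apply Cpow_nz; [exact H0| |apply rpow_neq_0|apply gprod_neq_0, Hs].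
  intros E0; apply (f_equal Re) in E0; simpl in E0; lra.
Qed.

Lemma dif_Xp_factor s : 0 < Re s -> dif Xp_factor s.
Proof.
  intros Hs. apply dif_mult; [apply dif_mult; [apply dif_pow, dif_id|apply dif_const]|].
  apply dif_mult; [eexists; apply Cd_rpow|apply dif_gprod, Hs].
Qed.

Lemma log_derive_X_E (s : C) : 0 < Re s -> X s <> 0 -> log_derive X s = RtoC (INR m) / s + Gsum s + log_derive E s.
Proof.
  intros Hs HX. rewrite X_right in HX by exact Hs.
  assert (HEs : E s <> 0) by (intros E0; apply HX; unfold Xp; rewrite E0; ring).
  rewrite <- (log_derive_ext_loc Xp X).
  - unfold Xp. rewrite log_derive_mult; [|apply dif_Xp_factor, Hs|apply dif_E|apply Xp_factor_neq_0, Hs|exact HEs].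
    rewrite log_derive_Xp_factor by exact Hs. reflexivity.
  - generalize (locally_Re_gt s 0 Hs). apply filter_imp. intros w Hw. symmetry. apply X_right, Hw.
  - apply dif_Xp, Hs.
Qed.

Lemma E_eq_locally (s : C) : s <> 1 -> locally s (fun w => E w = (w - 1) ^ m * L w).
Proof. intros H. generalize (locally_neq s 1 H). apply filter_imp. intros w Hw. apply HEL. auto. Qed.

Lemma dif_L (s : C) : s <> 1 \/ m = 0%nat -> dif L s.
Proof.
  intros H. destruct H as [H|H].
  - apply dif_ext_loc with (fun w => E w / (w - 1) ^ m).
    + generalize (locally_neq s 1 H). apply filter_imp. intros w Hw. rewrite HEL by auto.
      cfield. apply Cpow_nz, Cminus_eq_contra, Hw.
    + apply dif_div; [apply dif_E|apply dif_pow, dif_minus; [apply dif_id|apply dif_const]|apply Cpow_nz, Cminus_eq_contra, H].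
  - apply dif_ext_loc with E; [|apply dif_E]. apply filter_forall. intros w. rewrite HEL by auto. rewrite H. simpl. cring.
Qed.

Lemma log_derive_E (s : C) : s <> 1 \/ m = 0%nat -> E s <> 0 -> log_derive E s = RtoC (INR m) / (s - 1) + log_derive L s.
Proof.
  intros H HEs. pose proof (dif_L s H) as HL.
  destruct H as [H|H].
  - rewrite HEL in HEs by auto.
    assert (HLs : L s <> 0) by (intros E0; apply HEs; rewrite E0; ring).
    rewrite (log_derive_ext_loc E (fun w => (w - 1) ^ m * L w)); [|apply E_eq_locally, H|apply dif_E].
    rewrite log_derive_mult; [|apply dif_pow, dif_minus; [apply dif_id|apply dif_const]|exact HL|apply Cpow_nz, Cminus_eq_contra, H|exact HLs].
    rewrite log_derive_pow by exact H. reflexivity.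
  - rewrite (log_derive_ext_loc E L); [|apply filter_forall; intros w; rewrite HEL by auto; rewrite H; simpl; cring|apply dif_E].
    rewrite H. simpl. unfold Cdiv. ring.
Qed.

Lemma log_derive_X (s : C) : 0 < Re s -> s <> 1 \/ m = 0%nat -> X s <> 0 ->
  log_derive X s = RtoC (INR m) / s + RtoC (INR m) / (s - 1) + Gsum s + log_derive L s.
Proof.
  intros Hs H1 HX. rewrite log_derive_X_E by assumption.
  assert (HEs : E s <> 0).
  { intros E0. apply HX. rewrite X_right by exact Hs. unfold Xp. rewrite E0. ring. }
  rewrite log_derive_E by assumption. ring.
Qed.

End Xi.

(** * The sum over the zeros *)

Lemma entire_zero_multiplicity f c z0 : entire_dif f -> f c <> 0 -> f z0 = 0 -> exists n, zero_of_multiplicity f z0 n.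
Proof.
  intros Hf Hc H0. set (r := (Cmod (z0 - c) + 1)%R). pose proof (Cmod_ge_0 (z0 - c)) as Hp.
  destruct (zero_list_exists f c r Hf Hc ltac:(unfold r; lra)) as [l [g Hl]].
  assert (Hz : Cmod (z0 - c) < r) by (unfold r; lra).
  exists (count_occ Ceq_dec l z0). apply (zero_list_multiplicity f c r l g); [exact Hl|exact Hz|].
  destruct (Nat.eq_0_gt_0_cases (count_occ Ceq_dec l z0)) as [E|E]; [|lia].
  exfalso. destruct Hl as [_ [_ [Hfg Ng]]]. rewrite Hfg in H0. revert H0. apply Cmult_neq_0; [|apply Ng, Hz].
  apply Cprod_neq_0. intros x Hx. apply Cminus_eq_contra. intros ->.
  apply (count_occ_not_In Ceq_dec l x) in E. contradiction.
Qed.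

(* With [r = rho - 1/2], the left side is [-2 / (1 - r^2)], and [1 - r^2] lies in a sector
   around the positive axis when [|Re r| <= 1/2]. *)
Lemma pf_term_sector rho : 0 <= Re rho <= 1 ->
  / 2 * Cmod (pf_term (RtoC (3 / 2)) (RtoC (- (1 / 2))) rho) <= - Re (pf_term (RtoC (3 / 2)) (RtoC (- (1 / 2))) rho).
Proof.
  intros H.
  assert (N1 : RtoC (- (1 / 2)) <> rho) by (intros <-; simpl in H; lra).
  assert (N2 : RtoC (3 / 2) <> rho) by (intros <-; simpl in H; lra).
  rewrite pf_term_eq by assumption.
  set (D := (RtoC (- (1 / 2)) - rho) * (RtoC (3 / 2) - rho)).
  assert (HD : D <> 0) by (apply Cmult_neq_0; apply Cminus_eq_contra; assumption).
  assert (E : RtoC (3 / 2) - RtoC (- (1 / 2)) = RtoC 2) by (rewrite <- RtoC_minus; f_equal; field).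
  rewrite E. pose proof HD as HD0. apply Cmod_gt_0 in HD0.
  assert (HRe : Re (RtoC 2 / D) = (2 * Re D / Cmod D ^ 2)%R).
  { unfold Cdiv. rewrite re_scal_l. rewrite Cmod2_alt. unfold Re, Im. simpl. field.
    intros E2. assert (E3 : (Cmod D ^ 2 = 0)%R) by (rewrite Cmod2_alt; unfold Re, Im; simpl; lra).
    assert (0 < Cmod D ^ 2) by (apply pow_lt, HD0). lra. }
  (* With [tau = Im rho], [|Im D| <= |tau| <= 3/4 + tau^2 <= - Re D]; hence the constant [1/2] of
     the sector. *)
  assert (HDs : Cmod D <= - 2 * Re D).
  { eapply Rle_trans; [apply Cmod_le_xy|].
    assert (HR : Re D = (- (3 / 4) - Re rho * (1 - Re rho) - Im rho ^ 2)%R) by (unfold D; destruct rho; unfold Re, Im; simpl; field).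
    assert (HI : Im D = (2 * (Re rho - 1 / 2) * Im rho)%R) by (unfold D; destruct rho; unfold Re, Im; simpl; field).
    assert (H0 : 0 <= Re rho * (1 - Re rho)) by (apply Rmult_le_pos; lra).
    pose proof (pow2_ge_0 (Im rho)) as Hi2.
    assert (HIm : Rabs (Im D) <= Rabs (Im rho)).
    { rewrite HI, Rabs_mult. rewrite <- (Rmult_1_l (Rabs (Im rho))) at 2. apply Rmult_le_compat_r; [apply Rabs_pos|].
      apply Rabs_le. lra. }
    assert (HIm2 : Rabs (Im rho) <= 3 / 4 + Im rho ^ 2).
    { rewrite <- (pow2_abs (Im rho)). pose proof (pow2_ge_0 (Rabs (Im rho) - 1 / 2)). nra. }
    rewrite (Rabs_left (Re D)) by lra. lra. }
  rewrite HRe, Cmod_div, Cmod_R, Rabs_pos_eq by (assumption || lra).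
  apply Rmult_le_reg_r with (Cmod D ^ 2)%R; [apply pow_lt, HD0|].
  replace (/ 2 * (2 / Cmod D) * Cmod D ^ 2)%R with (Cmod D) by (field; lra).
  replace (- (2 * Re D / Cmod D ^ 2) * Cmod D ^ 2)%R with (- 2 * Re D)%R by (field; lra). exact HDs.
Qed.

Section ZeroSum.
Variable L : selberg_class.
Variable E : C -> C.
Hypothesis HEe : entire E.
Hypothesis HEo : finite_order E.
Hypothesis HEL : forall s : C, s <> 1 \/ m_pole L = 0%nat -> E s = (s - 1) ^ m_pole L * L s.

Notation XL := (X L E).

Lemma nontrivial_zeros_eq : nontrivial_zeros L = zpairs XL.
Proof.
  assert (Hxi : xi L = XL) by (apply functional_extensionality; intros s; apply (xi_X L E HEe HEL)).
  unfold nontrivial_zeros, zpairs. rewrite Hxi. reflexivity.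
Qed.

Notation c32 := (RtoC (3 / 2)).
Notation sm := (RtoC (- (1 / 2))).

Lemma XL_c : XL c32 <> 0.
Proof. apply (X_neq_0_right L E HEL). simpl. lra. Qed.

Lemma XL_sm : XL sm <> 0.
Proof. intros H. apply (X_zero_strip L E HEL) in H. simpl in H. lra. Qed.

Lemma zero_term_pf z rho k : 0 <= Re rho <= 1 -> 1 / 2 - Ci * z <> rho ->
  zero_term z (rho, k) = pf_term c32 (1 / 2 - Ci * z) rho + - (1 / 2) * pf_term c32 sm rho.
Proof.
  intros H Hs. unfold zero_term, pf_term. simpl fst.
  assert (N1 : sm - rho <> 0) by (apply Cminus_eq_contra; intros <-; simpl in H; lra).
  assert (N2 : c32 - rho <> 0) by (apply Cminus_eq_contra; intros <-; simpl in H; lra).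
  pose proof (Cminus_eq_contra _ _ Hs) as N3.
  set (s := 1 / 2 - Ci * z) in *.
  assert (Ez : Ci * z = 1 / 2 - s) by (unfold s; ring).
  replace (1 + Ci * (rho - 1 / 2) * z) with (1 + (rho - 1 / 2) * (Ci * z)) by ring. rewrite Ez.
  (* The quadratic denominator of the theorem factors at the two base points. With [A] and [B] these
     factors, both sides equal [1 / (s - rho) - (1 / A + 1 / B) / 2]. *)
  assert (EA : (rho - 1 / 2) ^ 2 - 1 = (sm - rho) * (c32 - rho)).
  { rewrite RtoC_opp, !RtoC_div by lra. field. }
  rewrite EA. replace (rho - 1 / 2 + (1 / 2 - s)) with (- (s - rho)) by ring.
  assert (N4 : - (s - rho) <> 0).
  { intros E0. apply N3. replace (s - rho) with (- - (s - rho)) by ring. rewrite E0. ring. }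
  assert (E1 : 1 + (rho - 1 / 2) * (1 / 2 - s) = - ((sm - rho) * (c32 - rho)) - (rho - 1 / 2) * (s - rho)).
  { rewrite <- EA. field. }
  rewrite E1.
  assert (E2 : rho - 1 / 2 = (- (sm - rho) - (c32 - rho)) / 2) by (rewrite RtoC_opp, !RtoC_div by lra; field).
  rewrite E2.
  set (A := sm - rho) in *. set (B := c32 - rho) in *. set (D := s - rho) in *.
  assert (E3 : B - A = 2).
  { unfold A, B. rewrite RtoC_opp, !RtoC_div by lra. field. }
  assert (E4 : B = A + 2) by (rewrite <- E3; ring).
  rewrite E4 in *. field. repeat split; assumption.
Qed.

Lemma zero_sum z : XL (1 / 2 - Ci * z) <> 0 ->
  is_usum (nontrivial_zeros L) (zero_term z)
    (log_derive XL (1 / 2 - Ci * z) - Ci * RtoC (Im (log_derive XL c32))).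
Proof.
  intros Hs. rewrite nontrivial_zeros_eq. set (s := 1 / 2 - Ci * z) in *.
  pose proof (entire_X L E HEe HEL) as HX. pose proof (small_growth_X L E HEe HEo HEL) as HG.
  assert (Hz : forall p, zpairs XL p -> XL (fst p) = 0 /\ 0 <= Re (fst p) <= 1).
  { intros p [n [Hn _]]. apply multiplicity_zero in Hn. split; [exact Hn|apply (X_zero_strip L E HEL), Hn]. }
  assert (Hsc : sm <> c32) by (intros E0; apply RtoC_inj in E0; lra).
  destruct (partial_fraction_bounded XL c32 sm (/ 2) HX HG XL_c XL_sm ltac:(lra)) as [B HB].
  { intros p Hp. apply pf_term_sector, Hz, Hp. }
  assert (S1 : is_usum (zpairs XL) (fun p => pf_term c32 s (fst p)) (log_derive XL s - log_derive XL c32)).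
  { apply partial_fraction_usum; [exact HX|exact HG|exact XL_c|exact Hs|].
    apply (partial_fraction_summable XL c32 s sm B HX XL_c Hs XL_sm Hsc HB). }
  assert (S2 : is_usum (zpairs XL) (fun p => pf_term c32 sm (fst p)) (log_derive XL sm - log_derive XL c32)).
  { apply partial_fraction_usum; [exact HX|exact HG|exact XL_c|exact XL_sm|].
    apply (partial_fraction_summable XL c32 sm sm B HX XL_c XL_sm XL_sm Hsc HB). }
  pose proof (is_usum_plus _ _ _ _ _ S1 (is_usum_scal _ _ (- (1 / 2)) _ S2)) as S3. cbv beta in S3.
  replace (log_derive XL s - Ci * RtoC (Im (log_derive XL c32))) with
    (log_derive XL s - log_derive XL c32 + - (1 / 2) * (log_derive XL sm - log_derive XL c32)).
  - eapply is_usum_ext; [|exact S3]. intros [rho k] Hp. destruct (Hz _ Hp) as [H1 H2]. simpl in H1, H2.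
    symmetry. apply zero_term_pf; [exact H2|]. fold s. intros E0. apply Hs. rewrite E0. exact H1.
  (* With [c0 = X'/X(3/2)] and [X'/X(-1/2) = - conj c0], the constants sum to
     [- c0 + (c0 + conj c0) / 2 = - i Im c0]. *)
  - rewrite (log_derive_X_sym L E HEe HEL sm XL_sm).
    replace (1 - Cconj sm) with c32.
    2:{ apply injective_projections; simpl; field. }
    rewrite im_alt. field. apply Ci_nz.
Qed.

End ZeroSum.

(** * Absolutely convergent integrals over the line *)

(** The envelope of the Herglotz integrand: a kernel of order [t^(-2)] times [W] of order
    [|t|^(1/2)]. On the positive axis the primitive [-2 / sqrt (1 + t)] gives explicit tails. *)
Definition dec (t : R) : R := (/ ((1 + Rabs t) * sqrt (1 + Rabs t)))%R.

Lemma continuous_dec t : continuous dec t.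
Proof.
  pose proof (Rabs_pos t). assert (Hs : 0 < sqrt (1 + Rabs t)) by (apply sqrt_lt_R0; lra).
  apply (continuous_Rinv_comp (fun t => ((1 + Rabs t) * sqrt (1 + Rabs t))%R)).
  - assert (H1 : continuous (fun t => (1 + Rabs t)%R) t).
    { apply (continuous_plus (V := R_NormedModule) (fun _ => 1%R) Rabs); [apply continuous_const|apply continuous_Rabs]. }
    apply (continuous_mult (K := R_AbsRing)); [exact H1|].
    apply (continuous_sqrt_comp (fun t => (1 + Rabs t)%R)). exact H1.
  - apply Rgt_not_eq, Rmult_lt_0_compat; lra.
Qed.

Lemma ex_RInt_dec a b : ex_RInt dec a b.
Proof. apply (ex_RInt_continuous (V := R_CompleteNormedModule)). intros t _. apply continuous_dec. Qed.

Lemma RInt_dec_tail T b : 0 <= T -> T <= b -> RInt dec T b <= 2 / sqrt (1 + T).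
Proof.
  intros HT Hb.
  assert (E : is_RInt (fun t => (/ ((1 + t) * sqrt (1 + t)))%R) T b (minus (-2 / sqrt (1 + b)) (-2 / sqrt (1 + T)))%R).
  { apply (is_RInt_derive (V := R_CompleteNormedModule) (fun t => (-2 / sqrt (1 + t))%R));
    intros t; rewrite Rmin_left, Rmax_right by exact Hb; intros Ht;
    assert (Hs : 0 < sqrt (1 + t)) by (apply sqrt_lt_R0; lra).
    - auto_derive; [repeat split; lra|].
      assert (Eq : (1 + t = sqrt (1 + t) * sqrt (1 + t))%R) by (symmetry; apply sqrt_sqrt; lra).
      replace ((1 + t) * sqrt (1 + t))%R with (sqrt (1 + t) * sqrt (1 + t) * sqrt (1 + t))%R by (rewrite <- Eq; reflexivity).
      field. lra.
    - apply (continuous_Rinv_comp (fun t => ((1 + t) * sqrt (1 + t))%R)); [|apply Rgt_not_eq, Rmult_lt_0_compat; lra].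
      assert (H1 : continuous (fun t => (1 + t)%R) t).
      { apply (continuous_plus (V := R_NormedModule) (fun _ => 1%R) (fun t => t)); [apply continuous_const|apply continuous_id]. }
      apply (continuous_mult (K := R_AbsRing)); [exact H1|]. apply (continuous_sqrt_comp (fun t => (1 + t)%R)). exact H1. }
  rewrite (RInt_ext _ (fun t => (/ ((1 + t) * sqrt (1 + t)))%R)).
  - rewrite (is_RInt_unique (V := R_CompleteNormedModule) _ _ _ _ E). unfold minus, plus, opp; simpl.
    assert (0 < / sqrt (1 + b)) by (apply Rinv_0_lt_compat, sqrt_lt_R0; lra). unfold Rdiv. lra.
  - rewrite Rmin_left, Rmax_right by exact Hb. intros t Ht. unfold dec. rewrite Rabs_pos_eq by lra. reflexivity.
Qed.

Lemma RInt_dec_tail_neg T a : 0 <= T -> a <= - T -> RInt dec a (- T) <= 2 / sqrt (1 + T).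
Proof.
  intros HT Ha.
  assert (E : RInt dec a (- T) = RInt dec T (- a)).
  { assert (H := RInt_comp_lin (V := R_CompleteNormedModule) dec (-1) 0 T (- a) (ex_RInt_dec _ _)).
    replace (-1 * T + 0)%R with (- T)%R in H by ring. replace (-1 * - a + 0)%R with a in H by ring.
    rewrite <- (opp_RInt_swap (V := R_CompleteNormedModule)) by apply ex_RInt_dec. rewrite <- H.
    rewrite <- (RInt_opp (V := R_CompleteNormedModule)).
    - apply RInt_ext. intros t _. unfold dec, opp, scal; simpl. unfold mult; simpl.
      replace (-1 * t + 0)%R with (- t)%R by ring. rewrite Rabs_Ropp. ring.
    - apply (ex_RInt_ext (V := R_NormedModule) (fun t => opp (dec t))).
      + intros t _. unfold dec, opp, scal; simpl. unfold mult; simpl.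
        replace (-1 * t + 0)%R with (- t)%R by ring. rewrite Rabs_Ropp. ring.
      + apply (ex_RInt_opp (V := R_NormedModule)), ex_RInt_dec. }
  rewrite E. apply RInt_dec_tail; lra.
Qed.

Lemma tail_small A eps : 0 <= A -> 0 < eps -> exists N : nat, forall T, INR N <= T -> 4 * A / sqrt (1 + T) < eps.
Proof.
  intros HA He. destruct (nfloor_ex ((4 * A / eps) ^ 2)) as [N [_ HN]]; [apply pow2_ge_0|].
  exists (S N). intros T HT. rewrite S_INR in HT.
  assert (Hs : 4 * A / eps < sqrt (1 + T)).
  { assert (0 <= 4 * A / eps) by (apply Rdiv_le_0_compat; lra).
    rewrite <- (sqrt_pow2 (4 * A / eps)) by assumption. apply sqrt_lt_1_alt. split; [apply pow2_ge_0|lra]. }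
  assert (Hs0 : 0 < sqrt (1 + T)) by (apply sqrt_lt_R0; pose proof (pos_INR N); lra).
  apply Rmult_lt_reg_r with (sqrt (1 + T)); [exact Hs0|].
  unfold Rdiv. rewrite Rmult_assoc, Rinv_l, Rmult_1_r by lra.
  apply (Rmult_lt_compat_l eps) in Hs; [|exact He].
  replace (eps * (4 * A / eps))%R with (4 * A)%R in Hs by (field; lra). exact Hs.
Qed.

Section Line.
Variables (f : R -> C) (A : R).
Hypothesis (Hc : forall t, cts f t) (HA : 0 <= A) (Hb : forall t, Cmod (f t) <= A * dec t).

Lemma ctsI_all a b : ctsI a b f.
Proof. intros t _. apply Hc. Qed.

Lemma CI_line_tail T a b : 0 <= T -> a <= - T -> T <= b -> Cmod (CI f a b - CI f (- T) T) <= 4 * A / sqrt (1 + T).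
Proof.
  intros HT Ha Hb'.
  rewrite <- (CI_Chasles f a (- T) b) by (try lra; apply ctsI_all).
  rewrite <- (CI_Chasles f (- T) T b) by (try lra; apply ctsI_all).
  replace (CI f a (- T) + (CI f (- T) T + CI f T b) - CI f (- T) T) with (CI f a (- T) + CI f T b) by ring.
  eapply Rle_trans; [apply Cmod_triangle|].
  assert (K : forall x y, x <= y -> Cmod (CI f x y) <= A * RInt dec x y).
  { intros x y Hxy. eapply Rle_trans; [apply (Cmod_CI_le x y Hxy f (fun t => (A * dec t)%R))|].
    - apply ctsI_all.
    - apply (ex_RInt_scal (V := R_NormedModule)), ex_RInt_dec.
    - intros t _. apply Hb.
    - rewrite (RInt_scal (V := R_CompleteNormedModule)) by apply ex_RInt_dec. right. reflexivity. }
  pose proof (K a (- T)%R ltac:(lra)) as K1. pose proof (K T b ltac:(lra)) as K2.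
  pose proof (RInt_dec_tail T b HT Hb') as R1. pose proof (RInt_dec_tail_neg T a HT Ha) as R2.
  apply (Rmult_le_compat_l A) in R1; [|exact HA]. apply (Rmult_le_compat_l A) in R2; [|exact HA].
  replace (4 * A / sqrt (1 + T))%R with (A * (2 / sqrt (1 + T)) + A * (2 / sqrt (1 + T)))%R by (unfold Rdiv; ring). lra.
Qed.

Lemma line_limit : exists I, forall eps, 0 < eps -> exists T0, forall a b, a <= - T0 -> T0 <= b -> Cmod (CI f a b - I) < eps.
Proof.
  set (u := fun n : nat => CI f (- INR n) (INR n)).
  assert (HC : forall eps, 0 < eps -> exists N : nat, forall n, (N <= n)%nat -> Cmod (u n - u N) < eps).
  { intros eps He. destruct (tail_small A eps HA He) as [N HN]. exists N. intros n Hn.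
    eapply Rle_lt_trans; [apply CI_line_tail|apply (HN (INR N)); lra].
    - apply pos_INR.
    - apply le_INR in Hn. lra.
    - apply le_INR, Hn. }
  assert (Hre : forall g : C -> R, (forall x y, Rabs (g x - g y) <= Cmod (x - y)) -> exists l : R, is_lim_seq (fun n => g (u n)) l).
  { intros g Hg. assert (H : ex_finite_lim_seq (fun n => g (u n))).
    { apply ex_lim_seq_cauchy_corr. intros eps. assert (He : 0 < eps / 2) by (pose proof (cond_pos eps); lra).
      destruct (HC _ He) as [N HN]. exists N. intros n k Hn Hk.
      pose proof (HN n Hn). pose proof (HN k Hk). pose proof (Hg (u n) (u N)). pose proof (Hg (u k) (u N)).
      assert (Ha : Rabs (g (u n) - g (u N)) < eps / 2) by lra. assert (Hb' : Rabs (g (u k) - g (u N)) < eps / 2) by lra.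
      apply Rabs_def2 in Ha. apply Rabs_def2 in Hb'. apply Rabs_def1; lra. }
    destruct H as [l Hl]. exists l. exact Hl. }
  destruct (Hre Re) as [l1 H1]. { intros x y. exact (re_le_Cmod (x - y)). }
  destruct (Hre Im) as [l2 H2]. { intros x y. exact (im_le_Cmod (x - y)). }
  exists (l1, l2). intros eps He.
  assert (He4 : 0 < eps / 4) by lra.
  destruct (proj2 (is_lim_seq_spec _ _) H1 (mkposreal _ He4)) as [N1 HN1].
  destruct (proj2 (is_lim_seq_spec _ _) H2 (mkposreal _ He4)) as [N2 HN2].
  destruct (tail_small A (eps / 2) HA ltac:(lra)) as [N3 HN3].
  set (N := (N1 + N2 + N3)%nat). exists (INR N). intros a b Ha Hb'.
  assert (K1 : Rabs (Re (u N) - l1) < eps / 4) by exact (HN1 N ltac:(unfold N; lia)).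
  assert (K2 : Rabs (Im (u N) - l2) < eps / 4) by exact (HN2 N ltac:(unfold N; lia)).
  specialize (HN3 (INR N) ltac:(apply le_INR; unfold N; lia)).
  pose proof (CI_line_tail (INR N) a b (pos_INR N) Ha Hb') as HT.
  replace (CI f a b - (l1, l2)) with ((CI f a b - u N) + (u N - (l1, l2))) by ring.
  eapply Rle_lt_trans; [apply Cmod_triangle|].
  assert (Cmod (u N - (l1, l2)) < eps / 2).
  { eapply Rle_lt_trans; [apply Cmod_le_xy|]. change (Re (u N - (l1, l2))) with (Re (u N) - l1)%R.
    change (Im (u N - (l1, l2))) with (Im (u N) - l2)%R. lra. }
  unfold u in *. lra.
Qed.

Lemma line_is_RInt_gen I : (forall eps, 0 < eps -> exists T0, forall a b, a <= - T0 -> T0 <= b -> Cmod (CI f a b - I) < eps) ->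
  is_RInt_gen (V := C_R_NormedModule) f (Rbar_locally m_infty) (Rbar_locally p_infty) I.
Proof.
  intros HI P HP. apply (locallyC I P) in HP. destruct HP as [d [Hd HP]]. destruct (HI d Hd) as [T0 HT0].
  set (T := (Rabs T0 + 1)%R). pose proof (Rle_abs T0). pose proof (Rabs_pos T0).
  apply (Filter_prod _ _ _ (fun a => a < - T) (fun b => T < b)).
  - exists (- T)%R. auto.
  - exists T. auto.
  - intros a b Ha Hb'. exists (CI f a b). split.
    + apply (is_RInt_fct_extend_pair (U := R_NormedModule) (V := R_NormedModule)).
      * apply (RInt_correct (V := R_CompleteNormedModule)). apply (ctsI_fst a b); [unfold T in *; lra|apply ctsI_all].
      * apply (RInt_correct (V := R_CompleteNormedModule)). apply (ctsI_snd a b); [unfold T in *; lra|apply ctsI_all].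
    + apply HP, HT0; unfold T in *; lra.
Qed.

(** The bound by [dec] forces convergence over all growing intervals, so the value can be identified
    along the symmetric integer intervals that contour integration provides. *)
Lemma line_RInt I : lim eventually (fun n => CI f (- INR n) (INR n)) I -> RInt_line f = I.
Proof.
  intros HI. destruct line_limit as [I' HI']. unfold RInt_line.
  apply (is_RInt_gen_unique (V := C_R_CompleteNormedModule)).
  apply line_is_RInt_gen. replace I with I'; [exact HI'|].
  apply (lim_unique eventually (fun n => CI f (- INR n) (INR n))); [|exact HI].
  intros eps He. destruct (HI' eps He) as [T0 HT0]. destruct (nfloor_ex (Rabs T0)) as [N [_ HN]]; [apply Rabs_pos|].
  exists (S N). intros n Hn. pose proof (Rle_abs T0). apply le_INR in Hn. rewrite S_INR in Hn. apply HT0; lra.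
Qed.
End Line.

Lemma line_ex f A : (forall t, cts f t) -> 0 <= A -> (forall t, Cmod (f t) <= A * dec t) -> ex_RInt_line f.
Proof.
  intros Hc HA Hb. split.
  - destruct (line_limit f A Hc HA Hb) as [I HI]. exists I. apply line_is_RInt_gen; assumption.
  - assert (Hc2 : forall t, cts (fun t => RtoC (Cmod (f t))) t) by (intros t; apply cts_Cmod, Hc).
    destruct (line_limit (fun t => RtoC (Cmod (f t))) A Hc2 HA) as [I HI].
    { intros t. rewrite Cmod_R, Rabs_pos_eq by apply Cmod_ge_0. apply Hb. }
    exists (fst I). pose proof (line_is_RInt_gen _ Hc2 I HI) as H.
    intros P HP.
    assert (HP2 : locally (T := C_UniformSpace) I (fun y => P (fst y))).
    { apply locallyC. apply locallyR in HP. destruct HP as [d [Hd HP]]. exists d. split; [exact Hd|].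
      intros w Hw. apply HP. eapply Rle_lt_trans; [apply (re_le_Cmod (w - I))|exact Hw]. }
    specialize (H (fun y => P (fst y)) HP2). unfold filtermapi in *. revert H. apply filter_imp.
    intros [x y] [v [Hv1 Hv2]]. exists (fst v). split; [|exact Hv2].
    exact (is_RInt_fct_extend_fst (U := R_NormedModule) (V := R_NormedModule) _ _ _ _ Hv1).
Qed.

(** * The Herglotz formula for functions on the upper half-plane *)

(** The subtracted Cauchy kernel [1 / (t - p) - 1 / (t + i)]. The subtraction produces the decay
    [t^(-2)], and its pole [-i] lies below the contours. *)
Definition Ker (p t : C) : C := (p + Ci) / ((t - p) * (t + Ci)).

Lemma far_from_line p : Im p <> 0%R -> exists c, 0 < c /\ forall t : R, c * (1 + Rabs t) <= Cmod (RtoC t - p).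
Proof.
  intros Hp. set (y := Rabs (Im p)). assert (Hy : 0 < y) by (apply Rabs_pos_lt, Hp).
  pose proof (Cmod_ge_0 p) as Hp0.
  set (k := ((1 + Cmod p) / y + 1)%R).
  assert (Hk0 : 0 < (1 + Cmod p) / y) by (apply Rdiv_lt_0_compat; lra).
  assert (Hk : 0 < k) by (unfold k; lra).
  exists (/ k)%R. split; [apply Rinv_0_lt_compat, Hk|]. intros t.
  assert (H1 : y <= Cmod (RtoC t - p)).
  { eapply Rle_trans; [|apply im_le_Cmod]. unfold y. rewrite <- Rabs_Ropp. right. f_equal. destruct p; unfold Im; simpl; ring. }
  assert (H2 : Rabs t <= Cmod (RtoC t - p) + Cmod p).
  { rewrite <- Cmod_R. replace (RtoC t) with ((RtoC t - p) + p) at 1 by ring. apply Cmod_triangle. }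
  apply Rmult_le_reg_l with k; [exact Hk|]. rewrite <- Rmult_assoc, Rinv_r, Rmult_1_l by lra.
  unfold k. rewrite Rmult_plus_distr_r, Rmult_1_l.
  assert (H3 : (1 + Cmod p) / y * y <= (1 + Cmod p) / y * Cmod (RtoC t - p)) by (apply Rmult_le_compat_l; lra).
  replace ((1 + Cmod p) / y * y)%R with (1 + Cmod p)%R in H3 by (field; lra). lra.
Qed.

Lemma line_neq p (t : R) : Im p <> 0%R -> RtoC t - p <> 0.
Proof.
  intros Hp E0. apply Hp. apply (f_equal Im) in E0. destruct p as [x y]. unfold Im in *. simpl in *. lra.
Qed.

Lemma line_neq_Ci (t : R) : RtoC t + Ci <> 0.
Proof. intros E0. apply (f_equal Im) in E0. unfold Im in E0. simpl in E0. lra. Qed.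

Lemma Ker_line_bound p : Im p <> 0%R -> exists A, 0 <= A /\ forall t : R, Cmod (Ker p (RtoC t)) <= A * / (1 + Rabs t) ^ 2.
Proof.
  intros Hp. destruct (far_from_line p Hp) as [c [Hc H1]]. destruct (far_from_line (- Ci)) as [c' [Hc' H2]].
  { unfold Im; simpl; lra. }
  pose proof (Cmod_ge_0 (p + Ci)) as Hp0.
  exists (Cmod (p + Ci) * (/ c * / c'))%R.
  assert (Hi : 0 < / c * / c') by (apply Rmult_lt_0_compat; apply Rinv_0_lt_compat; assumption).
  split; [apply Rmult_le_pos; lra|]. intros t. pose proof (Rabs_pos t) as Ht.
  specialize (H1 t). specialize (H2 t). replace (RtoC t - - Ci) with (RtoC t + Ci) in H2 by ring.
  unfold Ker. rewrite Cmod_div by (apply Cmult_neq_0; [apply line_neq, Hp|apply line_neq_Ci]).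
  rewrite Cmod_mult. unfold Rdiv. rewrite Rmult_assoc. apply Rmult_le_compat_l; [exact Hp0|].
  replace (/ c * / c' * / (1 + Rabs t) ^ 2)%R with (/ ((c * (1 + Rabs t)) * (c' * (1 + Rabs t))))%R by (field; lra).
  assert (0 < c * (1 + Rabs t)) by (apply Rmult_lt_0_compat; lra).
  assert (0 < c' * (1 + Rabs t)) by (apply Rmult_lt_0_compat; lra).
  apply Rinv_le_contravar; [apply Rmult_lt_0_compat; lra|]. apply Rmult_le_compat; lra.
Qed.

Lemma cts_Ker p (t : R) : Im p <> 0%R -> cts (fun t : R => Ker p (RtoC t)) t.
Proof.
  intros Hp. apply cts_div; [apply cts_const| |apply Cmult_neq_0; [apply line_neq, Hp|apply line_neq_Ci]].
  apply cts_mult; [apply cts_minus|apply cts_plus]; try apply cts_idR; apply cts_const.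
Qed.

(** In the box [[-T, T] x [0, T]] the three other sides have total length [4 T] and lie at distance
    at least [T] from the origin. *)
Lemma bottom_small f T M : 0 < T -> 0 <= M -> (forall z, rect (- T) T 0 T z -> almost_dif f z) ->
  (forall z, rect (- T) T 0 T z -> T <= Cmod z -> Cmod (f z) <= M) ->
  Cmod (CI (fun x => f (RtoC x)) (- T) T) <= 4 * M * T.
Proof.
  intros HT HM Hf HB.
  assert (HJ : J f (- T) T 0 T = 0) by (apply goursat_almost; [lra|lra|exact Hf]).
  assert (Hc : ctsR f (- T) T 0 T) by (intros z Hz; apply Hf, Hz).
  unfold J in HJ.
  replace (CI (fun x => f (RtoC x)) (- T) T) with
    (CI (fun x => f (x, T)) (- T) T - Ci * CI (fun y => f (T, y)) 0 T + Ci * CI (fun y => f ((- T)%R, y)) 0 T).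
  - assert (B1 : Cmod (CI (fun x => f (x, T)) (- T) T) <= M * (T - - T)).
    { apply Cmod_CI_const; [lra|eapply ctsR_h; [exact Hc|lra]|]. intros t Ht. apply HB; [split; simpl; lra|].
      eapply Rle_trans; [|apply im_le_Cmod]. unfold Im. simpl. rewrite Rabs_pos_eq; lra. }
    assert (B2 : forall x, x = T \/ x = (- T)%R -> Cmod (Ci * CI (fun y => f (x, y)) 0 T) <= M * (T - 0)).
    { intros x Hx. rewrite Cmod_mult, Cmod_Ci, Rmult_1_l.
      apply Cmod_CI_const; [lra|eapply ctsR_v; [exact Hc|lra]|]. intros t Ht. apply HB; [split; simpl; lra|].
      eapply Rle_trans; [|apply re_le_Cmod]. unfold Re. simpl. destruct Hx as [-> | ->]; [|rewrite Rabs_Ropp]; rewrite Rabs_pos_eq; lra. }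
    pose proof (B2 T (or_introl eq_refl)). pose proof (B2 (- T)%R (or_intror eq_refl)).
    eapply Rle_trans; [apply Cmod_triangle|]. unfold Cminus.
    eapply Rle_trans; [apply Rplus_le_compat_r, Cmod_triangle|]. rewrite Cmod_opp. lra.
  - change (fun x : R => f (RtoC x)) with (fun x : R => f (x, 0%R)).
    apply (proj2 (Ceq_minus _ _)). transitivity (- (0)); [rewrite <- HJ|]; ring.
Qed.

Lemma lim_small_T (u : nat -> C) B : 0 <= B -> (exists N : nat, forall n, (N <= n)%nat -> Cmod (u n) <= B / sqrt (1 + INR n)) ->
  lim eventually u 0.
Proof.
  intros HB [N HN] eps He. destruct (tail_small (B / 4) eps ltac:(lra) He) as [N2 HN2]. exists (N + N2)%nat. intros n Hn.
  replace (u n - 0) with (u n) by ring. eapply Rle_lt_trans; [apply HN; lia|].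
  specialize (HN2 (INR n) ltac:(apply le_INR; lia)). replace (4 * (B / 4))%R with B in HN2 by field. exact HN2.
Qed.

Section Herglotz.
Variables (G : C -> C) (B : R).
Hypothesis (HG : forall z, 0 <= Im z -> locally z (dif G)).
Hypothesis (HB0 : 0 <= B) (HB : forall z, 0 <= Im z -> Cmod (G z) <= B * sqrt (1 + Cmod z)).

Lemma cts_G_line (t : R) : cts (fun t : R => G (RtoC t)) t.
Proof.
  apply (cts_comp G); [apply cts_idR|]. apply dif_cts, (locally_singleton _ _ (HG (RtoC t) ltac:(unfold Im; simpl; lra))).
Qed.

(** After division by [z + i], the integrand on the outer sides is of order [T^(1/2) / T^2] against
    a length [4 T], which leaves [T^(-1/2)]. *)
Lemma contour_limit (Q : C -> C) D R0 : 0 <= D -> (forall z, 0 <= Im z -> almost_dif Q z) ->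
  (forall z, 0 <= Im z -> R0 <= Cmod z -> Cmod (Q z) <= D * sqrt (1 + Cmod z) / Cmod z) ->
  lim eventually (fun n => CI (fun t => Q (RtoC t) / (RtoC t + Ci)) (- INR n) (INR n)) 0.
Proof.
  (* Here [4 M T = 16 D sqrt (1 + T) / T], which is at most [24 D / sqrt (1 + T)] once [T >= 2]. *)
  intros HD HQ HQb. apply lim_small_T with (24 * D)%R; [lra|].
  destruct (nfloor_ex (Rabs R0 + 2)) as [N [_ HN]]; [pose proof (Rabs_pos R0); lra|].
  exists (S N). intros n Hn. set (T := INR n).
  assert (HT : Rabs R0 + 2 <= T) by (apply le_INR in Hn; rewrite S_INR in Hn; unfold T; lra).
  pose proof (Rle_abs R0). pose proof (Rabs_pos R0).
  assert (Hs : 0 < sqrt (1 + T)) by (apply sqrt_lt_R0; lra).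
  assert (Ess : (sqrt (1 + T) * sqrt (1 + T) = 1 + T)%R) by (apply sqrt_sqrt; lra).
  set (M := (4 * D * sqrt (1 + T) / (T * T))%R).
  assert (HTT : 0 < T * T) by (apply Rmult_lt_0_compat; lra).
  assert (HM : 0 <= M).
  { apply Rdiv_le_0_compat; [|exact HTT]. apply Rmult_le_pos; lra. }
  eapply Rle_trans; [apply (bottom_small (fun z => Q z / (z + Ci)) T M)|].
  - lra.
  - exact HM.
  - intros z [Hz1 Hz2]. apply almost_dif_mult; [apply HQ, Hz2|]. apply dif_almost.
    assert (Hzi : z + Ci <> 0).
    { intros E0. apply (f_equal Im) in E0. destruct z. unfold Im in E0. simpl in *. lra. }
    assert (Hc : cts (fun z => z + Ci) z) by (apply cts_plus; [apply cts_id|apply cts_const]).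
    generalize (lim_neq_0 _ _ _ Hc Hzi). apply filter_imp. intros w Hw.
    apply dif_inv; [apply dif_plus; [apply dif_id|apply dif_const]|].
    apply Cmod_gt_0. pose proof (Cmod_ge_0 (z + Ci)). lra.
  - intros z [Hz1 Hz2] HzT.
    assert (Hz3 : Cmod z <= 2 * T).
    { eapply Rle_trans; [apply Cmod_le_xy|]. unfold Re, Im.
      assert (Rabs (fst z) <= T) by (apply Rabs_le; lra). assert (Rabs (snd z) <= T) by (apply Rabs_le; lra). lra. }
    assert (Hz4 : T / 2 <= Cmod (z + Ci)).
    { pose proof (Cmod_triangle (z + Ci) (- Ci)) as Ht. rewrite Cmod_opp, Cmod_Ci in Ht.
      replace (z + Ci + - Ci) with z in Ht by ring. lra. }
    assert (Hzi : z + Ci <> 0) by (apply Cmod_gt_0; lra).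
    rewrite Cmod_div by exact Hzi.
    assert (H1 : Cmod (Q z) <= D * (2 * sqrt (1 + T)) / T).
    { eapply Rle_trans; [apply HQb; [apply Hz2|lra]|]. unfold Rdiv. apply Rmult_le_compat.
      - apply Rmult_le_pos; [exact HD|apply sqrt_pos].
      - left. apply Rinv_0_lt_compat. lra.
      - apply Rmult_le_compat_l; [exact HD|].
        replace (2 * sqrt (1 + T))%R with (sqrt (4 * (1 + T))).
        + apply sqrt_le_1_alt. lra.
        + rewrite sqrt_mult_alt by lra. f_equal. replace 4%R with (2 ^ 2)%R by ring. apply sqrt_pow2. lra.
      - apply Rinv_le_contravar; lra. }
    unfold M. replace (4 * D * sqrt (1 + T) / (T * T))%R with ((D * (2 * sqrt (1 + T)) / T) * / (T / 2))%R by (field; lra).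
    apply Rmult_le_compat; [apply Cmod_ge_0|left; apply Rinv_0_lt_compat; lra|exact H1|].
    apply Rinv_le_contravar; lra.
  - unfold M. replace (4 * (4 * D * sqrt (1 + T) / (T * T)) * T)%R with (16 * D * sqrt (1 + T) / T)%R by (field; lra).
    apply Rmult_le_reg_r with (T * sqrt (1 + T))%R; [apply Rmult_lt_0_compat; lra|].
    replace (16 * D * sqrt (1 + T) / T * (T * sqrt (1 + T)))%R with (16 * D * (sqrt (1 + T) * sqrt (1 + T)))%R by (field; lra).
    replace (24 * D / sqrt (1 + T) * (T * sqrt (1 + T)))%R with (24 * D * T)%R by (field; lra).
    rewrite Ess. replace (16 * D * (1 + T))%R with (D * (16 * (1 + T)))%R by ring.
    replace (24 * D * T)%R with (D * (24 * T))%R by ring. apply Rmult_le_compat_l; lra.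
Qed.

(** With [p] below the axis the kernel is holomorphic on the closed upper half-plane, so the contour
    encloses no singularity. *)
Lemma lower_limit p : Im p < 0 ->
  lim eventually (fun n => CI (fun t => Ker p (RtoC t) * G (RtoC t)) (- INR n) (INR n)) 0.
Proof.
  intros Hp. pose proof (Cmod_ge_0 (p + Ci)) as Hpi. pose proof (Cmod_ge_0 p) as Hp0.
  assert (Hne : forall z, 0 <= Im z -> z - p <> 0).
  { intros z Hz E0. apply (f_equal Im) in E0. destruct z, p. unfold Im in *. simpl in *. lra. }
  refine (lim_ext_loc _ _ _ _ _ (contour_limit (fun z => (p + Ci) * (G z / (z - p))) (Cmod (p + Ci) * (2 * B)) (2 * Cmod p + 1) _ _ _)).
  - apply filter_forall. intros n. pose proof (pos_INR n). apply CI_ext; [lra|]. intros t _. unfold Ker.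
    pose proof (line_neq_Ci t). pose proof (Hne (RtoC t) ltac:(unfold Im; simpl; lra)). field. split; assumption.
  - apply Rmult_le_pos; lra.
  - intros z Hz. apply dif_almost.
    assert (Hc : cts (fun z => z - p) z) by (apply cts_minus; [apply cts_id|apply cts_const]).
    generalize (filter_and _ _ (HG z Hz) (lim_neq_0 _ _ _ Hc (Hne z Hz))). apply filter_imp. intros w [H1 H2].
    apply dif_mult; [apply dif_const|]. apply dif_div; [exact H1|apply dif_minus; [apply dif_id|apply dif_const]|].
    apply Cmod_gt_0. pose proof (Cmod_ge_0 (z - p)). lra.
  - intros z Hz HR. rewrite Cmod_mult, Cmod_div by (apply Hne, Hz).
    assert (Hzp : Cmod z / 2 <= Cmod (z - p)).
    { pose proof (Cmod_triangle (z - p) p) as Ht. replace (z - p + p) with z in Ht by ring. lra. }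
    replace (Cmod (p + Ci) * (2 * B) * sqrt (1 + Cmod z) / Cmod z)%R with
      (Cmod (p + Ci) * (B * sqrt (1 + Cmod z) * / (Cmod z / 2)))%R by (field; lra).
    apply Rmult_le_compat_l; [exact Hpi|]. apply Rmult_le_compat; [apply Cmod_ge_0| |apply HB, Hz|].
    + left. apply Rinv_0_lt_compat. lra.
    + apply Rinv_le_contravar; lra.
Qed.

(** Subtracting [G p] turns the pole of the kernel at [p] into a difference quotient, which is
    [almost_dif] everywhere above the line; the contribution of the constant [G p] is left to
    [Ker_upper_limit]. *)
Lemma upper_limit_diff p : 0 < Im p ->
  lim eventually (fun n => CI (fun t => Ker p (RtoC t) * (G (RtoC t) - G p)) (- INR n) (INR n)) 0.
Proof.
  intros Hp. pose proof (Cmod_ge_0 (p + Ci)) as Hpi. pose proof (Cmod_ge_0 p) as Hp0. pose proof (Cmod_ge_0 (G p)) as HGp.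
  pose proof (dif_C_derive G p (locally_singleton _ _ (HG p ltac:(lra)))) as Hd.
  refine (lim_ext_loc _ _ _ _ _ (contour_limit (fun z => (p + Ci) * quot G p (C_derive G p) z) (Cmod (p + Ci) * (2 * (B + Cmod (G p)))) (2 * Cmod p + 1) _ _ _)).
  - apply filter_forall. intros n. pose proof (pos_INR n). apply CI_ext; [lra|]. intros t _. unfold Ker.
    assert (Hn : RtoC t - p <> 0) by (apply line_neq; lra).
    rewrite quot_off by (intros E0; apply Hn; rewrite E0; ring).
    pose proof (line_neq_Ci t). field. split; assumption.
  - apply Rmult_le_pos; lra.
  - intros z Hz. apply almost_dif_mult; [apply dif_almost, filter_forall; intros w; apply dif_const|].
    apply quot_almost; [exact Hd|apply dif_almost, HG, Hz].
  - intros z Hz HR. rewrite Cmod_mult.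
    assert (Hzp : Cmod z / 2 <= Cmod (z - p)).
    { pose proof (Cmod_triangle (z - p) p) as Ht. replace (z - p + p) with z in Ht by ring. lra. }
    assert (Hn : z - p <> 0) by (apply Cmod_gt_0; lra).
    rewrite quot_off by (intros E0; apply Hn; rewrite E0; ring). rewrite Cmod_div by exact Hn.
    replace (Cmod (p + Ci) * (2 * (B + Cmod (G p))) * sqrt (1 + Cmod z) / Cmod z)%R with
      (Cmod (p + Ci) * ((B + Cmod (G p)) * sqrt (1 + Cmod z) * / (Cmod z / 2)))%R by (field; lra).
    apply Rmult_le_compat_l; [exact Hpi|]. apply Rmult_le_compat; [apply Cmod_ge_0|left; apply Rinv_0_lt_compat; lra| |].
    + eapply Rle_trans; [apply Cmod_triangle|]. rewrite Cmod_opp, Rmult_plus_distr_r. apply Rplus_le_compat; [apply HB, Hz|].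
      rewrite <- (Rmult_1_r (Cmod (G p))) at 1. apply Rmult_le_compat_l; [exact HGp|].
      rewrite <- sqrt_1 at 1. apply sqrt_le_1_alt. pose proof (Cmod_ge_0 z). lra.
    + apply Rinv_le_contravar; lra.
Qed.
End Herglotz.

(** At [p = i] the kernel is [2 i / (1 + t^2)], with primitive [2 i arctan t]. *)
Lemma Ker_Ci_limit : lim eventually (fun n => CI (fun t => Ker Ci (RtoC t)) (- INR n) (INR n)) (2 * RtoC PI * Ci).
Proof.
  assert (E : forall n, CI (fun t => Ker Ci (RtoC t)) (- INR n) (INR n) = RtoC (4 * atan (INR n)) * Ci).
  { intros n. pose proof (pos_INR n).
    rewrite (CI_FTC (fun t => (0, (2 * atan t)%R)) (fun t => Ker Ci (RtoC t))); [| | |].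
    - rewrite atan_opp. apply injective_projections; simpl; ring.
    - lra.
    - intros t _. apply cts_Ker. unfold Im; simpl; lra.
    - intros t _. assert (Hk : Ker Ci (RtoC t) = (0%R, (2 * / (1 + t²))%R)).
      { unfold Ker. assert (Hd : (RtoC t - Ci) * (RtoC t + Ci) = RtoC (1 + t²)).
        { apply injective_projections; unfold Rsqr; simpl; ring. }
        rewrite Hd. assert (0 < 1 + t²) by (pose proof (Rle_0_sqr t); lra).
        unfold Cdiv. rewrite <- RtoC_inv by lra. apply injective_projections; simpl; ring. }
      rewrite Hk. simpl. split; [apply (is_derive_const (K := R_AbsRing) (V := R_NormedModule) 0%R)|].
      apply (is_derive_scal atan t 2), is_derive_atan. }
  refine (lim_ext_loc _ (fun n => RtoC (4 * atan (INR n)) * Ci) _ _ _ _).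
  { apply filter_forall. intros n. symmetry. apply E. }
  apply lim_mult; [typeclasses eauto| |apply lim_const; typeclasses eauto].
  assert (HL : is_lim_seq (fun n => atan (/ INR (S n))) (atan 0)).
  { apply is_lim_seq_continuous; [apply continuity_pt_filterlim, continuous_atan|].
    apply (is_lim_seq_incr_1 (fun n => / INR n)%R). change 0%R with (real (Rbar_inv p_infty)).
    apply (is_lim_seq_inv INR p_infty); [apply is_lim_seq_INR|discriminate]. }
  rewrite atan_0 in HL. apply (is_lim_seq_incr_1 (fun n => atan (/ INR n))) in HL.
  intros eps He. assert (He4 : 0 < eps / 4) by lra.
  destruct (proj2 (is_lim_seq_spec _ _) HL (mkposreal _ He4)) as [N HN]. simpl in HN.
  exists (S N). intros n Hn. specialize (HN n ltac:(lia)). rewrite Rminus_0_r in HN.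
  assert (Hn0 : 0 < INR n) by (apply lt_0_INR; lia). rewrite atan_inv in HN by exact Hn0.
  rewrite <- RtoC_mult, <- RtoC_minus, Cmod_R.
  replace (4 * atan (INR n) - 2 * PI)%R with (4 * - (PI / 2 - atan (INR n)))%R by field.
  rewrite Rabs_mult, Rabs_Ropp, (Rabs_pos_eq 4) by lra. lra.
Qed.

(** Reduces the integral for a general [p] above the line to the explicit one for [i]: the remaining
    conjugated kernel has its pole below, and [lower_limit] with the constant function 1 shows that
    it contributes 0. *)
Lemma Ker_conj p (t : R) : Im p <> 0%R -> Ker p (RtoC t) = Ker Ci (RtoC t) + Cconj (Ker (Cconj p) (RtoC t)).
Proof.
  intros Hp. pose proof (line_neq p t Hp) as H1.
  assert (Hp2 : Im (Cconj p) <> 0%R) by (rewrite im_conj; lra).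
  pose proof (line_neq (Cconj p) t Hp2) as H2. pose proof (line_neq_Ci t) as H3.
  assert (H4 : RtoC t - Ci <> 0) by (apply line_neq; unfold Im; simpl; lra).
  unfold Ker. rewrite Cdiv_conj by (apply Cmult_neq_0; assumption).
  rewrite Cmult_conj, Cminus_conj, !Cplus_conj, Cconj_conj.
  replace (Cconj (RtoC t)) with (RtoC t) by (apply injective_projections; simpl; ring).
  replace (Cconj Ci) with (- Ci) by (apply injective_projections; simpl; ring).
  assert (H5 : RtoC t + - Ci <> 0) by exact H4.
  field. repeat split; assumption.
Qed.

Lemma Ker_upper_limit p : 0 < Im p -> lim eventually (fun n => CI (fun t => Ker p (RtoC t)) (- INR n) (INR n)) (2 * RtoC PI * Ci).
Proof.
  intros Hp.
  assert (Hpc : Im (Cconj p) < 0) by (rewrite im_conj; lra).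
  pose proof (lower_limit (fun _ => 1) 1 (fun z _ => filter_forall _ (fun w => dif_const 1 w)) ltac:(lra)) as HL.
  specialize (HL ltac:(intros z _; cbv beta; rewrite Cmod_1, Rmult_1_l; rewrite <- sqrt_1 at 1; apply sqrt_le_1_alt; pose proof (Cmod_ge_0 z); lra) (Cconj p) Hpc).
  pose proof (lim_plus _ _ _ _ _ Ker_Ci_limit (lim_conj _ _ _ HL)) as H.
  replace (2 * RtoC PI * Ci + Cconj 0) with (2 * RtoC PI * Ci) in H by (apply injective_projections; simpl; ring).
  refine (lim_ext_loc _ _ _ _ _ H). apply filter_forall. intros n. pose proof (pos_INR n).
  rewrite <- CI_conj; [|lra|].
  - rewrite <- CI_plus; [|lra| |].
    + apply CI_ext; [lra|]. intros t _. rewrite (Ker_conj p t) by lra. rewrite Cmult_1_r. reflexivity.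
    + intros t _. apply cts_Ker. unfold Im; simpl; lra.
    + intros t _. apply cts_conj, cts_mult; [apply cts_Ker; lra|apply cts_const].
  - intros t _. apply cts_mult; [apply cts_Ker; lra|apply cts_const].
Qed.

Section Herglotz2.
Variables (G : C -> C) (B : R).
Hypothesis (HG : forall z, 0 <= Im z -> locally z (dif G)).
Hypothesis (HB0 : 0 <= B) (HB : forall z, 0 <= Im z -> Cmod (G z) <= B * sqrt (1 + Cmod z)).

Lemma upper_limit p : 0 < Im p ->
  lim eventually (fun n => CI (fun t => Ker p (RtoC t) * G (RtoC t)) (- INR n) (INR n)) (2 * RtoC PI * Ci * G p).
Proof.
  intros Hp. pose proof (upper_limit_diff G B HG HB0 HB p Hp) as H1.
  pose proof (lim_mult _ _ _ _ _ (lim_const _ (G p)) (Ker_upper_limit p Hp)) as H2.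
  pose proof (lim_plus _ _ _ _ _ H1 H2) as H.
  replace (0 + G p * (2 * RtoC PI * Ci)) with (2 * RtoC PI * Ci * G p) in H by ring.
  refine (lim_ext_loc _ _ _ _ _ H). apply filter_forall. intros n. pose proof (pos_INR n).
  assert (HK : ctsI (- INR n) (INR n) (fun t => Ker p (RtoC t))) by (intros t _; apply cts_Ker; lra).
  rewrite <- CI_scal; [|lra|exact HK]. rewrite <- CI_plus; [|lra| |].
  - apply CI_ext; [lra|]. intros t _. ring.
  - intros t Ht. apply cts_mult; [apply HK, Ht|]. apply cts_minus; [apply cts_G_line, HG|apply cts_const].
  - intros t Ht. apply cts_mult; [apply cts_const|apply HK, Ht].
Qed.

Definition herglotz_integrand (z : C) (t : R) : C :=
  (1 + RtoC t * z) / (RtoC t - z) * RtoC (2 * Re (G (RtoC t))) / RtoC (1 + t ^ 2).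

(** The left side is [1 / (t - z) - t / (1 + t^2)], and [t / (1 + t^2)] is the average of
    [1 / (t - i)] and [1 / (t + i)]. *)
Lemma kernel_split z (t : R) : Im z <> 0%R ->
  (1 + RtoC t * z) / (RtoC t - z) / RtoC (1 + t ^ 2) = Ker z (RtoC t) - / 2 * Ker Ci (RtoC t).
Proof.
  intros Hz. pose proof (line_neq z t Hz) as H1. pose proof (line_neq_Ci t) as H2.
  assert (H3 : RtoC t - Ci <> 0) by (apply line_neq; unfold Im; simpl; lra).
  assert (Hd : RtoC (1 + t ^ 2) = (RtoC t - Ci) * (RtoC t + Ci)) by (apply injective_projections; simpl; ring).
  rewrite Hd. unfold Ker.
  assert (Hii : Ci * Ci = - (1)) by (apply injective_projections; simpl; ring).
  apply (Cmult_reg_r _ _ (2 * (RtoC t - z) * (RtoC t - Ci) * (RtoC t + Ci))).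
  - repeat apply Cmult_neq_0; try assumption. intros E0; apply RtoC_inj in E0; lra.
  - transitivity (2 * (1 + RtoC t * z)); [field; repeat split; assumption|].
    transitivity (2 * (z + Ci) * (RtoC t - Ci) - 2 * Ci * (RtoC t - z)).
    + replace (2 * (z + Ci) * (RtoC t - Ci) - 2 * Ci * (RtoC t - z)) with (2 * RtoC t * z - 2 * (Ci * Ci)) by ring. rewrite Hii. ring.
    + field. repeat split; assumption.
Qed.

(** Writing [2 Re G = G + conj G] and using that on the real line the kernel at [z] is the conjugate
    of the kernel at [conj z], the non-holomorphic integrand becomes a holomorphic boundary value
    plus the conjugate of one. *)
Lemma herglotz_split z (t : R) : Im z <> 0%R ->
  herglotz_integrand z t = (Ker z (RtoC t) - / 2 * Ker Ci (RtoC t)) * G (RtoC t)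
     + Cconj ((Ker (Cconj z) (RtoC t) - / 2 * Ker Ci (RtoC t)) * G (RtoC t)).
Proof.
  intros Hz. assert (Hzc : Im (Cconj z) <> 0%R) by (rewrite im_conj; lra).
  rewrite <- !kernel_split by assumption.
  pose proof (line_neq z t Hz) as H1. pose proof (line_neq (Cconj z) t Hzc) as H1c.
  assert (H2 : RtoC (1 + t ^ 2) <> 0).
  { intros E0. apply RtoC_inj in E0. pose proof (pow2_ge_0 t). lra. }
  assert (Hk : Cconj ((1 + RtoC t * Cconj z) / (RtoC t - Cconj z) / RtoC (1 + t ^ 2)) = (1 + RtoC t * z) / (RtoC t - z) / RtoC (1 + t ^ 2)).
  { rewrite !Cdiv_conj by assumption. rewrite Cminus_conj, Cplus_conj, Cmult_conj, Cconj_conj.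
    assert (Er : forall x, Cconj (RtoC x) = RtoC x) by (intros x; apply injective_projections; simpl; ring).
    rewrite !Er. reflexivity. }
  rewrite Cmult_conj, Hk. unfold herglotz_integrand. rewrite RtoC_mult, re_alt.
  field. split; assumption.
Qed.

Lemma herglotz_cts z (t : R) : Im z <> 0%R -> cts (herglotz_integrand z) t.
Proof.
  intros Hz. assert (Hzc : Im (Cconj z) <> 0%R) by (rewrite im_conj; lra).
  assert (Hi : Im Ci <> 0%R) by (unfold Im; simpl; lra).
  apply cts_ext_loc with (fun t => (Ker z (RtoC t) - / 2 * Ker Ci (RtoC t)) * G (RtoC t)
     + Cconj ((Ker (Cconj z) (RtoC t) - / 2 * Ker Ci (RtoC t)) * G (RtoC t))).
  - apply filter_forall. intros s. symmetry. apply herglotz_split, Hz.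
  - apply cts_plus; [|apply cts_conj]; (apply cts_mult; [|apply cts_G_line, HG]);
    (apply cts_minus; [apply cts_Ker; assumption|]); (apply cts_mult; [apply cts_const|apply cts_Ker; assumption]).
Qed.

Lemma herglotz_bound z : Im z <> 0%R -> exists A, 0 <= A /\ forall t, Cmod (herglotz_integrand z t) <= A * dec t.
Proof.
  intros Hz. destruct (Ker_line_bound z Hz) as [A1 [HA1 H1]].
  destruct (Ker_line_bound Ci ltac:(unfold Im; simpl; lra)) as [A2 [HA2 H2]].
  assert (HAB : 0 <= (A1 + A2) * (2 * B)) by (apply Rmult_le_pos; lra).
  exists ((A1 + A2) * (2 * B))%R. split; [exact HAB|]. intros t. pose proof (Rabs_pos t) as Ht.
  assert (Hi : 0 < / (1 + Rabs t) ^ 2) by (apply Rinv_0_lt_compat, pow_lt; lra).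
  assert (E0 : herglotz_integrand z t = (Ker z (RtoC t) - / 2 * Ker Ci (RtoC t)) * RtoC (2 * Re (G (RtoC t)))).
  { rewrite <- kernel_split by exact Hz. unfold herglotz_integrand, Cdiv. ring. }
  rewrite E0, Cmod_mult.
  assert (K1 : Cmod (Ker z (RtoC t) - / 2 * Ker Ci (RtoC t)) <= (A1 + A2) * / (1 + Rabs t) ^ 2).
  { eapply Rle_trans; [apply Cmod_triangle|]. rewrite Cmod_opp, Cmod_mult, Rmult_plus_distr_r.
    apply Rplus_le_compat; [apply H1|]. rewrite <- RtoC_inv, Cmod_R, Rabs_pos_eq by lra.
    specialize (H2 t). pose proof (Cmod_ge_0 (Ker Ci (RtoC t))). lra. }
  assert (K2 : Cmod (RtoC (2 * Re (G (RtoC t)))) <= 2 * B * sqrt (1 + Rabs t)).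
  { rewrite Cmod_R, Rabs_mult, Rabs_pos_eq by lra. rewrite Rmult_assoc. apply Rmult_le_compat_l; [lra|].
    eapply Rle_trans; [apply re_le_Cmod|]. rewrite <- (Cmod_R t). apply HB. unfold Im; simpl; lra. }
  assert (Hs : 0 < sqrt (1 + Rabs t)) by (apply sqrt_lt_R0; lra).
  apply Rle_trans with ((A1 + A2) * / (1 + Rabs t) ^ 2 * (2 * B * sqrt (1 + Rabs t)))%R.
  - apply Rmult_le_compat; try apply Cmod_ge_0; assumption.
  - right. unfold dec.
    assert (Eq : (1 + Rabs t = sqrt (1 + Rabs t) * sqrt (1 + Rabs t))%R) by (symmetry; apply sqrt_sqrt; lra).
    revert Hs Eq. generalize (sqrt (1 + Rabs t)). intros q Hs Eq. rewrite Eq. field. lra.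
Qed.

Lemma herglotz_formula z : 0 < Im z ->
  ex_RInt_line (herglotz_integrand z) /\
  RInt_line (herglotz_integrand z) = 2 * RtoC PI * Ci * (G z - Ci * RtoC (Im (G Ci))).
Proof.
  intros Hz. assert (Hz0 : Im z <> 0%R) by lra.
  assert (Hzc : Im (Cconj z) < 0) by (rewrite im_conj; lra).
  assert (Hi : 0 < Im Ci) by (unfold Im; simpl; lra).
  destruct (herglotz_bound z Hz0) as [A [HA HAb]].
  assert (Hc : forall t, cts (herglotz_integrand z) t) by (intros t; apply herglotz_cts, Hz0).
  split; [apply (line_ex _ A Hc HA HAb)|]. apply (line_RInt _ A Hc HA HAb).
  pose proof (lim_mult _ _ _ _ _ (lim_const _ (/ 2)) (upper_limit Ci Hi)) as LCi.
  pose proof (lim_minus _ _ _ _ _ (upper_limit z Hz) LCi) as L1.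
  pose proof (lim_conj _ _ _ (lim_minus _ _ _ _ _ (lower_limit G B HG HB0 HB (Cconj z) Hzc) LCi)) as L2.
  pose proof (lim_plus _ _ _ _ _ L1 L2) as LL.
  (* The first summand contributes [2 pi i (G z - G i / 2)]. In the conjugated one the kernel at
     [conj z] gives 0, and [pi i conj (G i)] remains. Together they leave [G z] and the imaginary
     part of [G i]. *)
  assert (HE : 2 * RtoC PI * Ci * G z - / 2 * (2 * RtoC PI * Ci * G Ci) + Cconj (0 - / 2 * (2 * RtoC PI * Ci * G Ci))
     = 2 * RtoC PI * Ci * (G z - Ci * RtoC (Im (G Ci)))).
  { rewrite im_alt. replace (0 - / 2 * (2 * RtoC PI * Ci * G Ci)) with (- (RtoC PI * Ci * G Ci)) by field.
    rewrite Copp_conj, !Cmult_conj.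
    replace (Cconj (RtoC PI)) with (RtoC PI) by (apply injective_projections; simpl; ring).
    replace (Cconj Ci) with (- Ci) by (apply injective_projections; simpl; ring).
    field. apply Ci_nz. }
  rewrite HE in LL.
  refine (lim_ext_loc _ _ _ _ _ LL). apply filter_forall. intros n. pose proof (pos_INR n) as Hn.
  assert (Hab : - INR n <= INR n) by lra.
  assert (HK : forall p, Im p <> 0%R -> ctsI (- INR n) (INR n) (fun t => Ker p (RtoC t) * G (RtoC t))).
  { intros p Hp t _. apply cts_mult; [apply cts_Ker, Hp|apply cts_G_line, HG]. }
  assert (Hi0 : Im Ci <> 0%R) by lra. assert (Hzc0 : Im (Cconj z) <> 0%R) by lra.
  assert (HS : ctsI (- INR n) (INR n) (fun t => / 2 * (Ker Ci (RtoC t) * G (RtoC t)))).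
  { intros t Ht. apply cts_mult; [apply cts_const|apply HK; assumption]. }
  assert (HM : forall p, Im p <> 0%R -> ctsI (- INR n) (INR n) (fun t => Ker p (RtoC t) * G (RtoC t) - / 2 * (Ker Ci (RtoC t) * G (RtoC t)))).
  { intros p Hp t Ht. apply cts_minus; [apply HK; assumption|apply HS, Ht]. }
  rewrite <- CI_scal; [|exact Hab|apply HK, Hi0].
  rewrite <- !CI_minus; [|exact Hab|apply HK; assumption|exact HS|exact Hab|apply HK; assumption|exact HS].
  rewrite <- CI_conj; [|exact Hab|apply HM; assumption].
  rewrite <- CI_plus; [|exact Hab|apply HM; assumption|intros t Ht; apply cts_conj, HM; assumption].
  apply CI_ext; [exact Hab|]. intros t _. rewrite herglotz_split by exact Hz0.
  f_equal; [ring|f_equal; ring].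
Qed.
End Herglotz2.

(** * The extension to the upper half-plane *)

Lemma Re_crit z : Re (1 / 2 - Ci * z) = (1 / 2 + Im z)%R.
Proof. destruct z. unfold Re, Im. simpl. field. Qed.

Lemma dif_crit z : dif (fun z => 1 / 2 - Ci * z) z.
Proof. apply dif_minus; [apply dif_const|apply dif_mult; [apply dif_const|apply dif_id]]. Qed.

Lemma crit_locally z (P : C -> Prop) : locally (1 / 2 - Ci * z) P -> locally z (fun w => P (1 / 2 - Ci * w)).
Proof. intros H. apply (lim_locally (locally z) (fun w => 1 / 2 - Ci * w) _ P (dif_cts _ _ (dif_crit z)) H). Qed.

Lemma crit_locally' z (P : C -> Prop) : locally' (1 / 2 - Ci * z) P -> locally' z (fun w => P (1 / 2 - Ci * w)).
Proof.
  unfold locally', within. intros H. generalize (crit_locally z _ H). apply filter_imp.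
  intros w Hw Hn. apply Hw. intros E. apply Hn.
  apply (Cmult_reg_r _ _ (- Ci)); [intros E0; apply (f_equal Im) in E0; unfold Im in E0; simpl in E0; lra|].
  replace (w * - Ci) with (1 / 2 - Ci * w - 1 / 2) by ring. rewrite E. ring.
Qed.

Lemma holo_log_derive f s : locally s (dif f) -> f s <> 0 -> locally s (dif (log_derive f)).
Proof.
  intros Hf H0. pose proof (lim_neq_0 _ _ _ (dif_cts _ _ (locally_singleton _ _ Hf)) H0) as HN.
  generalize (filter_and _ _ (locally_locally _ _ Hf) HN). apply filter_imp. intros w [H1 H2].
  apply (dif_div (C_derive f) f); [apply derive_holomorphic, H1|apply (locally_singleton _ _ H1)|].
  apply Cmod_gt_0. apply Cmod_gt_0 in H0. lra.
Qed.

(** For [Im z >= 0] the argument has real part at least [lam / 2], even when [Re mu = 0], so the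
    polar term of [digamma_bound] stays bounded and the square root prevails. *)
Lemma log_derive_sqrt_bound (lam : R) (mu : C) : 0 < lam -> 0 <= Re mu ->
  exists B, 0 <= B /\ forall z, 0 <= Im z ->
    Cmod (RtoC lam * digamma (RtoC lam * (1 / 2 - Ci * z) + mu)) <= B * sqrt (1 + Cmod z).
Proof.
  intros Hl Hm. pose proof Sq_pos as HS. set (K := (1 + lam + Cmod mu)%R).
  assert (HK : 0 < K) by (pose proof (Cmod_ge_0 mu); unfold K; lra).
  assert (Hi : 0 < / (lam / 2)) by (apply Rinv_0_lt_compat; lra).
  exists (lam * (/ (lam / 2) + sqrt (2 * K) * Sq))%R. split.
  { apply Rmult_le_pos; [lra|]. assert (0 <= sqrt (2 * K) * Sq) by (apply Rmult_le_pos; [apply sqrt_pos|lra]). lra. }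
  intros z Hz. pose proof (Cmod_ge_0 z) as Hz0.
  set (w := RtoC lam * (1 / 2 - Ci * z) + mu).
  assert (Hw : lam / 2 <= Re w).
  { unfold w. change (Re (RtoC lam * (1 / 2 - Ci * z) + mu)) with (Re (RtoC lam * (1 / 2 - Ci * z)) + Re mu)%R.
    rewrite re_scal_l, Re_crit. assert (0 <= lam * Im z) by (apply Rmult_le_pos; lra).
    rewrite Rmult_plus_distr_l. lra. }
  assert (Hw2 : 1 + Cmod w <= K * (1 + Cmod z)).
  { assert (H : Cmod w <= lam * (1 / 2 + Cmod z) + Cmod mu).
    { unfold w. eapply Rle_trans; [apply Cmod_triangle|]. apply Rplus_le_compat_r. rewrite Cmod_mult, Cmod_R, Rabs_pos_eq by lra.
      apply Rmult_le_compat_l; [lra|]. eapply Rle_trans; [apply Cmod_triangle|].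
      rewrite Cmod_opp, Cmod_mult, Cmod_Ci, Rmult_1_l. apply Rplus_le_compat_r.
      replace (1 / 2) with (RtoC (1 / 2)) by (rewrite RtoC_div by lra; reflexivity). rewrite Cmod_R, Rabs_pos_eq; lra. }
    unfold K. pose proof (Cmod_ge_0 mu).
    assert (0 <= Cmod mu * Cmod z) by (apply Rmult_le_pos; lra).
    replace ((1 + lam + Cmod mu) * (1 + Cmod z))%R with (1 + lam + Cmod mu + Cmod z + lam * Cmod z + Cmod mu * Cmod z)%R by ring. lra. }
  assert (Hs1 : 1 <= sqrt (1 + Cmod z)) by (rewrite <- sqrt_1 at 1; apply sqrt_le_1_alt; lra).
  rewrite Cmod_mult, Cmod_R, Rabs_pos_eq by lra. rewrite Rmult_assoc. apply Rmult_le_compat_l; [lra|].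
  eapply Rle_trans; [apply digamma_bound; lra|]. rewrite Rmult_plus_distr_r. apply Rplus_le_compat.
  - rewrite <- (Rmult_1_r (/ Re w)). apply Rmult_le_compat; [left; apply Rinv_0_lt_compat; lra|lra| |exact Hs1].
    apply Rinv_le_contravar; lra.
  - replace (sqrt (2 * K) * Sq * sqrt (1 + Cmod z))%R with (sqrt (2 * K) * sqrt (1 + Cmod z) * Sq)%R by ring.
    apply Rmult_le_compat_r; [lra|]. rewrite <- sqrt_mult_alt by lra. apply sqrt_le_1_alt. lra.
Qed.

Section Gamma_part.
Variable L : selberg_class.

Lemma dif_Gsum s : 0 < Re s -> dif (Gsum L) s.
Proof.
  intros Hs. apply dif_plus; [apply dif_const|].
  apply (dif_Csum (fun (p : R * C) s => RtoC (fst p) * digamma (RtoC (fst p) * s + snd p))).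
  intros p Hp. apply dif_mult; [apply dif_const|].
  apply (dif_comp digamma (fun s => RtoC (fst p) * s + snd p)).
  - apply dif_plus; [apply dif_mult; [apply dif_const|apply dif_id]|apply dif_const].
  - apply dif_digamma, (Re_garg L); assumption.
Qed.

Definition Gline (z : C) : C := Gsum L (1 / 2 - Ci * z).

Lemma holo_Gline z : 0 <= Im z -> locally z (dif Gline).
Proof.
  intros Hz. assert (H : 0 < Re (1 / 2 - Ci * z)) by (rewrite Re_crit; lra).
  generalize (crit_locally z _ (locally_Re_gt _ _ H)). apply filter_imp. intros w Hw.
  apply (dif_comp (Gsum L)); [apply dif_crit|apply dif_Gsum, Hw].
Qed.

Lemma Gline_bound : exists B, 0 <= B /\ forall z, 0 <= Im z -> Cmod (Gline z) <= B * sqrt (1 + Cmod z).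
Proof.
  assert (K : forall l, (forall p, In p l -> In p (gammas L)) -> exists B, 0 <= B /\ forall z, 0 <= Im z ->
    Cmod (Csum (fun p : R * C => RtoC (fst p) * digamma (RtoC (fst p) * (1 / 2 - Ci * z) + snd p)) l) <= B * sqrt (1 + Cmod z)).
  { induction l as [|p l IH]; intros Hl.
    - exists 0%R. split; [lra|]. intros z _. simpl. rewrite Cmod_0. lra.
    - destruct IH as [B1 [HB1 H1]]; [intros q Hq; apply Hl; right; exact Hq|].
      destruct (gam_pos L p (Hl p (or_introl eq_refl))) as [P1 P2].
      destruct (log_derive_sqrt_bound (fst p) (snd p) P1 P2) as [B2 [HB2 H2]].
      exists (B2 + B1)%R. split; [lra|]. intros z Hz. rewrite Csum_cons, Rmult_plus_distr_r.
      eapply Rle_trans; [apply Cmod_triangle|]. apply Rplus_le_compat; [apply H2, Hz|apply H1, Hz]. }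
  destruct (K (gammas L) (fun p H => H)) as [B [HB H]].
  exists (Rabs (ln (Qcond L)) + B)%R. pose proof (Rabs_pos (ln (Qcond L))) as HQ. split; [lra|].
  intros z Hz. unfold Gline, Gsum. eapply Rle_trans; [apply Cmod_triangle|].
  rewrite Rmult_plus_distr_r. apply Rplus_le_compat; [|apply H, Hz].
  rewrite Cmod_R. rewrite <- (Rmult_1_r (Rabs (ln (Qcond L)))) at 1. apply Rmult_le_compat_l; [exact HQ|].
  pose proof (Cmod_ge_0 z). rewrite <- sqrt_1 at 1. apply sqrt_le_1_alt. lra.
Qed.

Lemma W_Gline t : W L t = (2 * Re (Gline (RtoC t)))%R.
Proof.
  unfold W, Gline, Gsum.
  change (Re (RtoC (ln (Qcond L)) + ?x)) with (ln (Qcond L) + Re x)%R.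
  rewrite Rmult_plus_distr_l. do 3 f_equal. apply Csum_ext. intros p Hp.
  rewrite log_derive_CGamma; [reflexivity|]. apply (Re_garg L); [exact Hp|]. rewrite Re_crit. simpl. lra.
Qed.

(** The substitution [s = 1/2 - i z] sends [i] to [3/2], so the constant of the Herglotz formula is
    evaluated at the base point of the sum over zeros. *)
Lemma integral_part z : 0 < Im z -> ex_RInt_line (integrand L z) /\
  RInt_line (integrand L z) = 2 * RtoC PI * Ci * (Gsum L (1 / 2 - Ci * z) - Ci * RtoC (Im (Gsum L (RtoC (3 / 2))))).
Proof.
  intros Hz. destruct Gline_bound as [B [HB0 HB]].
  pose proof (herglotz_formula Gline B holo_Gline HB0 HB z Hz) as H.
  replace (integrand L z) with (herglotz_integrand Gline z).
  - unfold Gline in H at 3 4. replace (1 / 2 - Ci * Ci) with (RtoC (3 / 2)) in H; [exact H|].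
    apply injective_projections; simpl; field.
  - apply functional_extensionality. intros t. unfold herglotz_integrand, integrand. rewrite W_Gline. reflexivity.
Qed.
End Gamma_part.

Section Extension.
Variable L : selberg_class.
Variable E : C -> C.
Hypothesis HEe : entire E.
Hypothesis HEo : finite_order E.
Hypothesis HEL : forall s : C, s <> 1 \/ m_pole L = 0%nat -> E s = (s - 1) ^ m_pole L * L s.
Notation XL := (X L E).
Notation m := (m_pole L).

Lemma singular_iff z : singular_point L z <-> XL (1 / 2 - Ci * z) = 0 \/ ((0 < m)%nat /\ 1 / 2 - Ci * z = 1).
Proof.
  pose proof Ci_nz as HCi.
  assert (H2 : RtoC 2 <> 0) by (intros E0; apply RtoC_inj in E0; lra).
  assert (Hii : Ci * Ci = - (1)) by (apply injective_projections; simpl; ring).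
  assert (Hg : forall s, s = 1 / 2 - Ci * z <-> z = gamma_of s).
  { intros s. unfold gamma_of. split.
    - intros ->. field. assumption.
    - intros ->. field. assumption. }
  unfold singular_point. rewrite (nontrivial_zeros_eq L E HEe HEL). split.
  - intros [[p [[n [Hn _]] Hz]]|[Hm Hz]].
    + left. apply Hg in Hz. rewrite <- Hz. apply (multiplicity_zero _ _ n Hn).
    + right. split; [exact Hm|]. rewrite Hz.
      replace (1 / 2 - Ci * (Ci / 2)) with (1 / 2 - Ci * Ci / 2) by field. rewrite Hii. field.
  - intros [H0|[Hm Hz]].
    + left. destruct (entire_zero_multiplicity XL (RtoC (3 / 2)) _ (entire_X L E HEe HEL) (XL_c L E HEL) H0) as [n Hn].
      exists (1 / 2 - Ci * z, 0%nat). split.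
      * exists n. split; [exact Hn|]. destruct Hn as [Hn _]. simpl. lia.
      * apply Hg. reflexivity.
    + right. split; [exact Hm|]. apply (Cmult_reg_r _ _ Ci HCi).
      replace (z * Ci) with (1 / 2 - (1 / 2 - Ci * z)) by ring. rewrite Hz.
      replace (Ci / 2 * Ci) with (Ci * Ci / 2) by field. rewrite Hii. field.
Qed.

(** Since the pole of [L] at 1 has order exactly [m], the completed function does not vanish there;
    the two kinds of singular points therefore never coincide. *)
Lemma X_1_neq_0 : ((0 < m)%nat -> E 1 <> 0) -> (0 < m)%nat -> XL 1 <> 0.
Proof.
  intros HE1 Hm. rewrite (X_right L E) by (simpl; lra). unfold Xp.
  apply Cmult_neq_0; [apply Xp_factor_neq_0; simpl; lra|apply HE1, Hm].
Qed.

Lemma nonsingular z : ~ singular_point L z ->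
  XL (1 / 2 - Ci * z) <> 0 /\ (1 / 2 - Ci * z <> 1 \/ m = 0%nat).
Proof.
  intros H. rewrite singular_iff in H. split; [tauto|].
  destruct (Nat.eq_dec m 0) as [|Hm]; [tauto|]. left. intros E0. apply H. right. split; [lia|exact E0].
Qed.

Lemma polar_part z : 1 / 2 - Ci * z <> 0 -> 1 / 2 - Ci * z <> 1 ->
  4 * z / (Ci * RtoC PI * (1 + 4 * z ^ 2)) = - (1 / (2 * RtoC PI) * (/ (1 / 2 - Ci * z) + / (1 / 2 - Ci * z - 1))).
Proof.
  intros H0 H1.
  pose proof Ci_nz as HCi.
  assert (H2 : RtoC 2 <> 0) by (intros E0; apply RtoC_inj in E0; lra).
  assert (Hii : Ci * Ci = - (1)) by (apply injective_projections; simpl; ring).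
  assert (HPI : RtoC PI <> 0) by (intros E0; apply RtoC_inj in E0; pose proof PI_RGT_0; lra).
  assert (H1' : 1 / 2 - Ci * z - 1 <> 0) by (apply Cminus_eq_contra, H1).
  set (s := 1 / 2 - Ci * z) in *.
  (* In the variable [s] the poles [z = i/2] and [z = -i/2] are [s = 1] and [s = 0]. *)
  assert (Hd : 1 + 4 * z ^ 2 = - (4 * s * (s - 1))).
  { unfold s. replace (- (4 * (1 / 2 - Ci * z) * (1 / 2 - Ci * z - 1))) with (1 - 4 * (Ci * Ci) * z ^ 2) by field.
    rewrite Hii. ring. }
  assert (H4 : RtoC 4 <> 0) by (intros E0; apply RtoC_inj in E0; lra).
  rewrite Hd.
  assert (Hz : z = (s - 1 / 2) / - Ci) by (unfold s; field; repeat split; assumption).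
  rewrite Hz.
  replace (4 * ((s - 1 / 2) / - Ci) / (Ci * RtoC PI * - (4 * s * (s - 1)))) with ((s - 1 / 2) / ((Ci * Ci) * RtoC PI * (s * (s - 1)))).
  - rewrite Hii. field. repeat split; assumption.
  - field. repeat split; assumption.
Qed.

(** The integral supplies [G], the sum over zeros [- X'/X], and the rational term the polar part, so
    [- L'/L] remains. The imaginary constants are [- Im G(3/2)] from the integral and
    [Im G(3/2) + Im L'/L(3/2)] from the zeros; [C_L] cancels what is left. *)
Lemma F_extension_eq z : 0 < Im z -> ~ singular_point L z ->
  F_extension L z = - (1 / (2 * RtoC PI)) * log_derive L (1 / 2 - Ci * z).
Proof.
  intros Hz Hs. apply nonsingular in Hs. destruct Hs as [HX H1].
  assert (HR : 0 < Re (1 / 2 - Ci * z)) by (rewrite Re_crit; lra).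
  pose proof (Re_crit z) as HRe.
  unfold F_extension. rewrite (usum_eq _ _ _ (zero_sum L E HEe HEo HEL z HX)).
  rewrite (proj2 (integral_part L z Hz)).
  rewrite (log_derive_X L E HEe HEL _ HR H1 HX).
  rewrite (log_derive_X L E HEe HEL (RtoC (3 / 2))); [|simpl; lra| |apply (XL_c L E HEL)].
  2: { left. intros E0. apply RtoC_inj in E0. lra. }
  (* At the real point [3/2] the polar terms are real and drop out of the imaginary part. *)
  assert (HI : Im (RtoC (INR m) / RtoC (3 / 2) + RtoC (INR m) / (RtoC (3 / 2) - 1) + Gsum L (RtoC (3 / 2)) + log_derive L (RtoC (3 / 2)))
    = (Im (Gsum L (RtoC (3 / 2))) + Im (log_derive L (RtoC (3 / 2))))%R).
  { rewrite <- RtoC_minus, <- !RtoC_div by lra. rewrite <- RtoC_plus. unfold Im. simpl. ring. }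
  rewrite HI. unfold C_L.
  (* [polar_part] requires [s <> 1]. The point [s = 1] is allowed only for [m = 0], when both sides
     vanish. *)
  assert (HP : RtoC (INR m) * (4 * z / (Ci * RtoC PI * (1 + 4 * z ^ 2))) =
     - (1 / (2 * RtoC PI) * (RtoC (INR m) / (1 / 2 - Ci * z) + RtoC (INR m) / (1 / 2 - Ci * z - 1)))).
  { destruct H1 as [H1|H1].
    - rewrite polar_part; [unfold Cdiv; ring| |exact H1]. apply neq0_Re, HR.
    - rewrite H1. simpl INR. unfold Cdiv. ring. }
  replace (4 * RtoC (INR m) * z / (Ci * RtoC PI * (1 + 4 * z ^ 2))) with (RtoC (INR m) * (4 * z / (Ci * RtoC PI * (1 + 4 * z ^ 2)))) by (unfold Cdiv; ring).
  rewrite HP.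
  pose proof Ci_nz as HCi.
  assert (H2 : RtoC 2 <> 0) by (intros E0; apply RtoC_inj in E0; lra).
  assert (H4 : RtoC 4 <> 0) by (intros E0; apply RtoC_inj in E0; lra).
  pose proof PI_RGT_0 as HPI0.
  assert (HPI : RtoC PI <> 0) by (intros E0; apply RtoC_inj in E0; lra).
  rewrite RtoC_mult, RtoC_opp, (RtoC_div 1), (RtoC_mult 2 PI), RtoC_plus by lra.
  generalize (RtoC (INR m) / (1 / 2 - Ci * z)) (RtoC (INR m) / (1 / 2 - Ci * z - 1)) (Gsum L (1 / 2 - Ci * z))
   (log_derive L (1 / 2 - Ci * z)) (RtoC (Im (Gsum L (RtoC (3 / 2))))) (RtoC (Im (log_derive L (RtoC (3 / 2))))).
  intros c1 c2 c3 c4 c5 c6. field. repeat split; assumption.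
Qed.

Lemma L_neq_0_of_X (s : C) : 0 < Re s -> s <> 1 \/ m = 0%nat -> XL s <> 0 -> L s <> 0.
Proof.
  intros Hs H1 HX E0. apply HX. rewrite (X_right L E) by exact Hs. unfold Xp. rewrite HEL, E0 by exact H1. ring.
Qed.

Lemma nonsingular_locally z : ~ singular_point L z -> locally z (fun w => ~ singular_point L w).
Proof.
  intros H. apply nonsingular in H. destruct H as [HX H1].
  pose proof (lim_neq_0 _ _ _ (dif_cts _ _ (entire_X L E HEe HEL (1 / 2 - Ci * z))) HX) as HN.
  assert (H1' : locally (1 / 2 - Ci * z) (fun s : C => s <> 1 \/ m = 0%nat)).
  { destruct H1 as [H1|H1]; [|apply filter_forall; auto].
    generalize (locally_neq _ _ H1). apply filter_imp. auto. }
  generalize (crit_locally z _ (filter_and _ _ HN H1')). apply filter_imp. intros w [K1 K2] K.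
  apply singular_iff in K. destruct K as [K|[K K']].
  - rewrite K, Cmod_0 in K1. apply Cmod_gt_0 in HX. lra.
  - destruct K2 as [K2|K2]; [exact (K2 K')|lia].
Qed.

Lemma locally_Im z : 0 < Im z -> locally z (fun w => 0 < Im w).
Proof.
  intros Hz. apply locallyC. exists (Im z). split; [exact Hz|]. intros w Hw.
  pose proof (im_le_Cmod (w - z)) as H. change (Im (w - z)) with (Im w - Im z)%R in H.
  assert (H' : Rabs (Im w - Im z) < Im z) by lra. apply Rabs_def2 in H'. lra.
Qed.

(** Holomorphy is transported from [L'/L] through the identity of [F_extension_eq] on a
    neighbourhood, rather than obtained from the sum and the integral term by term. *)
Lemma F_extension_holomorphic z : 0 < Im z -> ~ singular_point L z -> locally z (dif (F_extension L)).
Proof.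
  intros Hz Hs.
  assert (HE : locally z (fun w => F_extension L w = - (1 / (2 * RtoC PI)) * log_derive L (1 / 2 - Ci * w))).
  { generalize (filter_and _ _ (locally_Im z Hz) (nonsingular_locally z Hs)). apply filter_imp. intros w [H1 H2].
    apply F_extension_eq; assumption. }
  assert (HR : 0 < Re (1 / 2 - Ci * z)) by (rewrite Re_crit; lra).
  destruct (nonsingular z Hs) as [HX H1].
  assert (HL : locally (1 / 2 - Ci * z) (dif L)).
  { destruct H1 as [H1|H1].
    - generalize (locally_neq _ _ H1). apply filter_imp. intros w Hw. apply (dif_L L E HEe HEL). left. exact Hw.
    - apply filter_forall. intros w. apply (dif_L L E HEe HEL). right. exact H1. }
  pose proof (crit_locally z _ (holo_log_derive L _ HL (L_neq_0_of_X _ HR H1 HX))) as HD.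
  generalize (filter_and _ _ (locally_locally _ _ HE) HD). apply filter_imp. intros w [K1 K2].
  apply dif_ext_loc with (fun w => - (1 / (2 * RtoC PI)) * log_derive L (1 / 2 - Ci * w)).
  - revert K1. apply filter_imp. intros y Hy. symmetry. exact Hy.
  - apply dif_mult; [apply dif_const|]. apply (dif_comp (log_derive L)); [apply dif_crit|exact K2].
Qed.

(** Transports a simple pole from the variable [s] to [z]: under [s = 1/2 - i z] increments are
    multiplied by [- i], which only rescales the residue. *)
Lemma simple_pole F z (c : C) (r : C -> C) : c <> 0 -> locally (1 / 2 - Ci * z) (dif r) ->
  locally' z (fun w => F w = - (1 / (2 * RtoC PI)) * (c / ((1 / 2 - Ci * w) - (1 / 2 - Ci * z)) + r (1 / 2 - Ci * w))) ->
  pole_of_order F z 1.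
Proof.
  intros Hc Hr HF.
  pose proof Ci_nz as HCi.
  assert (H2P : 2 * RtoC PI <> 0).
  { rewrite <- RtoC_mult. intros E0; apply RtoC_inj in E0. pose proof PI_RGT_0; lra. }
  split; [lia|].
  exists (fun w => - (1 / (2 * RtoC PI)) * (c / - Ci + (w - z) * r (1 / 2 - Ci * w))). split; [|split].
  - apply holomorphic_at_dif. generalize (crit_locally z _ Hr). apply filter_imp. intros w Hw.
    apply dif_mult; [apply dif_const|]. apply dif_plus; [apply dif_const|]. apply dif_mult.
    + apply dif_minus; [apply dif_id|apply dif_const].
    + apply (dif_comp r); [apply dif_crit|exact Hw].
  - replace (- (1 / (2 * RtoC PI)) * (c / - Ci + (z - z) * r (1 / 2 - Ci * z))) with (c / (2 * RtoC PI * Ci)).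
    + unfold Cdiv. apply Cmult_neq_0; [exact Hc|].
      assert (Hq : 2 * RtoC PI * Ci <> 0) by (apply Cmult_neq_0; assumption).
      apply Cmod_gt_0. rewrite Cmod_inv by exact Hq. apply Rinv_0_lt_compat, Cmod_gt_0, Hq.
    + revert H2P. generalize (2 * RtoC PI). intros q H2P. cfield. repeat split; assumption.
  - generalize (filter_and _ _ HF (locally'_neq z z)). apply filter_imp. intros w [-> Hw].
    assert (Hwz : w - z <> 0) by (apply Cminus_eq_contra, Hw).
    replace (1 / 2 - Ci * w - (1 / 2 - Ci * z)) with (- Ci * (w - z)) by ring.
    revert H2P. generalize (2 * RtoC PI) (r (1 / 2 - Ci * w)). intros q y H2P.
    replace ((w - z) ^ 1) with (w - z) by ring.
    revert Hwz. generalize (w - z). intros v Hv.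
    field. repeat split; assumption.
Qed.

(** All poles are simple, being those of a logarithmic derivative: [L'/L] has residue [n] at a zero
    of [X] of multiplicity [n], and residue [- m] at [s = 1]. The value that [F_extension] takes at
    the point itself, where terms divide by zero, does not enter the punctured neighbourhood. *)
Lemma F_extension_pole z : ((0 < m)%nat -> E 1 <> 0) -> 0 < Im z -> singular_point L z -> exists n, pole_of_order (F_extension L) z n.
Proof.
  intros HE1 Hz Hs. exists 1%nat. apply singular_iff in Hs.
  set (s := 1 / 2 - Ci * z) in *.
  assert (HR : 0 < Re s) by (unfold s; rewrite Re_crit; lra).
  assert (Hs0 : s <> 0) by (apply neq0_Re, HR).
  pose proof (entire_X L E HEe HEL) as HXe.
  assert (HRl : locally s (fun w => 0 < Re w)) by (apply locally_Re_gt, HR).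
  assert (HG : locally s (dif (Gsum L))) by (revert HRl; apply filter_imp; intros w Hw; apply dif_Gsum, Hw).
  assert (Hm0 : locally s (dif (fun w => RtoC (INR m) / w))).
  { generalize (locally_neq s 0 Hs0). apply filter_imp. intros w Hw.
    apply dif_div; [apply dif_const|apply dif_id|exact Hw]. }
  assert (Key : forall (c : C) r, c <> 0 -> locally s (dif r) ->
    locally' s (fun w : C => XL w <> 0 /\ (w <> 1 \/ m = 0%nat)) ->
    locally' s (fun w : C => XL w <> 0 -> w <> 1 \/ m = 0%nat -> 0 < Re w -> log_derive L w = c / (w - s) + r w) ->
    pole_of_order (F_extension L) z 1).
  { intros c r Hc Hr Hns HL. apply (simple_pole _ z c r Hc Hr).
    assert (HI : locally' z (fun w => 0 < Im w)) by (apply locally_locally', locally_Im, Hz).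
    generalize (filter_and _ _ HI (filter_and _ _ (crit_locally' z _ Hns) (crit_locally' z _ HL))).
    apply filter_imp. intros w [K1 [[K2 K3] K4]].
    rewrite F_extension_eq; [|exact K1|].
    - rewrite (K4 K2 K3); [reflexivity|]. rewrite Re_crit. lra.
    - intros K. apply singular_iff in K. destruct K as [K|[K K']]; [exact (K2 K)|].
      destruct K3 as [K3|K3]; [exact (K3 K')|lia]. }
  destruct Hs as [Hs|[Hm Hs]].
  - assert (H1 : s <> 1 \/ m = 0%nat).
    { destruct (Nat.eq_dec m 0) as [|Hm]; [auto|]. left. intros E1. apply (X_1_neq_0 HE1); [lia|]. rewrite <- E1. exact Hs. }
    destruct (entire_zero_multiplicity XL (RtoC (3 / 2)) s HXe (XL_c L E HEL) Hs) as [n [Hn [g [Hg [Ng Eg]]]]].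
    apply holomorphic_at_dif in Hg.
    assert (H1l : locally s (fun w : C => w <> 1 \/ m = 0%nat)).
    { destruct H1 as [H1|H1]; [|apply filter_forall; auto]. generalize (locally_neq s 1 H1). apply filter_imp. auto. }
    assert (Hgl : locally s (fun w => g w <> 0)).
    { generalize (lim_neq_0 _ _ _ (dif_cts _ _ (locally_singleton _ _ Hg)) Ng). apply filter_imp.
      intros w Hw. apply Cmod_gt_0. apply Cmod_gt_0 in Ng. lra. }
    assert (Hm1 : locally s (dif (fun w => RtoC (INR m) / (w - 1)))).
    { destruct H1 as [H1|H1].
      - generalize (locally_neq s 1 H1). apply filter_imp. intros w Hw. apply dif_div; [apply dif_const| |].
        + apply dif_minus; [apply dif_id|apply dif_const].
        + apply Cminus_eq_contra, Hw.
      - rewrite H1. apply filter_forall. intros w. apply dif_ext_loc with (fun _ => 0); [|apply dif_const].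
        apply filter_forall. intros y. simpl INR. unfold Cdiv. ring. }
    apply (Key (RtoC (INR n)) (fun w => log_derive g w - RtoC (INR m) / w - RtoC (INR m) / (w - 1) - Gsum L w)).
    + intros E0. apply RtoC_inj in E0. apply (not_0_INR n); [lia|exact E0].
    + generalize (filter_and _ _ (filter_and _ _ (holo_log_derive g s Hg Ng) Hm0) (filter_and _ _ Hm1 HG)).
      apply filter_imp. intros w [[K1 K2] [K3 K4]].
      apply dif_minus; [apply dif_minus; [apply dif_minus|]|]; assumption.
    + generalize (filter_and _ _ (locally'_neq s s) (locally_locally' _ _ (filter_and _ _ Eg (filter_and _ _ H1l Hgl)))).
      apply filter_imp. intros w [K1 [K2 [K3 K4]]]. split; [|exact K3].
      rewrite K2. apply Cmult_neq_0; [apply Cpow_nz, Cminus_eq_contra, K1|exact K4].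
    + generalize (filter_and _ _ (locally'_neq s s) (locally_locally' _ _ (filter_and _ _ (locally_locally _ _ Eg) (filter_and _ _ Hg Hgl)))).
      apply filter_imp. intros w [K1 [K2 [K3 K4]]] Q1 Q2 Q3.
      pose proof (log_derive_X L E HEe HEL w Q3 Q2 Q1) as HD.
      rewrite (log_derive_ext_loc XL (fun w => (w - s) ^ n * g w) w K2 (HXe w)) in HD.
      rewrite log_derive_mult in HD; [|apply dif_pow, dif_minus; [apply dif_id|apply dif_const]|exact K3| |exact K4].
      * rewrite log_derive_pow in HD by exact K1.
        transitivity (RtoC (INR n) / (w - s) + log_derive g w - RtoC (INR m) / w - RtoC (INR m) / (w - 1) - Gsum L w); [rewrite HD; ring|ring].
      * apply Cpow_nz, Cminus_eq_contra, K1.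
  - assert (HX1 : XL s <> 0) by (rewrite Hs; apply (X_1_neq_0 HE1 Hm)).
    apply (Key (- RtoC (INR m)) (fun w => log_derive XL w - RtoC (INR m) / w - Gsum L w)).
    + intros E0. apply (not_0_INR m); [lia|]. apply RtoC_inj. replace (RtoC (INR m)) with (- - RtoC (INR m)) by ring. rewrite E0. ring.
    + assert (HXl : locally s (dif (log_derive XL))) by (apply holo_log_derive; [apply filter_forall, HXe|exact HX1]).
      generalize (filter_and _ _ HXl (filter_and _ _ Hm0 HG)).
      apply filter_imp. intros w [K1 [K2 K3]]. apply dif_minus; [apply dif_minus|]; assumption.
    + generalize (filter_and _ _ (locally'_neq s s) (locally_locally' _ _ (lim_neq_0 _ _ _ (dif_cts _ _ (HXe s)) HX1))).
      apply filter_imp. intros w [K1 K2]. split; [|left; rewrite <- Hs; exact K1].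
      apply Cmod_gt_0. apply Cmod_gt_0 in HX1. lra.
    + generalize (locally'_neq s s). apply filter_imp. intros w K1 Q1 Q2 Q3.
      rewrite (log_derive_X L E HEe HEL w Q3 Q2 Q1), Hs. unfold Cdiv. ring.
Qed.
End Extension.

Theorem corollary5 (L : selberg_class) (a : R -> C)
  (Ha : explicit_formula_coef L a) :
  (forall z : C, (1 / 2 < Im z)%R ->
     summable (fun lam : R => (0 < lam)%R) (generating_term a z) /\
     (exists S : C,
        is_series (K := C_AbsRing) (V := C_NormedModule)
          (fun k : nat => Lambda L (k + 2) / rpow (INR (k + 2)) (1 / 2 - Ci * z)) S /\
        generating_function a z = 1 / (2 * RtoC PI) * S) /\
     generating_function a z
       = - (1 / (2 * RtoC PI)) * log_derive L (1 / 2 - Ci * z)) /\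
  (forall z : C, upper_half_plane z -> ~ singular_point L z ->
     ex_RInt_line (integrand L z) /\
     summable (nontrivial_zeros L) (zero_term z) /\
     holomorphic_at (F_extension L) z) /\
  meromorphic_on upper_half_plane (F_extension L) /\
  (forall z : C, (1 / 2 < Im z)%R -> generating_function a z = F_extension L z).
Proof.
  (* The continuation is given only through an existential, so [E] was a section variable; its
     nonvanishing at 1, [HE1], enters through the poles. *)
  destruct (L_continuation L) as [E [HEe [HEo [HEL HE1]]]].
  split; [|split; [|split]].
  - intros z Hz. split; [|split].
    + eexists. apply (generating_usum L a Ha z Hz).
    + exists (- log_derive L (1 / 2 - Ci * z)). split.
      * apply Lambda_series. rewrite Re_crit. lra.
      * rewrite (generating_function_eq L a Ha z Hz). ring.
    + apply (generating_function_eq L a Ha z Hz).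
  - intros z Hz Hs. split; [|split].
    + apply (integral_part L z Hz).
    + eexists. apply (zero_sum L E HEe HEo HEL z), (nonsingular L E HEe HEL z Hs).
    + apply holomorphic_at_dif, (F_extension_holomorphic L E HEe HEo HEL z Hz Hs).
  - intros z Hz. destruct (excluded_middle_informative (singular_point L z)) as [Hs|Hs].
    + right. apply (F_extension_pole L E HEe HEo HEL z HE1 Hz Hs).
    + left. apply holomorphic_at_dif, (F_extension_holomorphic L E HEe HEo HEL z Hz Hs).
  (* Here [Re s > 1], where [X] has no zeros and [s <> 1], so the two expressions for [L'/L] can be
     compared at every such point. *)
  - intros z Hz. assert (HR : 1 < Re (1 / 2 - Ci * z)) by (rewrite Re_crit; lra).
    rewrite (generating_function_eq L a Ha z Hz), (F_extension_eq L E HEe HEo HEL z); [reflexivity|lra|].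
    intros Hs. apply (singular_iff L E HEe HEL) in Hs. destruct Hs as [Hs|[_ Hs]].
    + exact (X_neq_0_right L E HEL _ HR Hs).
    + rewrite Hs in HR. simpl in HR. lra.
Qed.
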